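(* Let $c=\{c_k\}_{k\ge0}$ be a sequence of positive reals and $$\mathcal K_c=\Big\{b\in C^\infty(\mathbb S):\ b>0,\ \int_0^{2\pi}b^{-1}d\theta=2\pi,\ \hat b_0\le c_0,\ \zeta_b(-1)\le c_1,\ \zeta_b(-2m)\le c_{m+1}\ (m=1,2,\dots)\Big\}.$$ Then $\mathcal K_c$ is compact in $C^\infty(\mathbb S)$. There exists $\varepsilon_c>0$ depending only on $c_0,c_1$ such that $\varepsilon_c\le b\le\varepsilon_c^{-1}$ for all $b\in\mathcal K_c$. Moreover, for every positive integer $m$ there is $C_m$ depending only on $c_0,\dots,c_{m+2}$ with $\sup_{b\in\mathcal K_c}\|b\|_{C^m(\mathbb S)}\le C_m$ and $\sup_{b\in\mathcal K_c}\|\mathcal Hb\|_{C^m(\mathbb S)}\le C_m$.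
   Context: $\hat b_k$ are Fourier coefficients, $b=\sum\hat b_ke^{ik\theta}$. $\Lambda e^{in\theta}=|n|e^{in\theta}$, $\mathcal H\mathbf 1=0$, $\mathcal He^{in\theta}=\mathrm{sgn}(n)e^{in\theta}$ ($n\ne0$). For positive $b$ with $\int b^{-1}=2\pi$, $\zeta_b$ is the meromorphic continuation to $\mathbb C$ (only pole at $1$) of $\sum_{k\ge1}\lambda_k(b)^{-s}$, $\Re s>1$, where $0=\lambda_0(b)<\lambda_1(b)\le\dots$ are the eigenvalues of $b^{1/2}\Lambda b^{1/2}$; $\zeta_b(-1)$, $\zeta_b(-2m)$ are its values at these points. $C^\infty(\mathbb S)$ has its Fréchet topology. *)

(* Defs.v *)
From Stdlib Require Import Reals ZArith.
From Coquelicot Require Import Coquelicot.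
Open Scope R_scope.

Definition smooth_circ (f : R -> R) : Prop :=
  (forall x, f (x + 2 * PI) = f x) /\
  (forall (n : nat) (x : R), ex_derive (Derive_n f n) x).

(** Fourier coefficients of the complex function g = gr + i gi :
    hat g_n = (1/2pi) int_0^{2pi} g(t) e^{-int} dt. *)
Definition fourier (gr gi : R -> R) (n : Z) : C :=
  ( / (2 * PI) * RInt (fun t => gr t * cos (IZR n * t) + gi t * sin (IZR n * t)) 0 (2 * PI),
    / (2 * PI) * RInt (fun t => gi t * cos (IZR n * t) - gr t * sin (IZR n * t)) 0 (2 * PI)).

Definition fourierR (f : R -> R) (n : Z) : C := fourier f (fun _ => 0) n.

(** g = Lambda f, where Lambda e^{in t} = |n| e^{in t}  (f, g smooth, real-valued). *)
Definition LambdaRel (f g : R -> R) : Prop :=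
  smooth_circ g /\
  forall n : Z, fourierR g n = Cmult (RtoC (IZR (Z.abs n))) (fourierR f n).

(** g = gr + i gi = H b, where H 1 = 0 and H e^{in t} = sgn(n) e^{in t}. *)
Definition HilbertRel (b gr gi : R -> R) : Prop :=
  smooth_circ gr /\ smooth_circ gi /\
  forall n : Z, fourier gr gi n = Cmult (RtoC (IZR (Z.sgn n))) (fourierR b n).

(** A complete L^2(S)-orthonormal system of (smooth) eigenfunctions phi_k of
    b^{1/2} Lambda b^{1/2}, with eigenvalues lam_k listed nondecreasingly
    (with multiplicity). *)
Definition eigen_decomp (b : R -> R) (lam : nat -> R) (phi : nat -> R -> R) : Prop :=
  (forall k, smooth_circ (phi k)) /\
  (forall k k', RInt (fun t => phi k t * phi k' t) 0 (2 * PI) =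
                if Nat.eqb k k' then 1 else 0) /\
  (forall k, exists g, LambdaRel (fun t => sqrt (b t) * phi k t) g /\
                       forall t, sqrt (b t) * g t = lam k * phi k t) /\
  (forall k, lam k <= lam (S k)) /\
  (forall f, smooth_circ f ->
     is_series (fun k => (RInt (fun t => f t * phi k t) 0 (2 * PI)) ^ 2)
               (RInt (fun t => f t ^ 2) 0 (2 * PI))).

(** lam^{-s} = exp(-s ln lam) for lam > 0, s complex. *)
Definition cpow_neg (lam : R) (s : C) : C :=
  let w := (- (Re s) * ln lam, - (Im s) * ln lam) in
  (exp (Re w) * cos (Im w), exp (Re w) * sin (Im w)).

(** zeta_b(s) = v : value at s of the meromorphic continuation (holomorphic on
    C \ {1}) of sum_{k>=1} lam_k(b)^{-s}, Re s > 1. *)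
Definition zeta_value (b : R -> R) (s v : C) : Prop :=
  exists lam phi, eigen_decomp b lam phi /\
  exists Z : C -> C,
    (forall z : C, z <> RtoC 1 -> ex_derive (K := C_AbsRing) (V := C_NormedModule) Z z) /\
    (forall z : C, 1 < Re z -> is_series (fun k => cpow_neg (lam (S k)) z) (Z z)) /\
    Z s = v.

Definition Kc (c : nat -> R) (b : R -> R) : Prop :=
  smooth_circ b /\
  (forall t, 0 < b t) /\
  RInt (fun t => / b t) 0 (2 * PI) = 2 * PI /\
  Re (fourierR b 0%Z) <= c O /\
  (exists v, zeta_value b (RtoC (-1)) v /\ Re v <= c 1%nat) /\
  (forall m : nat, (1 <= m)%nat ->
     exists v, zeta_value b (RtoC (- 2 * INR m)) v /\ Re v <= c (S m)).

(** Sequential compactness in the Frechet space C^oo(S) (metrizable, so this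
    is compactness): every sequence in A has a subsequence converging, with all
    derivatives uniformly, to an element of A. *)
Definition compact_Coo (A : (R -> R) -> Prop) : Prop :=
  forall u : nat -> R -> R, (forall n, A (u n)) ->
  exists (sigma : nat -> nat) (f : R -> R),
    (forall n, (sigma n < sigma (S n))%nat) /\ A f /\
    forall (j : nat) (eps : R), 0 < eps ->
      exists N : nat, forall n, (N <= n)%nat -> forall x,
        Rabs (Derive_n (u (sigma n)) j x - Derive_n f j x) <= eps.

Definition Cm_norm_le (m : nat) (f : R -> R) (C : R) : Prop :=
  forall j : nat, (j <= m)%nat -> forall x, Rabs (Derive_n f j x) <= C.

Definition Cm_norm_le_C (m : nat) (gr gi : R -> R) (C : R) : Prop :=
  forall j : nat, (j <= m)%nat -> forall x,
    sqrt ((Derive_n gr j x) ^ 2 + (Derive_n gi j x) ^ 2) <= C.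

(* Main.v *)
(** Write [s] for the angle with [s' = 1/b] and compare the spectrum of [A = b^(1/2) Lambda b^(1/2)]
    with that of [b^(1/2) D b^(1/2)], whose eigenfunctions are [psi_n = exp(i n s) / sqrt b]: the difference
    of the squares is the smoothing operator [b^(1/2) K b^(1/2)], where [<K e_j, e_l>] is [2 |j l|] times a
    Fourier coefficient of [b] of index [|j| + |l|] or its opposite if [j l < 0], and [0] otherwise.
    With [P_nk] the squared overlaps of [psi_n] and the eigenfunctions [phi_k], the double sum
    [Xi (z) = sum_n sum_k (lam_k^-z - n^-z) P_nk] is entire and [zeta_b - Xi] does not depend on [b] for
    [Re z > 1], hence nowhere.  So, up to absolute constants, [zeta_b (-q)] is the sum over [n] of
    [tau_q (n) = <A^q psi_n, psi_n> + <A^q psi_-n, psi_-n> - 2 n^q], and these terms are nonnegative for [q = 1] and [q] even.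

    For [q = 1], averaging [tau_1 (n)] against the Fourier coefficients of a nonnegative kernel that vanishes
    at the origin and concentrates beside it gives [int b'^2 / b <= C (zeta_b (-1) + int b + const)], which bounds
    the oscillation of [ln b].  For [q = 2 m >= 4], [tau_q (n) >= n^(2m-4) |b^(1/2) K b^(1/2) psi_n|^2],
    and summing over [n] bounds the [H^m] norm of [b], inductively in [m].
    A sequence in [K_c] then has a subsequence along which the functions, the eigenvalues and the eigenfunctions
    converge; the limit inherits a complete eigensystem, and the bounds on the zeta values survive by Fatou. *)
Require Import Defs.
From Stdlib Require Import Reals ZArith Lra Lia FunctionalExtensionality ClassicalEpsilon.
From Stdlib Require Cantor.
From Coquelicot Require Import Coquelicot.
Open Scope R_scope.

(** The eigenvalues are never matched one by one with the integers. The overlaps replace a matching: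
    they form a matrix with row sums 2 and column sums 1, and [lam_k^2 - n^2] times an overlap of
    [psi_n] is an overlap of a smoothing operator applied to [psi_n], so the difference of
    [lam_k^-z] and [n^-z] costs nothing where the overlap is not tiny. Squares are compared because
    [A^2] differs from the square of [b^(1/2) D b^(1/2)] by an explicit operator, which keeps the
    argument within Fourier series.

    Since the zeta values are bounded from above only, signs are essential: a bound on a sum says
    something about its parts once all terms are nonnegative. The weights in the argument for
    [q = 1] lie in [-1, 1], so that the sign helps there too.

    Membership of the limit in [Kc] asks for an eigensystem and a continued zeta function, and no
    spectral theorem provides them. The eigensystem is a limit of given ones, complete because the
    eigenvalues grow at a rate that depends only on bounds of [b]; the continuation is borrowed from
    one member of the sequence and corrected by two functions [Xi]. *)

Definition cts (f : R -> R) := forall x, continuous f x.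
Definition per (f : R -> R) := forall x, f (x + 2 * PI) = f x.
Definition I2 (f : R -> R) : R := RInt f 0 (2 * PI).
Notation N2 f := (I2 (fun x => f x ^ 2)).
Notation ip f g := (I2 (fun x => f x * g x)).
Tactic Notation "fext" ident(x) := apply functional_extensionality; intros x.

Lemma Rinv_nneg x : 0 < x -> 0 <= / x.
Proof. intros H; apply Rlt_le, Rinv_0_lt_compat, H. Qed.

(** * Continuity and integration over one period *)

Lemma cts_plus f g : cts f -> cts g -> cts (fun x => f x + g x).
Proof. intros Hf Hg x; apply (continuous_plus f g); auto. Qed.
Lemma cts_minus f g : cts f -> cts g -> cts (fun x => f x - g x).
Proof. intros Hf Hg x; apply (continuous_minus f g); auto. Qed.
Lemma cts_opp f : cts f -> cts (fun x => - f x).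
Proof. intros Hf x; apply (continuous_opp f); auto. Qed.
Lemma cts_mult f g : cts f -> cts g -> cts (fun x => f x * g x).
Proof. intros Hf Hg x; apply (continuous_mult f g); auto. Qed.
Lemma cts_const c : cts (fun _ => c).
Proof. intros x; apply continuous_const. Qed.
Lemma cts_id : cts (fun x => x).
Proof. intros x; apply continuous_id. Qed.
Lemma cts_comp f g : cts f -> cts g -> cts (fun x => f (g x)).
Proof. intros Hf Hg x; apply (continuous_comp g f); auto. Qed.
Lemma cts_cos : cts cos.
Proof. intros x; apply continuity_pt_filterlim, continuity_cos. Qed.
Lemma cts_sin : cts sin.
Proof. intros x; apply continuity_pt_filterlim, continuity_sin. Qed.
Lemma cts_cos' f : cts f -> cts (fun x => cos (f x)).
Proof. apply cts_comp, cts_cos. Qed.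
Lemma cts_sin' f : cts f -> cts (fun x => sin (f x)).
Proof. apply cts_comp, cts_sin. Qed.
Lemma cts_pow f n : cts f -> cts (fun x => f x ^ n).
Proof.
  intros Hf; induction n; simpl; [apply cts_const|].
  apply cts_mult; auto.
Qed.
Lemma cts_abs f : cts f -> cts (fun x => Rabs (f x)).
Proof. intros Hf x; apply (continuous_comp f Rabs); auto. apply continuous_Rabs. Qed.
Lemma cts_sqrt f : cts f -> cts (fun x => sqrt (f x)).
Proof. intros Hf x; apply (continuous_comp f sqrt); auto. apply continuous_sqrt. Qed.
Lemma cts_ex_derive (f : R -> R) : (forall x, ex_derive f x) -> cts f.
Proof. intros H x; apply (ex_derive_continuous f x), H. Qed.
Lemma cts_derive (f f' : R -> R) : (forall x, is_derive f x (f' x)) -> cts f.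
Proof. intros H; apply cts_ex_derive; intros x; eexists; apply H. Qed.

Create HintDb cts discriminated.
#[export] Hint Constants Opaque : cts.
#[export] Hint Variables Opaque : cts.
#[export] Hint Resolve cts_plus cts_minus cts_opp cts_mult cts_const cts_id cts_cos' cts_sin'
  cts_pow cts_abs cts_sqrt cts_cos cts_sin : cts.

Ltac ctac := auto 20 with cts.

Lemma ex_RInt_cts f a b : cts f -> ex_RInt f a b.
Proof. intros H; apply (ex_RInt_continuous f); intros; apply H. Qed.
#[export] Hint Extern 1 (ex_RInt _ _ _) => apply ex_RInt_cts : cts.

Lemma two_pi_pos : 0 < 2 * PI.
Proof. generalize PI_RGT_0; lra. Qed.
Lemma two_pi_nonneg : 0 <= 2 * PI.
Proof. generalize PI_RGT_0; lra. Qed.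
#[export] Hint Resolve two_pi_pos two_pi_nonneg PI_RGT_0 : cts.

Lemma RInt_plus' f g a b : cts f -> cts g ->
  RInt (fun x => f x + g x) a b = RInt f a b + RInt g a b.
Proof. intros Hf Hg; apply (RInt_plus f g); ctac. Qed.
Lemma RInt_minus' f g a b : cts f -> cts g ->
  RInt (fun x => f x - g x) a b = RInt f a b - RInt g a b.
Proof. intros Hf Hg; apply (RInt_minus f g); ctac. Qed.
Lemma RInt_scal' f c a b : cts f -> RInt (fun x => c * f x) a b = c * RInt f a b.
Proof. intros Hf; apply (RInt_scal f); ctac. Qed.
Lemma RInt_const' (c a b : R) : RInt (fun _ => c) a b = (b - a) * c.
Proof. rewrite RInt_const; reflexivity. Qed.
Lemma RInt_ext' (f g : R -> R) a b : (forall x, f x = g x) -> RInt f a b = RInt g a b.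
Proof. intros H; apply RInt_ext; intros; apply H. Qed.
Lemma RInt_derive' (f f' : R -> R) a b : (forall x, is_derive f x (f' x)) -> cts f' ->
  RInt f' a b = f b - f a.
Proof.
  intros Hf Hc; apply is_RInt_unique.
  apply (is_RInt_derive f f'); intros; auto.
Qed.

Lemma I2_plus f g : cts f -> cts g -> I2 (fun x => f x + g x) = I2 f + I2 g.
Proof. apply RInt_plus'. Qed.
Lemma I2_minus f g : cts f -> cts g -> I2 (fun x => f x - g x) = I2 f - I2 g.
Proof. apply RInt_minus'. Qed.
Lemma I2_scal c f : cts f -> I2 (fun x => c * f x) = c * I2 f.
Proof. intros; apply RInt_scal'; auto. Qed.
Lemma I2_opp f : cts f -> I2 (fun x => - f x) = - I2 f.
Proof.
  intros H; transitivity (I2 (fun x => (-1) * f x)).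
  apply RInt_ext'; intros; ring. rewrite I2_scal; auto; ring.
Qed.
Lemma I2_const c : I2 (fun _ => c) = 2 * PI * c.
Proof. unfold I2; rewrite RInt_const'; ring. Qed.
Lemma I2_ext f g : (forall x, f x = g x) -> I2 f = I2 g.
Proof. apply RInt_ext'. Qed.
Lemma I2_le f g : cts f -> cts g -> (forall x, f x <= g x) -> I2 f <= I2 g.
Proof. intros; apply RInt_le; ctac. Qed.
Lemma I2_nonneg f : cts f -> (forall x, 0 <= f x) -> 0 <= I2 f.
Proof. intros; apply RInt_ge_0; ctac. Qed.
Lemma I2_abs f : cts f -> Rabs (I2 f) <= I2 (fun x => Rabs (f x)).
Proof. intros; apply abs_RInt_le; ctac. Qed.
Lemma I2_bound f M : cts f -> (forall x, Rabs (f x) <= M) -> Rabs (I2 f) <= 2 * PI * M.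
Proof.
  intros Hf HM; eapply Rle_trans; [apply I2_abs; auto|].
  rewrite <- I2_const; apply I2_le; ctac.
Qed.
Lemma I2_derive_per (f f' : R -> R) : (forall x, is_derive f x (f' x)) -> cts f' -> per f -> I2 f' = 0.
Proof.
  intros H Hc Hp; unfold I2; rewrite (RInt_derive' f f'); auto.
  generalize (Hp 0); rewrite Rplus_0_l; intros ->; ring.
Qed.
Lemma is_derive_mult' (f g : R -> R) x f' g' : is_derive f x f' -> is_derive g x g' ->
  is_derive (fun t => f t * g t) x (f' * g x + f x * g').
Proof.
  intros; apply (is_derive_mult f g); auto. intros; apply Rmult_comm.
Qed.
Lemma I2_ibp (f g f' g' : R -> R) : (forall x, is_derive f x (f' x)) -> (forall x, is_derive g x (g' x)) ->
  cts f' -> cts g' -> per f -> per g ->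
  ip f' g = - ip f g'.
Proof.
  intros Hf Hg Hf' Hg' Pf Pg.
  assert (cf := cts_derive _ _ Hf). assert (cg := cts_derive _ _ Hg).
  assert (H : I2 (fun x => f' x * g x + f x * g' x) = 0).
  { apply (I2_derive_per (fun x => f x * g x)); ctac.
    - intros; apply is_derive_mult'; auto.
    - intros x; rewrite Pf, Pg; auto. }
  rewrite I2_plus in H; ctac. lra.
Qed.

Lemma RInt_shift (f : R -> R) a b t : cts f -> RInt (fun x => f (x + t)) a b = RInt f (a + t) (b + t).
Proof.
  intros Hf.
  rewrite <- (RInt_comp f (fun x => x + t) (fun _ => 1)).
  - apply RInt_ext'; intros; unfold scal; simpl; unfold mult; simpl; ring.
  - intros; apply Hf.
  - intros; split; [auto_derive; auto; ring | apply continuous_const].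
Qed.
Lemma RInt_Chasles' f a b c : cts f -> RInt f a b + RInt f b c = RInt f a c.
Proof. intros; apply (RInt_Chasles f); ctac. Qed.
Lemma RInt_per f a : cts f -> per f -> RInt f a (a + 2 * PI) = I2 f.
Proof.
  intros Hf Hp.
  rewrite <- (RInt_Chasles' f a 0), <- (RInt_Chasles' f 0 (2 * PI) (a + 2 * PI)); auto.
  assert (H : RInt f (2 * PI) (a + 2 * PI) = RInt f 0 a).
  { replace (2 * PI) with (0 + 2 * PI) at 1 by ring.
    rewrite <- RInt_shift; auto. apply RInt_ext'; auto. }
  rewrite H. fold (I2 f).
  generalize (RInt_Chasles' f a 0 a Hf); rewrite RInt_point. change (zero : R) with 0. lra.
Qed.
Lemma I2_shift f t : cts f -> per f -> I2 (fun x => f (x + t)) = I2 f.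
Proof.
  intros Hf Hp; unfold I2 at 1; rewrite RInt_shift; auto.
  replace (0 + t) with t by ring. rewrite Rplus_comm. apply RInt_per; auto.
Qed.
Lemma I2_sym f : cts f -> per f -> RInt f (- PI) PI = I2 f.
Proof.
  intros Hf Hp. rewrite <- (RInt_per f (- PI)); auto. f_equal; ring.
Qed.

Lemma cts_delta f x0 eps : cts f -> 0 < eps ->
  exists d, 0 < d /\ forall x, Rabs (x - x0) < d -> Rabs (f x - f x0) < eps.
Proof.
  intros Hf He. specialize (Hf x0).
  assert (L : locally (f x0) (fun y => Rabs (y - f x0) < eps)).
  { exists (mkposreal eps He); intros y Hy; exact Hy. }
  destruct (Hf _ L) as [d Hd]. exists d; split; [apply cond_pos|].
  intros x Hx; apply Hd, Hx.
Qed.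

Lemma I2_zero_eq f : cts f -> (forall x, 0 <= f x) -> I2 f = 0 ->
  forall x, 0 < x < 2 * PI -> f x = 0.
Proof.
  intros Hf Hp H0 x Hx.
  destruct (Req_dec (f x) 0) as [|Hn]; auto. exfalso.
  assert (Hpos : 0 < f x) by (generalize (Hp x); lra).
  destruct (cts_delta f x (f x / 2) Hf) as [d [Hd Hc]]; [lra|].
  set (e := Rmin (d / 2) (Rmin x (2 * PI - x))).
  assert (He : 0 < e) by (unfold e; repeat apply Rmin_glb_lt; lra).
  assert (e <= d / 2) by apply Rmin_l.
  assert (e <= x) by (eapply Rle_trans; [apply Rmin_r|apply Rmin_l]).
  assert (e <= 2 * PI - x) by (eapply Rle_trans; [apply Rmin_r|apply Rmin_r]).
  assert (Hl : RInt f 0 (x - e) + RInt f (x - e) (x + e) + RInt f (x + e) (2 * PI) = I2 f).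
  { rewrite !RInt_Chasles'; auto. }
  assert (0 <= RInt f 0 (x - e)) by (apply RInt_ge_0; ctac; lra).
  assert (0 <= RInt f (x + e) (2 * PI)) by (apply RInt_ge_0; ctac; lra).
  assert (Hm : RInt (fun _ => f x / 2) (x - e) (x + e) <= RInt f (x - e) (x + e)).
  { apply RInt_le; ctac; [lra|]. intros y Hy.
    assert (Hy' : Rabs (f y - f x) < f x / 2) by (apply Hc, Rabs_def1; lra).
    apply Rabs_def2 in Hy'; lra. }
  rewrite RInt_const' in Hm. nra.
Qed.

Lemma per_shift_nat f (n : nat) x : per f -> f (x + 2 * PI * INR n) = f x.
Proof.
  intros Hp; induction n.
  - simpl; f_equal; ring.
  - rewrite S_INR. replace (x + 2 * PI * (INR n + 1)) with (x + 2 * PI * INR n + 2 * PI) by ring.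
    rewrite Hp; auto.
Qed.
Lemma per_reduce f x : per f -> exists y, 0 <= y < 2 * PI /\ f y = f x.
Proof.
  intros Hp.
  set (z := Int_part (x / (2 * PI))).
  assert (P := two_pi_pos).
  destruct (base_Int_part (x / (2 * PI))) as [B1 B2]; fold z in B1, B2.
  assert (E : x = x / (2 * PI) * (2 * PI)) by (field; lra).
  exists (x - 2 * PI * IZR z); split.
  - split; nra.
  - destruct (Z_le_gt_dec 0 z) as [Hz|Hz].
    + rewrite <- (per_shift_nat f (Z.to_nat z) (x - _)); auto. f_equal.
      rewrite INR_IZR_INZ, Z2Nat.id; auto; ring.
    + rewrite <- (per_shift_nat f (Z.to_nat (- z)) x); auto. f_equal.
      rewrite INR_IZR_INZ, Z2Nat.id by lia. rewrite opp_IZR; ring.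
Qed.
Lemma per_bounded f : cts f -> per f -> exists C, forall x, Rabs (f x) <= C.
Proof.
  intros Hf Hp.
  destruct (continuity_ab_maj (fun x => Rabs (f x)) 0 (2 * PI)) as [m [Hm _]]; ctac.
  { intros c _; apply continuity_pt_filterlim, (cts_abs f Hf). }
  exists (Rabs (f m)); intros x.
  destruct (per_reduce f x Hp) as [y [Hy <-]]. apply Hm; lra.
Qed.
Lemma I2_zero_eq_per f : cts f -> per f -> (forall x, 0 <= f x) -> I2 f = 0 -> forall x, f x = 0.
Proof.
  intros Hf Hp Hpos H0 x.
  destruct (per_reduce f x Hp) as [y [Hy <-]].
  destruct (Req_dec (f y) 0) as [|Hn]; auto. exfalso.
  assert (0 < f y) by (generalize (Hpos y); lra).
  destruct (cts_delta f y (f y) Hf) as [d [Hd Hc]]; auto.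
  (* At [y = 0] the statement for the open interval says nothing, so the contradiction is sought at
     [y + e], which is interior and so close to [y] that [f] is still positive there. *)
  set (e := Rmin (d / 2) ((2 * PI - y) / 2)).
  assert (0 < e) by (apply Rmin_glb_lt; lra).
  assert (e <= d / 2) by apply Rmin_l.
  assert (e <= (2 * PI - y) / 2) by apply Rmin_r.
  assert (Z : f (y + e) = 0) by (apply I2_zero_eq; auto; lra).
  specialize (Hc (y + e)). rewrite Z in Hc.
  replace (y + e - y) with e in Hc by ring.
  rewrite (Rabs_right e) in Hc by lra.
  assert (C := Hc ltac:(lra)). rewrite Rabs_left in C; lra.
Qed.

(** * Families bounded in C^infinity *)

Ltac toR := cbv beta; match goal with |- @eq _ ?a ?b => change (@eq R a b) end.

(** A family that is bounded in the Frechet space of smooth functions; a single smooth function is a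
    family with a trivial index. Uniformity in the index is what the compactness argument and the
    decay in [n] consume. *)
Definition usm {I : Type} (F : I -> R -> R) :=
  forall n, exists C, forall i x,
    ex_derive (Derive_n (F i) n) x /\ Rabs (Derive_n (F i) n x) <= C.
Definition pusm {I : Type} (F : I -> R -> R) := usm F /\ forall i, per (F i).

(** The algebra generated by [G] and the bounded families of constants. A composite such as [1 / F]
    or [cos (k s)] is shown to be bounded in C^infinity by naming generators whose derivatives lie
    in this algebra, without any formula for its higher derivatives. *)
Inductive clo {I : Type} (G : (I -> R -> R) -> Prop) : (I -> R -> R) -> Prop :=
| clo_base F : G F -> clo G F
| clo_cst (c : I -> R) C : (forall i, Rabs (c i) <= C) -> clo G (fun i _ => c i)
| clo_add F F' : clo G F -> clo G F' -> clo G (fun i x => F i x + F' i x)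
| clo_mul F F' : clo G F -> clo G F' -> clo G (fun i x => F i x * F' i x).

(** By the Leibniz rule differentiation maps the algebra to itself, and every element of it is
    bounded; hence all iterated derivatives are bounded. *)
Lemma clo_usm {I : Type} (G : (I -> R -> R) -> Prop) :
  (forall F, G F -> (exists C, forall i x, Rabs (F i x) <= C) /\
     exists F', clo G F' /\ forall i x, is_derive (F i) x (F' i x)) ->
  forall F, clo G F -> usm F.
Proof.
  intros HG.
  assert (H1 : forall F, clo G F -> (exists C, forall i x, Rabs (F i x) <= C) /\
     exists F', clo G F' /\ forall i x, is_derive (F i) x (F' i x)).
  { intros F HF; induction HF as [F HF|c C Hc|F F' HF IF HF' IF'|F F' HF IF HF' IF'].
    - apply HG, HF.
    - split; [exists C; auto|]. exists (fun _ _ => 0); split.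
      + apply (clo_cst G (fun _ => 0) 0). intros; rewrite Rabs_R0; lra.
      + intros; apply (is_derive_const (c i)).
    - destruct IF as [[C HC] [D [HD D1]]], IF' as [[C' HC'] [D' [HD' D1']]]; split.
      + exists (C + C'); intros; eapply Rle_trans; [apply Rabs_triang|].
        apply Rplus_le_compat; auto.
      + eexists; split; [apply (clo_add _ _ _ HD HD')|].
        intros; apply (is_derive_plus (F i) (F' i)); auto.
    - destruct IF as [[C HC] [D [HD D1]]], IF' as [[C' HC'] [D' [HD' D1']]]; split.
      + exists (C * C'); intros; rewrite Rabs_mult.
        apply Rmult_le_compat; auto; apply Rabs_pos.
      + eexists; split.
        * apply (clo_add _ _ _ (clo_mul _ _ _ HD HF') (clo_mul _ _ _ HF HD')).
        * intros; apply is_derive_mult'; auto. }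
  assert (H2 : forall n F, clo G F -> exists F', clo G F' /\ forall i, Derive_n (F i) n = F' i).
  { intros n; induction n; intros F HF.
    - exists F; split; auto.
    - destruct (IHn F HF) as [F' [HF' E]].
      destruct (H1 _ HF') as [_ [F'' [HF'' D]]].
      exists F''; split; auto. intros i; simpl; rewrite E.
      fext x; apply is_derive_unique, D. }
  intros F HF n. destruct (H2 n F HF) as [F' [HF' E]].
  destruct (H1 _ HF') as [[C HC] [F'' [HF'' D]]].
  exists C; intros i x; rewrite E; split; auto. eexists; apply D.
Qed.

Lemma usm_bd {I} (F : I -> R -> R) : usm F -> exists C, forall i x, Rabs (F i x) <= C.
Proof. intros H; destruct (H 0%nat) as [C HC]; exists C; intros; apply HC. Qed.
Lemma Derive_n_Derive f n : Derive_n (Derive f) n = Derive_n f (S n).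
Proof.
  fext x.
  change (Derive f) with (Derive_n f 1). rewrite Derive_n_comp. f_equal; lia.
Qed.
Lemma usm_derive {I} (F : I -> R -> R) : usm F -> usm (fun i => Derive (F i)).
Proof.
  intros H n; destruct (H (S n)) as [C HC]; exists C; intros i x.
  rewrite Derive_n_Derive; apply HC.
Qed.
Lemma usm_is_derive {I} (F : I -> R -> R) i x : usm F -> is_derive (F i) x (Derive (F i) x).
Proof. intros H; apply Derive_correct. destruct (H 0%nat) as [C HC]; apply HC. Qed.
Lemma clo_usm_self {I} (F : I -> R -> R) : clo usm F -> usm F.
Proof.
  apply clo_usm; intros G HG; split; [apply usm_bd; auto|].
  exists (fun i => Derive (G i)); split; [apply clo_base, usm_derive; auto|].
  intros; apply usm_is_derive; auto.
Qed.
Lemma usm_plus {I} (F G : I -> R -> R) : usm F -> usm G -> usm (fun i x => F i x + G i x).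
Proof. intros; apply clo_usm_self, clo_add; apply clo_base; auto. Qed.
Lemma usm_mult {I} (F G : I -> R -> R) : usm F -> usm G -> usm (fun i x => F i x * G i x).
Proof. intros; apply clo_usm_self, clo_mul; apply clo_base; auto. Qed.
Lemma usm_cst {I} (c : I -> R) C : (forall i, Rabs (c i) <= C) -> usm (fun i (_ : R) => c i).
Proof. intros; apply clo_usm_self; eapply clo_cst; eauto. Qed.
Lemma usm_reindex {I J} (F : I -> R -> R) (u : J -> I) : usm F -> usm (fun j => F (u j)).
Proof. intros H n; destruct (H n) as [C HC]; exists C; auto. Qed.
Lemma usm_inv {I} (F : I -> R -> R) c : usm F -> 0 < c -> (forall i x, c <= F i x) ->
  usm (fun i x => / F i x).
Proof.
  intros HF Hc Hp.
  (* The generators are the families already known to be uniformly smooth together with [1 / F],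
     whose derivative is [- F' (1 / F)^2]. *)
  apply (clo_usm (fun H => usm H \/ H = (fun i x => / F i x))); [|apply clo_base; right; auto].
  intros H [HH | ->].
  - split; [apply usm_bd; auto|].
    exists (fun i => Derive (H i)); split; [apply clo_base; left; apply usm_derive; auto|].
    intros; apply usm_is_derive; auto.
  - split.
    + exists (/ c); intros i x. specialize (Hp i x).
      rewrite Rabs_right; [apply Rinv_le_contravar; lra|].
      apply Rle_ge, Rinv_nneg; lra.
    + exists (fun i x => (-1) * Derive (F i) x * (/ F i x * / F i x)); split.
      * apply clo_mul; [apply clo_mul|apply clo_mul; apply clo_base; right; auto].
        apply (clo_cst _ (fun _ => -1) 1). intros; rewrite Rabs_left; lra.
        apply clo_base; left; apply usm_derive; auto.
      * intros i x. assert (F i x <> 0) by (specialize (Hp i x); lra).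
        evar_last. apply (is_derive_inv (F i) x _ (usm_is_derive F i x HF)); auto.
        simpl. field; auto.
Qed.
Lemma usm_sqrt {I} (F : I -> R -> R) c : usm F -> 0 < c -> (forall i x, c <= F i x) ->
  usm (fun i x => sqrt (F i x)).
Proof.
  intros HF Hc Hp.
  assert (HI := usm_inv F c HF Hc Hp).
  apply (clo_usm (fun H => usm H \/ H = (fun i x => sqrt (F i x)))); [|apply clo_base; right; auto].
  intros H [HH | ->].
  - split; [apply usm_bd; auto|].
    exists (fun i => Derive (H i)); split; [apply clo_base; left; apply usm_derive; auto|].
    intros; apply usm_is_derive; auto.
  - split.
    + destruct (usm_bd F HF) as [C HC]. exists (sqrt C); intros i x.
      rewrite Rabs_right by (apply Rle_ge, sqrt_pos). apply sqrt_le_1_alt.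
      eapply Rle_trans; [apply RRle_abs|apply HC].
    (* [1 / (2 sqrt F)] is written as [sqrt F / (2 F)]: [1 / F] is already uniformly smooth, and
       [sqrt F] remains the only new generator. *)
    + exists (fun i x => (/ 2) * Derive (F i) x * (/ F i x * sqrt (F i x))); split.
      * apply clo_mul; [apply clo_mul|apply clo_mul; apply clo_base; auto].
        apply (clo_cst _ (fun _ => / 2) 1). intros; rewrite Rabs_right; lra.
        apply clo_base; left; apply usm_derive; auto.
      * intros i x. assert (Hx : 0 < F i x) by (specialize (Hp i x); lra).
        evar_last. apply (is_derive_sqrt (F i) x _ (usm_is_derive F i x HF)); auto.
        assert (0 < sqrt (F i x)) by (apply sqrt_lt_R0; auto).
        replace (/ F i x) with (/ (sqrt (F i x) * sqrt (F i x))) by (rewrite sqrt_sqrt; lra).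
        simpl. field; lra.
Qed.

Lemma per_Derive_n f n : per f -> per (Derive_n f n).
Proof.
  intros Hp x. rewrite <- Derive_n_comp_trans.
  apply Derive_n_ext; auto.
Qed.
Lemma sc_pusm {I : Type} f : smooth_circ f -> pusm (fun _ : I => f).
Proof.
  intros [Hp Hs]; split; auto. intros n.
  destruct (per_bounded (Derive_n f n)) as [C HC].
  - apply cts_ex_derive; auto.
  - apply per_Derive_n; auto.
  - exists C; auto.
Qed.
Lemma pusm_sc {I} (F : I -> R -> R) i : pusm F -> smooth_circ (F i).
Proof. intros [H Hp]; split; [apply Hp|]. intros n x; destruct (H n) as [C HC]; apply HC. Qed.

Lemma pusm_plus {I} (F G : I -> R -> R) : pusm F -> pusm G -> pusm (fun i x => F i x + G i x).
Proof. intros [H P] [H' P']; split; [apply usm_plus; auto|]. intros i x; rewrite P, P'; auto. Qed.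
Lemma pusm_mult {I} (F G : I -> R -> R) : pusm F -> pusm G -> pusm (fun i x => F i x * G i x).
Proof. intros [H P] [H' P']; split; [apply usm_mult; auto|]. intros i x; rewrite P, P'; auto. Qed.
Lemma pusm_cst {I} (c : I -> R) C : (forall i, Rabs (c i) <= C) -> pusm (fun i (_ : R) => c i).
Proof. intros; split; [eapply usm_cst; eauto|]. intros i x; auto. Qed.
Lemma pusm_scal {I} c (F : I -> R -> R) : pusm F -> pusm (fun i x => c * F i x).
Proof. intros; apply pusm_mult; auto. apply (pusm_cst (fun _ => c) (Rabs c)). intros; lra. Qed.
Lemma pusm_minus {I} (F G : I -> R -> R) : pusm F -> pusm G -> pusm (fun i x => F i x - G i x).
Proof.
  intros HF HG. replace (fun i x => F i x - G i x) with (fun i x => F i x + (-1) * G i x).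
  apply pusm_plus, pusm_scal; auto.
  repeat (apply functional_extensionality; intros); ring.
Qed.
Lemma pusm_derive {I} (F : I -> R -> R) : pusm F -> pusm (fun i => Derive (F i)).
Proof.
  intros [H P]; split; [apply usm_derive; auto|].
  intros i; apply (per_Derive_n (F i) 1); auto.
Qed.
Lemma pusm_inv {I} (F : I -> R -> R) c : pusm F -> 0 < c -> (forall i x, c <= F i x) ->
  pusm (fun i x => / F i x).
Proof. intros [H P] Hc Hp; split; [eapply usm_inv; eauto|]. intros i x; rewrite P; auto. Qed.
Lemma pusm_sqrt {I} (F : I -> R -> R) c : pusm F -> 0 < c -> (forall i x, c <= F i x) ->
  pusm (fun i x => sqrt (F i x)).
Proof. intros [H P] Hc Hp; split; [eapply usm_sqrt; eauto|]. intros i x; rewrite P; auto. Qed.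
Lemma pusm_reindex {I J} (F : I -> R -> R) (u : J -> I) : pusm F -> pusm (fun j => F (u j)).
Proof. intros [H P]; split; [apply (usm_reindex F u); auto|]. intros; apply P. Qed.

Lemma sc_plus f g : smooth_circ f -> smooth_circ g -> smooth_circ (fun x => f x + g x).
Proof. intros Hf Hg; apply (pusm_sc _ tt (pusm_plus _ _ (sc_pusm f Hf) (sc_pusm g Hg))). Qed.
Lemma sc_minus f g : smooth_circ f -> smooth_circ g -> smooth_circ (fun x => f x - g x).
Proof. intros Hf Hg; apply (pusm_sc _ tt (pusm_minus _ _ (sc_pusm f Hf) (sc_pusm g Hg))). Qed.
Lemma sc_mult f g : smooth_circ f -> smooth_circ g -> smooth_circ (fun x => f x * g x).
Proof. intros Hf Hg; apply (pusm_sc _ tt (pusm_mult _ _ (sc_pusm f Hf) (sc_pusm g Hg))). Qed.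
Lemma sc_const c : smooth_circ (fun _ => c).
Proof. apply (pusm_sc _ tt (pusm_cst (fun _ : unit => c) (Rabs c) ltac:(intros; lra))). Qed.
Lemma sc_opp f : smooth_circ f -> smooth_circ (fun x => - f x).
Proof.
  intros H. replace (fun x => - f x) with (fun x => (-1) * f x).
  apply sc_mult; auto; apply sc_const. apply functional_extensionality; intros; ring.
Qed.
Lemma sc_Derive f : smooth_circ f -> smooth_circ (Derive f).
Proof. intros H; apply (pusm_sc _ tt (pusm_derive _ (sc_pusm f H))). Qed.
Lemma sc_Derive_n f n : smooth_circ f -> smooth_circ (Derive_n f n).
Proof. intros H; induction n; auto. simpl; apply sc_Derive; auto. Qed.
Lemma sc_pow f n : smooth_circ f -> smooth_circ (fun x => f x ^ n).
Proof. intros H; induction n; simpl; [apply sc_const|apply sc_mult; auto]. Qed.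
Lemma sc_ex_derive f x : smooth_circ f -> ex_derive f x.
Proof. intros H; apply (proj2 H 0%nat). Qed.
Lemma sc_is_derive f x : smooth_circ f -> is_derive f x (Derive f x).
Proof. intros H; apply Derive_correct, sc_ex_derive, H. Qed.
Lemma sc_cts f : smooth_circ f -> cts f.
Proof. intros H; apply cts_ex_derive; intros; apply sc_ex_derive; auto. Qed.
Lemma sc_per f : smooth_circ f -> per f.
Proof. intros H; exact (proj1 H). Qed.
Lemma sc_bounded f : smooth_circ f -> exists C, forall x, Rabs (f x) <= C.
Proof. intros H; apply per_bounded; [apply sc_cts|apply sc_per]; auto. Qed.
Lemma per_min_pos f : cts f -> per f -> (forall x, 0 < f x) -> exists c, 0 < c /\ forall x, c <= f x.
Proof.
  intros Hf Hp Hpos.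
  destruct (continuity_ab_min f 0 (2 * PI)) as [m [Hm _]]; ctac.
  { intros c _; apply continuity_pt_filterlim, Hf. }
  exists (f m); split; auto. intros x.
  destruct (per_reduce f x Hp) as [y [Hy <-]]. apply Hm; lra.
Qed.
Lemma sc_min_pos f : smooth_circ f -> (forall x, 0 < f x) -> exists c, 0 < c /\ forall x, c <= f x.
Proof. intros H; apply per_min_pos; [apply sc_cts|apply sc_per]; auto. Qed.
Lemma sc_inv f : smooth_circ f -> (forall x, 0 < f x) -> smooth_circ (fun x => / f x).
Proof.
  intros H Hp; destruct (sc_min_pos f H Hp) as [c [Hc Hm]].
  apply (pusm_sc _ tt (pusm_inv _ c (sc_pusm f H) Hc (fun _ => Hm))).
Qed.
Lemma sc_sqrt f : smooth_circ f -> (forall x, 0 < f x) -> smooth_circ (fun x => sqrt (f x)).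
Proof.
  intros H Hp; destruct (sc_min_pos f H Hp) as [c [Hc Hm]].
  apply (pusm_sc _ tt (pusm_sqrt _ c (sc_pusm f H) Hc (fun _ => Hm))).
Qed.
Create HintDb sc discriminated.
#[export] Hint Constants Opaque : sc.
#[export] Hint Variables Opaque : sc.
#[export] Hint Resolve sc_plus sc_minus sc_mult sc_const sc_opp sc_Derive sc_Derive_n sc_pow sc_inv sc_sqrt : sc.
#[export] Hint Resolve sc_cts : cts.
#[export] Hint Resolve sc_cts sc_per : sc.
Ltac sctac := auto 20 with sc.
Ltac cstac := auto 20 with sc cts.

Lemma Derive_plus_sc f g : smooth_circ f -> smooth_circ g ->
  Derive (fun x => f x + g x) = fun x => Derive f x + Derive g x.
Proof. intros; apply functional_extensionality; intros; apply Derive_plus; apply sc_ex_derive; auto. Qed.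
Lemma Derive_mult_sc f g : smooth_circ f -> smooth_circ g ->
  Derive (fun x => f x * g x) = fun x => Derive f x * g x + f x * Derive g x.
Proof. intros; apply functional_extensionality; intros; apply Derive_mult; apply sc_ex_derive; auto. Qed.
Lemma Derive_scal_sc c f : Derive (fun x => c * f x) = fun x => c * Derive f x.
Proof. apply functional_extensionality; intros; apply Derive_scal. Qed.

Lemma I2_ibp_sc f g : smooth_circ f -> smooth_circ g ->
  ip (Derive f) g = - ip f (Derive g).
Proof. intros; apply I2_ibp; cstac; intros; apply sc_is_derive; auto. Qed.

(** [s] lifts an orientation-preserving diffeomorphism of the circle of degree one, with density
    [w]. Fourier analysis is carried out once for all such angles and used twice, with [w = 1] and
    with [w = 1 / b]. *)
Definition phase (w s : R -> R) :=
  smooth_circ w /\ (forall x, 0 < w x) /\ (forall x, is_derive s x (w x)) /\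
  (forall x, s (x + 2 * PI) = s x + 2 * PI).

Lemma cos_INR_per (n : nat) x : cos (INR n * (x + 2 * PI)) = cos (INR n * x).
Proof. rewrite <- (cos_period (INR n * x) n); f_equal; ring. Qed.
Lemma sin_INR_per (n : nat) x : sin (INR n * (x + 2 * PI)) = sin (INR n * x).
Proof. rewrite <- (sin_period (INR n * x) n); f_equal; ring. Qed.

Lemma is_derive_cos_phase w s k x : phase w s ->
  is_derive (fun x => cos (k * s x)) x (- k * w x * sin (k * s x)).
Proof.
  intros (_ & _ & Hs & _).
  evar_last. apply (is_derive_comp cos (fun x => k * s x)). apply is_derive_cos.
  apply (is_derive_scal s x k (w x)), Hs. unfold scal; simpl; unfold mult; simpl; ring.
Qed.
Lemma is_derive_sin_phase w s k x : phase w s ->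
  is_derive (fun x => sin (k * s x)) x (k * w x * cos (k * s x)).
Proof.
  intros (_ & _ & Hs & _).
  evar_last. apply (is_derive_comp sin (fun x => k * s x)). apply is_derive_sin.
  apply (is_derive_scal s x k (w x)), Hs. unfold scal; simpl; unfold mult; simpl; ring.
Qed.
Lemma usm_trig w s k : phase w s ->
  usm (fun (_ : unit) x => cos (k * s x)) /\ usm (fun (_ : unit) x => sin (k * s x)).
Proof.
  intros H.
  set (c := (fun (_ : unit) x => cos (k * s x))). set (d := (fun (_ : unit) x => sin (k * s x))).
  assert (HH : forall F, clo (fun F => usm F \/ F = c \/ F = d) F -> usm F).
  { apply clo_usm. intros F [HF|[-> | ->]].
    - split; [apply usm_bd; auto|].
      exists (fun i => Derive (F i)); split; [apply clo_base; left; apply usm_derive; auto|].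
      intros; apply usm_is_derive; auto.
    - split; [exists 1; intros; unfold c; apply Rabs_le, COS_bound|].
      exists (fun i x => (- k) * w x * d i x); split.
      + apply clo_mul; [|apply clo_base; auto].
        apply clo_base; left. apply usm_mult.
        apply (usm_cst (fun _ => - k) (Rabs k)); intros; rewrite Rabs_Ropp; lra.
        apply (sc_pusm w), H.
      + intros; apply is_derive_cos_phase; auto.
    - split; [exists 1; intros; unfold d; apply Rabs_le, SIN_bound|].
      exists (fun i x => k * w x * c i x); split.
      + apply clo_mul; [|apply clo_base; auto].
        apply clo_base; left. apply usm_mult.
        apply (usm_cst (fun _ => k) (Rabs k)); intros; lra.
        apply (sc_pusm w), H.
      + intros; apply is_derive_sin_phase; auto. }
  split; apply HH, clo_base; auto.
Qed.
Lemma sc_cos_phase w s (n : nat) : phase w s -> smooth_circ (fun x => cos (INR n * s x)).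
Proof.
  intros H; apply (pusm_sc (fun (_ : unit) x => cos (INR n * s x)) tt); split.
  - exact (proj1 (usm_trig w s (INR n) H)).
  - intros _ x. destruct H as (_ & _ & _ & Hp). rewrite Hp; apply cos_INR_per.
Qed.
Lemma sc_sin_phase w s (n : nat) : phase w s -> smooth_circ (fun x => sin (INR n * s x)).
Proof.
  intros H; apply (pusm_sc (fun (_ : unit) x => sin (INR n * s x)) tt); split.
  - exact (proj2 (usm_trig w s (INR n) H)).
  - intros _ x. destruct H as (_ & _ & _ & Hp). rewrite Hp; apply sin_INR_per.
Qed.
Lemma phase_id : phase (fun _ => 1) (fun x => x).
Proof.
  split; [apply sc_const|]. split; [intros; lra|]. split; [|auto].
  intros; apply (is_derive_id x).
Qed.

(** * Uniformly convergent series *)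

Lemma series_tail (M : nat -> R) : ex_series M -> forall eps, 0 < eps ->
  exists N, forall n, (N <= n)%nat -> Rabs (Series M - sum_n M n) < eps.
Proof.
  intros HM eps He. apply Series_correct in HM.
  destruct (HM (fun y => Rabs (Series M - y) < eps)) as [N HN].
  - exists (mkposreal eps He); intros y Hy. rewrite Rabs_minus_sym. exact Hy.
  - exists N; auto.
Qed.

Lemma Series_minus_sum_n (a : nat -> R) n : ex_series a ->
  Series a - sum_n a n = Series (fun k => a (S n + k)%nat).
Proof.
  intros H. rewrite (Series_incr_n a (S n)); [|lia|auto].
  rewrite sum_n_Reals; simpl pred. ring.
Qed.

Lemma Series_le' (a b : nat -> R) : (forall n, a n <= b n) -> ex_series a -> ex_series b ->
  Series a <= Series b.
Proof.
  intros H Ha Hb.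
  assert (0 <= Series (fun n => b n - a n)).
  { rewrite <- (Rmult_0_l (Series (fun _ => 0))), <- Series_scal_l.
    apply Series_le; [|apply (ex_series_minus b a); auto].
    intros n; specialize (H n); lra. }
  rewrite Series_minus in H0; auto. lra.
Qed.

Lemma ex_series_Rle (a b : nat -> R) : (forall n, Rabs (a n) <= b n) -> ex_series b -> ex_series a.
Proof. intros H; apply (@ex_series_le R_AbsRing R_CompleteNormedModule a b), H. Qed.

Lemma Series_Rabs_le (a b : nat -> R) : (forall n, Rabs (a n) <= b n) -> ex_series b ->
  Rabs (Series a) <= Series b.
Proof.
  intros H Hb.
  assert (E : ex_series (fun n => Rabs (a n))).
  { apply (ex_series_Rle _ b); auto. intros; rewrite Rabs_Rabsolu; auto. }
  eapply Rle_trans; [apply Series_Rabs, E|]. apply Series_le'; auto.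
Qed.

Lemma ex_series_scalR (c : R) (a : nat -> R) : ex_series a -> ex_series (fun n => c * a n).
Proof. apply (ex_series_scal_l c a). Qed.
Lemma ex_series_plusR (a b : nat -> R) : ex_series a -> ex_series b -> ex_series (fun n => a n + b n).
Proof. apply (ex_series_plus a b). Qed.
Lemma ex_series_minusR (a b : nat -> R) : ex_series a -> ex_series b -> ex_series (fun n => a n - b n).
Proof. apply (ex_series_minus a b). Qed.

Lemma is_series_scalR (k : R) (a : nat -> R) (x : R) : is_series a x -> is_series (fun n => k * a n) (k * x).
Proof. apply (is_series_scal_l k a x). Qed.
Lemma is_series_plusR (a c : nat -> R) (x y : R) : is_series a x -> is_series c y -> is_series (fun n => a n + c n) (x + y).
Proof. apply (is_series_plus a c x y). Qed.
Lemma is_series_minusR (a c : nat -> R) (x y : R) : is_series a x -> is_series c y -> is_series (fun n => a n - c n) (x - y).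
Proof. apply (is_series_minus a c x y). Qed.

Section UnifSeries.
Variables (u : nat -> R -> R) (M : nat -> R).
Hypothesis Hu : forall n, cts (u n).
Hypothesis Hb : forall n x, Rabs (u n x) <= M n.
Hypothesis HM : ex_series M.

Lemma ex_series_unif x : ex_series (fun n => u n x).
Proof. apply (ex_series_Rle _ M); auto. Qed.

Lemma unif_tail n x : Rabs (Series (fun n => u n x) - sum_n (fun n => u n x) n) <= Series M - sum_n M n.
Proof.
  rewrite !Series_minus_sum_n; auto; [|apply ex_series_unif].
  apply Series_Rabs_le; auto.
  apply (ex_series_incr_n M (S n)); auto.
Qed.

Lemma cts_sum_n n : cts (fun x => sum_n (fun n => u n x) n).
Proof.
  induction n.
  - intros x; apply (continuous_ext (u 0%nat)); [intros; rewrite sum_O; auto|apply Hu].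
  - intros x; apply (continuous_ext (fun x => sum_n (fun n => u n x) n + u (S n) x)).
    intros; rewrite sum_Sn; auto. apply cts_plus; auto.
Qed.

Lemma unif_series_cts : cts (fun x => Series (fun n => u n x)).
Proof.
  intros x P [[eps He] HP].
  destruct (series_tail M HM (eps / 3)) as [N HN]; [lra|].
  specialize (HN N (Nat.le_refl _)).
  destruct (cts_delta _ x (eps / 3) (cts_sum_n N)) as [d [Hd Hc]]; [lra|].
  exists (mkposreal d Hd); intros y Hy. apply HP.
  change (Rabs (Series (fun n => u n y) - Series (fun n => u n x)) < eps).
  assert (T1 := unif_tail N x). assert (T2 := unif_tail N y).
  specialize (Hc y Hy). generalize (Rle_abs (Series M - sum_n M N)).
  apply Rabs_def2 in Hc. apply Rabs_le_between in T1. apply Rabs_le_between in T2.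
  intros; apply Rabs_def1; lra.
Qed.

Lemma RInt_sum_n a b n : RInt (fun x => sum_n (fun n => u n x) n) a b = sum_n (fun n => RInt (u n) a b) n.
Proof.
  induction n.
  - rewrite sum_O; apply RInt_ext'; intros; rewrite sum_O; auto.
  - rewrite sum_Sn, <- IHn. rewrite <- (RInt_plus' _ (u (S n))).
    + apply RInt_ext'; intros; rewrite sum_Sn; auto.
    + apply cts_sum_n.
    + auto.
Qed.

Lemma unif_series_RInt a b : a <= b ->
  is_series (fun n => RInt (u n) a b) (RInt (fun x => Series (fun n => u n x)) a b).
Proof.
  intros Hab P [[eps He] HP].
  destruct (series_tail M HM (eps / (b - a + 1))) as [N HN].
  { apply Rdiv_lt_0_compat; lra. }
  exists N; intros n Hn. apply HP.
  change (Rabs (sum_n (fun n => RInt (u n) a b) n - RInt (fun x => Series (fun n => u n x)) a b) < eps).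
  rewrite <- RInt_sum_n, <- RInt_minus'; [|apply cts_sum_n|apply unif_series_cts].
  eapply Rle_lt_trans.
  { apply abs_RInt_le_const with (M := Rabs (Series M - sum_n M n)); auto.
    - apply ex_RInt_cts, cts_minus; [apply cts_sum_n|apply unif_series_cts].
    - intros t _. rewrite Rabs_minus_sym.
      eapply Rle_trans; [apply unif_tail|apply RRle_abs]. }
  specialize (HN n Hn).
  apply Rle_lt_trans with ((b - a) * (eps / (b - a + 1))).
  - apply Rmult_le_compat_l; lra.
  - unfold Rdiv. rewrite <- Rmult_assoc. apply Rmult_lt_reg_r with (b - a + 1); [lra|].
    rewrite Rmult_assoc, Rinv_l by lra. nra.
Qed.
End UnifSeries.

Lemma ex_series_inv_sq : ex_series (fun n => / INR (S n) ^ 2).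
Proof.
  apply ex_series_Rle with (b := fun n => 2 * (/ INR (S n) - / INR (S (S n)))).
  - intros n. rewrite Rabs_right.
    2: { apply Rle_ge, Rinv_nneg, pow_lt, lt_0_INR; lia. }
    rewrite (S_INR (S n)), (S_INR n). assert (0 <= INR n) by apply pos_INR.
    apply Rmult_le_reg_r with ((INR n + 1) ^ 2 * (INR n + 1 + 1)); [nra|].
    field_simplify; nra.
  - exists (2 * 1). apply (is_series_scal_l 2 _ 1).
    assert (E : forall n, sum_n (fun n => / INR (S n) - / INR (S (S n))) n = 1 - / INR (S (S n))).
    { induction n; [rewrite sum_O; simpl; field|].
      rewrite sum_Sn, IHn. unfold plus; simpl plus. rewrite ?S_INR. simpl. ring. }
    intros P HP.
    assert (L : is_lim_seq (fun n => 1 - / INR (S (S n))) 1).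
    { replace (Finite 1) with (Finite (1 - 0)) by (f_equal; ring).
      apply is_lim_seq_minus'; [apply is_lim_seq_const|].
      apply (is_lim_seq_incr_1 (fun n => / INR (S n))), (is_lim_seq_incr_1 (fun n => / INR n)).
      replace (Finite 0) with (Rbar_inv p_infty) by reflexivity.
      apply is_lim_seq_inv; [apply is_lim_seq_INR|discriminate]. }
    destruct (L P HP) as [N HN]; exists N; intros n Hn.
    rewrite E; auto.
Qed.

(** * Fourier series in the angle [s] *)

Lemma phase_lt w s x y : phase w s -> x < y -> s x < s y.
Proof.
  intros (Hw & Hp & Hs & _) Hxy.
  assert (E : RInt w x y = s y - s x) by (apply RInt_derive'; cstac).
  assert (0 < RInt w x y) by (apply RInt_gt_0; auto; intros; apply (sc_cts w Hw)).
  lra.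
Qed.
Lemma phase_cts w s : phase w s -> cts s.
Proof. intros (_ & _ & Hs & _); apply (cts_derive s w Hs). Qed.

Lemma cos_Z_per (k : Z) x : cos (IZR k * (x + 2 * PI)) = cos (IZR k * x).
Proof.
  destruct (Z_le_gt_dec 0 k) as [H|H].
  - rewrite <- (Z2Nat.id k), <- INR_IZR_INZ by lia. apply cos_INR_per.
  - rewrite <- cos_neg, <- (cos_neg (IZR k * x)), !Ropp_mult_distr_l, <- opp_IZR.
    rewrite <- (Z2Nat.id (- k)), <- INR_IZR_INZ by lia. apply cos_INR_per.
Qed.
Lemma sin_Z_per (k : Z) x : sin (IZR k * (x + 2 * PI)) = sin (IZR k * x).
Proof.
  destruct (Z_le_gt_dec 0 k) as [H|H].
  - rewrite <- (Z2Nat.id k), <- INR_IZR_INZ by lia. apply sin_INR_per.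
  - rewrite <- (Ropp_involutive (IZR k)), <- opp_IZR.
    rewrite <- (Z2Nat.id (- k)), <- INR_IZR_INZ by lia.
    rewrite <- !Ropp_mult_distr_l, !sin_neg. f_equal; apply sin_INR_per.
Qed.

Section Unique.
Variables (w s h : R -> R).
Hypothesis Hph : phase w s.
Hypothesis Hh : cts h.
Hypothesis Hper : per h.
Hypothesis Hc : forall n : nat, I2 (fun x => h x * cos (INR n * s x) * w x) = 0.
Hypothesis Hs : forall n : nat, I2 (fun x => h x * sin (INR n * s x) * w x) = 0.

Let cw : cts w. Proof. apply sc_cts, Hph. Qed.
Let cs : cts s. Proof. apply (phase_cts w), Hph. Qed.

(** Multiplication by [1 + cos (s - s0)] mixes the frequency [k] with [k - 1] and [k + 1], so the
    vanishing of all coefficients passes to [h (1 + cos (s - s0))^m]. The induction runs over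
    integer frequencies because [k - 1] may be negative. *)
Lemma unique_kernel s0 (m : nat) : forall k : Z,
  I2 (fun x => h x * (1 + cos (s x - s0)) ^ m * cos (IZR k * s x) * w x) = 0 /\
  I2 (fun x => h x * (1 + cos (s x - s0)) ^ m * sin (IZR k * s x) * w x) = 0.
Proof.
  induction m; intros k.
  - destruct (Z_le_gt_dec 0 k) as [Hk|Hk].
    + rewrite <- (Z2Nat.id k), <- INR_IZR_INZ by lia. split.
      * rewrite <- (Hc (Z.to_nat k)). apply I2_ext; intros; simpl; ring.
      * rewrite <- (Hs (Z.to_nat k)). apply I2_ext; intros; simpl; ring.
    + split.
      * rewrite <- (Hc (Z.to_nat (- k))). apply I2_ext; intros; simpl.
        rewrite INR_IZR_INZ, Z2Nat.id, opp_IZR by lia.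
        rewrite <- Ropp_mult_distr_l, cos_neg. ring.
      * rewrite <- (Ropp_involutive (I2 _)), <- I2_opp by ctac.
        rewrite <- Ropp_0, <- (Hs (Z.to_nat (- k))). f_equal. apply I2_ext; intros; simpl.
        rewrite INR_IZR_INZ, Z2Nat.id, opp_IZR by lia.
        rewrite <- Ropp_mult_distr_l, sin_neg. ring.
  - set (g := fun j x => h x * (1 + cos (s x - s0)) ^ m * cos (IZR j * s x) * w x) in IHm.
    set (d := fun j x => h x * (1 + cos (s x - s0)) ^ m * sin (IZR j * s x) * w x) in IHm.
    assert (cg : forall j, cts (g j)) by (intros; unfold g; ctac).
    assert (cd : forall j, cts (d j)) by (intros; unfold d; ctac).
    destruct (IHm k) as [A1 A2], (IHm (k + 1)%Z) as [B1 B2], (IHm (k - 1)%Z) as [C1 C2].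
    fold (g k) (g (k + 1)%Z) (g (k - 1)%Z) in *. fold (d k) (d (k + 1)%Z) (d (k - 1)%Z) in *.
    split.
    + transitivity (I2 (fun x => g k x + (cos s0 / 2 * g (k + 1)%Z x + (cos s0 / 2 * g (k - 1)%Z x +
        (sin s0 / 2 * d (k + 1)%Z x + - sin s0 / 2 * d (k - 1)%Z x))))).
      * apply I2_ext; intros x; unfold g, d. rewrite plus_IZR, minus_IZR.
        replace ((IZR k + 1) * s x) with (IZR k * s x + s x) by ring.
        replace ((IZR k - 1) * s x) with (IZR k * s x - s x) by ring.
        rewrite cos_plus, !cos_minus, sin_plus, sin_minus. simpl. field.
      * rewrite !I2_plus, !I2_scal; ctac. fold (g k) (g (k+1)%Z) (g (k-1)%Z) (d (k+1)%Z) (d (k-1)%Z).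
        rewrite A1, B1, B2, C1, C2; ring.
    + transitivity (I2 (fun x => d k x + (cos s0 / 2 * d (k + 1)%Z x + (cos s0 / 2 * d (k - 1)%Z x +
        (sin s0 / 2 * g (k - 1)%Z x + - sin s0 / 2 * g (k + 1)%Z x))))).
      * apply I2_ext; intros x; unfold g, d. rewrite plus_IZR, minus_IZR.
        replace ((IZR k + 1) * s x) with (IZR k * s x + s x) by ring.
        replace ((IZR k - 1) * s x) with (IZR k * s x - s x) by ring.
        rewrite cos_plus, !cos_minus, sin_plus, sin_minus. simpl. field.
      * rewrite !I2_plus, !I2_scal; ctac. fold (g (k+1)%Z) (g (k-1)%Z) (d k) (d (k+1)%Z) (d (k-1)%Z).
        rewrite A2, B1, B2, C1, C2; ring.
Qed.

(** The powers of [1 + cos (s - s x0)] concentrate at [x0]. If [h x0 > 0], a small neighbourhood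
    would contribute at least a multiple of [q1^m] to their integral against [h], while everything
    outside a larger one contributes at most a multiple of [q^m] with [q < q1]; yet these integrals
    vanish. *)
Lemma unique_nonpos x0 : 0 < x0 < 2 * PI -> h x0 <= 0.
Proof.
  intros Hx0. destruct (Rle_lt_dec (h x0) 0) as [|Hpos]; auto. exfalso.
  destruct (cts_delta h x0 (h x0 / 2) Hh) as [d0 [Hd0 Hdc]]; [lra|].
  set (d := Rmin (d0 / 2) (Rmin (x0 / 2) ((2 * PI - x0) / 2))).
  assert (Hd : 0 < d) by (unfold d; repeat apply Rmin_glb_lt; lra).
  assert (L1 : d <= d0 / 2) by apply Rmin_l.
  assert (L2 : d <= x0 / 2) by (eapply Rle_trans; [apply Rmin_r|apply Rmin_l]).
  assert (L3 : d <= (2 * PI - x0) / 2) by (eapply Rle_trans; [apply Rmin_r|apply Rmin_r]).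
  assert (S2 : s (2 * PI) = s 0 + 2 * PI).
  { destruct Hph as (_ & _ & _ & H). rewrite <- H; f_equal; ring. }
  assert (mono := fun x y => phase_lt w s x y Hph).
  (* [e] is a distance in the angle: within the period and outside the [d]-neighbourhood of [x0],
     [s x] keeps the distance [e] from [s x0] modulo [2 PI], so that [U <= q] there. *)
  set (e := Rmin (Rmin (s x0 - s (x0 - d)) (s (x0 + d) - s x0))
                 (Rmin (Rmin (2 * PI - (s x0 - s 0)) (s x0 - s 0)) 1)).
  assert (He : 0 < e).
  { generalize (mono (x0 - d) x0 ltac:(lra)) (mono x0 (x0 + d) ltac:(lra))
      (mono 0 x0 ltac:(lra)) (mono x0 (2 * PI) ltac:(lra)). intros.
    unfold e; repeat apply Rmin_glb_lt; lra. }
  assert (E1 : e <= s x0 - s (x0 - d)) by (eapply Rle_trans; [apply Rmin_l|apply Rmin_l]).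
  assert (E2 : e <= s (x0 + d) - s x0) by (eapply Rle_trans; [apply Rmin_l|apply Rmin_r]).
  assert (E3 : e <= 2 * PI - (s x0 - s 0))
    by (eapply Rle_trans; [apply Rmin_r|eapply Rle_trans; [apply Rmin_l|apply Rmin_l]]).
  assert (E4 : e <= s x0 - s 0)
    by (eapply Rle_trans; [apply Rmin_r|eapply Rle_trans; [apply Rmin_l|apply Rmin_r]]).
  assert (E5 : e <= 1) by (eapply Rle_trans; [apply Rmin_r|apply Rmin_r]).
  clearbody e.
  assert (P3 : 3 < PI) by (generalize PI2_3_2; lra).
  set (q := 1 + cos e). set (q1 := 1 + cos (e / 2)).
  assert (Hq : q < q1) by (unfold q, q1; generalize (cos_decreasing_1 (e / 2) e); lra).
  assert (Hq0 : 0 < q).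
  { unfold q. generalize (cos_gt_0 e). lra. }
  set (U := fun x => 1 + cos (s x - s x0)).
  assert (U0 : forall x, 0 <= U x).
  { intros x; unfold U; generalize (COS_bound (s x - s x0)); lra. }
  assert (far : forall x, 0 <= x <= 2 * PI -> d <= Rabs (x - x0) -> U x <= q).
  { intros x Hx Hfar. unfold U, q. apply Rplus_le_compat_l.
    assert (B : e <= Rabs (s x - s x0) <= 2 * PI - e).
    { destruct (Rle_lt_dec x x0) as [Hl|Hl].
      - rewrite Rabs_left1 in Hfar by lra.
        assert (s x <= s (x0 - d)).
        { destruct (Req_dec x (x0 - d)) as [->|]; [lra|]. apply Rlt_le, mono; lra. }
        assert (s 0 <= s x).
        { destruct (Req_dec x 0) as [->|]; [lra|]. apply Rlt_le, mono; lra. }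
        rewrite Rabs_left1; lra.
      - rewrite Rabs_right in Hfar by lra.
        assert (s (x0 + d) <= s x).
        { destruct (Req_dec x (x0 + d)) as [->|]; [lra|]. apply Rlt_le, mono; lra. }
        assert (s x <= s (2 * PI)).
        { destruct (Req_dec x (2 * PI)) as [->|]; [lra|]. apply Rlt_le, mono; lra. }
        rewrite Rabs_right; lra. }
    replace (cos (s x - s x0)) with (cos (Rabs (s x - s x0))).
    2: { unfold Rabs; destruct Rcase_abs; auto. apply cos_neg. }
    set (y := Rabs (s x - s x0)) in *. clearbody y.
    destruct (Rle_lt_dec y PI).
    - apply cos_decr_1; lra.
    - replace (cos y) with (cos (2 * PI - y)).
      + apply cos_decr_1; lra.
      + rewrite cos_minus, cos_2PI, sin_2PI; ring. }
  destruct (cts_delta s x0 (e / 2) cs) as [d1' [Hd1' Hd1c]]; [lra|].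
  set (d1 := Rmin (d1' / 2) d).
  assert (Hd1 : 0 < d1) by (apply Rmin_glb_lt; lra).
  assert (M1 : d1 <= d1' / 2) by apply Rmin_l.
  assert (M2 : d1 <= d) by apply Rmin_r.
  assert (near : forall x, Rabs (x - x0) <= d1 -> q1 <= U x).
  { intros x Hx. unfold q1, U. apply Rplus_le_compat_l.
    assert (Hy := Hd1c x ltac:(lra)).
    replace (cos (s x - s x0)) with (cos (Rabs (s x - s x0))).
    2: { unfold Rabs; destruct Rcase_abs; auto. apply cos_neg. }
    generalize (Rabs_pos (s x - s x0)); intros. apply cos_decr_1; lra. }
  destruct (per_bounded h Hh Hper) as [M HM].
  assert (M0 : 0 <= M) by (eapply Rle_trans; [apply Rabs_pos|apply (HM 0)]).
  assert (wpos := proj1 (proj2 Hph)).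
  assert (Ww : I2 w = 2 * PI).
  { unfold I2. rewrite (RInt_derive' s w); auto; [lra|]. apply Hph. }
  set (c := RInt w (x0 - d1) (x0 + d1)).
  assert (Hcp : 0 < c) by (apply RInt_gt_0; intros; try apply cw; auto; lra).
  assert (main : forall m, h x0 / 2 * q1 ^ m * c <= M * q ^ m * (2 * PI)).
  { intros m.
    (* Adding [M q^m w] makes the integrand nonnegative on the whole period, so its integral is
       bounded below by the part near [x0] where [U >= q1]. *)
    set (G := fun x => h x * U x ^ m * cos (IZR 0 * s x) * w x + M * q ^ m * w x).
    assert (cU : cts U) by (unfold U; ctac).
    assert (cG : cts G) by (unfold G; ctac).
    assert (HG : I2 G = M * q ^ m * (2 * PI)).
    { unfold G. rewrite I2_plus, I2_scal; ctac.
      unfold U; rewrite (proj1 (unique_kernel (s x0) m 0)), Ww; ring. }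
    assert (Gx : forall x, G x = (h x * U x ^ m + M * q ^ m) * w x).
    { intros; unfold G. rewrite Rmult_0_l, cos_0; ring. }
    assert (Um : forall x, 0 <= U x ^ m) by (intros; apply pow_le; auto).
    assert (Gp : forall x, 0 <= x <= 2 * PI -> 0 <= G x).
    { intros x Hx. rewrite Gx. apply Rmult_le_pos; [|apply Rlt_le; auto].
      destruct (Rle_lt_dec d (Rabs (x - x0))) as [Hf|Hn].
      - assert (U x ^ m <= q ^ m) by (apply pow_incr; auto).
        specialize (HM x). apply Rabs_le_between in HM. specialize (Um x). nra.
      - assert (Hy := Hdc x ltac:(lra)). apply Rabs_def2 in Hy.
        specialize (Um x). assert (0 <= q ^ m) by (apply pow_le; lra). nra. }
    rewrite <- HG. unfold I2.
    rewrite <- (RInt_Chasles' G 0 (x0 - d1)), <- (RInt_Chasles' G (x0 - d1) (x0 + d1)); auto.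
    assert (0 <= RInt G 0 (x0 - d1)) by (apply RInt_ge_0; ctac; [lra|intros; apply Gp; lra]).
    assert (0 <= RInt G (x0 + d1) (2 * PI)) by (apply RInt_ge_0; ctac; [lra|intros; apply Gp; lra]).
    assert (RInt (fun x => h x0 / 2 * q1 ^ m * w x) (x0 - d1) (x0 + d1) <= RInt G (x0 - d1) (x0 + d1)).
    { apply RInt_le; ctac; [lra|]. intros x Hx. rewrite Gx.
      apply Rmult_le_compat_r; [apply Rlt_le; auto|].
      assert (Hax : Rabs (x - x0) <= d1) by (apply Rabs_le; lra).
      assert (Hy := Hdc x ltac:(lra)). apply Rabs_def2 in Hy.
      assert (q1 ^ m <= U x ^ m) by (apply pow_incr; split; [lra|auto]).
      assert (0 <= q ^ m) by (apply pow_le; lra).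
      assert (0 <= q1 ^ m) by (apply pow_le; lra). nra. }
    rewrite RInt_scal' in H1 by auto. fold c in H1. lra. }
  assert (H1 : Rabs (q / q1) < 1).
  { rewrite Rabs_right. apply Rmult_lt_reg_r with q1; [lra|]. unfold Rdiv; rewrite Rmult_assoc, Rinv_l; lra.
    apply Rle_ge, Rlt_le, Rdiv_lt_0_compat; lra. }
  assert (H2 : 0 < h x0 / 2 * c / (M * (2 * PI) + 1)).
  { generalize two_pi_pos; intros. apply Rdiv_lt_0_compat; nra. }
  destruct (pow_lt_1_zero (q / q1) H1 _ H2) as [N HN].
  specialize (HN N (Nat.le_refl _)). specialize (main N).
  assert (P : 0 < q1 ^ N) by (apply pow_lt; lra).
  assert (P' : 0 < q ^ N) by (apply pow_lt; lra).
  unfold Rdiv at 1 in HN. rewrite Rpow_mult_distr, pow_inv in HN.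
  rewrite Rabs_right in HN by (apply Rle_ge, Rlt_le, Rdiv_lt_0_compat; auto).
  generalize two_pi_pos; intros TP.
  assert (Q : 0 < M * (2 * PI) + 1) by nra.
  apply (Rmult_lt_compat_r (q1 ^ N * (M * (2 * PI) + 1))) in HN; [|nra].
  replace (q ^ N * / q1 ^ N * (q1 ^ N * (M * (2 * PI) + 1))) with (q ^ N * (M * (2 * PI) + 1)) in HN by (field; lra).
  replace (h x0 / 2 * c / (M * (2 * PI) + 1) * (q1 ^ N * (M * (2 * PI) + 1))) with (h x0 / 2 * q1 ^ N * c) in HN by (field; lra).
  nra.
Qed.
End Unique.

(** The one-sided bound is applied to [h] and to [- h] at interior points; the integral of [h^2] is
    then zero, which together with periodicity reaches the end point. *)
Lemma fourier_unique w s h : phase w s -> cts h -> per h ->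
  (forall n : nat, I2 (fun x => h x * cos (INR n * s x) * w x) = 0) ->
  (forall n : nat, I2 (fun x => h x * sin (INR n * s x) * w x) = 0) ->
  forall x, h x = 0.
Proof.
  intros Hph Hh Hper Hc Hs.
  assert (cw : cts w) by (apply sc_cts, Hph).
  assert (cs := phase_cts w s Hph).
  assert (H : forall x, 0 < x < 2 * PI -> h x = 0).
  { intros x Hx.
    assert (h x <= 0) by (apply (unique_nonpos w s h); auto).
    assert ((fun x => - h x) x <= 0); [|simpl in *; lra].
    apply (unique_nonpos w s (fun x => - h x)); ctac.
    - intros y; rewrite Hper; auto.
    - intros n. rewrite <- Ropp_0, <- (Hc n), <- I2_opp by ctac. apply I2_ext; intros; ring.
    - intros n. rewrite <- Ropp_0, <- (Hs n), <- I2_opp by ctac. apply I2_ext; intros; ring. }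
  assert (Z : N2 h = 0).
  { unfold I2. rewrite (RInt_ext _ (fun _ => 0)); [rewrite RInt_const'; ring|].
    rewrite Rmin_left, Rmax_right by ctac.
    intros x Hx; rewrite H by auto; simpl; ring. }
  intros x. assert (E := I2_zero_eq_per (fun x => h x ^ 2)).
  assert (h x ^ 2 = 0).
  { apply E; ctac. intros y; rewrite Hper; auto. intros; apply pow2_ge_0. }
  nra.
Qed.

Definition cc w s (n : nat) f := I2 (fun x => f x * cos (INR n * s x) * w x).
Definition ss w s (n : nat) f := I2 (fun x => f x * sin (INR n * s x) * w x).

Section Fourier.
Variables (w s : R -> R).
Hypothesis Hph : phase w s.

Let cw : cts w. Proof. apply sc_cts, Hph. Qed.
Let cs : cts s. Proof. apply (phase_cts w), Hph. Qed.
Let sw : smooth_circ w. Proof. apply Hph. Qed.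
Let wpos : forall x, 0 < w x. Proof. apply Hph. Qed.

Lemma I2_weight : I2 w = 2 * PI.
Proof.
  unfold I2. destruct Hph as (_ & _ & Hs & Hp). rewrite (RInt_derive' s w); auto.
  rewrite <- (Rplus_0_l (2 * PI)), Hp. ring.
Qed.

Lemma int_cos_Z (k : Z) : k <> 0%Z -> I2 (fun x => cos (IZR k * s x) * w x) = 0.
Proof.
  intros Hk. assert (IZR k <> 0) by (apply not_0_IZR; auto).
  apply (I2_derive_per (fun x => / IZR k * sin (IZR k * s x))); ctac.
  - intros x. evar_last. apply (is_derive_scal (fun x => sin (IZR k * s x)) x (/ IZR k)).
    apply (is_derive_sin_phase w s); auto. unfold scal; simpl; unfold mult; simpl. field; auto.
  - intros x; destruct Hph as (_ & _ & _ & Hp). rewrite Hp, sin_Z_per; auto.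
Qed.
Lemma int_sin_Z (k : Z) : I2 (fun x => sin (IZR k * s x) * w x) = 0.
Proof.
  destruct (Z.eq_dec k 0) as [->|Hk].
  - transitivity (I2 (fun _ => 0)); [|rewrite I2_const; ring].
    apply I2_ext; intros. rewrite Rmult_0_l, sin_0; ring.
  - assert (IZR k <> 0) by (apply not_0_IZR; auto).
    apply (I2_derive_per (fun x => - / IZR k * cos (IZR k * s x))); ctac.
    + intros x. evar_last. apply (is_derive_scal (fun x => cos (IZR k * s x)) x (- / IZR k)).
      apply (is_derive_cos_phase w s); auto. unfold scal; simpl; unfold mult; simpl. field; auto.
    + intros x; destruct Hph as (_ & _ & _ & Hp). rewrite Hp, cos_Z_per; auto.
Qed.
Lemma int_cos_Z' (k : Z) : I2 (fun x => cos (IZR k * s x) * w x) = if Z.eq_dec k 0 then 2 * PI else 0.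
Proof.
  destruct Z.eq_dec as [->|Hk]; [|apply int_cos_Z; auto].
  rewrite <- I2_weight. apply I2_ext; intros. rewrite Rmult_0_l, cos_0; ring.
Qed.

Lemma ortho_trig (m n : nat) :
  I2 (fun x => cos (INR m * s x) * cos (INR n * s x) * w x) =
    (if Nat.eq_dec m n then if Nat.eq_dec n 0 then 2 * PI else PI else 0) /\
  I2 (fun x => sin (INR m * s x) * sin (INR n * s x) * w x) =
    (if Nat.eq_dec m n then if Nat.eq_dec n 0 then 0 else PI else 0) /\
  I2 (fun x => cos (INR m * s x) * sin (INR n * s x) * w x) = 0.
Proof.
  set (p := (Z.of_nat m + Z.of_nat n)%Z). set (q := (Z.of_nat m - Z.of_nat n)%Z).
  assert (Ep : IZR p = INR m + INR n) by (unfold p; rewrite plus_IZR, <- !INR_IZR_INZ; auto).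
  assert (Eq : IZR q = INR m - INR n) by (unfold q; rewrite minus_IZR, <- !INR_IZR_INZ; auto).
  assert (Cp := int_cos_Z' p). assert (Cq := int_cos_Z' q).
  assert (Sp := int_sin_Z p). assert (Sq := int_sin_Z q).
  rewrite Ep in *; rewrite Eq in *.
  split; [|split].
  - transitivity (/ 2 * I2 (fun x => cos ((INR m + INR n) * s x) * w x) +
      / 2 * I2 (fun x => cos ((INR m - INR n) * s x) * w x)).
    + rewrite <- !I2_scal, <- I2_plus; ctac. apply I2_ext; intros.
      rewrite Rmult_plus_distr_r, Rmult_minus_distr_r, cos_plus, cos_minus. field.
    + rewrite Cp, Cq. unfold p, q. repeat destruct Z.eq_dec; repeat destruct Nat.eq_dec; try lia; field.
  - transitivity (/ 2 * I2 (fun x => cos ((INR m - INR n) * s x) * w x) -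
      / 2 * I2 (fun x => cos ((INR m + INR n) * s x) * w x)).
    + rewrite <- !I2_scal, <- I2_minus; ctac. apply I2_ext; intros.
      rewrite Rmult_plus_distr_r, Rmult_minus_distr_r, cos_plus, cos_minus. field.
    + rewrite Cp, Cq. unfold p, q. repeat destruct Z.eq_dec; repeat destruct Nat.eq_dec; try lia; field.
  - transitivity (/ 2 * I2 (fun x => sin ((INR m + INR n) * s x) * w x) -
      / 2 * I2 (fun x => sin ((INR m - INR n) * s x) * w x)).
    + rewrite <- !I2_scal, <- I2_minus; ctac. apply I2_ext; intros.
      rewrite Rmult_plus_distr_r, Rmult_minus_distr_r, sin_plus, sin_minus. field.
    + rewrite Sp, Sq; ring.
Qed.

(** Differentiation with respect to the angle [s]. *)
Definition dw f : R -> R := fun x => Derive f x * / w x.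

Lemma sc_dw f : smooth_circ f -> smooth_circ (dw f).
Proof. intros; unfold dw; sctac. Qed.

Lemma cc_dw n f : smooth_circ f -> INR n * cc w s n f = - ss w s n (dw f).
Proof.
  intros Hf. unfold cc, ss. rewrite <- I2_scal by cstac.
  transitivity (I2 (fun x => (INR n * w x * cos (INR n * s x)) * f x)).
  { apply I2_ext; intros; ring. }
  rewrite (I2_ibp (fun x => sin (INR n * s x)) f _ (Derive f)); cstac.
  - f_equal. apply I2_ext; intros x. unfold dw. generalize (wpos x); intros; field; lra.
  - intros; apply is_derive_sin_phase; auto.
  - intros; apply sc_is_derive; auto.
  - apply sc_per, (sc_sin_phase w), Hph.
Qed.
Lemma ss_dw n f : smooth_circ f -> INR n * ss w s n f = cc w s n (dw f).
Proof.
  intros Hf. unfold cc, ss. rewrite <- I2_scal by cstac.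
  transitivity (- I2 (fun x => (- INR n * w x * sin (INR n * s x)) * f x)).
  { rewrite <- I2_opp by cstac. apply I2_ext; intros; ring. }
  rewrite (I2_ibp (fun x => cos (INR n * s x)) f _ (Derive f)); cstac.
  - rewrite Ropp_involutive. apply I2_ext; intros x. unfold dw. generalize (wpos x); intros; field; lra.
  - intros; apply is_derive_cos_phase; auto.
  - intros; apply sc_is_derive; auto.
  - apply sc_per, (sc_cos_phase w), Hph.
Qed.

Lemma coef_bound n f M : cts f -> (forall x, Rabs (f x) <= M) ->
  Rabs (cc w s n f) <= 2 * PI * M /\ Rabs (ss w s n f) <= 2 * PI * M.
Proof.
  intros Hf HM.
  assert (H : forall g, cts g -> (forall x, Rabs (g x) <= 1) ->
     Rabs (I2 (fun x => f x * g x * w x)) <= 2 * PI * M).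
  { intros g Hg Hb. eapply Rle_trans; [apply I2_abs; ctac|].
    rewrite <- I2_weight, Rmult_comm, <- I2_scal by auto. apply I2_le; ctac.
    intros x. rewrite !Rabs_mult, (Rabs_right (w x)) by (apply Rle_ge, Rlt_le, wpos).
    apply Rmult_le_compat_r; [apply Rlt_le, wpos|].
    generalize (HM x) (Hb x) (Rabs_pos (f x)) (Rabs_pos (g x)); nra. }
  split; apply H; ctac; intros; apply Rabs_le; [apply COS_bound|apply SIN_bound].
Qed.

(** Two integrations by parts in the angle, without boundary terms by periodicity. *)
Lemma coef_decay f : smooth_circ f -> exists C, forall n,
  Rabs (cc w s (S n) f) <= C * / INR (S n) ^ 2 /\ Rabs (ss w s (S n) f) <= C * / INR (S n) ^ 2.
Proof.
  intros Hf. assert (H1 := sc_dw f Hf). assert (H2 := sc_dw _ H1).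
  destruct (sc_bounded _ H2) as [M HM]. exists (2 * PI * M); intros n.
  destruct (coef_bound (S n) _ M (sc_cts _ H2) HM) as [B1 B2].
  assert (P : 0 < INR (S n)) by (apply lt_0_INR; lia).
  assert (E1 : INR (S n) ^ 2 * cc w s (S n) f = - cc w s (S n) (dw (dw f))).
  { rewrite <- ss_dw by auto. replace (INR (S n) ^ 2 * cc w s (S n) f) with (INR (S n) * (INR (S n) * cc w s (S n) f)) by ring.
    rewrite cc_dw by auto. ring. }
  assert (E2 : INR (S n) ^ 2 * ss w s (S n) f = - ss w s (S n) (dw (dw f))).
  { rewrite <- cc_dw by auto. replace (INR (S n) ^ 2 * ss w s (S n) f) with (INR (S n) * (INR (S n) * ss w s (S n) f)) by ring.
    rewrite ss_dw by auto. ring. }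
  assert (P2 : 0 < INR (S n) ^ 2) by (apply pow_lt; auto).
  split.
  - apply Rmult_le_reg_l with (INR (S n) ^ 2); auto.
    rewrite <- (Rabs_right (INR (S n) ^ 2)) at 1 by lra. rewrite <- Rabs_mult, E1, Rabs_Ropp.
    replace (INR (S n) ^ 2 * (2 * PI * M * / INR (S n) ^ 2)) with (2 * PI * M) by (field; lra). auto.
  - apply Rmult_le_reg_l with (INR (S n) ^ 2); auto.
    rewrite <- (Rabs_right (INR (S n) ^ 2)) at 1 by lra. rewrite <- Rabs_mult, E2, Rabs_Ropp.
    replace (INR (S n) ^ 2 * (2 * PI * M * / INR (S n) ^ 2)) with (2 * PI * M) by (field; lra). auto.
Qed.

Definition trig (c d : nat -> R) n x :=
  c (S n) * cos (INR (S n) * s x) + d (S n) * sin (INR (S n) * s x).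

Lemma trig_cts c d n : cts (trig c d n).
Proof. unfold trig; ctac. Qed.
Lemma trig_per c d n : per (trig c d n).
Proof.
  intros x; unfold trig. destruct Hph as (_ & _ & _ & Hp). rewrite Hp, cos_INR_per, sin_INR_per; auto.
Qed.
Lemma trig_bound c d n x : Rabs (trig c d n x) <= Rabs (c (S n)) + Rabs (d (S n)).
Proof.
  unfold trig. eapply Rle_trans; [apply Rabs_triang|]. rewrite !Rabs_mult.
  assert (Rabs (cos (INR (S n) * s x)) <= 1) by apply Rabs_le, COS_bound.
  assert (Rabs (sin (INR (S n) * s x)) <= 1) by apply Rabs_le, SIN_bound.
  generalize (Rabs_pos (c (S n))) (Rabs_pos (d (S n))); nra.
Qed.

Definition tser (c d : nat -> R) x := Series (fun n => trig c d n x).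

Lemma sum_n_single (a : nat -> R) (m : nat) : (forall n, n <> m -> a n = 0) -> is_series a (a m).
Proof.
  intros H P HP. exists m; intros n Hn.
  assert (E : a m = sum_n a n);
    [|assert (HP' := locally_singleton (a m) P HP); rewrite E in HP'; exact HP'].
  induction Hn as [|n Hn IH].
  - destruct m; [rewrite sum_O; auto|]. rewrite sum_Sn.
    replace (sum_n a m) with 0; [unfold plus; simpl; ring|].
    symmetry. transitivity (sum_n (fun _ => 0) m).
    + apply sum_n_ext_loc; intros k Hk; apply H; lia.
    + rewrite sum_n_const. ring.
  - rewrite sum_Sn, <- IH, (H (S n)) by lia. unfold plus; simpl; ring.
Qed.

Section Coefs.
Variables (c d M : nat -> R).
Hypothesis HcM : forall n, Rabs (c (S n)) + Rabs (d (S n)) <= M n.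
Hypothesis HM : ex_series M.

Lemma tser_term_bound n x : Rabs (trig c d n x) <= M n.
Proof. eapply Rle_trans; [apply trig_bound|auto]. Qed.
Lemma tser_cts : cts (tser c d).
Proof. apply unif_series_cts with M; auto using trig_cts, tser_term_bound. Qed.
Lemma tser_per : per (tser c d).
Proof. intros x; unfold tser; apply Series_ext; intros; apply trig_per. Qed.

Lemma tser_int g : cts g -> per g ->
  is_series (fun n => ip (trig c d n) g) (ip (tser c d) g).
Proof.
  intros Hg Hp. destruct (per_bounded g Hg Hp) as [G HG].
  assert (E : ip (tser c d) g = I2 (fun x => Series (fun n => trig c d n x * g x))).
  { apply I2_ext; intros x; unfold tser; rewrite Series_scal_r; auto. }
  rewrite E. apply unif_series_RInt with (M := fun n => M n * G); ctac.
  - intros; apply cts_mult; auto using trig_cts.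
  - intros n x; rewrite Rabs_mult. apply Rmult_le_compat; auto using Rabs_pos, tser_term_bound.
  - apply (ex_series_scal_r G M HM).
Qed.

Lemma trig_coef m n :
  I2 (fun x => trig c d n x * (cos (INR m * s x) * w x)) = (if Nat.eq_dec (S n) m then PI * c m else 0) /\
  I2 (fun x => trig c d n x * (sin (INR m * s x) * w x)) = (if Nat.eq_dec (S n) m then PI * d m else 0).
Proof.
  destruct (ortho_trig (S n) m) as (O1 & O2 & O3).
  destruct (ortho_trig m (S n)) as (_ & _ & O4).
  unfold trig; split.
  - transitivity (c (S n) * I2 (fun x => cos (INR (S n) * s x) * cos (INR m * s x) * w x) +
       d (S n) * I2 (fun x => cos (INR m * s x) * sin (INR (S n) * s x) * w x)).
    + rewrite <- !I2_scal, <- I2_plus; ctac. apply I2_ext; intros; ring.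
    + rewrite O1, O4. destruct Nat.eq_dec as [<-|]; [|ring]. destruct Nat.eq_dec; [lia|ring].
  - transitivity (c (S n) * I2 (fun x => cos (INR (S n) * s x) * sin (INR m * s x) * w x) +
       d (S n) * I2 (fun x => sin (INR (S n) * s x) * sin (INR m * s x) * w x)).
    + rewrite <- !I2_scal, <- I2_plus; ctac. apply I2_ext; intros; ring.
    + rewrite O2, O3. destruct Nat.eq_dec as [<-|]; [|ring]. destruct Nat.eq_dec; [lia|ring].
Qed.

Lemma tser_coef m : cc w s (S m) (tser c d) = PI * c (S m) /\ ss w s (S m) (tser c d) = PI * d (S m).
Proof.
  split.
  - assert (H := tser_int (fun x => cos (INR (S m) * s x) * w x)).
    assert (S1 := sum_n_single (fun n => I2 (fun x => trig c d n x * (cos (INR (S m) * s x) * w x))) m).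
    transitivity (I2 (fun x => tser c d x * (cos (INR (S m) * s x) * w x))).
    { apply I2_ext; intros; ring. }
    rewrite <- (is_series_unique _ _ (H ltac:(ctac) ltac:(apply sc_per, sc_mult; auto; apply (sc_cos_phase w); auto))).
    rewrite (is_series_unique _ _ (S1 ltac:(intros n Hn; cbv beta; rewrite (proj1 (trig_coef _ _)); destruct Nat.eq_dec; auto; lia))).
    rewrite (proj1 (trig_coef _ _)). destruct Nat.eq_dec; auto; lia.
  - assert (H := tser_int (fun x => sin (INR (S m) * s x) * w x)).
    assert (S1 := sum_n_single (fun n => I2 (fun x => trig c d n x * (sin (INR (S m) * s x) * w x))) m).
    transitivity (I2 (fun x => tser c d x * (sin (INR (S m) * s x) * w x))).
    { apply I2_ext; intros; ring. }
    rewrite <- (is_series_unique _ _ (H ltac:(ctac) ltac:(apply sc_per, sc_mult; auto; apply (sc_sin_phase w); auto))).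
    rewrite (is_series_unique _ _ (S1 ltac:(intros n Hn; cbv beta; rewrite (proj2 (trig_coef _ _)); destruct Nat.eq_dec; auto; lia))).
    rewrite (proj2 (trig_coef _ _)). destruct Nat.eq_dec; auto; lia.
Qed.
Lemma tser_coef0 : cc w s 0 (tser c d) = 0 /\ ss w s 0 (tser c d) = 0.
Proof.
  split.
  - assert (H := tser_int (fun x => cos (INR 0 * s x) * w x)).
    transitivity (I2 (fun x => tser c d x * (cos (INR 0 * s x) * w x))).
    { apply I2_ext; intros; ring. }
    rewrite <- (is_series_unique _ _ (H ltac:(ctac) ltac:(apply sc_per, sc_mult; auto; apply (sc_cos_phase w); auto))).
    transitivity (Series (fun n => 0 * 0)).
    + apply Series_ext; intros n. rewrite (proj1 (trig_coef _ _)). destruct Nat.eq_dec; [lia|ring].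
    + rewrite Series_scal_l; ring.
  - transitivity (I2 (fun _ => 0)); [|rewrite I2_const; ring].
    apply I2_ext; intros. simpl. rewrite Rmult_0_l, sin_0; ring.
Qed.
End Coefs.

Lemma ss_0 f : ss w s 0 f = 0.
Proof.
  transitivity (I2 (fun _ => 0)); [|rewrite I2_const; ring].
  apply I2_ext; intros. simpl. rewrite Rmult_0_l, sin_0; ring.
Qed.

Lemma coef_plus n f g : cts f -> cts g ->
  cc w s n (fun x => f x + g x) = cc w s n f + cc w s n g /\
  ss w s n (fun x => f x + g x) = ss w s n f + ss w s n g.
Proof.
  intros Hf Hg; unfold cc, ss; split; rewrite <- I2_plus by ctac; apply I2_ext; intros; ring.
Qed.
Lemma coef_scal n a f : cts f ->
  cc w s n (fun x => a * f x) = a * cc w s n f /\ ss w s n (fun x => a * f x) = a * ss w s n f.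
Proof.
  intros Hf; unfold cc, ss; split; rewrite <- I2_scal by ctac; apply I2_ext; intros; ring.
Qed.
Lemma coef_const m a :
  cc w s (S m) (fun _ => a) = 0 /\ ss w s (S m) (fun _ => a) = 0 /\ cc w s 0 (fun _ => a) = 2 * PI * a.
Proof.
  assert (Hz : IZR (Z.of_nat (S m)) = INR (S m)) by (symmetry; apply INR_IZR_INZ).
  unfold cc, ss; split; [|split].
  - rewrite <- (Rmult_0_r a), <- (int_cos_Z (Z.of_nat (S m))) by lia.
    rewrite <- I2_scal by ctac. apply I2_ext; intros; rewrite Hz; ring.
  - rewrite <- (Rmult_0_r a), <- (int_sin_Z (Z.of_nat (S m))).
    rewrite <- I2_scal by ctac. apply I2_ext; intros; rewrite Hz; ring.
  - rewrite <- I2_weight, Rmult_comm, <- I2_scal by auto. apply I2_ext; intros; simpl.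
    rewrite Rmult_0_l, cos_0; ring.
Qed.

Lemma coef_inj f g : cts f -> per f -> cts g -> per g ->
  (forall n, cc w s n f = cc w s n g) -> (forall n, ss w s n f = ss w s n g) -> forall x, f x = g x.
Proof.
  intros Hf Pf Hg Pg Hc Hs.
  assert (E : forall n, cc w s n (fun x => f x + (-1) * g x) = 0 /\ ss w s n (fun x => f x + (-1) * g x) = 0).
  { intros n. destruct (coef_plus n f (fun x => (-1) * g x)) as [-> ->]; ctac.
    destruct (coef_scal n (-1) g) as [-> ->]; auto. rewrite Hc, Hs; split; ring. }
  intros x. assert ((fun x => f x + (-1) * g x) x = 0); [|simpl in H; lra].
  apply (fourier_unique w s (fun x => f x + (-1) * g x)); ctac.
  - intros y; rewrite Pf, Pg; auto.
  - intros n; exact (proj1 (E n)).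
  - intros n; exact (proj2 (E n)).
Qed.

(** No summation kernel is involved: the coefficients are summable, so the series defines a
    continuous periodic function with the coefficients of [f], and uniqueness identifies the two. *)
Lemma fourier_series f x : smooth_circ f ->
  is_series (fun n => (cc w s (S n) f * cos (INR (S n) * s x) + ss w s (S n) f * sin (INR (S n) * s x)) / PI)
    (f x - cc w s 0 f / (2 * PI)).
Proof.
  intros Hf. destruct (coef_decay f Hf) as [C HC].
  set (c := fun n => cc w s n f / PI). set (d := fun n => ss w s n f / PI).
  set (M := fun n => (2 * C / PI) * / INR (S n) ^ 2).
  assert (PP := PI_RGT_0).
  assert (HcM : forall n, Rabs (c (S n)) + Rabs (d (S n)) <= M n).
  { intros n; unfold c, d, M, Rdiv. rewrite !Rabs_mult, (Rabs_right (/ PI)).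
    2: { apply Rle_ge, Rinv_nneg; auto. }
    destruct (HC n) as [H1 H2]. rewrite <- Rmult_plus_distr_r.
    replace (2 * C * / PI * / INR (S n) ^ 2) with ((C * / INR (S n) ^ 2 + C * / INR (S n) ^ 2) * / PI) by ring.
    apply Rmult_le_compat_r; [apply Rinv_nneg; auto|lra]. }
  assert (HM : ex_series M) by apply (ex_series_scal_l (2 * C / PI) _ ex_series_inv_sq).
  assert (tc := tser_cts c d M HcM HM).
  assert (tp := tser_per c d).
  assert (E : f x = cc w s 0 f / (2 * PI) + tser c d x).
  { apply (coef_inj f (fun x => cc w s 0 f / (2 * PI) + tser c d x)); cstac.
    - intros y; rewrite tp; auto.
    - intros n. destruct (coef_plus n (fun _ => cc w s 0 f / (2 * PI)) (tser c d)) as [-> _]; ctac.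
      destruct n.
      + rewrite (proj1 (tser_coef0 c d M HcM HM)), (proj2 (proj2 (coef_const 0 _))). field; lra.
      + rewrite (proj1 (tser_coef c d M HcM HM n)), (proj1 (coef_const n _)). unfold c. field; lra.
    - intros n. destruct (coef_plus n (fun _ => cc w s 0 f / (2 * PI)) (tser c d)) as [_ ->]; ctac.
      destruct n.
      + rewrite !ss_0; ring.
      + rewrite (proj2 (tser_coef c d M HcM HM n)), (proj1 (proj2 (coef_const n _))). unfold d. field; lra. }
  replace (f x - cc w s 0 f / (2 * PI)) with (tser c d x) by lra.
  unfold tser. apply (is_series_ext (fun n => trig c d n x)).
  { intros n; unfold trig, c, d. toR; field; lra. }
  apply Series_correct, (ex_series_unif (fun n => trig c d n) M); auto.
  intros; apply (tser_term_bound c d M HcM).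
Qed.

(** Smoothness is asked of [f] only: its series converges uniformly and may be integrated against a
    merely continuous [g]. The frequency zero has a different normalization and stands on the other
    side. *)
Lemma fourier_parseval f g : smooth_circ f -> cts g -> per g ->
  is_series (fun n => (cc w s (S n) f * cc w s (S n) g + ss w s (S n) f * ss w s (S n) g) / PI)
    (I2 (fun x => f x * g x * w x) - cc w s 0 f * cc w s 0 g / (2 * PI)).
Proof.
  intros Hf Hg Pg. destruct (coef_decay f Hf) as [C HC].
  set (c := fun n => cc w s n f / PI). set (d := fun n => ss w s n f / PI).
  set (M := fun n => (2 * C / PI) * / INR (S n) ^ 2).
  assert (PP := PI_RGT_0).
  assert (HcM : forall n, Rabs (c (S n)) + Rabs (d (S n)) <= M n).
  { intros n; unfold c, d, M, Rdiv. rewrite !Rabs_mult, (Rabs_right (/ PI)).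
    2: { apply Rle_ge, Rinv_nneg; auto. }
    destruct (HC n) as [H1 H2]. rewrite <- Rmult_plus_distr_r.
    replace (2 * C * / PI * / INR (S n) ^ 2) with ((C * / INR (S n) ^ 2 + C * / INR (S n) ^ 2) * / PI) by ring.
    apply Rmult_le_compat_r; [apply Rinv_nneg; auto|lra]. }
  assert (HM : ex_series M) by apply (ex_series_scal_l (2 * C / PI) _ ex_series_inv_sq).
  assert (E : forall x, f x = cc w s 0 f / (2 * PI) + tser c d x).
  { intros x. assert (H := fourier_series f x Hf). apply is_series_unique in H.
    unfold tser.
    replace (Series (fun n => trig c d n x)) with (f x - cc w s 0 f / (2 * PI)); [lra|].
    rewrite <- H. apply Series_ext; intros n. unfold trig, c, d. field; lra. }
  assert (T := tser_int c d M HcM HM (fun x => g x * w x) ltac:(ctac)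
    ltac:(intros y; rewrite Pg, (sc_per w sw); auto)).
  replace (I2 (fun x => f x * g x * w x) - cc w s 0 f * cc w s 0 g / (2 * PI))
    with (I2 (fun x => tser c d x * (g x * w x))).
  - apply (is_series_ext (fun n => I2 (fun x => trig c d n x * (g x * w x)))); auto.
    intros n. unfold trig.
    transitivity (I2 (fun x => c (S n) * (g x * cos (INR (S n) * s x) * w x) + d (S n) * (g x * sin (INR (S n) * s x) * w x))).
    + apply I2_ext; intros; ring.
    + rewrite I2_plus, !I2_scal; ctac. unfold c, d.
      fold (cc w s (S n) g) (ss w s (S n) g). toR; field; lra.
  - assert (tc := tser_cts c d M HcM HM).
    transitivity (I2 (fun x => f x * g x * w x - cc w s 0 f / (2 * PI) * (g x * cos (INR 0 * s x) * w x))).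
    + apply I2_ext; intros x. rewrite (E x). simpl. rewrite Rmult_0_l, cos_0. ring.
    + rewrite I2_minus, I2_scal; cstac. change (I2 (fun x => g x * cos (INR 0 * s x) * w x)) with (cc w s 0 g). field; lra.
Qed.
End Fourier.

(** * The operator Lambda on smooth functions *)

Notation fc := (cc (fun _ => 1) (fun x => x)).
Notation fs := (ss (fun _ => 1) (fun x => x)).
Notation ts := (tser (fun x => x)).

Lemma INR_S_pos n : 0 < INR (S n).
Proof. apply lt_0_INR; lia. Qed.
#[export] Hint Resolve INR_S_pos pos_INR : cts.

Lemma fc_eq n f : fc n f = I2 (fun x => f x * cos (INR n * x)).
Proof. apply I2_ext; intros; ring. Qed.
Lemma fs_eq n f : fs n f = I2 (fun x => f x * sin (INR n * x)).
Proof. apply I2_ext; intros; ring. Qed.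
Lemma fc_0 f : fc 0 f = I2 f.
Proof. apply I2_ext; intros. simpl. rewrite Rmult_0_l, cos_0; ring. Qed.
Lemma fs_0 f : fs 0 f = 0.
Proof. apply ss_0. Qed.

Lemma coef_ext n f g : (forall x, f x = g x) -> fc n f = fc n g /\ fs n f = fs n g.
Proof. intros H; split; apply I2_ext; intros; rewrite H; auto. Qed.

Lemma coef_opp1 n f : cts f -> fc n (fun x => - f x) = - fc n f.
Proof. intros; unfold cc; rewrite <- I2_opp by ctac; apply I2_ext; intros; ring. Qed.
Lemma coef_opp2 n f : cts f -> fs n (fun x => - f x) = - fs n f.
Proof. intros; unfold ss; rewrite <- I2_opp by ctac; apply I2_ext; intros; ring. Qed.

Lemma dw_one f x : dw (fun _ => 1) f x = Derive f x.
Proof. unfold dw. rewrite Rinv_1; ring. Qed.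
Lemma fc_Derive n f : smooth_circ f -> fc n (Derive f) = INR n * fs n f.
Proof.
  intros H. rewrite (ss_dw _ _ phase_id n f H). refine (proj1 (coef_ext n _ _ _)). intros; rewrite dw_one; auto.
Qed.
Lemma fs_Derive n f : smooth_circ f -> fs n (Derive f) = - (INR n * fc n f).
Proof.
  intros H. rewrite (cc_dw _ _ phase_id n f H), Ropp_involutive.
  refine (proj2 (coef_ext n _ _ _)). intros; rewrite dw_one; auto.
Qed.
Lemma coef_Derive_n_abs n f k : smooth_circ f ->
  Rabs (fc n (Derive_n f k)) + Rabs (fs n (Derive_n f k)) = INR n ^ k * (Rabs (fc n f) + Rabs (fs n f)).
Proof.
  intros H; induction k; [change (Derive_n f 0) with f; rewrite pow_O; ring|].
  change (Derive_n f (S k)) with (Derive (Derive_n f k)). rewrite fc_Derive, fs_Derive by sctac.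
  rewrite Rabs_Ropp, !Rabs_mult, (Rabs_right (INR n)) by apply Rle_ge, pos_INR.
  transitivity (INR n * (Rabs (fc n (Derive_n f k)) + Rabs (fs n (Derive_n f k)))); [ring|].
  rewrite IHk, <- tech_pow_Rmult. ring.
Qed.

(** The Fourier side of [usm]: decay faster than every power, uniformly in [i]. The frequency zero
    is left out and controlled separately. *)
Definition rapid {I : Type} (c d : I -> nat -> R) :=
  forall m, exists C, forall i n, INR (S n) ^ m * (Rabs (c i (S n)) + Rabs (d i (S n))) <= C.

Lemma pusm_rapid {I} (F : I -> R -> R) : pusm F ->
  rapid (fun i n => fc n (F i)) (fun i n => fs n (F i)).
Proof.
  intros HF m. destruct (proj1 HF m) as [C HC]. exists (2 * PI * C + 2 * PI * C); intros i n.
  assert (Hs := pusm_sc F i HF).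
  rewrite <- coef_Derive_n_abs by auto.
  destruct (coef_bound _ _ phase_id (S n) (Derive_n (F i) m) C) as [B1 B2]; cstac.
  - intros; apply HC.
  - lra.
Qed.

Lemma sc_sup_bound f M : smooth_circ f -> ex_series M ->
  (forall n, Rabs (fc (S n) f) + Rabs (fs (S n) f) <= M n) ->
  forall x, Rabs (f x) <= Rabs (fc 0 f) / (2 * PI) + Series M / PI.
Proof.
  intros Hf HM Hb x. assert (PP := PI_RGT_0).
  assert (F := fourier_series _ _ phase_id f x Hf). apply is_series_unique in F.
  assert (B : Rabs (f x - fc 0 f / (2 * PI)) <= Series (fun n => / PI * M n)).
  { rewrite <- F. apply Series_Rabs_le; [|apply (ex_series_scal_l (/ PI) M HM)].
    intros n. unfold Rdiv; rewrite Rabs_mult, (Rabs_right (/ PI)).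
    2: { apply Rle_ge, Rinv_nneg; auto. }
    rewrite Rmult_comm. apply Rmult_le_compat_l; [apply Rinv_nneg; auto|].
    eapply Rle_trans; [|apply Hb].
    apply (trig_bound (fun x => x) (fun n => fc n f) (fun n => fs n f) n x). }
  rewrite Series_scal_l in B.
  assert (E : Rabs (fc 0 f / (2 * PI)) = Rabs (fc 0 f) / (2 * PI)).
  { unfold Rdiv; rewrite Rabs_mult, (Rabs_right (/ (2 * PI))); auto.
    apply Rle_ge, Rinv_nneg; ctac. }
  replace (f x) with ((f x - fc 0 f / (2 * PI)) + fc 0 f / (2 * PI)) by ring.
  eapply Rle_trans; [apply Rabs_triang|]. rewrite E. unfold Rdiv at 4. lra.
Qed.

Lemma rapid_pusm {I} (F : I -> R -> R) C0 : (forall i, smooth_circ (F i)) ->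
  (forall i, Rabs (fc 0 (F i)) <= C0) ->
  rapid (fun i n => fc n (F i)) (fun i n => fs n (F i)) -> pusm F.
Proof.
  intros Hs H0 HR; split; [|intros; apply sc_per; auto].
  (* Two powers beyond the order [k] of the derivative leave the summable majorant [1 / n^2]. *)
  intros k. destruct (HR (k + 2)%nat) as [C HC].
  set (M := fun n => C * / INR (S n) ^ 2).
  assert (HM : ex_series M) by apply (ex_series_scal_l C _ ex_series_inv_sq).
  exists (C0 / (2 * PI) + Series M / PI).
  assert (PP := PI_RGT_0).
  intros i x; split; [apply (sc_ex_derive (Derive_n (F i) k)); sctac|].
  eapply Rle_trans; [apply (sc_sup_bound _ M); sctac|].
  - intros n. rewrite coef_Derive_n_abs by auto. unfold M.
    specialize (HC i n). rewrite pow_add in HC.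
    assert (0 < INR (S n) ^ 2) by (apply pow_lt; ctac).
    apply Rmult_le_reg_r with (INR (S n) ^ 2); auto.
    replace (C * / INR (S n) ^ 2 * INR (S n) ^ 2) with C by (field; apply Rgt_not_eq, INR_S_pos). lra.
  - apply Rplus_le_compat_r. unfold Rdiv. apply Rmult_le_compat_r.
    { apply Rinv_nneg; lra. }
    assert (0 <= C0) by (eapply Rle_trans; [apply Rabs_pos|apply (H0 i)]).
    destruct k; [apply H0|].
    change (Derive_n (F i) (S k)) with (Derive (Derive_n (F i) k)). rewrite fc_Derive by sctac. simpl INR. rewrite Rmult_0_l, Rabs_R0; auto.
Qed.

(** Remainder bounds of second order are additive over a series. Termwise differentiation is
    obtained from this, with summable constants in place of uniform convergence of the
    derivatives. *)
Lemma is_derive_quad (f : R -> R) x l K : (forall h, Rabs (f (x + h) - f x - h * l) <= K * h ^ 2) ->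
  is_derive f x l.
Proof.
  intros H. apply is_derive_Reals. intros eps He.
  assert (HK : 0 < Rabs K + 1) by (generalize (Rabs_pos K); lra).
  exists (mkposreal (eps / (Rabs K + 1)) (Rdiv_lt_0_compat _ _ He HK)). simpl. intros h Hh0 Hh.
  specialize (H h).
  replace ((f (x + h) - f x) / h - l) with ((f (x + h) - f x - h * l) / h) by (field; auto).
  unfold Rdiv. rewrite Rabs_mult, Rabs_inv.
  assert (0 < Rabs h) by (apply Rabs_pos_lt; auto).
  apply Rmult_lt_reg_r with (Rabs h); auto.
  rewrite Rmult_assoc, Rinv_l, Rmult_1_r by lra.
  apply (Rmult_lt_compat_r (Rabs K + 1)) in Hh; auto.
  unfold Rdiv in Hh; rewrite Rmult_assoc, Rinv_l, Rmult_1_r in Hh by lra.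
  assert (E : h ^ 2 = Rabs h * Rabs h) by (rewrite <- Rabs_mult, Rabs_right; nra).
  rewrite E in H. generalize (RRle_abs K); intros. nra.
Qed.

Lemma taylor_quad (f f1 f2 : R -> R) M : (forall x, is_derive f x (f1 x)) -> (forall x, is_derive f1 x (f2 x)) ->
  (forall x, Rabs (f2 x) <= M) -> forall x h, Rabs (f (x + h) - f x - h * f1 x) <= M * h ^ 2.
Proof.
  intros H1 H2 HM x h.
  assert (C : forall g g' : R -> R, (forall x, is_derive g x (g' x)) -> forall y, continuity_pt g y).
  { intros g g' Hg y. apply continuity_pt_filterlim, (ex_derive_continuous g). eexists; apply Hg. }
  destruct (MVT_gen f x (x + h) f1) as [xi [Hxi E1]]; auto.
  { intros; apply (C f f1 H1). }
  destruct (MVT_gen f1 x xi f2) as [et [_ E2]]; auto.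
  { intros; apply (C f1 f2 H2). }
  assert (Hd : Rabs (xi - x) <= Rabs h).
  { unfold Rmin, Rmax in Hxi; destruct Rle_dec; unfold Rabs; repeat destruct Rcase_abs; lra. }
  replace (f (x + h) - f x - h * f1 x) with (h * (f2 et * (xi - x))).
  2: { rewrite E1, <- E2. ring. }
  rewrite !Rabs_mult. replace (h ^ 2) with (Rabs h * Rabs h) by (rewrite <- Rabs_mult, Rabs_right; nra).
  specialize (HM et). generalize (Rabs_pos h) (Rabs_pos (f2 et)) (Rabs_pos (xi - x)); intros.
  assert (Rabs (f2 et) * Rabs (xi - x) <= M * Rabs h) by (apply Rmult_le_compat; auto).
  nra.
Qed.

Lemma rapid_weak {I} (c d : I -> nat -> R) : rapid c d ->
  rapid (fun i n => INR n * d i n) (fun i n => - (INR n * c i n)).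
Proof.
  intros H m. destruct (H (S m)) as [C HC]. exists C; intros i n. specialize (HC i n).
  rewrite Rabs_Ropp, !Rabs_mult, (Rabs_right (INR (S n))) by (apply Rle_ge; ctac).
  rewrite <- tech_pow_Rmult in HC. lra.
Qed.

Lemma rapid_summable (c d : unit -> nat -> R) : rapid c d ->
  exists M, ex_series M /\ forall n, Rabs (c tt (S n)) + Rabs (d tt (S n)) <= M n.
Proof.
  intros H. destruct (H 2%nat) as [C HC]. exists (fun n => C * / INR (S n) ^ 2); split.
  - apply (ex_series_scal_l C _ ex_series_inv_sq).
  - intros n; specialize (HC tt n).
    assert (0 < INR (S n) ^ 2) by (apply pow_lt; ctac).
    apply Rmult_le_reg_l with (INR (S n) ^ 2); auto.
    replace (INR (S n) ^ 2 * (C * / INR (S n) ^ 2)) with C by (field; apply Rgt_not_eq, INR_S_pos). auto.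
Qed.

Definition dc (c d : nat -> R) : nat -> R := fun n => INR n * d n.
Definition dd (c d : nat -> R) : nat -> R := fun n => - (INR n * c n).

Lemma is_derive_trig c d n x : is_derive (trig (fun x => x) c d n) x (trig (fun x => x) (dc c d) (dd c d) n x).
Proof.
  unfold trig, dc, dd. evar_last.
  apply (is_derive_plus (fun x => c (S n) * cos (INR (S n) * x)) (fun x => d (S n) * sin (INR (S n) * x))).
  - apply (is_derive_scal (fun x => cos (INR (S n) * x)) x (c (S n))).
    apply (is_derive_cos_phase _ (fun x => x) _ _ phase_id).
  - apply (is_derive_scal (fun x => sin (INR (S n) * x)) x (d (S n))).
    apply (is_derive_sin_phase _ (fun x => x) _ _ phase_id).
  - generalize (INR (S n)) (c (S n)) (d (S n)); intros; simpl; toR; unfold plus; simpl; ring.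
Qed.

Lemma is_derive_tser c d : rapid (fun _ : unit => c) (fun _ => d) ->
  forall x, is_derive (ts c d) x (ts (dc c d) (dd c d) x).
Proof.
  intros HR x.
  assert (HR1 := rapid_weak _ _ HR). assert (HR2 := rapid_weak _ _ HR1).
  destruct (rapid_summable _ _ HR) as [M0 [S0 B0]].
  destruct (rapid_summable _ _ HR1) as [M1 [S1 B1]].
  destruct (rapid_summable _ _ HR2) as [M2 [S2 B2]].
  assert (T0 : forall x, ex_series (fun n => trig (fun x => x) c d n x)).
  { intros y; apply (ex_series_unif _ M0); auto. intros; apply tser_term_bound; auto. }
  assert (T1 : forall x, ex_series (fun n => trig (fun x => x) (dc c d) (dd c d) n x)).
  { intros y; apply (ex_series_unif _ M1); auto. intros; apply tser_term_bound; auto. }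
  apply is_derive_quad with (Series M2). intros h.
  unfold tser. rewrite <- Series_scal_l, <- !Series_minus; auto.
  2: apply (ex_series_minus (fun n => trig _ c d n (x + h)) (fun n => trig _ c d n x)); auto.
  2: apply (ex_series_scal_l h (fun n => trig (fun x => x) (dc c d) (dd c d) n x)); auto.
  rewrite <- Series_scal_r. apply Series_Rabs_le.
  2: apply (ex_series_scal_r (h ^ 2) M2); auto.
  intros n. apply (taylor_quad _ _ (trig (fun x => x) (dc (dc c d) (dd c d)) (dd (dc c d) (dd c d)) n)).
  - intros; apply is_derive_trig.
  - intros; apply is_derive_trig.
  - intros y. apply tser_term_bound. intros k. apply (B2 k).
Qed.

Lemma sc_tser c d : rapid (fun _ : unit => c) (fun _ => d) -> smooth_circ (ts c d).
Proof.
  intros HR.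
  set (G := fun F : unit -> R -> R => exists c d, rapid (fun _ : unit => c) (fun _ => d) /\ F = fun _ => ts c d).
  apply (pusm_sc (fun _ : unit => ts c d) tt). split; [|intros _; apply (tser_per _ _ phase_id)].
  apply (clo_usm G); [|apply clo_base; exists c, d; auto].
  intros F (c' & d' & HR' & ->); split.
  - destruct (rapid_summable _ _ HR') as [M0 [S0 B0]].
    destruct (per_bounded (ts c' d')) as [C HC].
    + apply (tser_cts _ _ phase_id _ _ M0); auto.
    + apply (tser_per _ _ phase_id).
    + exists C; auto.
  - exists (fun _ => ts (dc c' d') (dd c' d')); split.
    + apply clo_base. eexists _, _; split; [|reflexivity]. apply (rapid_weak _ _ HR').
    + intros; apply is_derive_tser; auto.
Qed.
Lemma ts_coef c d : rapid (fun _ : unit => c) (fun _ => d) ->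
  forall n, fc (S n) (ts c d) = PI * c (S n) /\ fs (S n) (ts c d) = PI * d (S n) /\ fc 0 (ts c d) = 0.
Proof.
  intros HR n. destruct (rapid_summable _ _ HR) as [M [SM BM]].
  destruct (tser_coef _ _ phase_id c d M BM SM n) as [-> ->].
  destruct (tser_coef0 _ _ phase_id c d M BM SM) as [-> _]. auto.
Qed.

(** An operator defined by its Fourier series; [LambdaRel_Lam] and [LambdaRel_intro] identify it
    with the relation [LambdaRel]. *)
Definition Lam f := ts (fun n => INR n * fc n f / PI) (fun n => INR n * fs n f / PI).

Lemma Lam_rapid {I} (F : I -> R -> R) : pusm F ->
  rapid (fun i n => INR n * fc n (F i) / PI) (fun i n => INR n * fs n (F i) / PI).
Proof.
  intros HF m. destruct (pusm_rapid F HF (S m)) as [C HC]. exists (C * / PI); intros i n.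
  specialize (HC i n). assert (PP := PI_RGT_0). assert (0 < / PI) by (apply Rinv_0_lt_compat; auto).
  unfold Rdiv. rewrite !Rabs_mult, (Rabs_right (INR (S n))), (Rabs_right (/ PI)) by (apply Rle_ge; ctac; lra).
  rewrite <- tech_pow_Rmult in HC. apply (Rmult_le_compat_r (/ PI)) in HC; lra.
Qed.
Lemma sc_Lam f : smooth_circ f -> smooth_circ (Lam f).
Proof. intros H; apply sc_tser, (Lam_rapid (fun _ : unit => f)), sc_pusm, H. Qed.
#[export] Hint Resolve sc_Lam : sc.
Lemma Lam_coef n f : smooth_circ f -> fc n (Lam f) = INR n * fc n f /\ fs n (Lam f) = INR n * fs n f.
Proof.
  intros H.
  assert (HR := Lam_rapid (fun _ : unit => f) (sc_pusm f H)). simpl in HR.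
  assert (PP := PI_RGT_0).
  destruct n.
  - destruct (ts_coef _ _ HR 0) as (_ & _ & E). unfold Lam; rewrite E, !fs_0. simpl; split; ring.
  - destruct (ts_coef _ _ HR n) as (E1 & E2 & _). unfold Lam; rewrite E1, E2; split; field; lra.
Qed.
Lemma pusm_Lam {I} (F : I -> R -> R) : pusm F -> pusm (fun i => Lam (F i)).
Proof.
  intros HF. assert (Hs := fun i => pusm_sc F i HF).
  apply (rapid_pusm _ 0).
  - intros; sctac.
  - intros i; rewrite (proj1 (Lam_coef 0 (F i) (Hs i))). simpl; rewrite Rmult_0_l, Rabs_R0; lra.
  - intros m. destruct (pusm_rapid F HF (S m)) as [C HC]. exists C; intros i n. specialize (HC i n).
    destruct (Lam_coef (S n) (F i) (Hs i)) as [-> ->].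
    rewrite !Rabs_mult, (Rabs_right (INR (S n))) by (apply Rle_ge; ctac).
    rewrite <- tech_pow_Rmult in HC. lra.
Qed.

Lemma sc_coef_inj f g : smooth_circ f -> smooth_circ g ->
  (forall n, fc n f = fc n g) -> (forall n, fs n f = fs n g) -> f = g.
Proof.
  intros Hf Hg Hc Hs. apply functional_extensionality.
  apply (coef_inj _ _ phase_id); cstac.
Qed.

Lemma parseval f g : smooth_circ f -> smooth_circ g ->
  is_series (fun n => (fc (S n) f * fc (S n) g + fs (S n) f * fs (S n) g) / PI)
    (ip f g - fc 0 f * fc 0 g / (2 * PI)).
Proof.
  intros Hf Hg. assert (H := fourier_parseval _ _ phase_id f g Hf (sc_cts g Hg) (sc_per g Hg)).
  cbv beta in H. replace (ip f g) with (I2 (fun x => f x * g x * 1)); auto.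
  apply I2_ext; intros; ring.
Qed.

Lemma Lam_form f g : smooth_circ f -> smooth_circ g ->
  is_series (fun n => INR (S n) * (fc (S n) f * fc (S n) g + fs (S n) f * fs (S n) g) / PI)
    (ip (Lam f) g).
Proof.
  intros Hf Hg. assert (H := parseval (Lam f) g (sc_Lam f Hf) Hg).
  rewrite (proj1 (Lam_coef 0 f Hf)) in H. simpl INR in H. rewrite Rmult_0_l, Rmult_0_l in H.
  unfold Rdiv at 2 in H. rewrite Rmult_0_l, Rminus_0_r in H.
  eapply is_series_ext; [|exact H]. intros n. destruct (Lam_coef (S n) f Hf) as [-> ->].
  toR. unfold Rdiv; ring.
Qed.
Lemma Lam_sym f g : smooth_circ f -> smooth_circ g ->
  ip (Lam f) g = ip f (Lam g).
Proof.
  intros Hf Hg. rewrite (I2_ext (fun x => f x * Lam g x) (fun x => Lam g x * f x)) by (intros; ring).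
  rewrite <- (is_series_unique _ _ (Lam_form f g Hf Hg)), <- (is_series_unique _ _ (Lam_form g f Hg Hf)).
  apply Series_ext; intros; unfold Rdiv; ring.
Qed.
Lemma Lam_Derive f : smooth_circ f -> Lam (Derive f) = Derive (Lam f).
Proof.
  intros H; apply sc_coef_inj; sctac; intros n.
  - destruct (Lam_coef n (Derive f) ltac:(sctac)) as [-> _].
    rewrite !fc_Derive by sctac. destruct (Lam_coef n f H) as [_ ->]; ring.
  - destruct (Lam_coef n (Derive f) ltac:(sctac)) as [_ ->].
    rewrite !fs_Derive by sctac. destruct (Lam_coef n f H) as [-> _]; ring.
Qed.
Lemma Lam_Lam f : smooth_circ f -> Lam (Lam f) = fun x => - Derive (Derive f) x.
Proof.
  intros H; apply sc_coef_inj; sctac; intros n.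
  - destruct (Lam_coef n (Lam f) ltac:(sctac)) as [-> _]. destruct (Lam_coef n f H) as [-> _].
    rewrite coef_opp1, fc_Derive, fs_Derive by cstac. ring.
  - destruct (Lam_coef n (Lam f) ltac:(sctac)) as [_ ->]. destruct (Lam_coef n f H) as [_ ->].
    rewrite coef_opp2, fs_Derive, fc_Derive by cstac. ring.
Qed.
Lemma Lam_norm f : smooth_circ f -> N2 (Lam f) = N2 (Derive f).
Proof.
  intros H. transitivity (ip (Lam f) (Lam f)); [apply I2_ext; intros; ring|].
  rewrite Lam_sym, Lam_Lam by sctac.
  transitivity (- ip f (Derive (Derive f))).
  - rewrite <- I2_opp by cstac. apply I2_ext; intros; ring.
  - rewrite <- I2_ibp_sc by sctac. apply I2_ext; intros; ring.
Qed.
Lemma Lam_scal a f : smooth_circ f -> Lam (fun x => a * f x) = fun x => a * Lam f x.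
Proof.
  intros Hf; apply sc_coef_inj; sctac; intros n.
  - destruct (Lam_coef n (fun x => a * f x) ltac:(sctac)) as [-> _].
    rewrite (proj1 (coef_scal _ _ phase_id n a f ltac:(cstac))),
      (proj1 (coef_scal _ _ phase_id n a (Lam f) ltac:(cstac))).
    destruct (Lam_coef n f Hf) as [-> _]. ring.
  - destruct (Lam_coef n (fun x => a * f x) ltac:(sctac)) as [_ ->].
    rewrite (proj2 (coef_scal _ _ phase_id n a f ltac:(cstac))),
      (proj2 (coef_scal _ _ phase_id n a (Lam f) ltac:(cstac))).
    destruct (Lam_coef n f Hf) as [_ ->]. ring.
Qed.
Lemma Lam_const a : Lam (fun _ => a) = fun _ => 0.
Proof.
  apply sc_coef_inj; sctac; intros n.
  - destruct (Lam_coef n (fun _ => a) ltac:(sctac)) as [-> _]. destruct n.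
    + rewrite (proj2 (proj2 (coef_const _ _ phase_id 0 0))). simpl; ring.
    + rewrite !(proj1 (coef_const _ _ phase_id n _)). ring.
  - destruct (Lam_coef n (fun _ => a) ltac:(sctac)) as [_ ->]. destruct n.
    + rewrite !fs_0. ring.
    + rewrite !(proj1 (proj2 (coef_const _ _ phase_id n _))). ring.
Qed.
(* The form inequality Lambda >= +-D, written for the real and imaginary parts of f + i g. *)
Lemma Lam_pair f g : smooth_circ f -> smooth_circ g ->
  2 * ip (Derive f) g <= ip (Lam f) f + ip (Lam g) g.
Proof.
  intros Hf Hg. assert (PP := PI_RGT_0).
  assert (H1 := Lam_form f f Hf Hf). assert (H2 := Lam_form g g Hg Hg).
  assert (H3 := parseval (Derive f) g ltac:(sctac) Hg).
  rewrite fc_Derive in H3 by auto. simpl INR in H3. rewrite Rmult_0_l, Rmult_0_l in H3.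
  unfold Rdiv at 2 in H3. rewrite Rmult_0_l, Rminus_0_r in H3.
  rewrite <- (is_series_unique _ _ H1), <- (is_series_unique _ _ H2), <- (is_series_unique _ _ H3).
  rewrite <- Series_scal_l, <- Series_plus by (eexists; eassumption).
  apply Series_le'.
  - intros n. rewrite fc_Derive, fs_Derive by auto.
    assert (0 < INR (S n) / PI) by (apply Rdiv_lt_0_compat; ctac).
    match goal with |- ?a <= ?b =>
      assert (E : b - a = INR (S n) / PI * ((fc (S n) g - fs (S n) f) ^ 2 + (fs (S n) g + fc (S n) f) ^ 2)) by (field; lra) end.
    generalize (pow2_ge_0 (fc (S n) g - fs (S n) f)) (pow2_ge_0 (fs (S n) g + fc (S n) f)). nra.
  - apply ex_series_scalR. eexists; eassumption.
  - apply ex_series_plusR; eexists; eassumption.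
Qed.
Lemma Lam_pos f : smooth_circ f -> 0 <= ip (Lam f) f.
Proof.
  intros Hf. assert (H := Lam_pair f (fun _ => 0) Hf (sc_const 0)). cbv beta in H.
  rewrite (I2_ext (fun x => Derive f x * 0) (fun _ => 0)), (I2_ext (fun x => Lam (fun _ => 0) x * 0) (fun _ => 0)), I2_const in H
    by (intros; ring). lra.
Qed.
(** [Lambda f] and [f'] have the same L^2 norm, so [Lambda f = 0] forces [f' = 0]. *)
Lemma Lam_zero f : smooth_circ f -> (forall x, Lam f x = 0) -> exists c, forall x, f x = c.
Proof.
  intros Hf H0.
  assert (Z : N2 (Derive f) = 0).
  { rewrite <- Lam_norm by auto. transitivity (I2 (fun _ => 0)); [|rewrite I2_const; ring].
    apply I2_ext; intros; rewrite H0; ring. }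
  assert (D : forall x, Derive f x = 0).
  { intros x. assert (Derive f x ^ 2 = 0); [|nra].
    apply (I2_zero_eq_per (fun x => Derive f x ^ 2)); cstac. intros; apply pow2_ge_0. }
  exists (f 0); intros x.
  assert (E : RInt (Derive f) 0 x = f x - f 0).
  { apply RInt_derive'; cstac. intros; apply sc_is_derive; auto. }
  rewrite (RInt_ext' _ (fun _ => 0)), RInt_const' in E by auto. lra.
Qed.

(** * The operators [b^(1/2) Lambda b^(1/2)] and [b^(1/2) D b^(1/2)] *)

Definition ph (b : R -> R) x : R := RInt (fun t => / b t) 0 x.
Definition csn b n x := cos (INR n * ph b x).
Definition snn b n x := sin (INR n * ph b x).
(* The orthonormal eigenfunctions [cos (n s) / sqrt (PI b)], [sin (n s) / sqrt (PI b)], where [s' = 1 / b]. *)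
Definition pc b n x := csn b n x * / sqrt (b x) * / sqrt PI.
Definition ps b n x := snn b n x * / sqrt (b x) * / sqrt PI.
Definition Aop b f x := sqrt (b x) * Lam (fun y => sqrt (b y) * f y) x.
(** The square of [b^(1/2) Lambda b^(1/2)] has [Lambda b Lambda] in the middle, the square of
    [b^(1/2) (- i D) b^(1/2)] has [- D b D], and [Kop] is the difference of the two. [Rop] is this
    difference between factors [b^(1/2)], and [Yop] is the second square. *)
Definition Kop b u x := Lam (fun y => b y * Lam u y) x + Derive (fun y => b y * Derive u y) x.
Definition Rop b f x := sqrt (b x) * Kop b (fun y => sqrt (b y) * f y) x.
Definition Yop b f x := - sqrt (b x) * Derive (fun y => b y * Derive (fun z => sqrt (b z) * f z) y) x.

Definition admissible b := smooth_circ b /\ (forall x, 0 < b x) /\ I2 (fun t => / b t) = 2 * PI.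

Lemma phase_ph b : admissible b -> phase (fun t => / b t) (ph b).
Proof.
  intros (Hb & Hp & Hi). assert (sw : smooth_circ (fun t => / b t)) by sctac.
  split; [auto|]. split; [intros; apply Rinv_0_lt_compat; auto|]. split.
  - intros x. apply (is_derive_RInt (fun t => / b t) (ph b) 0 x); [|apply (sc_cts _ sw)].
    exists (mkposreal 1 Rlt_0_1); intros y _. apply (RInt_correct (fun t => / b t)). cstac.
  - intros x. unfold ph. rewrite <- (RInt_Chasles' _ 0 x) by cstac.
    rewrite RInt_per by cstac. rewrite Hi; auto.
Qed.

Section Operators.
Variable b : R -> R.
Hypothesis Hadm : admissible b.

Let Hb : smooth_circ b. Proof. apply Hadm. Qed.
Let bpos : forall x, 0 < b x. Proof. apply Hadm. Qed.
Let Hph := phase_ph b Hadm.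
Let sr : smooth_circ (fun x => sqrt (b x)). Proof. sctac. Qed.
Let rpos : forall x, 0 < sqrt (b x). Proof. intros; apply sqrt_lt_R0; auto. Qed.
Let sri : smooth_circ (fun x => / sqrt (b x)). Proof. sctac. Qed.

Lemma sc_csn n : smooth_circ (csn b n).
Proof. apply (sc_cos_phase _ _ n Hph). Qed.
Lemma sc_snn n : smooth_circ (snn b n).
Proof. apply (sc_sin_phase _ _ n Hph). Qed.
Hint Resolve sc_csn sc_snn : sc.
Lemma Derive_csn n : Derive (csn b n) = fun x => - INR n * / b x * snn b n x.
Proof.
  fext x. apply is_derive_unique.
  apply (is_derive_cos_phase _ _ (INR n) x Hph).
Qed.
Lemma Derive_snn n : Derive (snn b n) = fun x => INR n * / b x * csn b n x.
Proof.
  fext x. apply is_derive_unique.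
  apply (is_derive_sin_phase _ _ (INR n) x Hph).
Qed.
Lemma sc_pc n : smooth_circ (pc b n).
Proof. unfold pc; apply sc_mult; sctac. Qed.
Lemma sc_ps n : smooth_circ (ps b n).
Proof. unfold ps; apply sc_mult; sctac. Qed.
Hint Resolve sc_pc sc_ps : sc.

Lemma r_pc n : (fun x => sqrt (b x) * pc b n x) = fun x => / sqrt PI * csn b n x.
Proof.
  fext x; unfold pc. generalize (rpos x); intros.
  assert (0 < sqrt PI) by apply sqrt_lt_R0, PI_RGT_0. field; lra.
Qed.
Lemma r_ps n : (fun x => sqrt (b x) * ps b n x) = fun x => / sqrt PI * snn b n x.
Proof.
  fext x; unfold ps. generalize (rpos x); intros.
  assert (0 < sqrt PI) by apply sqrt_lt_R0, PI_RGT_0. field; lra.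
Qed.

Lemma sc_Aop f : smooth_circ f -> smooth_circ (Aop b f).
Proof. intros; unfold Aop; apply sc_mult; sctac. Qed.
Lemma sc_Kop f : smooth_circ f -> smooth_circ (Kop b f).
Proof. intros; unfold Kop; sctac. Qed.
Hint Resolve sc_Aop sc_Kop : sc.
Lemma sc_Rop f : smooth_circ f -> smooth_circ (Rop b f).
Proof. intros; unfold Rop; sctac. Qed.
Lemma sc_Yop f : smooth_circ f -> smooth_circ (Yop b f).
Proof. intros; unfold Yop; sctac. Qed.
Hint Resolve sc_Rop sc_Yop : sc.

Lemma Aop_Aop f : smooth_circ f -> Aop b (Aop b f) = fun x => Rop b f x + Yop b f x.
Proof.
  intros Hf. fext x. unfold Rop, Yop, Kop, Aop.
  replace (fun y => sqrt (b y) * (sqrt (b y) * Lam (fun y0 => sqrt (b y0) * f y0) y))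
    with (fun y => b y * Lam (fun y0 => sqrt (b y0) * f y0) y); [ring|].
  fext y. rewrite <- Rmult_assoc, sqrt_sqrt; auto.
  apply Rlt_le; auto.
Qed.

(** On functions of the angle [b D] is differentiation in [s], so [Yop] is minus the second
    derivative in [s], conjugated by [b^(1/2)]. *)
Lemma Yop_pc n : Yop b (pc b n) = fun x => INR n ^ 2 * pc b n x.
Proof.
  fext x. unfold Yop. rewrite r_pc, Derive_scal_sc, Derive_csn.
  replace (fun y => b y * (/ sqrt PI * (- INR n * / b y * snn b n y)))
    with (fun y => (/ sqrt PI * - INR n) * snn b n y).
  - rewrite Derive_scal_sc, Derive_snn. unfold pc. generalize (rpos x) (bpos x); intros.
    assert (0 < sqrt PI) by apply sqrt_lt_R0, PI_RGT_0.
    replace (/ b x) with (/ (sqrt (b x) * sqrt (b x))) by (rewrite sqrt_sqrt; lra). field; lra.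
  - fext y. generalize (bpos y); intros.
    assert (0 < sqrt PI) by apply sqrt_lt_R0, PI_RGT_0. field; lra.
Qed.
Lemma Yop_ps n : Yop b (ps b n) = fun x => INR n ^ 2 * ps b n x.
Proof.
  fext x. unfold Yop. rewrite r_ps, Derive_scal_sc, Derive_snn.
  replace (fun y => b y * (/ sqrt PI * (INR n * / b y * csn b n y)))
    with (fun y => (/ sqrt PI * INR n) * csn b n y).
  - rewrite Derive_scal_sc, Derive_csn. unfold ps. generalize (rpos x) (bpos x); intros.
    assert (0 < sqrt PI) by apply sqrt_lt_R0, PI_RGT_0.
    replace (/ b x) with (/ (sqrt (b x) * sqrt (b x))) by (rewrite sqrt_sqrt; lra). field; lra.
  - fext y. generalize (bpos y); intros.
    assert (0 < sqrt PI) by apply sqrt_lt_R0, PI_RGT_0. field; lra.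
Qed.

Lemma Aop_sym f g : smooth_circ f -> smooth_circ g ->
  ip (Aop b f) g = ip f (Aop b g).
Proof.
  intros Hf Hg. unfold Aop.
  transitivity (I2 (fun x => Lam (fun y => sqrt (b y) * f y) x * (sqrt (b x) * g x))).
  { apply I2_ext; intros; ring. }
  rewrite Lam_sym by sctac. apply I2_ext; intros; ring.
Qed.
Lemma Kop_sym f g : smooth_circ f -> smooth_circ g ->
  ip (Kop b f) g = ip f (Kop b g).
Proof.
  intros Hf Hg.
  assert (E : forall u v, smooth_circ u -> smooth_circ v ->
    ip (Kop b u) v = I2 (fun x => b x * (Lam u x * Lam v x)) - I2 (fun x => b x * (Derive u x * Derive v x))).
  { intros u v Hu Hv. unfold Kop.
    transitivity (ip (Lam (fun y => b y * Lam u y)) v + ip (Derive (fun y => b y * Derive u y)) v).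
    - rewrite <- I2_plus by cstac. apply I2_ext; intros; ring.
    - rewrite Lam_sym, I2_ibp_sc by sctac. unfold Rminus. apply f_equal2; [|apply Ropp_eq_compat]; apply I2_ext; intros; ring. }
  transitivity (ip (Kop b g) f); [|apply I2_ext; intros; ring].
  rewrite !E by auto. apply f_equal2; apply I2_ext; intros; ring.
Qed.

Lemma pusm_sqrt_b {I : Type} : pusm (fun (_ : I) x => sqrt (b x)).
Proof. apply sc_pusm; auto. Qed.
Lemma pusm_Aop {I} (F : I -> R -> R) : pusm F -> pusm (fun i => Aop b (F i)).
Proof.
  intros H. apply (pusm_mult (fun _ x => sqrt (b x)) (fun i => Lam (fun y => sqrt (b y) * F i y))).
  - apply pusm_sqrt_b.
  - apply (pusm_Lam (fun i y => sqrt (b y) * F i y)). apply (pusm_mult (fun _ x => sqrt (b x)) F); auto.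
    apply pusm_sqrt_b.
Qed.
Lemma Aop_scal a f : smooth_circ f -> Aop b (fun x => a * f x) = fun x => a * Aop b f x.
Proof.
  intros Hf. fext x. unfold Aop.
  replace (fun y => sqrt (b y) * (a * f y)) with (fun y => a * (sqrt (b y) * f y)).
  - rewrite Lam_scal by sctac. ring.
  - apply functional_extensionality; intros; ring.
Qed.
Lemma Kop_scal a f : smooth_circ f -> Kop b (fun x => a * f x) = fun x => a * Kop b f x.
Proof.
  intros Hf. fext x. unfold Kop.
  rewrite Lam_scal, Derive_scal_sc by sctac.
  replace (fun y => b y * (a * Lam f y)) with (fun y => a * (b y * Lam f y))
    by (apply functional_extensionality; intros; ring).
  replace (fun y => b y * (a * Derive f y)) with (fun y => a * (b y * Derive f y))
    by (apply functional_extensionality; intros; ring).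
  rewrite Lam_scal, Derive_scal_sc by sctac. ring.
Qed.

Lemma sc_cosn n : smooth_circ (fun x => cos (INR n * x)).
Proof. apply (sc_cos_phase _ _ n phase_id). Qed.
Lemma sc_sinn n : smooth_circ (fun x => sin (INR n * x)).
Proof. apply (sc_sin_phase _ _ n phase_id). Qed.
Hint Resolve sc_cosn sc_sinn : sc.
Lemma Derive_cosn n : Derive (fun x => cos (INR n * x)) = fun x => - INR n * sin (INR n * x).
Proof.
  fext x. apply is_derive_unique.
  evar_last. apply (is_derive_cos_phase _ _ (INR n) x phase_id). simpl; ring.
Qed.
Lemma Derive_sinn n : Derive (fun x => sin (INR n * x)) = fun x => INR n * cos (INR n * x).
Proof.
  fext x. apply is_derive_unique.
  evar_last. apply (is_derive_sin_phase _ _ (INR n) x phase_id). simpl; ring.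
Qed.
Lemma coef_cosn m n : fc m (fun x => cos (INR n * x)) = (if Nat.eq_dec m n then if Nat.eq_dec n 0 then 2 * PI else PI else 0)
  /\ fs m (fun x => cos (INR n * x)) = 0.
Proof.
  destruct (ortho_trig _ _ phase_id m n) as (E & _ & _).
  destruct (ortho_trig _ _ phase_id n m) as (_ & _ & E').
  split; [rewrite <- E|rewrite <- E'; auto]. apply I2_ext; intros; ring.
Qed.
Lemma coef_sinn m n : fc m (fun x => sin (INR n * x)) = 0 /\
  fs m (fun x => sin (INR n * x)) = (if Nat.eq_dec m n then if Nat.eq_dec n 0 then 0 else PI else 0).
Proof.
  destruct (ortho_trig _ _ phase_id m n) as (_ & E & E').
  split; [rewrite <- E'|rewrite <- E]; apply I2_ext; intros; ring.
Qed.
Lemma Lam_cosn n : Lam (fun x => cos (INR n * x)) = fun x => INR n * cos (INR n * x).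
Proof.
  apply sc_coef_inj; sctac; intros m.
  - destruct (Lam_coef m _ (sc_cosn n)) as [-> _].
    destruct (coef_scal _ _ phase_id m (INR n) (fun x => cos (INR n * x)) ltac:(cstac)) as [-> _].
    rewrite (proj1 (coef_cosn m n)). destruct Nat.eq_dec as [->|]; ring.
  - destruct (Lam_coef m _ (sc_cosn n)) as [_ ->].
    destruct (coef_scal _ _ phase_id m (INR n) (fun x => cos (INR n * x)) ltac:(cstac)) as [_ ->].
    rewrite (proj2 (coef_cosn m n)). ring.
Qed.
Lemma Lam_sinn n : Lam (fun x => sin (INR n * x)) = fun x => INR n * sin (INR n * x).
Proof.
  apply sc_coef_inj; sctac; intros m.
  - destruct (Lam_coef m _ (sc_sinn n)) as [-> _].
    destruct (coef_scal _ _ phase_id m (INR n) (fun x => sin (INR n * x)) ltac:(cstac)) as [-> _].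
    rewrite (proj1 (coef_sinn m n)). ring.
  - destruct (Lam_coef m _ (sc_sinn n)) as [_ ->].
    destruct (coef_scal _ _ phase_id m (INR n) (fun x => sin (INR n * x)) ltac:(cstac)) as [_ ->].
    rewrite (proj2 (coef_sinn m n)). destruct Nat.eq_dec as [->|]; ring.
Qed.

Lemma coef_prod l j :
  I2 (fun x => b x * cos (INR l * x) * cos (INR j * x)) - I2 (fun x => b x * sin (INR l * x) * sin (INR j * x)) = fc (j + l) b /\
  I2 (fun x => b x * cos (INR l * x) * sin (INR j * x)) + I2 (fun x => b x * sin (INR l * x) * cos (INR j * x)) = fs (j + l) b.
Proof.
  rewrite fc_eq, fs_eq, plus_INR, <- I2_minus, <- I2_plus by cstac.
  split; apply I2_ext; intros; rewrite Rmult_plus_distr_r, ?cos_plus, ?sin_plus; ring.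
Qed.

(** [Lambda] and [D] contribute the two products of the addition formula with the same weight [j l],
    and together they keep the frequency [j + l] only. The frequency [j - l], at which the
    coefficients of [b] would not decay, cancels; this is why [Kop] is smoothing. *)
Lemma Kop_cos_coef l j : fc j (Kop b (fun x => cos (INR l * x))) = INR j * INR l * fc (j + l) b /\
  fs j (Kop b (fun x => cos (INR l * x))) = INR j * INR l * fs (j + l) b.
Proof.
  destruct (coef_prod l j) as [<- <-]. unfold Kop. rewrite Lam_cosn, Derive_cosn.
  destruct (coef_plus _ _ phase_id j (Lam (fun y => b y * (INR l * cos (INR l * y))))
    (Derive (fun y => b y * (- INR l * sin (INR l * y))))) as [-> ->]; cstac.
  destruct (Lam_coef j (fun y => b y * (INR l * cos (INR l * y))) ltac:(sctac)) as [-> ->].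
  rewrite fc_Derive, fs_Derive by sctac. rewrite !fc_eq, !fs_eq.
  assert (E : forall k f g, cts f -> cts g -> I2 (fun x => b x * (k * f x) * g x) = k * I2 (fun x => b x * f x * g x)).
  { intros k f g Hf Hg. rewrite <- I2_scal by cstac. apply I2_ext; intros; ring. }
  rewrite !E by cstac. split; ring.
Qed.
Lemma Kop_sin_coef l j : fc j (Kop b (fun x => sin (INR l * x))) = INR j * INR l * fs (j + l) b /\
  fs j (Kop b (fun x => sin (INR l * x))) = - (INR j * INR l * fc (j + l) b).
Proof.
  destruct (coef_prod l j) as [<- <-]. unfold Kop. rewrite Lam_sinn, Derive_sinn.
  destruct (coef_plus _ _ phase_id j (Lam (fun y => b y * (INR l * sin (INR l * y))))
    (Derive (fun y => b y * (INR l * cos (INR l * y))))) as [-> ->]; cstac.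
  destruct (Lam_coef j (fun y => b y * (INR l * sin (INR l * y))) ltac:(sctac)) as [-> ->].
  rewrite fc_Derive, fs_Derive by sctac. rewrite !fc_eq, !fs_eq.
  assert (E : forall f g, cts f -> cts g -> I2 (fun x => b x * (INR l * f x) * g x) = INR l * I2 (fun x => b x * f x * g x)).
  { intros f g Hf Hg. rewrite <- I2_scal by cstac. apply I2_ext; intros; ring. }
  rewrite !E by cstac. split; ring.
Qed.

Lemma INR_pow_le (n N k : nat) : (n <= N)%nat -> INR n ^ k <= INR N ^ k.
Proof. intros; apply pow_incr; split; [apply pos_INR|apply le_INR; auto]. Qed.

(** A coefficient of [b] at the frequency [j + l] decays in [j] and in [l] at once, since both are
    at most [j + l]. *)
Lemma kappa_rapid (U : nat -> R -> R) m : (forall l, smooth_circ (U l)) ->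
  (forall l j, Rabs (fc j (U l)) + Rabs (fs j (U l)) <= INR j * INR l * (Rabs (fc (j + l) b) + Rabs (fs (j + l) b))) ->
  pusm (fun l x => INR l ^ m * U l x).
Proof.
  intros HU HB.
  assert (Hc : forall l j, Rabs (fc j (fun x => INR l ^ m * U l x)) + Rabs (fs j (fun x => INR l ^ m * U l x))
     <= INR l ^ m * (INR j * INR l * (Rabs (fc (j + l) b) + Rabs (fs (j + l) b)))).
  { intros l j. destruct (coef_scal _ _ phase_id j (INR l ^ m) (U l)) as [-> ->]; cstac.
    assert (0 <= INR l ^ m) by (apply pow_le; ctac).
    rewrite !Rabs_mult, (Rabs_right (INR l ^ m)), <- Rmult_plus_distr_l by lra.
    apply Rmult_le_compat_l; auto. }
  apply (rapid_pusm _ 0).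
  - intros; sctac.
  - intros l. specialize (Hc l 0%nat). simpl INR in Hc. rewrite !Rmult_0_l, Rmult_0_r in Hc.
    generalize (Rabs_pos (fs 0 (fun x => INR l ^ m * U l x))). lra.
  (* [q] powers serve the decay in [j], [m] powers the factor [l^m], and two powers the factor
     [j l]. *)
  - intros q. destruct (pusm_rapid (fun _ : unit => b) (sc_pusm b Hb) (q + (m + 2))%nat) as [C HC].
    exists C; intros l n. specialize (Hc l (S n)). specialize (HC tt (n + l)%nat).
    replace (S (n + l)) with (S n + l)%nat in HC by lia.
    set (B := Rabs (fc (S n + l) b) + Rabs (fs (S n + l) b)) in *.
    assert (HB0 : 0 <= B) by (unfold B; generalize (Rabs_pos (fc (S n + l) b)) (Rabs_pos (fs (S n + l) b)); lra).
    eapply Rle_trans; [|apply HC].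
    eapply Rle_trans; [apply Rmult_le_compat_l; [apply pow_le; ctac|apply Hc]|].
    replace (INR (S n) ^ q * (INR l ^ m * (INR (S n) * INR l * B))) with
      ((INR (S n) ^ q * (INR l ^ m * (INR (S n) * INR l))) * B) by ring.
    apply Rmult_le_compat_r; auto.
    rewrite !pow_add. simpl (INR (S n + l) ^ 2). rewrite Rmult_1_r.
    assert (INR (S n) <= INR (S n + l)) by (apply le_INR; lia).
    assert (INR l <= INR (S n + l)) by (apply le_INR; lia).
    repeat apply Rmult_le_compat; auto; try apply pow_le; ctac;
      try (apply INR_pow_le; lia); repeat apply Rmult_le_pos; try apply pow_le; ctac.
Qed.

Lemma kappa_cos m : pusm (fun l x => INR l ^ m * Kop b (fun x => cos (INR l * x)) x).
Proof.
  apply (kappa_rapid (fun l => Kop b (fun x => cos (INR l * x)))); [intros; sctac|].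
  intros l j. destruct (Kop_cos_coef l j) as [-> ->].
  rewrite !Rabs_mult, !(Rabs_right (INR _)) by (apply Rle_ge; ctac). lra.
Qed.
Lemma kappa_sin m : pusm (fun l x => INR l ^ m * Kop b (fun x => sin (INR l * x)) x).
Proof.
  apply (kappa_rapid (fun l => Kop b (fun x => sin (INR l * x)))); [intros; sctac|].
  intros l j. destruct (Kop_sin_coef l j) as [-> ->].
  rewrite Rabs_Ropp, !Rabs_mult, !(Rabs_right (INR _)) by (apply Rle_ge; ctac). lra.
Qed.

Definition DB g : R -> R := Derive (fun x => b x * g x).
(** [DB] is minus the transpose of [b D], and [b D] exchanges [csn] and [snn] up to sign while it
    multiplies by [n]. Each use gains a power of [n], as in the method of nonstationary phase. *)
Lemma csn_DB n g : smooth_circ g -> INR n * ip (csn b n) g = - ip (snn b n) (DB g).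
Proof.
  intros Hg. unfold DB. rewrite <- I2_ibp_sc by sctac. rewrite Derive_snn, <- I2_scal by cstac.
  apply I2_ext; intros x. generalize (bpos x); intros; field; lra.
Qed.
Lemma snn_DB n g : smooth_circ g -> INR n * ip (snn b n) g = ip (csn b n) (DB g).
Proof.
  intros Hg. unfold DB. rewrite <- (Ropp_involutive (I2 (fun x => csn b n x * _))), <- I2_ibp_sc by sctac.
  rewrite Derive_csn, <- I2_scal, <- I2_opp by cstac.
  apply I2_ext; intros x. generalize (bpos x); intros; field; lra.
Qed.
Lemma csn_abs n x : Rabs (csn b n x) <= 1 /\ Rabs (snn b n x) <= 1.
Proof. split; apply Rabs_le; [apply COS_bound|apply SIN_bound]. Qed.
Lemma csn_decay {I} c : forall (G : I -> R -> R), pusm G ->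
  exists C, forall i n, INR n ^ c * Rabs (ip (csn b n) (G i)) <= C /\
    INR n ^ c * Rabs (ip (snn b n) (G i)) <= C.
Proof.
  induction c; intros G HG.
  - destruct (usm_bd G (proj1 HG)) as [C HC]. exists (2 * PI * C); intros i n.
    assert (Hs := pusm_sc G i HG).
    rewrite pow_O, !Rmult_1_l. split; apply I2_bound; cstac; intros x; rewrite Rabs_mult;
      destruct (csn_abs n x) as [A1 A2]; specialize (HC i x);
      generalize (Rabs_pos (csn b n x)) (Rabs_pos (snn b n x)) (Rabs_pos (G i x)); nra.
  - assert (HD : pusm (fun i => DB (G i))).
    { apply (pusm_derive (fun i x => b x * G i x)), (pusm_mult (fun _ => b) G); auto. apply sc_pusm; auto. }
    destruct (IHc _ HD) as [C HC]. exists C; intros i n. destruct (HC i n) as [C1 C2].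
    assert (Hs := pusm_sc G i HG).
    assert (P : 0 <= INR n) by ctac.
    rewrite <- tech_pow_Rmult. split.
    + replace (INR n * INR n ^ c * Rabs (ip (csn b n) (G i)))
        with (INR n ^ c * (Rabs (INR n * ip (csn b n) (G i)))).
      * rewrite csn_DB, Rabs_Ropp by auto. auto.
      * rewrite Rabs_mult, (Rabs_right (INR n)) by lra. ring.
    + replace (INR n * INR n ^ c * Rabs (ip (snn b n) (G i)))
        with (INR n ^ c * (Rabs (INR n * ip (snn b n) (G i)))).
      * rewrite snn_DB by auto. auto.
      * rewrite Rabs_mult, (Rabs_right (INR n)) by lra. ring.
Qed.

(** By symmetry a Fourier coefficient of [K (U n)] is the pairing of [U n] with [K] of a cosine or a
    sine. The latter decays with its frequency in every C^m norm, and its pairing with the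
    oscillating [U n] decays in [n]; both rates hold jointly. *)
Lemma Kphase_pusm c (U : nat -> R -> R) : (forall n, smooth_circ (U n)) ->
  (forall (G : nat -> R -> R), pusm G -> exists C, forall i n, INR n ^ c * Rabs (ip (U n) (G i)) <= C) ->
  pusm (fun n x => INR n ^ c * Kop b (U n) x).
Proof.
  intros HU HD.
  assert (HC : forall n g, smooth_circ g -> I2 (fun x => INR n ^ c * Kop b (U n) x * g x) = INR n ^ c * ip (U n) (Kop b g)).
  { intros n g Hg. rewrite <- Kop_sym, <- I2_scal by cstac. apply I2_ext; intros; ring. }
  apply (rapid_pusm _ 0).
  - intros; sctac.
  - intros n. rewrite fc_0. rewrite (I2_ext _ (fun x => INR n ^ c * Kop b (U n) x * 1)) by (intros; ring).
    rewrite (HC n (fun _ => 1)) by sctac.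
    replace (Kop b (fun _ => 1)) with (fun _ : R => 0).
    + rewrite (I2_ext _ (fun _ => 0)), I2_const by (intros; ring). rewrite !Rmult_0_r, Rabs_R0; lra.
    + fext x. unfold Kop. rewrite Lam_const.
      rewrite (Derive_ext _ (fun _ => 0)), Derive_const.
      2: { intros; rewrite Derive_const; ring. }
      replace (fun y => b y * 0) with (fun _ : R => 0) by (apply functional_extensionality; intros; ring).
      rewrite Lam_const; ring.
  - intros m. destruct (HD _ (kappa_cos m)) as [C1 H1]. destruct (HD _ (kappa_sin m)) as [C2 H2].
    exists (C1 + C2); intros n l.
    rewrite fc_eq, fs_eq, !HC by sctac.
    specialize (H1 (S l) n). specialize (H2 (S l) n).
    assert (E : forall g, smooth_circ g -> INR (S l) ^ m * Rabs (INR n ^ c * ip (U n) g) =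
       INR n ^ c * Rabs (I2 (fun x => U n x * (INR (S l) ^ m * g x)))).
    { intros g Hg. replace (I2 (fun x => U n x * (INR (S l) ^ m * g x))) with (INR (S l) ^ m * ip (U n) g).
      - rewrite !Rabs_mult. rewrite (Rabs_right (INR n ^ c)), (Rabs_right (INR (S l) ^ m)) by (apply Rle_ge, pow_le; ctac). ring.
      - rewrite <- I2_scal by cstac. apply I2_ext; intros; ring. }
    rewrite Rmult_plus_distr_l, !E by sctac. lra.
Qed.

Lemma Rop_pc_pusm c : pusm (fun n x => INR n ^ c * Rop b (pc b n) x).
Proof.
  replace (fun n x => INR n ^ c * Rop b (pc b n) x) with
    (fun n x => sqrt (b x) * (/ sqrt PI * (INR n ^ c * Kop b (csn b n) x))).
  - apply (pusm_mult (fun _ x => sqrt (b x))); [apply pusm_sqrt_b|].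
    apply (pusm_scal (/ sqrt PI)). apply Kphase_pusm; [apply sc_csn|].
    intros G HG. destruct (csn_decay c G HG) as [C HC]. exists C; intros i n; exact (proj1 (HC i n)).
  - fext n; fext x.
    unfold Rop. rewrite r_pc, Kop_scal by sctac. ring.
Qed.
Lemma Rop_ps_pusm c : pusm (fun n x => INR n ^ c * Rop b (ps b n) x).
Proof.
  replace (fun n x => INR n ^ c * Rop b (ps b n) x) with
    (fun n x => sqrt (b x) * (/ sqrt PI * (INR n ^ c * Kop b (snn b n) x))).
  - apply (pusm_mult (fun _ x => sqrt (b x))); [apply pusm_sqrt_b|].
    apply (pusm_scal (/ sqrt PI)). apply Kphase_pusm; [apply sc_snn|].
    intros G HG. destruct (csn_decay c G HG) as [C HC]. exists C; intros i n; exact (proj2 (HC i n)).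
  - fext n; fext x.
    unfold Rop. rewrite r_ps, Kop_scal by sctac. ring.
Qed.

Definition Aiter a f := Nat.iter a (Aop b) f.
Lemma sc_Aiter a f : smooth_circ f -> smooth_circ (Aiter a f).
Proof. intros; induction a; auto. simpl. apply sc_Aop; auto. Qed.
Lemma Aiter_scal a k f : smooth_circ f -> Aiter a (fun x => k * f x) = fun x => k * Aiter a f x.
Proof.
  intros Hf; induction a; auto. simpl. fold (Aiter a (fun x => k * f x)). rewrite IHa.
  apply Aop_scal, sc_Aiter, Hf.
Qed.
Lemma pusm_Aiter {I} a (F : I -> R -> R) : pusm F -> pusm (fun i => Aiter a (F i)).
Proof. intros H; induction a; auto. apply (pusm_Aop (fun i => Aiter a (F i)) IHa). Qed.

Lemma Rop_decay (a c : nat) : exists C, 0 <= C /\ forall n x,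
  INR n ^ c * Rabs (Aiter a (Rop b (pc b n)) x) <= C /\ INR n ^ c * Rabs (Aiter a (Rop b (ps b n)) x) <= C.
Proof.
  destruct (usm_bd _ (proj1 (pusm_Aiter a _ (Rop_pc_pusm c)))) as [C1 H1].
  destruct (usm_bd _ (proj1 (pusm_Aiter a _ (Rop_ps_pusm c)))) as [C2 H2].
  exists (Rmax C1 C2); split.
  { eapply Rle_trans; [|apply Rmax_l]. eapply Rle_trans; [|apply (H1 0%nat 0)]. apply Rabs_pos. }
  intros n x. specialize (H1 n x). specialize (H2 n x). cbv beta in H1, H2.
  rewrite Aiter_scal in H1, H2 by sctac.
  rewrite Rabs_mult, (Rabs_right (INR n ^ c)) in H1, H2 by (apply Rle_ge, pow_le; ctac).
  split; [eapply Rle_trans; [apply H1|apply Rmax_l]|eapply Rle_trans; [apply H2|apply Rmax_r]].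
Qed.
End Operators.

(** * Integer Fourier coefficients and the relation [LambdaRel] *)

Lemma fourierR_nat f k : cts f -> fourierR f (Z.of_nat k) = (/ (2 * PI) * fc k f, - (/ (2 * PI) * fs k f)).
Proof.
  intros Hf. unfold fourierR, fourier. rewrite <- INR_IZR_INZ. f_equal.
  - f_equal. rewrite fc_eq. apply RInt_ext'; intros; ring.
  - rewrite Ropp_mult_distr_r, fs_eq, <- I2_opp by ctac. f_equal. apply RInt_ext'; intros; ring.
Qed.
Lemma fourierR_neg f k : cts f -> fourierR f (- Z.of_nat k) = (/ (2 * PI) * fc k f, / (2 * PI) * fs k f).
Proof.
  intros Hf. unfold fourierR, fourier. rewrite opp_IZR, <- INR_IZR_INZ. f_equal.
  - f_equal. rewrite fc_eq. apply RInt_ext'; intros. rewrite <- Ropp_mult_distr_l, cos_neg; ring.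
  - f_equal. rewrite fs_eq. apply RInt_ext'; intros. rewrite <- Ropp_mult_distr_l, cos_neg, sin_neg; ring.
Qed.
Lemma Cmult_R_pair (a x y : R) : Cmult (RtoC a) (x, y) = (a * x, a * y).
Proof. unfold Cmult, RtoC; simpl. f_equal; ring. Qed.

Lemma IZR_abs_nat n : IZR (Z.abs (Z.of_nat n)) = INR n.
Proof. rewrite Z.abs_eq by lia. symmetry; apply INR_IZR_INZ. Qed.

Lemma LambdaRel_Lam f g : smooth_circ f -> LambdaRel f g -> g = Lam f.
Proof.
  intros Hf [Hg H].
  assert (P : 0 < / (2 * PI)) by (apply Rinv_0_lt_compat; ctac).
  apply sc_coef_inj; sctac; intros n; specialize (H (Z.of_nat n));
    rewrite !fourierR_nat, IZR_abs_nat, Cmult_R_pair in H by cstac;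
    injection H; intros E1 E2.
  - destruct (Lam_coef n f Hf) as [-> _]. apply Rmult_eq_reg_l with (/ (2 * PI)); lra.
  - destruct (Lam_coef n f Hf) as [_ ->]. apply Rmult_eq_reg_l with (/ (2 * PI)); lra.
Qed.
Lemma LambdaRel_intro f : smooth_circ f -> LambdaRel f (Lam f).
Proof.
  intros Hf; split; [sctac|]. intros n.
  destruct (Z_le_gt_dec 0 n) as [Hn|Hn].
  - rewrite <- (Z2Nat.id n) by lia. generalize (Z.to_nat n); intros k.
    rewrite !fourierR_nat, IZR_abs_nat, Cmult_R_pair by cstac.
    destruct (Lam_coef k f Hf) as [-> ->]. f_equal; ring.
  - replace n with (- Z.of_nat (Z.to_nat (- n)))%Z by lia. generalize (Z.to_nat (- n)); intros k.
    rewrite !fourierR_neg, Z.abs_opp, IZR_abs_nat, Cmult_R_pair by cstac.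
    destruct (Lam_coef k f Hf) as [-> ->]. f_equal; ring.
Qed.

Lemma is_series_RR (a : nat -> R) (l l' : R) : is_series a l -> l = l' -> is_series a l'.
Proof. intros; subst; auto. Qed.
Lemma is_series_shift (a : nat -> R) (l : R) : a 0%nat = 0 -> is_series a l -> is_series (fun k => a (S k)) l.
Proof.
  intros H0 H. assert (H1 := is_series_incr_1 a (l - a 0%nat)).
  replace l with (l - a 0%nat) by lra. apply H1. unfold plus; simpl.
  replace (l - a 0%nat + a 0%nat) with l by ring; auto.
Qed.
Lemma is_series_nonneg_term (a : nat -> R) (l : R) m : (forall n, 0 <= a n) -> is_series a l -> a m <= l.
Proof.
  intros Hp H. assert (E := is_series_unique _ _ H). rewrite <- E.
  rewrite (Series_incr_n a (S m)); [|lia|exists l; auto].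
  simpl pred. assert (0 <= Series (fun k => a (S m + k)%nat)).
  { transitivity (Series (fun _ => 0 * 0)); [rewrite Series_scal_l; lra|].
    apply Series_le; [intros; rewrite Rmult_0_l; split; [lra|auto]|].
    apply (ex_series_incr_n a (S m)); exists l; auto. }
  assert (a m <= sum_f_R0 a m); [|lra].
  destruct m; simpl; [lra|]. assert (0 <= sum_f_R0 a m) by (apply cond_pos_sum; auto). lra.
Qed.

(** * Spectral data and overlaps *)

Section Spectral.
Variables (b : R -> R) (lam : nat -> R) (phi : nat -> R -> R).
Hypothesis Hadm : admissible b.
Hypothesis HE : eigen_decomp b lam phi.

Let Hb : smooth_circ b. Proof. apply Hadm. Qed.
Let bpos : forall x, 0 < b x. Proof. apply Hadm. Qed.
Let Hph := phase_ph b Hadm.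
Let rpos : forall x, 0 < sqrt (b x). Proof. intros; apply sqrt_lt_R0; auto. Qed.
Hint Resolve sc_csn sc_snn sc_pc sc_ps sc_Aop sc_Kop sc_Rop sc_Yop sc_Aiter : sc.

Lemma sc_phi k : smooth_circ (phi k).
Proof. apply HE. Qed.
Hint Resolve sc_phi : sc.

Definition ak k f := ip f (phi k).

Lemma phi_eigen k : Aop b (phi k) = fun x => lam k * phi k x.
Proof.
  destruct HE as (_ & _ & H & _). destruct (H k) as [g [Hg E]].
  apply LambdaRel_Lam in Hg; [|sctac]. subst g.
  fext x. apply E.
Qed.
Lemma phi_ortho k k' : ip (phi k) (phi k') = if Nat.eqb k k' then 1 else 0.
Proof. apply HE. Qed.
Lemma lam_mono k k' : (k <= k')%nat -> lam k <= lam k'.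
Proof.
  destruct HE as (_ & _ & _ & H & _). induction 1; [lra|]. eapply Rle_trans; [apply IHle|apply H].
Qed.
Lemma phi_parseval f : smooth_circ f -> is_series (fun k => ak k f ^ 2) (N2 f).
Proof. apply HE. Qed.

Lemma ak_lin k f g c : smooth_circ f -> smooth_circ g -> ak k (fun x => f x + c * g x) = ak k f + c * ak k g.
Proof.
  intros; unfold ak. rewrite <- I2_scal, <- I2_plus by cstac. apply I2_ext; intros; ring.
Qed.
(** Completeness is given for squared norms only; polarization extends it to scalar products. *)
Lemma phi_parseval2 f g : smooth_circ f -> smooth_circ g ->
  is_series (fun k => ak k f * ak k g) (ip f g).
Proof.
  intros Hf Hg.
  assert (H1 := phi_parseval (fun x => f x + 1 * g x) ltac:(sctac)).
  assert (H2 := phi_parseval (fun x => f x + (-1) * g x) ltac:(sctac)).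
  assert (H3 := is_series_minus _ _ _ _ H1 H2). apply (is_series_scal_l (/ 4)) in H3.
  eapply is_series_ext; [|eapply is_series_RR; [exact H3|]].
  - intros k. cbv beta. rewrite !ak_lin by auto. unfold scal, minus, plus, opp; simpl. unfold mult; simpl. toR. field.
  - unfold scal, minus, plus, opp; simpl. unfold mult; simpl. try rewrite Ropp_mult_distr_r_reverse.
    change (/ 4 * (I2 (fun x => (f x + 1 * g x) ^ 2) + - I2 (fun x => (f x + -1 * g x) ^ 2)) = ip f g).
    rewrite <- I2_opp, <- I2_plus, <- I2_scal by cstac. apply I2_ext; intros. field.
Qed.

Lemma ak_Aop k f : smooth_circ f -> ak k (Aop b f) = lam k * ak k f.
Proof.
  intros Hf. unfold ak. rewrite Aop_sym, phi_eigen, <- I2_scal by cstac. apply I2_ext; intros; ring.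
Qed.
Lemma ak_Aiter k a f : smooth_circ f -> ak k (Aiter b a f) = lam k ^ a * ak k f.
Proof.
  intros Hf; induction a; [simpl; ring|].
  change (Aiter b (S a) f) with (Aop b (Aiter b a f)). rewrite ak_Aop, IHa by sctac. simpl; ring.
Qed.

Lemma lam_nonneg k : 0 <= lam k.
Proof.
  assert (H : ip (Aop b (phi k)) (phi k) = lam k).
  { rewrite phi_eigen. rewrite (I2_ext _ (fun x => lam k * (phi k x * phi k x))) by (intros; ring).
    rewrite I2_scal, phi_ortho, Nat.eqb_refl by cstac. ring. }
  rewrite <- H. unfold Aop.
  rewrite (I2_ext _ (fun x => Lam (fun y => sqrt (b y) * phi k y) x * (sqrt (b x) * phi k x))) by (intros; ring).
  apply Lam_pos; sctac.
Qed.

(** This function spans the kernel of [b^(1/2) Lambda b^(1/2)], because [Lambda] annihilates exactly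
    the constants. *)
Definition u0 x := / sqrt (b x).
Lemma sc_u0 : smooth_circ u0.
Proof. unfold u0; sctac. Qed.
Hint Resolve sc_u0 : sc.
Lemma u0_norm : ip u0 u0 = 2 * PI.
Proof.
  transitivity (I2 (fun t => / b t)); [|apply (proj2 (proj2 Hadm))]. apply I2_ext; intros x. unfold u0.
  rewrite <- Rinv_mult, sqrt_sqrt; auto. apply Rlt_le; auto.
Qed.
Lemma ak_u0 k : lam k * ak k u0 = 0.
Proof.
  rewrite <- ak_Aop by sctac. unfold ak, Aop, u0.
  replace (fun y => sqrt (b y) * / sqrt (b y)) with (fun _ : R => 1).
  - rewrite Lam_const. rewrite (I2_ext _ (fun _ => 0)) by (intros; ring). rewrite I2_const; ring.
  - fext y. generalize (rpos y); intros; field; lra.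
Qed.
(** By completeness [u0] overlaps some eigenfunction, whose eigenvalue must then be zero; the
    ordering and [lam_nonneg] bring it to the index 0. *)
Lemma lam_0 : lam 0%nat = 0.
Proof.
  assert (exists k, ak k u0 <> 0) as [k Hk].
  { destruct (excluded_middle_informative (exists k, ak k u0 <> 0)) as [|Hn]; auto.
    assert (Z : forall k, ak k u0 = 0).
    { intros k. destruct (Req_dec (ak k u0) 0); auto. exfalso; apply Hn; eauto. }
    assert (H := phi_parseval2 u0 u0 sc_u0 sc_u0). apply is_series_unique in H.
    rewrite u0_norm in H. rewrite (Series_ext _ (fun _ => 0 * 0)), Series_scal_l in H.
    - generalize two_pi_pos; lra.
    - intros; rewrite Z; ring. }
  assert (lam k = 0) by (destruct (Rmult_integral _ _ (ak_u0 k)); auto; contradiction).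
  assert (lam 0%nat <= lam k) by (apply lam_mono; lia). generalize (lam_nonneg 0); lra.
Qed.
Lemma phi_kernel k : lam k = 0 -> exists c, forall x, phi k x = c * u0 x.
Proof.
  intros H0.
  destruct (Lam_zero (fun y => sqrt (b y) * phi k y)) as [c Hc]; [sctac| |].
  - intros x. assert (E : Aop b (phi k) x = 0) by (rewrite phi_eigen, H0; ring).
    unfold Aop in E. apply Rmult_integral in E. destruct E as [E|E]; auto. generalize (rpos x); lra.
  - exists c; intros x. rewrite <- (Hc x). unfold u0. generalize (rpos x); intros; field; lra.
Qed.
(** A second zero eigenvalue would also have an eigenfunction proportional to [u0], against
    orthonormality. *)
Lemma lam_pos k : 0 < lam (S k).
Proof.
  destruct (Req_dec (lam (S k)) 0) as [H0|]; [|generalize (lam_nonneg (S k)); lra]. exfalso.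
  destruct (phi_kernel _ H0) as [c Hc]. destruct (phi_kernel _ lam_0) as [c0 Hc0].
  assert (E1 := phi_ortho (S k) 0). assert (E2 := phi_ortho (S k) (S k)). assert (E3 := phi_ortho 0 0).
  rewrite (I2_ext _ (fun x => c * c0 * (u0 x * u0 x))) in E1 by (intros; rewrite Hc, Hc0; ring).
  rewrite (I2_ext _ (fun x => c * c * (u0 x * u0 x))) in E2 by (intros; rewrite Hc; ring).
  rewrite (I2_ext _ (fun x => c0 * c0 * (u0 x * u0 x))) in E3 by (intros; rewrite Hc0; ring).
  rewrite I2_scal, u0_norm in E1, E2, E3 by cstac. rewrite Nat.eqb_refl in E2, E3. simpl in E1.
  generalize two_pi_pos; intros.
  assert (c * c0 = 0) by nra. destruct (Rmult_integral _ _ H1); subst; lra.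
Qed.
Lemma ak_u0_S k : ak (S k) u0 = 0.
Proof. generalize (ak_u0 (S k)) (lam_pos k); intros. destruct (Rmult_integral _ _ H); auto; lra. Qed.

Lemma csn_mean n : I2 (fun x => csn b (S n) x * / b x) = 0 /\ I2 (fun x => snn b (S n) x * / b x) = 0.
Proof.
  unfold csn, snn. rewrite INR_IZR_INZ. split.
  - apply (int_cos_Z _ _ Hph). lia.
  - apply (int_sin_Z _ _ Hph).
Qed.
Lemma inv_r2 x : / sqrt (b x) * / sqrt (b x) = / b x.
Proof. rewrite <- Rinv_mult, sqrt_sqrt; auto. apply Rlt_le; auto. Qed.
Lemma ak0_psi n : ak 0 (pc b (S n)) = 0 /\ ak 0 (ps b (S n)) = 0.
Proof.
  destruct (phi_kernel _ lam_0) as [c0 Hc0]. destruct (csn_mean n) as [E1 E2]. unfold ak. split.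
  - rewrite (I2_ext _ (fun x => c0 * / sqrt PI * (csn b (S n) x * / b x))).
    + rewrite I2_scal, E1 by cstac; ring.
    + intros x; rewrite Hc0. unfold pc, u0. rewrite <- inv_r2; ring.
  - rewrite (I2_ext _ (fun x => c0 * / sqrt PI * (snn b (S n) x * / b x))).
    + rewrite I2_scal, E2 by cstac; ring.
    + intros x; rewrite Hc0. unfold ps, u0. rewrite <- inv_r2; ring.
Qed.
Lemma inv_sqrt_PI : / sqrt PI * / sqrt PI = / PI.
Proof. rewrite <- Rinv_mult, sqrt_sqrt; auto. apply Rlt_le, PI_RGT_0. Qed.
Lemma psi_norm n : ip (pc b (S n)) (pc b (S n)) = 1 /\ ip (ps b (S n)) (ps b (S n)) = 1.
Proof.
  destruct (ortho_trig _ _ Hph (S n) (S n)) as (O1 & O2 & _).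
  destruct (Nat.eq_dec (S n) (S n)); [|lia]. destruct (Nat.eq_dec (S n) 0); [lia|].
  assert (PP := PI_RGT_0). split.
  - transitivity (/ PI * PI); [|field; lra]. rewrite <- O1 at 2. rewrite <- I2_scal.
    + apply I2_ext; intros x. unfold pc, csn. rewrite <- inv_r2, <- inv_sqrt_PI; ring.
    + apply (cts_mult (fun x => csn b (S n) x * csn b (S n) x)); cstac.
  - transitivity (/ PI * PI); [|field; lra]. rewrite <- O2 at 2. rewrite <- I2_scal.
    + apply I2_ext; intros x. unfold ps, snn. rewrite <- inv_r2, <- inv_sqrt_PI; ring.
    + apply (cts_mult (fun x => snn b (S n) x * snn b (S n) x)); cstac.
Qed.

(** The squared length of the projection of [phi k] to the plane of [psi_n] and [psi_-n], of which
    [pc] and [ps] are a real orthonormal basis when [n >= 1]. *)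
Definition Pm n k := ak k (pc b n) ^ 2 + ak k (ps b n) ^ 2.
Lemma Pm_nonneg n k : 0 <= Pm n k.
Proof. unfold Pm; generalize (pow2_ge_0 (ak k (pc b n))) (pow2_ge_0 (ak k (ps b n))); lra. Qed.

(* The index [0] is absent: [phi 0] is a multiple of [b^(-1/2)], hence orthogonal to [pc] and [ps]. *)
Lemma Pm_form n a : is_series (fun k => lam (S k) ^ a * Pm (S n) (S k))
  (ip (Aiter b a (pc b (S n))) (pc b (S n)) + ip (Aiter b a (ps b (S n))) (ps b (S n))).
Proof.
  destruct (ak0_psi n) as [Z1 Z2].
  apply (is_series_shift (fun k => lam k ^ a * Pm (S n) k)).
  - unfold Pm; rewrite Z1, Z2; ring.
  - assert (H1 := phi_parseval2 (Aiter b a (pc b (S n))) (pc b (S n)) ltac:(sctac) ltac:(sctac)).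
    assert (H2 := phi_parseval2 (Aiter b a (ps b (S n))) (ps b (S n)) ltac:(sctac) ltac:(sctac)).
    assert (H3 := is_series_plus _ _ _ _ H1 H2).
    eapply is_series_ext; [|exact H3]. intros k; unfold Pm. cbv beta. rewrite !ak_Aiter by sctac.
    unfold plus; simpl; toR; ring.
Qed.
Lemma Pm_sum_k n : is_series (fun k => Pm (S n) (S k)) 2.
Proof.
  assert (H := Pm_form n 0). simpl in H. destruct (psi_norm n) as [E1 E2]. rewrite E1, E2 in H.
  eapply is_series_ext; [|eapply is_series_RR; [exact H|]]; [intros k; cbv beta; toR; ring|ring].
Qed.
Lemma ak_pc k n : ak k (pc b n) = / sqrt PI * cc (fun t => / b t) (ph b) n (fun x => sqrt (b x) * phi k x) /\
  ak k (ps b n) = / sqrt PI * ss (fun t => / b t) (ph b) n (fun x => sqrt (b x) * phi k x).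
Proof.
  unfold cc, ss, ak.
  assert (c1 : cts (fun x => sqrt (b x) * phi k x * cos (INR n * ph b x) * / b x)).
  { apply cts_mult; cstac. apply (cts_mult _ (csn b n)); cstac. }
  assert (c2 : cts (fun x => sqrt (b x) * phi k x * sin (INR n * ph b x) * / b x)).
  { apply cts_mult; cstac. apply (cts_mult _ (snn b n)); cstac. }
  rewrite <- !I2_scal by auto.
  split; apply I2_ext; intros x; unfold pc, ps, csn, snn; rewrite <- inv_r2; generalize (rpos x); intros;
   assert (0 < sqrt PI) by apply sqrt_lt_R0, PI_RGT_0; field; lra.
Qed.
(** The complete system here is the trigonometric one in the angle, whereas the sum over [k] rests
    on the completeness of the [phi k]. The frequency zero is missing from the sum: the mean of
    [b^(1/2) phi_k] in [ds] vanishes, as [phi (S k)] is orthogonal to [u0]. *)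
Lemma Pm_sum_n k : is_series (fun n => Pm (S n) (S k)) 1.
Proof.
  set (f := fun x => sqrt (b x) * phi (S k) x).
  assert (H := fourier_parseval _ _ Hph f f ltac:(unfold f; sctac) ltac:(unfold f; cstac) ltac:(unfold f; apply sc_per; sctac)).
  assert (E : I2 (fun x => f x * f x * / b x) = 1).
  { transitivity (ip (phi (S k)) (phi (S k))).
    - apply I2_ext; intros x; unfold f. rewrite <- inv_r2. generalize (rpos x); intros; field; lra.
    - rewrite phi_ortho, Nat.eqb_refl; auto. }
  assert (Z : cc (fun t => / b t) (ph b) 0 f = 0).
  { rewrite <- (ak_u0_S k). unfold cc, ak. apply I2_ext; intros x. simpl. rewrite Rmult_0_l, cos_0.
    unfold f, u0. rewrite <- inv_r2. generalize (rpos x); intros; field; lra. }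
  cbv beta in H. rewrite E, Z in H.
  eapply is_series_ext; [|eapply is_series_RR; [exact H|]].
  - intros n. unfold Pm. destruct (ak_pc (S k) (S n)) as [-> ->]. fold f.
    unfold Rdiv. rewrite <- inv_sqrt_PI. toR; ring.
  - field. generalize PI_RGT_0; lra.
Qed.

(** The identity [A^2 psi = R psi + n^2 psi] is paired with [phi k], and [A^2] is moved to the
    eigenfunction. *)
Lemma ak_Rop k n : (lam k ^ 2 - INR n ^ 2) * ak k (pc b n) = ak k (Rop b (pc b n)) /\
  (lam k ^ 2 - INR n ^ 2) * ak k (ps b n) = ak k (Rop b (ps b n)).
Proof.
  assert (G : forall f, smooth_circ f -> Yop b f = (fun x => INR n ^ 2 * f x) ->
    (lam k ^ 2 - INR n ^ 2) * ak k f = ak k (Rop b f)).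
  { intros f Hf HY.
    assert (E : ak k (Aiter b 2 f) = lam k ^ 2 * ak k f) by (apply ak_Aiter; auto).
    change (Aiter b 2 f) with (Aop b (Aop b f)) in E. rewrite Aop_Aop, HY in E by auto.
    rewrite ak_lin in E by sctac. lra. }
  split; apply G; sctac; [apply Yop_pc|apply Yop_ps]; auto.
Qed.

Lemma Rop_decay_sq a c : exists C, 0 <= C /\ forall n,
  INR n ^ (2 * c) * N2 (Aiter b a (Rop b (pc b n))) <= C /\
  INR n ^ (2 * c) * N2 (Aiter b a (Rop b (ps b n))) <= C.
Proof.
  destruct (Rop_decay b Hadm a c) as [C [HC0 HC]]. exists (2 * PI * C ^ 2); split.
  { generalize two_pi_pos (pow2_ge_0 C); nra. }
  intros n. rewrite <- !I2_scal by (apply cts_pow, sc_cts; sctac).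
  assert (P : 0 <= INR n ^ c) by (apply pow_le; ctac).
  assert (E : forall y, INR n ^ (2 * c) * y ^ 2 = (INR n ^ c * Rabs y) ^ 2).
  { intros y. rewrite Nat.mul_comm, pow_mult, Rpow_mult_distr, pow2_abs. ring. }
  assert (G : forall f, cts f -> (forall x, INR n ^ c * Rabs (f x) <= C) ->
     I2 (fun x => INR n ^ (2 * c) * f x ^ 2) <= 2 * PI * C ^ 2).
  { intros f Hf Hbd. rewrite <- I2_const. apply I2_le; ctac. intros x. rewrite E.
    apply pow_incr; split; auto. apply Rmult_le_pos; auto. apply Rabs_pos. }
  split; apply G; try (apply sc_cts; sctac); intros x; [exact (proj1 (HC n x))|exact (proj2 (HC n x))].
Qed.

Lemma AM_GM_weighted t x y : 0 < t -> Rabs (x * y) <= / 2 * (t * x ^ 2 + / t * y ^ 2).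
Proof.
  intros Ht. assert (0 < / t) by (apply Rinv_0_lt_compat; auto).
  assert (E : / 2 * (t * x ^ 2 + / t * y ^ 2) - Rabs (x * y) = / 2 * / t * (t * Rabs x - Rabs y) ^ 2).
  { rewrite Rabs_mult, <- (pow2_abs x), <- (pow2_abs y). field; lra. }
  generalize (pow2_ge_0 (t * Rabs x - Rabs y)); nra.
Qed.

(** Each term is a product of a coefficient of [A^a R psi] and one of [psi]. A weighted inequality
    of means replaces Cauchy-Schwarz: the weight [t = n^c] leaves [n^c] times the squared norm of
    [A^a R psi], which decays like [n^(-2c)], and [n^-c] times the squared norm of [psi], which is
    one. *)
Lemma gap_sum a c : exists C, 0 <= C /\ forall n,
  ex_series (fun k => lam (S k) ^ a * Rabs (lam (S k) ^ 2 - INR (S n) ^ 2) * Pm (S n) (S k)) /\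
  INR (S n) ^ c * Series (fun k => lam (S k) ^ a * Rabs (lam (S k) ^ 2 - INR (S n) ^ 2) * Pm (S n) (S k)) <= C.
Proof.
  destruct (Rop_decay_sq a c) as [C [HC0 HC]]. exists (C + 1); split; [lra|]. intros n.
  destruct (HC (S n)) as [C1 C2]. set (t := INR (S n) ^ c).
  assert (Ht : 0 < t) by (apply pow_lt; ctac).
  assert (Ht2 : INR (S n) ^ (2 * c) = t * t) by (unfold t; rewrite <- pow_add; f_equal; lia).
  rewrite Ht2 in C1, C2.
  set (F := fun k => / 2 * (t * (ak k (Aiter b a (Rop b (pc b (S n)))) ^ 2 + ak k (Aiter b a (Rop b (ps b (S n)))) ^ 2)
      + / t * (ak k (pc b (S n)) ^ 2 + ak k (ps b (S n)) ^ 2))).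
  assert (S1 := phi_parseval (Aiter b a (Rop b (pc b (S n)))) ltac:(sctac)).
  assert (S2 := phi_parseval (Aiter b a (Rop b (ps b (S n)))) ltac:(sctac)).
  assert (S3 := phi_parseval (pc b (S n)) ltac:(sctac)). assert (S4 := phi_parseval (ps b (S n)) ltac:(sctac)).
  destruct (psi_norm n) as [N1 N2].
  rewrite (I2_ext _ (fun x => pc b (S n) x * pc b (S n) x)), N1 in S3 by (intros; ring).
  rewrite (I2_ext _ (fun x => ps b (S n) x * ps b (S n) x)), N2 in S4 by (intros; ring).
  set (X1 := I2 _) in S1. set (X2 := I2 _) in S2.
  assert (SF : is_series F (/ 2 * (t * (X1 + X2) + / t * (1 + 1)))).
  { apply (is_series_scal_l (/ 2) _ (t * (X1 + X2) + / t * (1 + 1))).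
    apply (is_series_plus _ _ (t * (X1 + X2)) (/ t * (1 + 1))).
    - apply (is_series_scal_l t _ (X1 + X2)). apply (is_series_plus _ _ X1 X2); auto.
    - apply (is_series_scal_l (/ t) _ (1 + 1)). apply (is_series_plus _ _ 1 1); auto. }
  assert (F0 : forall k, 0 <= F k).
  { intros k; unfold F. assert (0 < / t) by (apply Rinv_0_lt_compat; auto).
    generalize (pow2_ge_0 (ak k (Aiter b a (Rop b (pc b (S n)))))) (pow2_ge_0 (ak k (Aiter b a (Rop b (ps b (S n))))))
      (pow2_ge_0 (ak k (pc b (S n)))) (pow2_ge_0 (ak k (ps b (S n)))); intros.
    apply Rmult_le_pos; [lra|]. apply Rplus_le_le_0_compat; apply Rmult_le_pos; lra. }
  assert (bound : forall k, 0 <= lam k ^ a * Rabs (lam k ^ 2 - INR (S n) ^ 2) * Pm (S n) k <= F k).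
  { intros k. assert (L := lam_nonneg k). assert (La : 0 <= lam k ^ a) by (apply pow_le; auto). split.
    - apply Rmult_le_pos; [apply Rmult_le_pos; auto; apply Rabs_pos|apply Pm_nonneg].
    - destruct (ak_Rop k (S n)) as [A1 A2].
      assert (B1 := AM_GM_weighted t (ak k (Aiter b a (Rop b (pc b (S n))))) (ak k (pc b (S n))) Ht).
      assert (B2 := AM_GM_weighted t (ak k (Aiter b a (Rop b (ps b (S n))))) (ak k (ps b (S n))) Ht).
      rewrite ak_Aiter, <- A1, !Rabs_mult, (Rabs_right (lam k ^ a)) in B1 by (sctac; apply Rle_ge; auto).
      rewrite ak_Aiter, <- A2, !Rabs_mult, (Rabs_right (lam k ^ a)) in B2 by (sctac; apply Rle_ge; auto).
      assert (Q : forall y, y ^ 2 = Rabs y * Rabs y) by (intros y; rewrite <- Rabs_mult, Rabs_right; nra).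
      unfold F, Pm. rewrite (Q (ak k (pc b (S n)))) at 1. rewrite (Q (ak k (ps b (S n)))) at 1.
      rewrite !ak_Aiter, <- A1, <- A2 by sctac. lra. }
  assert (EF : ex_series (fun k => F (S k))).
  { apply (ex_series_incr_1 F). eexists; apply SF. }
  assert (EX : ex_series (fun k => lam (S k) ^ a * Rabs (lam (S k) ^ 2 - INR (S n) ^ 2) * Pm (S n) (S k))).
  { apply (ex_series_Rle _ (fun k => F (S k))); auto. intros k. rewrite Rabs_right; [apply bound|apply Rle_ge, bound]. }
  split; auto. fold t.
  assert (SL : Series (fun k => lam (S k) ^ a * Rabs (lam (S k) ^ 2 - INR (S n) ^ 2) * Pm (S n) (S k)) <= Series F).
  { rewrite (Series_incr_1 F) by (eexists; apply SF).
    assert (Series (fun k => lam (S k) ^ a * Rabs (lam (S k) ^ 2 - INR (S n) ^ 2) * Pm (S n) (S k)) <= Series (fun k => F (S k))).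
    { apply Series_le'; auto. intros; apply bound. }
    generalize (F0 0%nat); lra. }
  rewrite (is_series_unique _ _ SF) in SL.
  apply (Rmult_le_compat_l t) in SL; [|lra].
  replace (t * (/ 2 * (t * (X1 + X2) + / t * (1 + 1)))) with (/ 2 * (t * t * X1 + t * t * X2) + 1) in SL by (field; lra).
  fold X1 in C1; fold X2 in C2. lra.
Qed.
End Spectral.

(** * Identity theorem for holomorphic functions *)

(** Complex differentiability written with [Cmod]. The derivative in [zeta_value] and the rules for
    products and compositions refer to two normed structures on [C]; both reduce to this form. *)
Definition Cd (f : C -> C) (z l : C) := forall eps, 0 < eps -> exists d, 0 < d /\
  forall h, Cmod h < d -> Cmod (f (z + h) - f z - h * l)%C <= eps * Cmod h.

Lemma Cplus_minus_cancel (z y : C) : (z + (y - z))%C = y.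
Proof. ring. Qed.
Lemma is_derive_Cd f z l : @is_derive C_AbsRing C_NormedModule f z l -> Cd f z l.
Proof.
  intros [_ H] eps He. specialize (H z (fun P HP => HP) (mkposreal eps He)).
  destruct H as [d Hd]. exists d; split; [apply cond_pos|]. intros h Hh.
  specialize (Hd (z + h)%C).
  assert (E : (z + h - z)%C = h) by ring.
  assert (B : ball (z : AbsRing_UniformSpace C_AbsRing) d (z + h)%C).
  { change (Cmod (z + h - z)%C < d). rewrite E; auto. }
  specialize (Hd B).
  change (Cmod (f (z + h) - f z - (z + h - z) * l)%C <= eps * Cmod (z + h - z)%C) in Hd.
  rewrite E in Hd. auto.
Qed.
Lemma Cd_is_derive f z l : Cd f z l -> @is_derive C_AbsRing C_NormedModule f z l.
Proof.
  intros H; split; [apply (@is_linear_scal_l C_AbsRing C_NormedModule)|].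
  intros x Hx. apply (@is_filter_lim_locally_unique C_AbsRing (AbsRing_NormedModule C_AbsRing)) in Hx. subst x.
  intros [eps He]. destruct (H eps He) as [d [Hd HH]].
  exists (mkposreal d Hd). intros y Hy.
  change (Cmod (y - z)%C < d) in Hy.
  change (Cmod (f y - f z - (y - z) * l)%C <= eps * Cmod (y - z)%C).
  specialize (HH _ Hy). rewrite Cplus_minus_cancel in HH. auto.
Qed.
Lemma Cd_is_derive' f z l : Cd f z l -> @is_derive C_AbsRing (AbsRing_NormedModule C_AbsRing) f z l.
Proof.
  intros H; split; [apply (@is_linear_scal_l C_AbsRing (AbsRing_NormedModule C_AbsRing))|].
  intros x Hx. apply (@is_filter_lim_locally_unique C_AbsRing (AbsRing_NormedModule C_AbsRing)) in Hx. subst x.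
  intros [eps He]. destruct (H eps He) as [d [Hd HH]].
  exists (mkposreal d Hd). intros y Hy.
  change (Cmod (y - z)%C < d) in Hy.
  change (Cmod (f y - f z - (y - z) * l)%C <= eps * Cmod (y - z)%C).
  specialize (HH _ Hy). rewrite Cplus_minus_cancel in HH. auto.
Qed.
Lemma is_derive_Cd' f z l : @is_derive C_AbsRing (AbsRing_NormedModule C_AbsRing) f z l -> Cd f z l.
Proof.
  intros [_ H] eps He. specialize (H z (fun P HP => HP) (mkposreal eps He)).
  destruct H as [d Hd]. exists d; split; [apply cond_pos|]. intros h Hh.
  specialize (Hd (z + h)%C).
  assert (E : (z + h - z)%C = h) by ring.
  assert (B : ball (z : AbsRing_UniformSpace C_AbsRing) d (z + h)%C).
  { change (Cmod (z + h - z)%C < d). rewrite E; auto. }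
  specialize (Hd B).
  change (Cmod (f (z + h) - f z - (z + h - z) * l)%C <= eps * Cmod (z + h - z)%C) in Hd.
  rewrite E in Hd. auto.
Qed.
Lemma Cd_mult f g z l m : Cd f z l -> Cd g z m -> Cd (fun x => f x * g x)%C z (l * g z + f z * m)%C.
Proof.
  intros Hf Hg. apply is_derive_Cd'.
  apply (@is_derive_mult C_AbsRing f g z l m); try apply Cd_is_derive'; auto.
  intros; apply Cmult_comm.
Qed.
Lemma Cd_comp f g z l m : Cd f (g z) l -> Cd g z m -> Cd (fun x => f (g x)) z (m * l)%C.
Proof.
  intros Hf Hg. apply is_derive_Cd'.
  apply (@is_derive_comp C_AbsRing (AbsRing_NormedModule C_AbsRing) f g z l m); apply Cd_is_derive'; auto.
Qed.
Lemma Cd_minus f g z l m : Cd f z l -> Cd g z m -> Cd (fun x => f x - g x)%C z (l - m)%C.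
Proof.
  intros Hf Hg. apply is_derive_Cd'.
  apply (@is_derive_minus C_AbsRing (AbsRing_NormedModule C_AbsRing) f g z l m); apply Cd_is_derive'; auto.
Qed.
Lemma Cd_plus f g z l m : Cd f z l -> Cd g z m -> Cd (fun x => f x + g x)%C z (l + m)%C.
Proof.
  intros Hf Hg. apply is_derive_Cd'.
  apply (@is_derive_plus C_AbsRing (AbsRing_NormedModule C_AbsRing) f g z l m); apply Cd_is_derive'; auto.
Qed.

Lemma Cmod_le_sum (x y : R) : Cmod (x, y) <= Rabs x + Rabs y.
Proof.
  replace (x, y) with ((x, 0%R) + (0%R, y))%C by (unfold Cplus; simpl; f_equal; ring).
  eapply Rle_trans; [apply Cmod_triangle|].
  assert (E1 : Cmod (x, 0) = Rabs x) by apply Cmod_R.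
  assert (E2 : Cmod (0, y) = Rabs y).
  { unfold Cmod; simpl. rewrite Rmult_0_l, Rplus_0_l, Rmult_1_r. apply sqrt_Rsqr_abs. }
  lra.
Qed.
Lemma Cmod_fst z : Rabs (fst z) <= Cmod z.
Proof. eapply Rle_trans; [apply Rmax_l|apply Rmax_Cmod]. Qed.
Lemma Cmod_snd z : Rabs (snd z) <= Cmod z.
Proof. eapply Rle_trans; [apply Rmax_r|apply Rmax_Cmod]. Qed.

Definition cexp (w : C) : C := (exp (fst w) * cos (snd w), exp (fst w) * sin (snd w)).

Lemma cexp_plus a b : cexp (a + b)%C = (cexp a * cexp b)%C.
Proof.
  unfold cexp, Cmult, Cplus; simpl. rewrite exp_plus, cos_plus, sin_plus. f_equal; ring.
Qed.
Lemma Cmod_cexp w : Cmod (cexp w) = exp (fst w).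
Proof.
  unfold cexp, Cmod; simpl.
  replace (_ + _) with (exp (fst w) * exp (fst w) * (Rsqr (sin (snd w)) + Rsqr (cos (snd w)))) by (unfold Rsqr; ring).
  rewrite sin2_cos2, Rmult_1_r. apply sqrt_square, Rlt_le, exp_pos.
Qed.
Lemma exp_bound1 x : Rabs (exp x - 1) <= Rabs x * exp (Rabs x).
Proof.
  destruct (MVT_gen exp 0 x exp) as [c [Hc E]].
  - intros; apply is_derive_exp.
  - intros; apply derivable_continuous_pt, derivable_pt_exp.
  - rewrite exp_0 in E. rewrite E, Rabs_mult, Rminus_0_r, Rmult_comm.
    apply Rmult_le_compat_l; [apply Rabs_pos|]. rewrite Rabs_right by (apply Rle_ge, Rlt_le, exp_pos).
    assert (c <= Rabs x) by (unfold Rmin, Rmax in Hc; destruct Rle_dec; unfold Rabs; destruct Rcase_abs; lra).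
    destruct (Req_dec c (Rabs x)) as [->|]; [lra|]. apply Rlt_le, exp_increasing; lra.
Qed.
Lemma exp_le_mono x y : x <= y -> exp x <= exp y.
Proof. intros H; destruct (Req_dec x y) as [->|]; [lra|]. apply Rlt_le, exp_increasing; lra. Qed.
Lemma exp_bound2 x : Rabs (exp x - 1 - x) <= x ^ 2 * exp (Rabs x).
Proof.
  destruct (MVT_gen (fun x => exp x - x) 0 x (fun x => exp x - 1)) as [c [Hc E]].
  - intros; auto_derive; auto; ring.
  - intros; apply continuity_pt_filterlim.
    apply (ex_derive_continuous (fun x => exp x - x)). auto_derive; auto.
  - rewrite exp_0 in E. replace (exp x - 1 - x) with ((exp c - 1) * (x - 0)) by lra.
    assert (Hcx : Rabs c <= Rabs x) by (unfold Rmin, Rmax in Hc; destruct Rle_dec; unfold Rabs; repeat destruct Rcase_abs; lra).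
    rewrite Rabs_mult, Rminus_0_r. replace (x ^ 2) with (Rabs x * Rabs x) by (rewrite <- Rabs_mult, Rabs_right; nra).
    assert (B := exp_bound1 c). assert (exp (Rabs c) <= exp (Rabs x)) by (apply exp_le_mono; auto).
    assert (Rabs c * exp (Rabs c) <= Rabs x * exp (Rabs x)).
    { apply Rmult_le_compat; auto; [apply Rabs_pos|apply Rlt_le, exp_pos]. }
    generalize (Rabs_pos x); nra.
Qed.
Lemma trig_bound2 y : Rabs (cos y - 1) <= y ^ 2 /\ Rabs (sin y - y) <= y ^ 2.
Proof.
  split.
  - assert (H := taylor_quad cos (fun x => - sin x) (fun x => - cos x) 1).
    assert (B := H (fun x => is_derive_cos x) ltac:(intros; auto_derive; auto; ring)
      ltac:(intros; cbv beta; rewrite Rabs_Ropp; apply Rabs_le, COS_bound) 0 y).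
    rewrite Rplus_0_l, cos_0, sin_0 in B. replace (cos y - 1 - y * - 0) with (cos y - 1) in B by ring. lra.
  - assert (H := taylor_quad sin cos (fun x => - sin x) 1).
    assert (B := H (fun x => is_derive_sin x) (fun x => is_derive_cos x)
      ltac:(intros; cbv beta; rewrite Rabs_Ropp; apply Rabs_le, SIN_bound) 0 y).
    rewrite Rplus_0_l, cos_0, sin_0 in B. replace (sin y - 0 - y * 1) with (sin y - y) in B by ring. lra.
Qed.
Lemma trig_bound1 y : Rabs (cos y - 1) <= Rabs y /\ Rabs (sin y) <= Rabs y.
Proof.
  split.
  - destruct (MVT_gen cos 0 y (fun x => - sin x)) as [c [_ E]].
    + intros; apply is_derive_cos.
    + intros; apply continuity_cos.
    + rewrite cos_0 in E. rewrite E, Rabs_mult, Rabs_Ropp, Rminus_0_r.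
      assert (Rabs (sin c) <= 1) by apply Rabs_le, SIN_bound. generalize (Rabs_pos y); nra.
  - destruct (MVT_gen sin 0 y cos) as [c [_ E]].
    + intros; apply is_derive_sin.
    + intros; apply continuity_sin.
    + rewrite sin_0, !Rminus_0_r in E. rewrite E, Rabs_mult.
      assert (Rabs (cos c) <= 1) by apply Rabs_le, COS_bound. generalize (Rabs_pos y); nra.
Qed.
Lemma cexp_bound1 w : Cmod (cexp w - 1)%C <= 3 * Cmod w * exp (Cmod w).
Proof.
  destruct w as [x y]. set (m := Cmod (x, y)).
  assert (Hx : Rabs x <= m) by apply (Cmod_fst (x, y)). assert (Hy : Rabs y <= m) by apply (Cmod_snd (x, y)).
  replace (cexp (x, y) - 1)%C with (((exp x - 1)%R, 0%R) + RtoC (exp x) * ((cos y - 1)%R, sin y))%C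
    by (unfold cexp, Cminus, Cplus, Copp, Cmult, RtoC; simpl; f_equal; ring).
  eapply Rle_trans; [apply Cmod_triangle|]. rewrite Cmod_mult, Cmod_R.
  assert (B1 := Cmod_le_sum (exp x - 1) 0). rewrite Rabs_R0 in B1.
  assert (B2 := Cmod_le_sum (cos y - 1) (sin y)). destruct (trig_bound1 y) as [T1 T2].
  assert (B3 := exp_bound1 x). rewrite (Rabs_right (exp x)) by (apply Rle_ge, Rlt_le, exp_pos).
  assert (E1 : exp (Rabs x) <= exp m) by (apply exp_le_mono; auto).
  assert (E2 : exp x <= exp m) by (apply exp_le_mono; eapply Rle_trans; [apply RRle_abs|auto]).
  generalize (exp_pos x) (exp_pos m) (exp_pos (Rabs x)) (Rabs_pos x) (Rabs_pos y); intros.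
  assert (Rabs x * exp (Rabs x) <= m * exp m) by (apply Rmult_le_compat; lra).
  assert (exp x * Cmod (cos y - 1, sin y) <= exp m * (2 * m)).
  { apply Rmult_le_compat; try lra. apply Cmod_ge_0. }
  lra.
Qed.
Lemma cexp_bound2 w : Cmod (cexp w - 1 - w)%C <= 4 * Cmod w ^ 2 * exp (Cmod w).
Proof.
  destruct w as [x y]. set (m := Cmod (x, y)).
  assert (Hx : Rabs x <= m) by apply (Cmod_fst (x, y)). assert (Hy : Rabs y <= m) by apply (Cmod_snd (x, y)).
  replace (cexp (x, y) - 1 - (x, y))%C with (((exp x - 1 - x)%R, ((exp x - 1) * y)%R) + RtoC (exp x) * ((cos y - 1)%R, (sin y - y)%R))%C
    by (unfold cexp, Cminus, Cplus, Copp, Cmult, RtoC; simpl; f_equal; ring).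
  eapply Rle_trans; [apply Cmod_triangle|]. rewrite Cmod_mult, Cmod_R.
  assert (B1 := Cmod_le_sum (exp x - 1 - x) ((exp x - 1) * y)). rewrite Rabs_mult in B1.
  assert (B2 := Cmod_le_sum (cos y - 1) (sin y - y)). destruct (trig_bound2 y) as [T1 T2].
  assert (B3 := exp_bound1 x). assert (B4 := exp_bound2 x).
  rewrite (Rabs_right (exp x)) by (apply Rle_ge, Rlt_le, exp_pos).
  assert (E1 : exp (Rabs x) <= exp m) by (apply exp_le_mono; auto).
  assert (E2 : exp x <= exp m) by (apply exp_le_mono; eapply Rle_trans; [apply RRle_abs|auto]).
  generalize (exp_pos x) (exp_pos m) (exp_pos (Rabs x)) (Rabs_pos x) (Rabs_pos y); intros.
  assert (Qx : x ^ 2 <= m ^ 2) by (rewrite <- pow2_abs; apply pow_incr; lra).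
  assert (Qy : y ^ 2 <= m ^ 2) by (rewrite <- pow2_abs; apply pow_incr; lra).
  assert (x ^ 2 * exp (Rabs x) <= m ^ 2 * exp m) by (apply Rmult_le_compat; try lra; apply pow2_ge_0).
  assert (Rabs (exp x - 1) * Rabs y <= (m * exp m) * m).
  { apply Rmult_le_compat; auto; [apply Rabs_pos|]. eapply Rle_trans; [apply B3|].
    apply Rmult_le_compat; lra. }
  assert (exp x * Cmod (cos y - 1, sin y - y) <= exp m * (2 * m ^ 2)).
  { apply Rmult_le_compat; try lra. apply Cmod_ge_0. }
  lra.
Qed.
Lemma Cd_quad f z l K : 0 <= K -> (forall h, Cmod h <= 1 -> Cmod (f (z + h) - f z - h * l)%C <= K * Cmod h ^ 2) -> Cd f z l.
Proof.
  intros HK H eps He. exists (Rmin 1 (eps / (K + 1))). assert (0 < eps / (K + 1)) by (apply Rdiv_lt_0_compat; lra).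
  split; [apply Rmin_glb_lt; lra|]. intros h Hh.
  assert (H1 : Cmod h < 1) by (eapply Rlt_le_trans; [apply Hh|apply Rmin_l]).
  assert (H2 : Cmod h < eps / (K + 1)) by (eapply Rlt_le_trans; [apply Hh|apply Rmin_r]).
  eapply Rle_trans; [apply H; lra|].
  apply (Rmult_lt_compat_r (K + 1)) in H2; [|lra]. unfold Rdiv in H2. rewrite Rmult_assoc, Rinv_l, Rmult_1_r in H2 by lra.
  generalize (Cmod_ge_0 h); intros. assert (K * Cmod h <= eps) by nra. nra.
Qed.
Lemma Cd_cexp w : Cd cexp w (cexp w).
Proof.
  apply (Cd_quad _ _ _ (exp (fst w) * (4 * exp 1))).
  { generalize (exp_pos (fst w)) (exp_pos 1); nra. }
  intros h Hh. rewrite cexp_plus.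
  replace (cexp w * cexp h - cexp w - h * cexp w)%C with (cexp w * (cexp h - 1 - h))%C by ring.
  rewrite Cmod_mult, Cmod_cexp. rewrite Rmult_assoc. apply Rmult_le_compat_l; [apply Rlt_le, exp_pos|].
  eapply Rle_trans; [apply cexp_bound2|].
  assert (exp (Cmod h) <= exp 1) by (apply exp_le_mono; auto).
  generalize (pow2_ge_0 (Cmod h)); nra.
Qed.
Lemma Cd_linear a c z : Cd (fun w => a + c * w)%C z c.
Proof.
  intros eps He. exists 1; split; [lra|]. intros h _.
  replace (a + c * (z + h) - (a + c * z) - h * c)%C with (RtoC 0) by ring.
  rewrite Cmod_0. generalize (Cmod_ge_0 h); nra.
Qed.

(** ** Goursat's lemma *)

Definition diff2 (P : R -> R -> R) x y p q := forall eps, 0 < eps -> exists d, 0 < d /\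
  forall x' y', Rabs (x' - x) < d -> Rabs (y' - y) < d ->
    Rabs (P x' y' - P x y - p * (x' - x) - q * (y' - y)) <= eps * (Rabs (x' - x) + Rabs (y' - y)).

Lemma diff2_cts P x y p q : diff2 P x y p q ->
  continuous (fun x' => P x' y) x /\ continuous (fun y' => P x y') y.
Proof.
  intros H. destruct (H 1 Rlt_0_1) as [d [Hd HH]].
  set (K := 1 + Rabs p + Rabs q). assert (0 < K) by (unfold K; generalize (Rabs_pos p) (Rabs_pos q); lra).
  split; intros V [[eps He] HV];
    (assert (Hm : 0 < Rmin d (eps / K)) by (apply Rmin_glb_lt; auto; apply Rdiv_lt_0_compat; auto);
    exists (mkposreal _ Hm)); simpl; intros t Ht; apply HV;
    [change (Rabs (P t y - P x y) < eps); change (Rabs (t - x) < Rmin d (eps / K)) in Ht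
    |change (Rabs (P x t - P x y) < eps); change (Rabs (t - y) < Rmin d (eps / K)) in Ht];
    assert (H1 := Rlt_le_trans _ _ _ Ht (Rmin_l _ _)); assert (H2 := Rlt_le_trans _ _ _ Ht (Rmin_r _ _));
    apply (Rmult_lt_compat_r K) in H2; auto; unfold Rdiv in H2; rewrite Rmult_assoc, Rinv_l, Rmult_1_r in H2 by lra.
  - assert (HB := HH t y H1 ltac:(rewrite Rminus_diag, Rabs_R0; auto)).
    rewrite Rminus_diag, Rabs_R0, Rplus_0_r, Rmult_0_r, Rminus_0_r in HB.
    replace (P t y - P x y) with ((P t y - P x y - p * (t - x)) + p * (t - x)) by ring.
    eapply Rle_lt_trans; [apply Rabs_triang|]. rewrite Rabs_mult. unfold K in H2.
    generalize (Rabs_pos (t - x)) (Rabs_pos q); nra.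
  - assert (HB := HH x t ltac:(rewrite Rminus_diag, Rabs_R0; auto) H1).
    rewrite Rminus_diag, Rabs_R0, Rplus_0_l, Rmult_0_r, Rminus_0_r in HB.
    replace (P x t - P x y) with ((P x t - P x y - q * (t - y)) + q * (t - y)) by ring.
    eapply Rle_lt_trans; [apply Rabs_triang|]. rewrite Rabs_mult. unfold K in H2.
    generalize (Rabs_pos (t - y)) (Rabs_pos p); nra.
Qed.

Section Goursat.
Variables (P Q : R -> R -> R) (a0 b0 c0 d0 : R).
Hypothesis Hab : a0 <= b0.
Hypothesis Hcd : c0 <= d0.
(** The shared coefficient [p2] says that [P dx + Q dy] is closed at every point. Continuity of the
    partial derivatives is not assumed, so Green's formula does not apply. *)
Hypothesis HD : forall x y, a0 <= x <= b0 -> c0 <= y <= d0 ->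
  exists p1 p2 q2, diff2 P x y p1 p2 /\ diff2 Q x y p2 q2.

Definition circ (a b c d : R) : R :=
  RInt (fun x => P x c) a b + RInt (fun y => Q b y) c d - RInt (fun x => P x d) a b - RInt (fun y => Q a y) c d.

Lemma goursat_exP a b y : a0 <= a -> a <= b -> b <= b0 -> c0 <= y <= d0 -> ex_RInt (fun x => P x y) a b.
Proof.
  intros. apply (ex_RInt_continuous (fun x => P x y)). rewrite Rmin_left, Rmax_right by auto.
  intros x Hx. destruct (HD x y) as (p1 & p2 & q2 & D1 & D2); try lra. apply (diff2_cts _ _ _ _ _ D1).
Qed.
Lemma goursat_exQ c d x : c0 <= c -> c <= d -> d <= d0 -> a0 <= x <= b0 -> ex_RInt (fun y => Q x y) c d.
Proof.
  intros. apply (ex_RInt_continuous (fun y => Q x y)). rewrite Rmin_left, Rmax_right by auto.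
  intros y Hy. destruct (HD x y) as (p1 & p2 & q2 & D1 & D2); try lra. apply (diff2_cts _ _ _ _ _ D2).
Qed.

Lemma circ_split a m b c n d : a0 <= a -> a <= m -> m <= b -> b <= b0 -> c0 <= c -> c <= n -> n <= d -> d <= d0 ->
  circ a b c d = circ a m c n + circ m b c n + circ a m n d + circ m b n d.
Proof.
  intros. unfold circ.
  assert (SP : forall y, c0 <= y <= d0 -> RInt (fun x => P x y) a b = RInt (fun x => P x y) a m + RInt (fun x => P x y) m b).
  { intros y Hy. symmetry. apply (RInt_Chasles (fun x => P x y)); apply goursat_exP; lra. }
  assert (SQ : forall x, a0 <= x <= b0 -> RInt (fun y => Q x y) c d = RInt (fun y => Q x y) c n + RInt (fun y => Q x y) n d).
  { intros x Hx. symmetry. apply (RInt_Chasles (fun y => Q x y)); apply goursat_exQ; lra. }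
  rewrite (SP c), (SP d), (SQ a), (SQ b) by lra. ring.
Qed.

(** One of the four quarters carries at least a fourth of the circulation; the last one is taken
    when the other three fail the test. *)
Definition quarter (r : (R * R) * (R * R)) : (R * R) * (R * R) :=
  let '((a, b), (c, d)) := r in
  let m := (a + b) / 2 in let n := (c + d) / 2 in
  let L := Rabs (circ a b c d) / 4 in
  if Rle_dec L (Rabs (circ a m c n)) then ((a, m), (c, n)) else
  if Rle_dec L (Rabs (circ m b c n)) then ((m, b), (c, n)) else
  if Rle_dec L (Rabs (circ a m n d)) then ((a, m), (n, d)) else ((m, b), (n, d)).

Definition Cr (r : (R * R) * (R * R)) := circ (fst (fst r)) (snd (fst r)) (fst (snd r)) (snd (snd r)).
Definition inside (r : (R * R) * (R * R)) :=
  a0 <= fst (fst r) /\ fst (fst r) <= snd (fst r) /\ snd (fst r) <= b0 /\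
  c0 <= fst (snd r) /\ fst (snd r) <= snd (snd r) /\ snd (snd r) <= d0.

Lemma quarter_spec r : inside r -> inside (quarter r) /\ Rabs (Cr r) / 4 <= Rabs (Cr (quarter r)) /\
  fst (fst r) <= fst (fst (quarter r)) /\ snd (fst (quarter r)) <= snd (fst r) /\
  fst (snd r) <= fst (snd (quarter r)) /\ snd (snd (quarter r)) <= snd (snd r) /\
  snd (fst (quarter r)) - fst (fst (quarter r)) = (snd (fst r) - fst (fst r)) / 2 /\
  snd (snd (quarter r)) - fst (snd (quarter r)) = (snd (snd r) - fst (snd r)) / 2.
Proof.
  destruct r as [[a b] [c d]]. unfold inside, Cr; simpl. intros (H1 & H2 & H3 & H4 & H5 & H6).
  assert (E := circ_split a ((a + b) / 2) b c ((c + d) / 2) d ltac:(lra) ltac:(lra) ltac:(lra) ltac:(lra)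
    ltac:(lra) ltac:(lra) ltac:(lra) ltac:(lra)).
  destruct Rle_dec as [L1|L1]; [simpl; repeat split; lra|].
  destruct Rle_dec as [L2|L2]; [simpl; repeat split; lra|].
  destruct Rle_dec as [L3|L3]; [simpl; repeat split; lra|].
  simpl; repeat split; try lra.
  destruct (Rle_lt_dec (Rabs (circ a b c d) / 4) (Rabs (circ ((a + b) / 2) b ((c + d) / 2) d))) as [|L4]; auto. exfalso.
  assert (T : Rabs (circ a b c d) <= Rabs (circ a ((a + b) / 2) c ((c + d) / 2)) + Rabs (circ ((a + b) / 2) b c ((c + d) / 2))
     + Rabs (circ a ((a + b) / 2) ((c + d) / 2) d) + Rabs (circ ((a + b) / 2) b ((c + d) / 2) d)).
  { rewrite E. repeat (eapply Rle_trans; [apply Rabs_triang|apply Rplus_le_compat_r]). lra. }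
  lra.
Qed.

Fixpoint rects (n : nat) := match n with O => ((a0, b0), (c0, d0)) | S n => quarter (rects n) end.

Lemma rects_inside n : inside (rects n).
Proof.
  induction n; [unfold inside; simpl; lra|]. simpl. apply quarter_spec; auto.
Qed.
Lemma rects_size n : snd (fst (rects n)) - fst (fst (rects n)) = (b0 - a0) / 2 ^ n /\
  snd (snd (rects n)) - fst (snd (rects n)) = (d0 - c0) / 2 ^ n /\
  Rabs (Cr (rects 0)) / 4 ^ n <= Rabs (Cr (rects n)).
Proof.
  induction n; [simpl; lra|]. destruct IHn as (I1 & I2 & I3).
  destruct (quarter_spec (rects n) (rects_inside n)) as (_ & Q1 & _ & _ & _ & _ & Q2 & Q3).
  change (rects (S n)) with (quarter (rects n)). rewrite Q2, Q3, I1, I2.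
  assert (0 < 2 ^ n) by (apply pow_lt; lra). assert (0 < 4 ^ n) by (apply pow_lt; lra).
  split; [simpl; field; lra|]. split; [simpl; field; lra|].
  eapply Rle_trans; [|apply Q1]. simpl. replace (Rabs (Cr (a0, b0, (c0, d0))) / (4 * 4 ^ n)) with (Rabs (Cr (rects 0)) / 4 ^ n / 4).
  - lra.
  - simpl. field; lra.
Qed.

Lemma nested_point (u v : nat -> R) : (forall n, u n <= u (S n)) -> (forall n, v (S n) <= v n) ->
  (forall n, u n <= v n) -> exists x, forall n, u n <= x <= v n.
Proof.
  intros Hu Hv Huv.
  assert (mu : forall n m, (n <= m)%nat -> u n <= u m).
  { induction 1; [lra|]. eapply Rle_trans; [apply IHle|apply Hu]. }
  assert (mv : forall n m, (n <= m)%nat -> v m <= v n).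
  { induction 1; [lra|]. eapply Rle_trans; [apply Hv|apply IHle]. }
  assert (B : forall n m, u n <= v m).
  { intros n m. apply Rle_trans with (u (n + m)%nat); [apply mu; lia|].
    apply Rle_trans with (v (n + m)%nat); [apply Huv|apply mv; lia]. }
  destruct (completeness (fun x => exists n, x = u n)) as [x [Hx1 Hx2]].
  - exists (v 0%nat). intros y [n ->]. apply B.
  - exists (u 0%nat), 0%nat; auto.
  - exists x; intros n; split; [apply Hx1; eauto|]. apply Hx2. intros y [m ->]. apply B.
Qed.

Lemma Rplus_minus_cancel (u v : R) : u = v + (u - v).
Proof. ring. Qed.
Lemma RInt_minus_R (f g : R -> R) (a b : R) : ex_RInt f a b -> ex_RInt g a b ->
  RInt (fun x => f x - g x) a b = RInt f a b - RInt g a b.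
Proof. apply (RInt_minus f g). Qed.
Lemma RInt_lin (A B x0 a b : R) : RInt (fun x => A + B * (x - x0)) a b = A * (b - a) + B * ((b - x0) ^ 2 - (a - x0) ^ 2) / 2.
Proof.
  rewrite (RInt_derive' (fun x => A * x + B * (x - x0) ^ 2 / 2)).
  - toR; field.
  - intros x. auto_derive; auto. field.
  - ctac.
Qed.

(** The linear part of the form has a symmetric matrix, hence no circulation round a rectangle. The
    remainder along a side is at most [eps] times its length times the half-perimeter, which adds up
    to [2 eps] times the square of the half-perimeter. *)
Lemma circ_small x y p1 p2 q2 eps d a b c e : a0 <= a -> a <= x <= b -> b <= b0 -> c0 <= c -> c <= y <= e -> e <= d0 ->
  b - a < d -> e - c < d -> 0 <= eps ->
  (forall x' y', Rabs (x' - x) < d -> Rabs (y' - y) < d ->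
    Rabs (P x' y' - P x y - p1 * (x' - x) - p2 * (y' - y)) <= eps * (Rabs (x' - x) + Rabs (y' - y))) ->
  (forall x' y', Rabs (x' - x) < d -> Rabs (y' - y) < d ->
    Rabs (Q x' y' - Q x y - p2 * (x' - x) - q2 * (y' - y)) <= eps * (Rabs (x' - x) + Rabs (y' - y))) ->
  Rabs (circ a b c e) <= 2 * eps * ((b - a) + (e - c)) ^ 2.
Proof.
  intros Ha Hx Hb Hc Hy He Hd1 Hd2 Heps BP BQ.
  set (D := (b - a) + (e - c)).
  assert (SP : forall t, c <= t <= e -> exists r, RInt (fun x' => P x' t) a b =
     (P x y + p2 * (t - y)) * (b - a) + p1 * ((b - x) ^ 2 - (a - x) ^ 2) / 2 + r /\ Rabs r <= (b - a) * (eps * D)).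
  { intros t Ht.
    exists (RInt (fun x' => P x' t - ((P x y + p2 * (t - y)) + p1 * (x' - x))) a b). split.
    - assert (E1 := goursat_exP a b t ltac:(lra) ltac:(lra) ltac:(lra) ltac:(lra)).
      assert (E2 : ex_RInt (fun x' => (P x y + p2 * (t - y)) + p1 * (x' - x)) a b) by ctac.
      rewrite (RInt_minus_R _ _ _ _ E1 E2), RInt_lin. apply (Rplus_minus_cancel (RInt _ _ _)).
    - apply abs_RInt_le_const; [lra| |].
      + apply (ex_RInt_minus (fun x' => P x' t) (fun x' => (P x y + p2 * (t - y)) + p1 * (x' - x))); [apply goursat_exP; lra|ctac].
      + intros x' Hx'. replace (P x' t - (P x y + p2 * (t - y) + p1 * (x' - x))) with (P x' t - P x y - p1 * (x' - x) - p2 * (t - y)) by ring.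
        assert (A1 : Rabs (x' - x) <= b - a) by (apply Rabs_le; lra).
        assert (A2 : Rabs (t - y) <= e - c) by (apply Rabs_le; lra).
        eapply Rle_trans; [apply BP; lra|]. apply Rmult_le_compat_l; auto. unfold D; lra. }
  assert (SQ : forall t, a <= t <= b -> exists r, RInt (fun y' => Q t y') c e =
     (Q x y + p2 * (t - x)) * (e - c) + q2 * ((e - y) ^ 2 - (c - y) ^ 2) / 2 + r /\ Rabs r <= (e - c) * (eps * D)).
  { intros t Ht.
    exists (RInt (fun y' => Q t y' - ((Q x y + p2 * (t - x)) + q2 * (y' - y))) c e). split.
    - assert (E1 := goursat_exQ c e t ltac:(lra) ltac:(lra) ltac:(lra) ltac:(lra)).
      assert (E2 : ex_RInt (fun y' => (Q x y + p2 * (t - x)) + q2 * (y' - y)) c e) by ctac.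
      rewrite (RInt_minus_R _ _ _ _ E1 E2), RInt_lin. apply (Rplus_minus_cancel (RInt _ _ _)).
    - apply abs_RInt_le_const; [lra| |].
      + apply (ex_RInt_minus (fun y' => Q t y') (fun y' => (Q x y + p2 * (t - x)) + q2 * (y' - y))); [apply goursat_exQ; lra|ctac].
      + intros y' Hy'. replace (Q t y' - (Q x y + p2 * (t - x) + q2 * (y' - y))) with (Q t y' - Q x y - p2 * (t - x) - q2 * (y' - y)) by ring.
        assert (A1 : Rabs (t - x) <= b - a) by (apply Rabs_le; lra).
        assert (A2 : Rabs (y' - y) <= e - c) by (apply Rabs_le; lra).
        eapply Rle_trans; [apply BQ; lra|]. apply Rmult_le_compat_l; auto. unfold D; lra. }
  destruct (SP c ltac:(lra)) as [r1 [E1 R1]]. destruct (SP e ltac:(lra)) as [r2 [E2 R2]].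
  destruct (SQ a ltac:(lra)) as [r3 [E3 R3]]. destruct (SQ b ltac:(lra)) as [r4 [E4 R4]].
  unfold circ. rewrite E1, E2, E3, E4.
  match goal with |- Rabs ?X <= _ => replace X with (r1 + r4 - r2 - r3) by field end.
  apply Rabs_le_between in R1, R2, R3, R4. apply Rabs_le. fold D. unfold D in *. nra.
Qed.

(** The chosen rectangles shrink to a point. Per step the circulation loses at most the factor 4,
    and the bound of [circ_small] loses exactly this factor, so the powers cancel and [eps] is
    arbitrary. *)
Lemma goursat : circ a0 b0 c0 d0 = 0.
Proof.
  assert (M := fun n => quarter_spec (rects n) (rects_inside n)).
  destruct (nested_point (fun n => fst (fst (rects n))) (fun n => snd (fst (rects n)))) as [x Hx].
  { intros n; apply (M n). } { intros n; apply (M n). } { intros n; apply (rects_inside n). }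
  destruct (nested_point (fun n => fst (snd (rects n))) (fun n => snd (snd (rects n)))) as [y Hy].
  { intros n; apply (M n). } { intros n; apply (M n). } { intros n; apply (rects_inside n). }
  assert (X0 := Hx 0%nat). assert (Y0 := Hy 0%nat). simpl in X0, Y0.
  destruct (HD x y X0 Y0) as (p1 & p2 & q2 & D1 & D2).
  set (D := (b0 - a0) + (d0 - c0)).
  assert (key : forall eps, 0 < eps -> Rabs (circ a0 b0 c0 d0) <= 2 * eps * D ^ 2).
  { intros eps He.
    destruct (D1 eps He) as [d1 [Hd1 B1]]. destruct (D2 eps He) as [d2 [Hd2 B2]].
    set (d := Rmin d1 d2). assert (Hd : 0 < d) by (apply Rmin_glb_lt; auto).
    assert (d <= d1) by apply Rmin_l. assert (d <= d2) by apply Rmin_r.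
    assert (Hh : Rabs (/ 2) < 1) by (rewrite Rabs_right; lra).
    assert (Hdd : 0 < d / (D + 1)) by (apply Rdiv_lt_0_compat; unfold D; lra).
    destruct (pow_lt_1_zero (/ 2) Hh _ Hdd) as [n Hn]. specialize (Hn n (Nat.le_refl _)).
    assert (P2 : 0 < 2 ^ n) by (apply pow_lt; lra).
    rewrite pow_inv, Rabs_right in Hn by (apply Rle_ge, Rinv_nneg; auto).
    destruct (rects_size n) as (S1 & S2 & S3).
    destruct (rects_inside n) as (J1 & J2 & J3 & J4 & J5 & J6).
    assert (small : D / 2 ^ n < d).
    { assert (Hq : / 2 ^ n * (D + 1) < d).
      { apply (Rmult_lt_compat_r (D + 1)) in Hn; [|unfold D; lra].
        unfold Rdiv in Hn. rewrite Rmult_assoc, Rinv_l, Rmult_1_r in Hn; auto. unfold D; lra. }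
      assert (0 < / 2 ^ n) by (apply Rinv_0_lt_compat; auto). unfold Rdiv. nra. }
    assert (p2pos : 0 < / 2 ^ n) by (apply Rinv_0_lt_compat; auto).
    unfold Rdiv in S1, S2. unfold D, Rdiv in small.
    assert (C := circ_small x y p1 p2 q2 eps d (fst (fst (rects n))) (snd (fst (rects n))) (fst (snd (rects n))) (snd (snd (rects n)))
      J1 (Hx n) J3 J4 (Hy n) J6 ltac:(nra) ltac:(nra) (Rlt_le _ _ He)
      ltac:(intros; apply B1; lra) ltac:(intros; apply B2; lra)).
    fold (Cr (rects n)) in C. rewrite S1, S2 in C.
    replace ((b0 - a0) * / 2 ^ n + (d0 - c0) * / 2 ^ n) with (D * / 2 ^ n) in C by (unfold D; ring).
    change (Cr (rects 0)) with (circ a0 b0 c0 d0) in S3.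
    assert (P4 : 0 < 4 ^ n) by (apply pow_lt; lra).
    assert (E4 : (/ 2 ^ n) ^ 2 = / 4 ^ n).
    { rewrite pow_inv. f_equal. rewrite <- pow_mult, Nat.mul_comm, pow_mult. f_equal; ring. }
    rewrite Rpow_mult_distr, E4 in C.
    assert (T := Rle_trans _ _ _ S3 C). apply (Rmult_le_compat_r (4 ^ n)) in T; [|lra].
    unfold Rdiv in T. rewrite Rmult_assoc, Rinv_l, Rmult_1_r in T by lra.
    replace (2 * eps * (D ^ 2 * / 4 ^ n) * 4 ^ n) with (2 * eps * D ^ 2) in T by (field; lra). auto. }
  destruct (Req_dec (circ a0 b0 c0 d0) 0) as [|Hne]; auto. exfalso.
  assert (Hp : 0 < Rabs (circ a0 b0 c0 d0)) by (apply Rabs_pos_lt; auto).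
  assert (HD2 := pow2_ge_0 D).
  assert (He : 0 < Rabs (circ a0 b0 c0 d0) / (4 * (D ^ 2 + 1))) by (apply Rdiv_lt_0_compat; lra).
  specialize (key _ He).
  assert (E : 2 * (Rabs (circ a0 b0 c0 d0) / (4 * (D ^ 2 + 1))) * D ^ 2 = Rabs (circ a0 b0 c0 d0) / 2 * (D ^ 2 / (D ^ 2 + 1))) by (field; lra).
  assert (D ^ 2 / (D ^ 2 + 1) <= 1).
  { apply Rmult_le_reg_r with (D ^ 2 + 1); [lra|]. unfold Rdiv. rewrite Rmult_assoc, Rinv_l; lra. }
  rewrite E in key. nra.
Qed.
End Goursat.

(** * Vanishing of holomorphic functions on discs *)

Lemma Cd_diff2 G x y l1 l2 : Cd G (x, y) (l1, l2) ->
  diff2 (fun x y => fst (G (x, y))) x y l1 (- l2) /\ diff2 (fun x y => snd (G (x, y))) x y l2 l1.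
Proof.
  intros H.
  assert (B : forall eps, 0 < eps -> exists d, 0 < d /\ forall x' y', Rabs (x' - x) < d -> Rabs (y' - y) < d ->
    Cmod (G (x', y') - G (x, y) - ((x' - x)%R, (y' - y)%R) * (l1, l2))%C <= eps * (Rabs (x' - x) + Rabs (y' - y))).
  { intros eps He. destruct (H eps He) as [d [Hd HH]]. exists (d / 2); split; [lra|].
    intros x' y' Hx Hy. assert (M := Cmod_le_sum (x' - x) (y' - y)).
    specialize (HH ((x' - x)%R, (y' - y)%R) ltac:(lra)).
    replace ((x, y) + ((x' - x)%R, (y' - y)%R))%C with (x', y') in HH by (unfold Cplus; simpl; f_equal; ring).
    eapply Rle_trans; [apply HH|]. apply Rmult_le_compat_l; lra. }
  split; intros eps He; destruct (B eps He) as [d [Hd HH]]; exists d; split; auto; intros x' y' Hx Hy;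
    eapply Rle_trans; [|apply (HH x' y' Hx Hy)| |apply (HH x' y' Hx Hy)].
  - eapply Rle_trans; [|apply Cmod_fst]. apply Req_le. f_equal. simpl. ring.
  - eapply Rle_trans; [|apply Cmod_snd]. apply Req_le. f_equal. simpl. ring.
Qed.
Lemma diff2_opp P x y p q : diff2 P x y p q -> diff2 (fun x y => - P x y) x y (- p) (- q).
Proof.
  intros H eps He. destruct (H eps He) as [d [Hd HH]]. exists d; split; auto. intros x' y' Hx Hy.
  rewrite <- Rabs_Ropp. eapply Rle_trans; [|apply (HH x' y' Hx Hy)]. apply Req_le. f_equal. ring.
Qed.

Section Disc.
Variables (F : C -> C) (z0 : C) (Rad del : R).
Hypothesis HF : forall z, Cmod (z - z0)%C < Rad -> exists l, Cd F z l.
Hypothesis Hdel : 0 < del.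
Hypothesis H0 : forall z, Cmod (z - z0)%C < del -> F z = RtoC 0.

(** In the logarithmic coordinate [w] a circle about [z0] is a vertical segment, over which
    [F (z0 + e^w) e^(- k w)] integrates to [2 PI] times a Laurent coefficient of [F]. Independence
    of the radius is Goursat's lemma on a rectangle whose horizontal sides cancel by periodicity;
    power series are avoided. *)
Definition polar (k : R) (w : C) : C := (F (z0 + 1 * cexp w) * cexp (0 + RtoC (- k) * w))%C.

Lemma in_disc w r : exp (fst w) < r -> Cmod (z0 + 1 * cexp w - z0)%C < r.
Proof. replace (z0 + 1 * cexp w - z0)%C with (cexp w) by ring. rewrite Cmod_cexp; auto. Qed.

Lemma polar_Cd k w : exp (fst w) < Rad -> exists l, Cd (polar k) w l.
Proof.
  intros Hw. destruct (HF _ (in_disc w Rad Hw)) as [l Hl].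
  assert (D1 : Cd (fun w => z0 + 1 * cexp w)%C w (cexp w * 1)%C).
  { apply (Cd_comp (fun v => z0 + 1 * v)%C cexp); [apply Cd_linear|apply Cd_cexp]. }
  assert (D2 := Cd_comp F (fun w => z0 + 1 * cexp w)%C w _ _ Hl D1).
  assert (D3 : Cd (fun w => cexp (0 + RtoC (- k) * w))%C w (RtoC (- k) * cexp (0 + RtoC (- k) * w))%C).
  { apply (Cd_comp cexp (fun w => 0 + RtoC (- k) * w)%C); [apply Cd_cexp|apply Cd_linear]. }
  eexists. apply (Cd_mult _ _ _ _ _ D2 D3).
Qed.

Lemma polar_per (k : Z) x : polar (IZR k) (x, 2 * PI) = polar (IZR k) (x, 0).
Proof.
  unfold polar. f_equal.
  - f_equal. f_equal. f_equal. unfold cexp; simpl. rewrite cos_2PI, sin_2PI, cos_0, sin_0; auto.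
  - unfold cexp, Cplus, Cmult, RtoC; simpl.
    assert (E : 0 + (- IZR k * (2 * PI) + 0 * x) = IZR (- k) * (0 + 2 * PI)) by (rewrite opp_IZR; ring).
    rewrite E, cos_Z_per, sin_Z_per.
    replace (IZR (- k) * 0) with (0 + (- IZR k * 0 + 0 * x)) by (rewrite opp_IZR; ring).
    f_equal; f_equal; f_equal; ring.
Qed.

Lemma polar_circle (k : Z) x1 x2 : x1 <= x2 -> exp x2 < Rad ->
  RInt (fun y => fst (polar (IZR k) (x2, y))) 0 (2 * PI) = RInt (fun y => fst (polar (IZR k) (x1, y))) 0 (2 * PI) /\
  RInt (fun y => snd (polar (IZR k) (x2, y))) 0 (2 * PI) = RInt (fun y => snd (polar (IZR k) (x1, y))) 0 (2 * PI).
Proof.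
  intros Hx HR.
  assert (HD : forall x y, x1 <= x <= x2 -> 0 <= y <= 2 * PI -> exists l1 l2, Cd (polar (IZR k)) (x, y) (l1, l2)).
  { intros x y Hxx _. destruct (polar_Cd (IZR k) (x, y)) as [[l1 l2] Hl]; [|eauto].
    simpl. eapply Rle_lt_trans; [|apply HR]. apply exp_le_mono; lra. }
  split.
  - assert (G := goursat (fun x y => snd (polar (IZR k) (x, y))) (fun x y => fst (polar (IZR k) (x, y)))
      x1 x2 0 (2 * PI) Hx two_pi_nonneg). unfold circ in G.
    rewrite (RInt_ext' (fun x => snd (polar (IZR k) (x, 2 * PI))) (fun x => snd (polar (IZR k) (x, 0)))) in G
      by (intros; rewrite polar_per; auto).
    assert (G' := G ltac:(intros x y Hxx Hyy; destruct (HD x y Hxx Hyy) as (l1 & l2 & Hl);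
      destruct (Cd_diff2 _ _ _ _ _ Hl) as [D1 D2]; eauto 10)).
    lra.
  - assert (G := goursat (fun x y => fst (polar (IZR k) (x, y))) (fun x y => - snd (polar (IZR k) (x, y)))
      x1 x2 0 (2 * PI) Hx two_pi_nonneg). unfold circ in G.
    rewrite (RInt_ext' (fun x => fst (polar (IZR k) (x, 2 * PI))) (fun x => fst (polar (IZR k) (x, 0)))) in G
      by (intros; rewrite polar_per; auto).
    assert (G' := G ltac:(intros x y Hxx Hyy; destruct (HD x y Hxx Hyy) as (l1 & l2 & Hl);
      destruct (Cd_diff2 _ _ _ _ _ Hl) as [D1 D2]; apply diff2_opp in D2; eauto 10)).
    assert (O : forall x, x1 <= x <= x2 -> RInt (fun y => - snd (polar (IZR k) (x, y))) 0 (2 * PI) = - RInt (fun y => snd (polar (IZR k) (x, y))) 0 (2 * PI)).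
    { intros x Hxx. apply (RInt_opp (fun y => snd (polar (IZR k) (x, y)))).
      apply (ex_RInt_continuous (fun y => snd (polar (IZR k) (x, y)))). rewrite Rmin_left, Rmax_right by ctac. intros y Hy.
      destruct (HD x y Hxx Hy) as (l1 & l2 & Hl). destruct (Cd_diff2 _ _ _ _ _ Hl) as [_ D2].
      apply (proj2 (diff2_cts _ _ _ _ _ D2)). }
    rewrite !O in G' by lra. lra.
Qed.

Definition h1 x y := fst (F (z0 + 1 * cexp (x, y)))%C.
Definition h2 x y := snd (F (z0 + 1 * cexp (x, y)))%C.

Lemma h_cts x : exp x < Rad -> cts (h1 x) /\ cts (h2 x).
Proof.
  intros HR. split; intros y; destruct (polar_Cd 0 (x, y) HR) as [[l1 l2] Hl];
    destruct (Cd_diff2 _ _ _ _ _ Hl) as [D1 D2].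
  - apply (continuous_ext (fun y => fst (polar 0 (x, y)))); [|apply (proj2 (diff2_cts _ _ _ _ _ D1))].
    intros t. unfold polar, h1. simpl. rewrite !Ropp_0, !Rmult_0_l, !Rplus_0_r, Rminus_0_r, Rplus_0_r, exp_0, cos_0, sin_0. ring.
  - apply (continuous_ext (fun y => snd (polar 0 (x, y)))); [|apply (proj2 (diff2_cts _ _ _ _ _ D2))].
    intros t. unfold polar, h2. simpl. rewrite !Ropp_0, !Rmult_0_l, !Rplus_0_r, Rminus_0_r, Rplus_0_r, exp_0, cos_0, sin_0. ring.
Qed.
Lemma h_per x : per (h1 x) /\ per (h2 x).
Proof.
  assert (E : forall y, cexp (x, y + 2 * PI) = cexp (x, y)).
  { intros y. unfold cexp; simpl. rewrite <- (cos_period y 1), <- (sin_period y 1). simpl.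
    replace (y + 2 * 1 * PI) with (y + 2 * PI) by ring. auto. }
  split; intros y; unfold h1, h2; rewrite E; auto.
Qed.

(** The integral is moved to a circle of radius below [del], on which [F] vanishes. *)
Lemma polar_zero (k : Z) x : exp x < Rad ->
  I2 (fun y => h1 x y * cos (IZR k * y) + h2 x y * sin (IZR k * y)) = 0 /\
  I2 (fun y => h2 x y * cos (IZR k * y) - h1 x y * sin (IZR k * y)) = 0.
Proof.
  intros HR. destruct (h_cts x HR) as [c1 c2].
  set (x1 := Rmin x (ln (del / 2))).
  assert (Hx1 : x1 <= x) by apply Rmin_l.
  assert (Hd1 : exp x1 < del).
  { eapply Rle_lt_trans; [apply exp_le_mono, Rmin_r|]. rewrite exp_ln; lra. }
  destruct (polar_circle k x1 x Hx1 HR) as [E1 E2].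
  assert (Z : forall y, polar (IZR k) (x1, y) = RtoC 0).
  { intros y. unfold polar. rewrite H0; [ring|]. apply in_disc; auto. }
  rewrite (RInt_ext' (fun y => fst (polar (IZR k) (x1, y))) (fun _ => 0)), RInt_const', Rmult_0_r in E1
    by (intros; rewrite Z; auto).
  rewrite (RInt_ext' (fun y => snd (polar (IZR k) (x1, y))) (fun _ => 0)), RInt_const', Rmult_0_r in E2
    by (intros; rewrite Z; auto).
  assert (X : forall y, polar (IZR k) (x, y) = (exp (- IZR k * x) * (h1 x y * cos (IZR k * y) + h2 x y * sin (IZR k * y)),
     exp (- IZR k * x) * (h2 x y * cos (IZR k * y) - h1 x y * sin (IZR k * y)))).
  { intros y. unfold polar, h1, h2. destruct (F (z0 + 1 * cexp (x, y)))%C as [u v].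
    unfold cexp, Cmult, Cplus, RtoC; simpl.
    replace (0 + (- IZR k * x - 0 * y)) with (- IZR k * x) by ring.
    replace (0 + (- IZR k * y + 0 * x)) with (- (IZR k * y)) by ring.
    rewrite cos_neg, sin_neg. f_equal; ring. }
  assert (P := exp_pos (- IZR k * x)).
  split.
  - rewrite (RInt_ext' _ (fun y => exp (- IZR k * x) * (h1 x y * cos (IZR k * y) + h2 x y * sin (IZR k * y)))) in E1
      by (intros; rewrite X; auto).
    rewrite RInt_scal' in E1 by ctac. destruct (Rmult_integral _ _ E1); auto; lra.
  - rewrite (RInt_ext' _ (fun y => exp (- IZR k * x) * (h2 x y * cos (IZR k * y) - h1 x y * sin (IZR k * y)))) in E2
      by (intros; rewrite X; auto).
    rewrite RInt_scal' in E2 by ctac. destruct (Rmult_integral _ _ E2); auto; lra.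
Qed.

(** All Fourier coefficients of [F] on the circle vanish, so uniqueness of Fourier coefficients
    finishes the proof. The frequencies [k] and [- k] together separate the real from the imaginary
    part. *)
Lemma circle_zero x y : exp x < Rad -> F (z0 + 1 * cexp (x, y))%C = RtoC 0.
Proof.
  intros HR. destruct (h_cts x HR) as [c1 c2]. destruct (h_per x) as [p1 p2].
  assert (K : forall n : nat, I2 (fun y => h1 x y * cos (INR n * y)) = 0 /\ I2 (fun y => h2 x y * sin (INR n * y)) = 0 /\
     I2 (fun y => h2 x y * cos (INR n * y)) = 0 /\ I2 (fun y => h1 x y * sin (INR n * y)) = 0).
  { intros n. destruct (polar_zero (Z.of_nat n) x HR) as [A1 A2]. destruct (polar_zero (- Z.of_nat n) x HR) as [B1 B2].
    rewrite opp_IZR, <- INR_IZR_INZ in B1, B2. rewrite <- INR_IZR_INZ in A1, A2.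
    rewrite (I2_ext _ (fun y => h1 x y * cos (INR n * y) - h2 x y * sin (INR n * y))) in B1
      by (intros; rewrite <- Ropp_mult_distr_l, cos_neg, sin_neg; ring).
    rewrite (I2_ext _ (fun y => h2 x y * cos (INR n * y) + h1 x y * sin (INR n * y))) in B2
      by (intros; rewrite <- Ropp_mult_distr_l, cos_neg, sin_neg; ring).
    rewrite I2_plus in A1, B2 by ctac. rewrite I2_minus in A2, B1 by ctac. repeat split; lra. }
  assert (Z1 : h1 x y = 0).
  { apply (fourier_unique (fun _ => 1) (fun x => x)); auto using phase_id; intros n; destruct (K n) as (K1 & K2 & K3 & K4).
    - rewrite <- K1. apply I2_ext; intros; ring.
    - rewrite <- K4. apply I2_ext; intros; ring. }
  assert (Z2 : h2 x y = 0).
  { apply (fourier_unique (fun _ => 1) (fun x => x)); auto using phase_id; intros n; destruct (K n) as (K1 & K2 & K3 & K4).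
    - rewrite <- K3. apply I2_ext; intros; ring.
    - rewrite <- K2. apply I2_ext; intros; ring. }
  unfold h1 in Z1; unfold h2 in Z2. rewrite (surjective_pairing (F _)), Z1, Z2. auto.
Qed.
End Disc.

Lemma polar_form z : z <> RtoC 0 -> exists x y, z = cexp (x, y).
Proof.
  intros Hz. assert (Hm : 0 < Cmod z).
  { destruct (Cmod_ge_0 z) as [|E]; auto. symmetry in E. apply Cmod_eq_0 in E. contradiction. }
  destruct z as [u v]. set (m := Cmod (u, v)) in *.
  assert (Hm2 : m * m = u * u + v * v).
  { unfold m, Cmod; simpl. rewrite sqrt_sqrt; [ring|nra]. }
  assert (B : -1 <= u / m <= 1).
  { assert (Hu := Cmod_fst (u, v)). simpl in Hu. fold m in Hu. apply Rabs_le_between in Hu.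
    split; [apply Rmult_le_reg_r with m|apply Rmult_le_reg_r with m]; auto; unfold Rdiv; rewrite Rmult_assoc, Rinv_l; lra. }
  assert (Ec : cos (acos (u / m)) = u / m) by (apply cos_acos; auto).
  assert (Es : sin (acos (u / m)) = sqrt (1 - (u / m)²)) by (apply sin_acos; auto).
  assert (Ev : 1 - (u / m)² = (v / m)²).
  { unfold Rsqr. replace 1 with ((m * m) / (m * m)) by (field; lra). rewrite Hm2 at 1. field; lra. }
  rewrite Ev, sqrt_Rsqr_abs in Es.
  assert (Ea : Rabs (v / m) = Rabs v / m).
  { unfold Rdiv. rewrite Rabs_mult, (Rabs_right (/ m)); auto. apply Rle_ge, Rinv_nneg; auto. }
  exists (ln m). destruct (Rle_lt_dec 0 v) as [Hv|Hv].
  - exists (acos (u / m)). unfold cexp; simpl. rewrite exp_ln, Ec, Es, Ea, Rabs_right by lra. f_equal; field; lra.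
  - exists (- acos (u / m)). unfold cexp; simpl. rewrite exp_ln, cos_neg, sin_neg, Ec, Es, Ea, Rabs_left by lra. f_equal; field; lra.
Qed.

Lemma disc_identity F z0 Rad del : (forall z, Cmod (z - z0)%C < Rad -> exists l, Cd F z l) -> 0 < del ->
  (forall z, Cmod (z - z0)%C < del -> F z = RtoC 0) ->
  forall z, Cmod (z - z0)%C < Rad -> F z = RtoC 0.
Proof.
  intros HF Hd H0 z Hz. destruct (excluded_middle_informative ((z - z0)%C = RtoC 0)) as [E|Hne].
  - apply H0. rewrite E, Cmod_0; auto.
  - destruct (polar_form _ Hne) as (x & y & E). rewrite E, Cmod_cexp in Hz. simpl in Hz.
    replace z with (z0 + 1 * cexp (x, y))%C by (rewrite <- E; ring).
    apply (circle_zero F z0 Rad del); auto.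
Qed.

Lemma Cmod_pair x y : Cmod (x, y) = sqrt (x ^ 2 + y ^ 2).
Proof. reflexivity. Qed.

(* Two discs, centred at [2 + iT] and [s + iT], lead from the half plane to the point [s] around [1]. *)
Theorem identity_punctured F : (forall z, z <> RtoC 1 -> exists l, Cd F z l) ->
  (forall z : C, 1 < Re z -> F z = RtoC 0) -> forall s : R, s < 1 -> F (RtoC s) = RtoC 0.
Proof.
  (* With this height the centres are at distance [T]. The first disc has radius
     [sqrt (1 + T^2) > T], so it contains a neighbourhood of the second centre; the second disc
     reaches from [s + iT] to [s] and omits 1 because [s < 1]. *)
  intros HF HZ s Hs. set (T := 2 - s).
  assert (HT : 1 < T) by (unfold T; lra).
  set (p := (2, T) : C). set (q := (s, T) : C).
  assert (D : forall r z : C, Cmod (z - r)%C < Cmod (RtoC 1 - r)%C -> exists l, Cd F z l).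
  { intros r z Hz. apply HF. intros ->. lra. }
  assert (Z1 : forall z, Cmod (z - p)%C < Cmod (RtoC 1 - p)%C -> F z = RtoC 0).
  { apply (disc_identity F p _ 1); [apply D|lra|]. intros z Hz. apply HZ.
    assert (A := Cmod_fst (z - p)%C). simpl in A. apply Rabs_le_between in A. unfold Re; lra. }
  assert (R1 : T < Cmod (RtoC 1 - p)%C).
  { replace (RtoC 1 - p)%C with ((-1)%R, (- T)%R) by (unfold p, RtoC, Cminus, Cplus, Copp; simpl; f_equal; ring).
    rewrite Cmod_pair. rewrite <- (sqrt_pow2 T) at 1 by lra. apply sqrt_lt_1; nra. }
  assert (Z2 : forall z, Cmod (z - q)%C < Cmod (RtoC 1 - p)%C - T -> F z = RtoC 0).
  { intros z Hz. apply Z1. replace (z - p)%C with ((z - q) + ((- T)%R, 0%R))%C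
      by (unfold p, q, T, RtoC, Cminus, Cplus, Copp; simpl; f_equal; ring).
    eapply Rle_lt_trans; [apply Cmod_triangle|]. assert (B := Cmod_le_sum (- T) 0).
    rewrite Rabs_R0, Rabs_Ropp, Rabs_right in B by lra. lra. }
  apply (disc_identity F q (Cmod (RtoC 1 - q)%C) (Cmod (RtoC 1 - p)%C - T)); [apply D|lra|auto|].
  replace (RtoC s - q)%C with (0%R, (- T)%R) by (unfold q, RtoC, Cminus, Cplus, Copp; simpl; f_equal; ring).
  replace (RtoC 1 - q)%C with ((1 - s)%R, (- T)%R) by (unfold q, RtoC, Cminus, Cplus, Copp; simpl; f_equal; ring).
  rewrite !Cmod_pair. apply sqrt_lt_1; nra.
Qed.

(** * The entire function [Xi] *)

Lemma sum_n_C (a : nat -> C) n : sum_n (G := C_AbelianMonoid) a n = (sum_n (fun k => fst (a k)) n, sum_n (fun k => snd (a k)) n).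
Proof.
  induction n.
  - rewrite !sum_O. apply surjective_pairing.
  - rewrite !sum_Sn, IHn. reflexivity.
Qed.
Lemma is_series_C (a : nat -> C) (l : C) : @is_series C_AbsRing C_NormedModule a l <->
  is_series (fun k => fst (a k)) (fst l) /\ is_series (fun k => snd (a k)) (snd l).
Proof.
  split.
  - intros H; split; intros P [eps HP].
    + destruct (H (fun w : C => P (fst w))) as [N HN].
      { exists eps. intros y [Hy _]. apply HP. exact Hy. }
      exists N; intros n Hn. specialize (HN n Hn).
      change (P (fst (sum_n (G := C_AbelianMonoid) a n))) in HN. rewrite sum_n_C in HN. exact HN.
    + destruct (H (fun w : C => P (snd w))) as [N HN].
      { exists eps. intros y [_ Hy]. apply HP. exact Hy. }
      exists N; intros n Hn. specialize (HN n Hn).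
      change (P (snd (sum_n (G := C_AbelianMonoid) a n))) in HN. rewrite sum_n_C in HN. exact HN.
  - intros [H1 H2] P [eps HP].
    destruct (H1 (ball (fst l) eps)) as [N1 HN1]; [exists eps; auto|].
    destruct (H2 (ball (snd l) eps)) as [N2 HN2]; [exists eps; auto|].
    exists (max N1 N2); intros n Hn. apply HP.
    change (ball (l : C_UniformSpace) eps (sum_n (G := C_AbelianMonoid) a n)). rewrite sum_n_C.
    split; [apply HN1; lia|apply HN2; lia].
Qed.

Definition CSer (a : nat -> C) : C := (Series (fun k => fst (a k)), Series (fun k => snd (a k))).

Lemma CSer_abs (a : nat -> C) (M : nat -> R) : (forall k, Cmod (a k) <= M k) -> ex_series M ->
  ex_series (fun k => fst (a k)) /\ ex_series (fun k => snd (a k)).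
Proof.
  intros H HM; split; apply (ex_series_Rle _ M); auto; intros k.
  - eapply Rle_trans; [apply Cmod_fst|auto].
  - eapply Rle_trans; [apply Cmod_snd|auto].
Qed.
Lemma CSer_Cmod (a : nat -> C) (M : nat -> R) : (forall k, Cmod (a k) <= M k) -> ex_series M ->
  Cmod (CSer a) <= 2 * Series M.
Proof.
  intros H HM. eapply Rle_trans; [apply Cmod_le_sum|].
  assert (Rabs (Series (fun k => fst (a k))) <= Series M).
  { apply Series_Rabs_le; auto. intros k. eapply Rle_trans; [apply Cmod_fst|auto]. }
  assert (Rabs (Series (fun k => snd (a k))) <= Series M).
  { apply Series_Rabs_le; auto. intros k. eapply Rle_trans; [apply Cmod_snd|auto]. }
  lra.
Qed.

(** A bound for the values, one for the candidate derivative [g] and one for the second-order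
    remainder, with a single constant on the disc of radius [r]. These bounds are additive, so sums
    over [k] and then over [n] with summable constants stay differentiable, and no theorem on limits
    of holomorphic functions is called for. *)
Definition Quad (r M : R) (f g : C -> C) := 0 <= M /\ forall z, Cmod z <= r ->
  Cmod (f z) <= M /\ Cmod (g z) <= M /\ forall h, Cmod h <= 1 -> Cmod (f (z + h) - f z - h * g z)%C <= M * Cmod h ^ 2.

Lemma Quad_shift r M f g z h : Quad r M f g -> Cmod z <= r -> Cmod h <= 1 -> Cmod (f (z + h))%C <= 3 * M.
Proof.
  intros [HM H] Hz Hh. destruct (H z Hz) as (B1 & B2 & B3). specialize (B3 h Hh).
  replace (f (z + h))%C with ((f (z + h) - f z - h * g z) + (f z + h * g z))%C by ring.
  eapply Rle_trans; [apply Cmod_triangle|].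
  assert (B4 := Cmod_triangle (f z) (h * g z)%C). rewrite Cmod_mult in B4.
  generalize (Cmod_ge_0 h) (Cmod_ge_0 (g z)); intros.
  assert (Cmod h ^ 2 <= 1) by nra. assert (Cmod h * Cmod (g z) <= M) by nra. nra.
Qed.

Lemma Quad_series r (M : nat -> R) (f g : nat -> C -> C) : (forall k, Quad r (M k) (f k) (g k)) -> ex_series M ->
  Quad r (2 * Series M) (fun z => CSer (fun k => f k z)) (fun z => CSer (fun k => g k z)).
Proof.
  intros HQ HM.
  assert (M0 : 0 <= 2 * Series M).
  { assert (0 <= Series M); [|lra]. transitivity (Series (fun _ => 0 * 0)); [rewrite Series_scal_l; lra|].
    apply Series_le; auto. intros k; destruct (HQ k) as [Hk _]. lra. }
  split; auto. intros z Hz.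
  assert (F1 : forall k, Cmod (f k z) <= M k) by (intros k; apply HQ; auto).
  assert (F2 : forall k, Cmod (g k z) <= M k) by (intros k; apply HQ; auto).
  split; [apply CSer_Cmod; auto|]. split; [apply CSer_Cmod; auto|]. intros h Hh.
  assert (F3 : forall k, Cmod (f k (z + h)%C) <= 3 * M k) by (intros k; eapply Quad_shift; eauto).
  assert (E3 : ex_series (fun k => 3 * M k)) by (apply ex_series_scalR; auto).
  destruct (CSer_abs _ _ F1 HM) as [A1 A2]. destruct (CSer_abs _ _ F2 HM) as [B1 B2]. destruct (CSer_abs _ _ F3 E3) as [C1 C2].
  replace (CSer (fun k => f k (z + h)%C) - CSer (fun k => f k z) - h * CSer (fun k => g k z))%C
    with (CSer (fun k => f k (z + h) - f k z - h * g k z)%C).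
  - replace (2 * Series M * Cmod h ^ 2) with (2 * Series (fun k => Cmod h ^ 2 * M k)) by (rewrite Series_scal_l; ring).
    apply CSer_Cmod.
    + intros k. rewrite Rmult_comm. apply HQ; auto.
    + apply ex_series_scalR; auto.
  - destruct h as [u v]. unfold CSer, Cminus, Cplus, Copp, Cmult; simpl. f_equal.
    + rewrite <- !Series_scal_l, <- Series_minus by (apply ex_series_scalR; auto).
      rewrite <- !Series_opp, <- !Series_plus; auto.
      * apply ex_series_plusR; auto. apply (ex_series_opp (fun k => fst (f k z))); auto.
      * apply (ex_series_opp (fun k => u * fst (g k z) - v * snd (g k z))).
        apply ex_series_minusR; apply ex_series_scalR; auto.
      * apply (ex_series_opp (fun k => fst (f k z))); auto.
    + rewrite <- !Series_scal_l, <- Series_plus by (apply ex_series_scalR; auto).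
      rewrite <- !Series_opp, <- !Series_plus; auto.
      * apply ex_series_plusR; auto. apply (ex_series_opp (fun k => snd (f k z))); auto.
      * apply (ex_series_opp (fun k => u * snd (g k z) + v * fst (g k z))).
        apply ex_series_plusR; apply ex_series_scalR; auto.
      * apply (ex_series_opp (fun k => snd (f k z))); auto.
Qed.

Definition Ee (a : R) (z : C) : C := cexp (RtoC a * z)%C.
Lemma cpow_Ee l z : cpow_neg l z = Ee (- ln l) z.
Proof.
  unfold cpow_neg, Ee, cexp, Re, Im. destruct z as [x y]. simpl.
  replace (- ln l * x - 0 * y) with (- x * ln l) by ring.
  replace (- ln l * y + 0 * x) with (- y * ln l) by ring. auto.
Qed.
Lemma Ee_plus a z h : Ee a (z + h)%C = (Ee a z * Ee a h)%C.
Proof. unfold Ee. rewrite <- cexp_plus. f_equal. ring. Qed.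
Lemma Ee_split a a' z : Ee a z = (Ee a' z * cexp (RtoC (a - a') * z))%C.
Proof. unfold Ee. rewrite <- cexp_plus. f_equal. rewrite RtoC_minus. ring. Qed.

Section EeBounds.
Variables (a a' L p : R) (r : nat).
Hypothesis Ha : Rabs a <= L.
Hypothesis Ha' : Rabs a' <= L.
Hypothesis Hp : 0 <= p.
Let d := Rabs (a - a').
Let X := exp L.

Let L0 : 0 <= L. Proof. eapply Rle_trans; [apply Rabs_pos|apply Ha]. Qed.
Let d0 : 0 <= d. Proof. apply Rabs_pos. Qed.
Let dL : d <= 2 * L.
Proof. unfold d. eapply Rle_trans; [apply Rabs_triang|]. rewrite Rabs_Ropp. lra. Qed.
Let X1 : 1 <= X. Proof. unfold X; rewrite <- exp_0; apply exp_le_mono; auto. Qed.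
Let LX : L <= X. Proof. unfold X. generalize (exp_ineq1_le L); lra. Qed.

Lemma exp_pow_INR y n : exp (y * INR n) = exp y ^ n.
Proof.
  induction n; [simpl; rewrite Rmult_0_r, exp_0; auto|].
  rewrite S_INR, Rmult_plus_distr_l, Rmult_1_r, exp_plus, IHn. simpl; ring.
Qed.
Lemma cexp_scal_bound c m n w : Rabs c <= INR m * L -> Cmod w <= INR n -> exp (Cmod (RtoC c * w)%C) <= X ^ (m * n).
Proof.
  intros Hc Hw. rewrite Cmod_mult, Cmod_R. unfold X. rewrite <- exp_pow_INR, mult_INR. apply exp_le_mono.
  generalize (Rabs_pos c) (Cmod_ge_0 w) (pos_INR m) (pos_INR n); intros.
  apply Rle_trans with (INR m * L * INR n); [apply Rmult_le_compat; auto|]. lra.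
Qed.
Lemma Ee_bound c n w : Rabs c <= L -> Cmod w <= INR n -> Cmod (Ee c w) <= X ^ n.
Proof.
  intros Hc Hw. unfold Ee. rewrite Cmod_cexp.
  apply Rle_trans with (exp (Cmod (RtoC c * w)%C)).
  - apply exp_le_mono. eapply Rle_trans; [apply RRle_abs|apply Cmod_fst].
  - rewrite <- (Nat.mul_1_l n). apply cexp_scal_bound; simpl; lra.
Qed.
Lemma Ee_diff n w : Cmod w <= INR n -> Cmod (Ee a w - Ee a' w)%C <= 3 * d * INR n * X ^ (3 * n).
Proof.
  intros Hw. rewrite (Ee_split a a').
  replace (Ee a' w * cexp (RtoC (a - a') * w) - Ee a' w)%C with (Ee a' w * (cexp (RtoC (a - a') * w) - 1))%C by ring.
  rewrite Cmod_mult. assert (B1 := Ee_bound a' n w Ha' Hw). assert (B2 := cexp_bound1 (RtoC (a - a') * w)%C).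
  assert (B3 := cexp_scal_bound (a - a') 2 n w ltac:(simpl; fold d; lra) Hw).
  rewrite Cmod_mult, Cmod_R in B2. rewrite Cmod_mult, Cmod_R in B3. fold d in B2, B3.
  replace (3 * n)%nat with (n + 2 * n)%nat by lia. rewrite pow_add.
  replace (3 * d * INR n * (X ^ n * X ^ (2 * n))) with (X ^ n * (3 * (d * INR n) * X ^ (2 * n))) by ring.
  generalize (Cmod_ge_0 w); intros.
  apply Rmult_le_compat; try apply Cmod_ge_0; auto. eapply Rle_trans; [apply B2|].
  apply Rmult_le_compat; try (apply Rlt_le, exp_pos); auto; [nra|]. apply Rmult_le_compat_l; [lra|]. apply Rmult_le_compat_l; auto.
Qed.
Lemma Xpow m n : (m <= n)%nat -> X ^ m <= X ^ n.
Proof. intros; apply Rle_pow; auto. Qed.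

Definition fE z := (RtoC p * (Ee a z - Ee a' z))%C.
Definition gE z := (RtoC p * (RtoC a * Ee a z - RtoC a' * Ee a' z))%C.

(** Every bound keeps the factor [d], the distance of the exponents. For [a = - ln lam_k] and
    [a' = - ln n] it is controlled by [lam_k^2 - n^2], which the overlaps can pay for; the powers of
    [X = e^L] become powers of [lam_k] and [n]. *)
Lemma Quad_E : Quad (INR r) (p * d * (12 * INR r + 12) * X ^ (3 * r + 4)) fE gE.
Proof.
  assert (XP : forall n, 0 < X ^ n) by (intros; apply pow_lt; lra).
  assert (Rn := pos_INR r).
  split.
  { generalize (XP (3 * r + 4)%nat); intros. repeat apply Rmult_le_pos; lra. }
  intros z Hz.
  assert (D := Ee_diff r z Hz). assert (Bz' := Ee_bound a' r z Ha' Hz). assert (Bz := Ee_bound a r z Ha Hz).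
  assert (Y1 : X ^ (3 * r) <= X ^ (3 * r + 4)) by (apply Xpow; lia).
  assert (Y2 : X ^ r <= X ^ (3 * r + 4)) by (apply Xpow; lia).
  assert (Y3 : X ^ (3 * r + 4) = X ^ (3 * r) * (X * X * X * X)) by (rewrite pow_add; simpl; ring).
  assert (XX : 1 <= X * X) by nra. assert (XXX : X <= X * X * X) by nra. assert (XXXX : X * X <= X * X * X * X) by nra.
  assert (Z3 := XP (3 * r)%nat). assert (Z4 := XP (3 * r + 4)%nat).
  set (W := X ^ (3 * r)) in *. set (V := X ^ (3 * r + 4)) in *.
  unfold fE, gE. split; [|split].
  - rewrite Cmod_mult, Cmod_R, Rabs_right by lra. rewrite !(Rmult_assoc p). apply Rmult_le_compat_l; auto.
    eapply Rle_trans; [apply D|].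
    apply Rle_trans with (3 * d * INR r * V); [apply Rmult_le_compat_l; auto; nra|].
    replace (d * ((12 * INR r + 12) * V)) with (3 * d * INR r * V + (9 * INR r + 12) * (d * V)) by ring.
    assert (0 <= d * V) by nra. nra.
  - rewrite Cmod_mult, Cmod_R, Rabs_right by lra. rewrite !(Rmult_assoc p). apply Rmult_le_compat_l; auto.
    replace (RtoC a * Ee a z - RtoC a' * Ee a' z)%C with (RtoC (a - a') * Ee a z + RtoC a' * (Ee a z - Ee a' z))%C
      by (rewrite RtoC_minus; ring).
    eapply Rle_trans; [apply Cmod_triangle|]. rewrite !Cmod_mult, !Cmod_R. fold d.
    assert (d * Cmod (Ee a z) <= d * V) by (apply Rmult_le_compat_l; auto; lra).
    assert (Rabs a' * Cmod (Ee a z - Ee a' z)%C <= X * (3 * d * INR r * W)).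
    { apply Rmult_le_compat; auto; try apply Rabs_pos; try apply Cmod_ge_0. lra. }
    assert (X * W <= V) by (rewrite Y3; assert (X <= X * X * X * X) by nra; nra).
    assert (3 * d * INR r * (X * W) <= 3 * d * INR r * V) by (apply Rmult_le_compat_l; auto; repeat apply Rmult_le_pos; lra).
    replace (d * ((12 * INR r + 12) * V)) with (d * V + 3 * d * INR r * V + (9 * INR r + 11) * (d * V)) by ring.
    assert (0 <= d * V) by nra. assert (0 <= (9 * INR r + 11) * (d * V)) by nra. nra.
  - intros h Hh.
    assert (Hh1 : Cmod h <= INR 1) by (simpl; auto).
    set (U := Ee a z). set (U' := Ee a' z).
    set (v := (cexp (RtoC a * h) - 1 - RtoC a * h)%C). set (v' := (cexp (RtoC a' * h) - 1 - RtoC a' * h)%C).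
    (* The remainder is a difference of two products. It is split so that each part contains a
       difference, either of the exponentials or of their remainders, and hence a factor [d]. *)
    replace (RtoC p * (Ee a (z + h) - Ee a' (z + h)) - RtoC p * (U - U') - h * (RtoC p * (RtoC a * U - RtoC a' * U')))%C
      with (RtoC p * ((U - U') * v + U' * (v - v')))%C.
    2: { rewrite !Ee_plus. unfold v, v', U, U', Ee. ring. }
    rewrite Cmod_mult, Cmod_R, Rabs_right by lra. rewrite !(Rmult_assoc p). apply Rmult_le_compat_l; auto.
    eapply Rle_trans; [apply Cmod_triangle|]. rewrite !Cmod_mult. fold U U' in D, Bz'.
    set (m := Cmod h) in *. assert (m0 : 0 <= m) by apply Cmod_ge_0.
    assert (Bv : Cmod v <= 4 * m ^ 2 * (X * X * X)).
    { eapply Rle_trans; [apply cexp_bound2|].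
      assert (Q := cexp_scal_bound a 1 1 h ltac:(simpl; lra) Hh1). simpl in Q. rewrite Rmult_1_r in Q.
      rewrite Cmod_mult, Cmod_R in *. fold m in Q |- *. rewrite Rpow_mult_distr.
      assert (Rabs a ^ 2 <= X * X) by (replace (X * X) with (X ^ 2) by ring; apply pow_incr; split; [apply Rabs_pos|lra]).
      replace (4 * m ^ 2 * (X * X * X)) with (4 * ((X * X) * m ^ 2) * X) by ring.
      apply Rmult_le_compat; auto; try (apply Rlt_le, exp_pos).
      - generalize (pow2_ge_0 (Rabs a)) (pow2_ge_0 m); nra.
      - generalize (pow2_ge_0 m); nra. }
    assert (Bvv : Cmod (v - v')%C <= 11 * d * m ^ 2 * (X * X * X * X)).
    { replace (v - v')%C with (cexp (RtoC a' * h) * (cexp (RtoC (a - a') * h) - 1 - RtoC (a - a') * h) + RtoC (a - a') * h * (cexp (RtoC a' * h) - 1))%C.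
      2: { unfold v, v'. replace (RtoC a * h)%C with (RtoC a' * h + RtoC (a - a') * h)%C by (rewrite RtoC_minus; ring).
           rewrite cexp_plus. ring. }
      eapply Rle_trans; [apply Cmod_triangle|]. rewrite !Cmod_mult, Cmod_R. fold d m.
      assert (Q1 := Ee_bound a' 1 h Ha' Hh1). unfold Ee in Q1. simpl in Q1. rewrite Rmult_1_r in Q1.
      assert (Q2 := cexp_bound2 (RtoC (a - a') * h)%C). rewrite Cmod_mult, Cmod_R in Q2. fold d m in Q2.
      assert (Q3 := cexp_scal_bound (a - a') 2 1 h ltac:(simpl; fold d; lra) Hh1). rewrite Cmod_mult, Cmod_R in Q3. fold d m in Q3.
      simpl in Q3. rewrite Rmult_1_r in Q3.
      assert (Q4 := cexp_bound1 (RtoC a' * h)%C). rewrite Cmod_mult, Cmod_R in Q4. fold m in Q4.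
      assert (Q5 := cexp_scal_bound a' 1 1 h ltac:(simpl; lra) Hh1). rewrite Cmod_mult, Cmod_R in Q5. fold m in Q5. simpl in Q5. rewrite Rmult_1_r in Q5.
      assert (m2 := pow2_ge_0 m).
      assert (T1 : Cmod (cexp (RtoC (a - a') * h) - 1 - RtoC (a - a') * h)%C <= 8 * d * m ^ 2 * (X * X * X)).
      { eapply Rle_trans; [apply Q2|]. rewrite Rpow_mult_distr.
        replace (8 * d * m ^ 2 * (X * X * X)) with (4 * (d * (2 * X) * m ^ 2) * (X * X)) by ring.
        apply Rmult_le_compat; auto; try (apply Rlt_le, exp_pos); [generalize (pow2_ge_0 d); nra|].
        apply Rmult_le_compat_l; [lra|]. apply Rmult_le_compat_r; auto. replace (d ^ 2) with (d * d) by ring. apply Rmult_le_compat_l; lra. }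
      assert (T2 : Cmod (cexp (RtoC a' * h) - 1)%C <= 3 * (X * m) * X).
      { eapply Rle_trans; [apply Q4|]. apply Rmult_le_compat; auto; try (apply Rlt_le, exp_pos).
        - generalize (Rabs_pos a'); nra.
        - apply Rmult_le_compat_l; [lra|]. apply Rmult_le_compat_r; lra. }
      assert (T3 : Cmod (cexp (RtoC a' * h)) * Cmod (cexp (RtoC (a - a') * h) - 1 - RtoC (a - a') * h)%C <= X * (8 * d * m ^ 2 * (X * X * X))).
      { apply Rmult_le_compat; auto; apply Cmod_ge_0. }
      assert (T4 : d * m * Cmod (cexp (RtoC a' * h) - 1)%C <= d * m * (3 * (X * m) * X)).
      { apply Rmult_le_compat_l; auto. nra. }
      replace (11 * d * m ^ 2 * (X * X * X * X)) with (X * (8 * d * m ^ 2 * (X * X * X)) + 3 * (d * m ^ 2) * (X * X * X * X)) by ring.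
      assert (3 * (d * m ^ 2) * (X * X) <= 3 * (d * m ^ 2) * (X * X * X * X)) by (apply Rmult_le_compat_l; auto; nra).
      replace (d * m * (3 * (X * m) * X)) with (3 * (d * m ^ 2) * (X * X)) in T4 by ring. lra. }
    assert (m2 := pow2_ge_0 m).
    assert (G1 : Cmod (U - U')%C * Cmod v <= (3 * d * INR r * W) * (4 * m ^ 2 * (X * X * X))).
    { apply Rmult_le_compat; auto; apply Cmod_ge_0. }
    assert (G2 : Cmod U' * Cmod (v - v')%C <= X ^ r * (11 * d * m ^ 2 * (X * X * X * X))).
    { apply Rmult_le_compat; auto; apply Cmod_ge_0. }
    assert (G3 : X ^ r <= W) by (apply Xpow; lia).
    assert (dm : 0 <= d * m ^ 2) by (apply Rmult_le_pos; auto).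
    assert (X4 : 0 <= X * X * X * X) by nra.
    assert (X34 : X * X * X <= X * X * X * X) by nra.
    assert (G4 : X ^ r * (11 * d * m ^ 2 * (X * X * X * X)) <= W * (11 * d * m ^ 2 * (X * X * X * X))).
    { apply Rmult_le_compat_r; auto. replace (11 * d * m ^ 2 * (X * X * X * X)) with (11 * ((d * m ^ 2) * (X * X * X * X))) by ring.
      assert (0 <= d * m ^ 2 * (X * X * X * X)) by (apply Rmult_le_pos; auto). lra. }
    assert (G5 : (3 * d * INR r * W) * (4 * m ^ 2 * (X * X * X)) <= (3 * d * INR r * W) * (4 * m ^ 2 * (X * X * X * X))).
    { apply Rmult_le_compat_l; [repeat apply Rmult_le_pos; lra|]. apply Rmult_le_compat_l; lra. }
    rewrite Y3.
    replace (d * ((12 * INR r + 12) * (W * (X * X * X * X))) * m ^ 2) with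
      ((3 * d * INR r * W) * (4 * m ^ 2 * (X * X * X * X)) + W * (11 * d * m ^ 2 * (X * X * X * X)) + (d * m ^ 2) * (W * (X * X * X * X))) by ring.
    assert (0 <= (d * m ^ 2) * (W * (X * X * X * X))) by (apply Rmult_le_pos; auto; apply Rmult_le_pos; lra).
    lra.
Qed.
End EeBounds.

Definition xi b lam phi n (z : C) : C :=
  CSer (fun k => fE (- ln (lam (S k))) (- ln (INR (S n))) (Pm b phi (S n) (S k)) z).
Definition Xi b lam phi (z : C) : C := CSer (fun n => xi b lam phi n z).
Definition tau b q n : R :=
  ip (Aiter b q (pc b (S n))) (pc b (S n)) +
  ip (Aiter b q (ps b (S n))) (ps b (S n)) - 2 * INR (S n) ^ q.

Lemma Quad_mono r M M' f g : Quad r M f g -> M <= M' -> Quad r M' f g.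
Proof.
  intros [H0 H] HM; split; [lra|]. intros z Hz. destruct (H z Hz) as (B1 & B2 & B3).
  split; [lra|split; [lra|]]. intros h Hh. eapply Rle_trans; [apply B3; auto|].
  apply Rmult_le_compat_r; auto. apply pow2_ge_0.
Qed.

Lemma ln_diff_le x y c : 0 < x -> 0 < y -> / x <= c -> / y <= c -> Rabs (ln x - ln y) <= Rabs (x - y) * c.
Proof.
  assert (H : forall u v, 0 < u -> 0 < v -> / v <= c -> ln u - ln v <= Rabs (u - v) * c).
  { intros u v Hu Hv Hc.
    assert (E : ln u - ln v = ln (u / v)).
    { unfold Rdiv. rewrite ln_mult, ln_Rinv by (auto; apply Rinv_0_lt_compat; auto). ring. }
    assert (B : ln (u / v) <= u / v - 1).
    { assert (P : 0 < u / v) by (apply Rdiv_lt_0_compat; auto).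
      generalize (exp_ineq1_le (ln (u / v))). rewrite exp_ln by auto. lra. }
    assert (E2 : u / v - 1 = (u - v) * / v) by (field; lra).
    assert (0 < / v) by (apply Rinv_0_lt_compat; auto).
    assert ((u - v) * / v <= Rabs (u - v) * c).
    { apply Rle_trans with (Rabs (u - v) * / v).
      - apply Rmult_le_compat_r; [lra|apply RRle_abs].
      - apply Rmult_le_compat_l; [apply Rabs_pos|auto]. }
    lra. }
  intros Hx Hy Hcx Hcy. apply Rabs_le; split.
  - assert (B := H y x Hy Hx Hcx). rewrite Rabs_minus_sym in B. lra.
  - apply H; auto.
Qed.

Lemma Ee_nat x q : 0 < x -> Ee (- ln x) (RtoC (- INR q)) = RtoC (x ^ q).
Proof.
  intros Hx. unfold Ee, cexp, Cmult, RtoC; simpl.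
  replace (- ln x * - INR q - 0 * 0) with (ln x * INR q) by ring.
  replace (- ln x * 0 + 0 * - INR q) with 0 by ring.
  rewrite exp_pow_INR, exp_ln, cos_0, sin_0 by auto. f_equal; ring.
Qed.
Lemma Cmod_Ee l z : Cmod (Ee (- ln l) z) = exp (- Re z * ln l).
Proof.
  unfold Ee. rewrite Cmod_cexp. f_equal. destruct z; unfold Re; simpl. ring.
Qed.

Section Tannery.
Variables (x : nat -> R) (Q : nat -> nat -> R).
Hypothesis Hx : ex_series (fun k => Rabs (x k)).
Hypothesis HQ : forall n k, 0 <= Q n k.
Hypothesis HQs : forall k, is_series (fun n => Q n k) 1.

Let SN N k : R := sum_n (fun n => Q n k) N.

Lemma tannery_SN N k : 0 <= SN N k <= 1.
Proof.
  assert (E := is_series_unique _ _ (HQs k)).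
  assert (H := Series_minus_sum_n (fun n => Q n k) N ltac:(exists 1; apply HQs)). rewrite E in H.
  assert (0 <= Series (fun n => Q (S N + n)%nat k)).
  { transitivity (Series (fun _ => 0 * 0)); [rewrite Series_scal_l; lra|]. apply Series_le.
    - intros; rewrite Rmult_0_l; split; [lra|auto].
    - apply (ex_series_incr_n (fun n => Q n k) (S N)). exists 1; apply HQs. }
  unfold SN. split; [|lra]. rewrite sum_n_Reals. apply cond_pos_sum; auto.
Qed.
Lemma tannery_term n : ex_series (fun k => x k * Q n k).
Proof.
  apply (ex_series_Rle _ (fun k => Rabs (x k))); auto. intros k. rewrite Rabs_mult, (Rabs_right (Q n k)) by (apply Rle_ge; auto).
  assert (Q n k <= 1) by apply (is_series_nonneg_term (fun n => Q n k) 1 n (fun n => HQ n k) (HQs k)).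
  generalize (Rabs_pos (x k)) (HQ n k); nra.
Qed.
Lemma tannery_partial N : ex_series (fun k => x k * SN N k) /\
  sum_n (fun n => Series (fun k => x k * Q n k)) N = Series (fun k => x k * SN N k).
Proof.
  induction N.
  - split.
    + eapply ex_series_ext; [|apply (tannery_term 0)]. intros k. unfold SN; rewrite sum_O; auto.
    + rewrite sum_O. apply Series_ext; intros k. unfold SN; rewrite sum_O; auto.
  - destruct IHN as [E1 E2].
    assert (E : forall k, x k * SN (S N) k = x k * SN N k + x k * Q (S N) k).
    { intros k. unfold SN. rewrite sum_Sn. unfold plus; simpl. ring. }
    split.
    + eapply ex_series_ext; [intros k; symmetry; apply E|]. apply ex_series_plusR; auto. apply tannery_term.
    + rewrite sum_Sn, E2. unfold plus; simpl. rewrite <- Series_plus; auto; [|apply tannery_term].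
      apply Series_ext; intros k; rewrite E; auto.
Qed.
(** The partial sums over [n] multiply [x_k] by numbers in [0, 1] that tend to one for each [k].
    Finitely many [k] are settled by this convergence, the others by the tail of the absolutely
    convergent series of [x]. *)
Lemma tannery : is_series (fun n => Series (fun k => x k * Q n k)) (Series x).
Proof.
  assert (Hx' : ex_series x) by (apply ex_series_Rabs; auto).
  intros P [[eps He] HP].
  destruct (series_tail _ Hx (eps / 2)) as [K HK]; [lra|]. specialize (HK K (Nat.le_refl _)).
  assert (L : is_lim_seq (fun N => sum_n (fun k => Rabs (x k) * (1 - SN N k)) K) 0).
  { clear HK. induction K.
    - apply (is_lim_seq_ext (fun N => Rabs (x 0%nat) * (1 - SN N 0%nat))); [intros N; rewrite sum_O; auto|].
      replace (Finite 0) with (Rbar_mult (Rabs (x 0%nat)) 0) by (simpl; f_equal; ring).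
      apply is_lim_seq_scal_l. replace (Finite 0) with (Finite (1 - 1)) by (f_equal; ring).
      apply is_lim_seq_minus'; [apply is_lim_seq_const|]. apply (HQs 0%nat).
    - apply (is_lim_seq_ext (fun N => sum_n (fun k => Rabs (x k) * (1 - SN N k)) K + Rabs (x (S K)) * (1 - SN N (S K)))); [intros N; rewrite sum_Sn; auto|].
      replace (Finite 0) with (Finite (0 + 0)) by (f_equal; ring).
      apply is_lim_seq_plus'; auto.
      replace (Finite 0) with (Rbar_mult (Rabs (x (S K))) 0) by (simpl; f_equal; ring).
      apply is_lim_seq_scal_l. replace (Finite 0) with (Finite (1 - 1)) by (f_equal; ring).
      apply is_lim_seq_minus'; [apply is_lim_seq_const|]. apply (HQs (S K)). }
  apply is_lim_seq_spec in L. destruct (L (mkposreal (eps / 2) ltac:(lra))) as [N HN]. simpl in HN.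
  exists N; intros n Hn. apply HP.
  change (Rabs (sum_n (fun n => Series (fun k => x k * Q n k)) n - Series x) < eps).
  destruct (tannery_partial n) as [E1 E2]. rewrite E2, Rabs_minus_sym, <- Series_minus by auto.
  assert (B : forall k, Rabs (x k - x k * SN n k) = Rabs (x k) * (1 - SN n k)).
  { intros k. replace (x k - x k * SN n k) with (x k * (1 - SN n k)) by ring. rewrite Rabs_mult, (Rabs_right (1 - _)); auto.
    destruct (tannery_SN n k); lra. }
  assert (EX : ex_series (fun k => Rabs (x k) * (1 - SN n k))).
  { apply (ex_series_Rle _ (fun k => Rabs (x k))); auto. intros k. destruct (tannery_SN n k).
    rewrite Rabs_right; generalize (Rabs_pos (x k)); intros; nra. }
  eapply Rle_lt_trans; [apply (Series_Rabs_le _ (fun k => Rabs (x k) * (1 - SN n k))); auto; intros; rewrite B; lra|].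
  assert (S1 := Series_minus_sum_n _ K EX). assert (S2 := Series_minus_sum_n _ K Hx).
  assert (S3 : Series (fun k => Rabs (x (S K + k)%nat) * (1 - SN n (S K + k)%nat)) <= Series (fun k => Rabs (x (S K + k)%nat))).
  { apply Series_le.
    - intros k. destruct (tannery_SN n (S K + k)). generalize (Rabs_pos (x (S K + k)%nat)); intros; split; nra.
    - apply (ex_series_incr_n (fun k => Rabs (x k)) (S K)); auto. }
  specialize (HN n Hn). rewrite Rminus_0_r in HN. apply Rabs_def2 in HN. apply Rabs_def2 in HK. lra.
Qed.
End Tannery.

(** Convexity of the power with a second-order term. Multiplying the inequality for [p] by [u] gives
    the next one, with the surplus [v^p (u - v)^2 ((p + 1) v + u)]. *)
Lemma pow_tangent u v p : 0 <= u -> 0 <= v ->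
  v ^ (p + 2) + INR (p + 2) * v ^ (p + 1) * (u - v) + v ^ p * (u - v) ^ 2 <= u ^ (p + 2).
Proof.
  intros Hu Hv; induction p; [simpl; right; ring|].
  assert (Vp : 0 <= v ^ p) by (apply pow_le; auto).
  apply Rle_trans with (u * (v ^ (p + 2) + INR (p + 2) * v ^ (p + 1) * (u - v) + v ^ p * (u - v) ^ 2)).
  2: { replace (S p + 2)%nat with (S (p + 2)) by lia. rewrite <- (tech_pow_Rmult u). apply Rmult_le_compat_l; auto. }
  assert (E : u * (v ^ (p + 2) + INR (p + 2) * v ^ (p + 1) * (u - v) + v ^ p * (u - v) ^ 2) -
    (v ^ (S p + 2) + INR (S p + 2) * v ^ (S p + 1) * (u - v) + v ^ S p * (u - v) ^ 2) = v ^ p * (u - v) ^ 2 * ((INR (p + 2) - 1) * v + u)).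
  { replace (S p + 2)%nat with (S (p + 2)) by lia. replace (S p + 1)%nat with (S (p + 1)) by lia.
    rewrite S_INR, <- !tech_pow_Rmult. rewrite !pow_add. simpl. ring. }
  assert (0 <= v ^ p * (u - v) ^ 2 * ((INR (p + 2) - 1) * v + u)); [|lra].
  apply Rmult_le_pos; [apply Rmult_le_pos; auto; apply pow2_ge_0|].
  rewrite plus_INR. simpl. generalize (pos_INR p); intros. nra.
Qed.
Lemma is_series_le (a c : nat -> R) (l m : R) : (forall n, a n <= c n) -> is_series a l -> is_series c m -> l <= m.
Proof.
  intros H Ha Hc. rewrite <- (is_series_unique _ _ Ha), <- (is_series_unique _ _ Hc).
  apply Series_le'; auto; eexists; eassumption.
Qed.

(** * Analyticity of Xi, its values at negative integers, and the signs of tau *)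

Section XiSec.
Variables (b : R -> R) (lam : nat -> R) (phi : nat -> R -> R).
Hypothesis Hadm : admissible b.
Hypothesis HE : eigen_decomp b lam phi.

Let Hb : smooth_circ b. Proof. apply Hadm. Qed.
Let bpos : forall x, 0 < b x. Proof. apply Hadm. Qed.
Let lpos := lam_pos b lam phi Hadm HE.
Let lmono := lam_mono b lam phi HE.
Hint Resolve sc_csn sc_snn sc_pc sc_ps sc_Aop sc_Kop sc_Rop sc_Yop sc_Aiter : sc.
Notation Pk := (Pm b phi).
Notation gap n k := (Rabs (lam (S k) ^ 2 - INR (S n) ^ 2)).

(** Dominates [1 / lam_k^2] and [1 / n^2] for all positive indices, and therefore also the quotient
    of [max (lam_k, 1 / lam_k)] by [lam_k]. *)
Let C1 := 1 + / lam 1%nat ^ 2.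
Let C1p : 1 <= C1.
Proof. unfold C1. assert (0 < / lam 1%nat ^ 2) by (apply Rinv_0_lt_compat, pow_lt, lpos). lra. Qed.
Let lam_ge k : lam 1%nat <= lam (S k). Proof. apply lmono; lia. Qed.
Let invl k : / lam (S k) ^ 2 <= C1.
Proof.
  apply Rle_trans with (/ lam 1%nat ^ 2); [|unfold C1; lra].
  apply Rinv_le_contravar; [apply pow_lt, lpos|]. apply pow_incr; split; [apply Rlt_le, lpos|apply lam_ge].
Qed.

Lemma exp_abs_ln_lam k : exp (Rabs (- ln (lam (S k)))) <= C1 * lam (S k).
Proof.
  assert (P := lpos k). rewrite Rabs_Ropp. unfold Rabs; destruct Rcase_abs as [H|H].
  - rewrite exp_Ropp, exp_ln by auto.
    assert (Q := invl k). replace (/ lam (S k)) with (/ lam (S k) ^ 2 * lam (S k)) by (field; lra).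
    apply Rmult_le_compat_r; lra.
  - rewrite exp_ln by auto. nra.
Qed.
(** The logarithms are compared through those of the squares, since it is [lam_k^2 - n^2] that
    [ak_Rop] controls. *)
Lemma ln_gap n k : Rabs (- ln (lam (S k)) - - ln (INR (S n))) <= C1 * gap n k.
Proof.
  assert (P := lpos k). assert (N := INR_S_pos n).
  assert (N1 : 1 <= INR (S n)) by (rewrite S_INR; generalize (pos_INR n); lra).
  assert (E : forall y, 0 < y -> ln (y ^ 2) = 2 * ln y).
  { intros y Hy. simpl. rewrite Rmult_1_r, ln_mult by auto. ring. }
  assert (B := ln_diff_le (lam (S k) ^ 2) (INR (S n) ^ 2) C1 ltac:(apply pow_lt; auto) ltac:(apply pow_lt; auto) (invl k)).
  rewrite !E in B by auto.
  assert (Hi : / INR (S n) ^ 2 <= C1).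
  { apply Rle_trans with 1; auto. rewrite <- Rinv_1. apply Rinv_le_contravar; [lra|]. nra. }
  specialize (B Hi).
  replace (2 * ln (lam (S k)) - 2 * ln (INR (S n))) with (2 * (ln (lam (S k)) - ln (INR (S n)))) in B by ring.
  rewrite Rabs_mult, (Rabs_right 2) in B by lra.
  replace (- ln (lam (S k)) - - ln (INR (S n))) with (- (ln (lam (S k)) - ln (INR (S n)))) by ring.
  rewrite Rabs_Ropp. generalize (Rabs_pos (ln (lam (S k)) - ln (INR (S n)))); lra.
Qed.

Definition Mb r n k := (12 * INR r + 12) * C1 ^ (3 * r + 5) * INR (S n) ^ (3 * r + 4) *
  (lam (S k) ^ (3 * r + 4) * gap n k * Pk (S n) (S k)).

Lemma term_quad r n k : Quad (INR r) (Mb r n k)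
  (fE (- ln (lam (S k))) (- ln (INR (S n))) (Pk (S n) (S k)))
  (gE (- ln (lam (S k))) (- ln (INR (S n))) (Pk (S n) (S k))).
Proof.
  assert (P := lpos k). assert (N := INR_S_pos n).
  assert (N1 : 1 <= INR (S n)) by (rewrite S_INR; generalize (pos_INR n); lra).
  assert (lnn : 0 <= ln (INR (S n))).
  { rewrite <- ln_1. destruct (Req_dec 1 (INR (S n))) as [<-|]; [lra|]. apply Rlt_le, ln_increasing; lra. }
  set (L := Rabs (- ln (lam (S k))) + ln (INR (S n))).
  assert (HP := Pm_nonneg b phi (S n) (S k)).
  eapply Quad_mono.
  - apply (Quad_E _ _ L); auto.
    + unfold L; lra.
    + rewrite Rabs_Ropp, Rabs_right by lra. unfold L. generalize (Rabs_pos (- ln (lam (S k)))); lra.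
  - assert (HX : exp L <= C1 * lam (S k) * INR (S n)).
    { unfold L. rewrite exp_plus, (exp_ln (INR (S n))) by auto. apply Rmult_le_compat_r; [lra|apply exp_abs_ln_lam]. }
    assert (HXp : exp L ^ (3 * r + 4) <= (C1 * lam (S k) * INR (S n)) ^ (3 * r + 4)).
    { apply pow_incr; split; auto. apply Rlt_le, exp_pos. }
    assert (HG := ln_gap n k). unfold Mb.
    replace (3 * r + 5)%nat with (S (3 * r + 4)) by lia. rewrite <- (tech_pow_Rmult C1).
    rewrite !Rpow_mult_distr in HXp. set (e := (3 * r + 4)%nat) in *.
    set (d := Rabs (- ln (lam (S k)) - - ln (INR (S n)))) in *.
    replace ((12 * INR r + 12) * (C1 * C1 ^ e) * INR (S n) ^ e * (lam (S k) ^ e * gap n k * Pk (S n) (S k)))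
      with (Pk (S n) (S k) * (C1 * gap n k) * (12 * INR r + 12) * (C1 ^ e * lam (S k) ^ e * INR (S n) ^ e)) by ring.
    assert (Rn := pos_INR r). assert (0 <= d) by apply Rabs_pos.
    apply Rmult_le_compat; auto; try (apply pow_le, Rlt_le, exp_pos).
    + apply Rmult_le_pos; [|lra]. apply Rmult_le_pos; auto.
    + apply Rmult_le_compat_r; [lra|]. apply Rmult_le_compat_l; auto.
Qed.

Lemma Mb_sum r : exists C, 0 <= C /\ forall n, ex_series (Mb r n) /\ 0 <= Series (Mb r n) <= C * / INR (S n) ^ 2.
Proof.
  (* [3 r + 4] powers of [lam] and of [n] come from [X^(3 r + 4)] in [Quad_E]; two further powers of
     [n] make the outer sum converge. *)
  destruct (gap_sum b lam phi Hadm HE (3 * r + 4) (3 * r + 4 + 2)) as [C [HC0 HC]].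
  set (K := (12 * INR r + 12) * C1 ^ (3 * r + 5)).
  assert (HK : 0 <= K) by (unfold K; apply Rmult_le_pos; [generalize (pos_INR r); lra|apply pow_le; lra]).
  exists (K * C); split; [apply Rmult_le_pos; auto|]. intros n. destruct (HC n) as [E B].
  assert (N := INR_S_pos n). assert (P2 : 0 < INR (S n) ^ 2) by (apply pow_lt; auto).
  assert (Pe : 0 <= INR (S n) ^ (3 * r + 4)) by (apply pow_le; lra).
  unfold Mb. fold K. clearbody K. split; [apply ex_series_scalR; auto|].
  rewrite Series_scal_l. set (Sg := Series _) in *.
  assert (S0 : 0 <= Sg).
  { unfold Sg. transitivity (Series (fun _ => 0 * 0)); [rewrite Series_scal_l; lra|]. apply Series_le; auto.
    intros k; rewrite Rmult_0_l; split; [lra|]. apply Rmult_le_pos; [apply Rmult_le_pos|apply Pm_nonneg].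
    - apply pow_le, Rlt_le, lpos.
    - apply Rabs_pos. }
  split; [repeat apply Rmult_le_pos; auto|].
  rewrite pow_add in B. apply Rmult_le_reg_r with (INR (S n) ^ 2); auto.
  replace (K * C * / INR (S n) ^ 2 * INR (S n) ^ 2) with (K * C) by (field; apply Rgt_not_eq; auto).
  replace (K * INR (S n) ^ (3 * r + 4) * Sg * INR (S n) ^ 2) with (K * (INR (S n) ^ (3 * r + 4) * INR (S n) ^ 2 * Sg)) by ring.
  apply Rmult_le_compat_l; auto.
Qed.

Lemma xi_quad r : exists (Mx : nat -> R) (g : nat -> C -> C), ex_series Mx /\ forall n, Quad (INR r) (Mx n) (xi b lam phi n) (g n).
Proof.
  destruct (Mb_sum r) as [C [HC0 HC]].
  exists (fun n => 2 * Series (Mb r n)), (fun n z => CSer (fun k => gE (- ln (lam (S k))) (- ln (INR (S n))) (Pk (S n) (S k)) z)).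
  split.
  - apply ex_series_scalR. apply (ex_series_Rle _ (fun n => C * / INR (S n) ^ 2)).
    + intros n. destruct (HC n) as [_ B]. rewrite Rabs_right; lra.
    + apply ex_series_scalR, ex_series_inv_sq.
  - intros n. apply (Quad_series (INR r) (Mb r n)); [intros; apply term_quad|apply HC].
Qed.
Lemma nat_above x : exists r : nat, x <= INR r.
Proof.
  destruct (archimed x) as [H _]. destruct (Z_le_gt_dec 0 (up x)) as [Hz|Hz].
  - exists (Z.to_nat (up x)). rewrite INR_IZR_INZ, Z2Nat.id by auto. lra.
  - exists 0%nat. simpl. assert (IZR (up x) < 0) by (apply IZR_lt; lia). lra.
Qed.
Lemma Xi_Cd z : exists l, Cd (Xi b lam phi) z l.
Proof.
  destruct (nat_above (Cmod z)) as [r Hr]. destruct (xi_quad r) as (Mx & g & HM & HQ).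
  destruct (Quad_series _ _ _ _ HQ HM) as [H0 H]. destruct (H z Hr) as (_ & _ & B).
  eexists. apply (Cd_quad _ _ _ _ H0). apply B.
Qed.
Lemma Xi_series z : is_series (fun n => fst (xi b lam phi n z)) (fst (Xi b lam phi z)) /\
  is_series (fun n => snd (xi b lam phi n z)) (snd (Xi b lam phi z)).
Proof.
  destruct (nat_above (Cmod z)) as [r Hr]. destruct (xi_quad r) as (Mx & g & HM & HQ).
  destruct (CSer_abs (fun n => xi b lam phi n z) Mx) as [A B]; auto.
  { intros n. apply (HQ n); auto. }
  split; apply Series_correct; auto.
Qed.

Lemma fE_nat q n k : fE (- ln (lam (S k))) (- ln (INR (S n))) (Pk (S n) (S k)) (RtoC (- INR q)) =
  RtoC (Pk (S n) (S k) * (lam (S k) ^ q - INR (S n) ^ q)).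
Proof.
  unfold fE. rewrite !Ee_nat by (try apply lpos; apply INR_S_pos). rewrite RtoC_mult, RtoC_minus. auto.
Qed.
Lemma tau_series q n : is_series (fun k => Pk (S n) (S k) * (lam (S k) ^ q - INR (S n) ^ q)) (tau b q n).
Proof.
  assert (H1 := Pm_form b lam phi Hadm HE n q). assert (H2 := Pm_sum_k b lam phi Hadm HE n).
  assert (H3 := is_series_scalR (INR (S n) ^ q) _ _ H2). assert (H4 := is_series_minusR _ _ _ _ H1 H3).
  eapply is_series_ext; [|eapply is_series_RR; [exact H4|]].
  - intros k. cbv beta. toR. ring.
  - unfold tau. ring.
Qed.
Lemma xi_tau q n : fst (xi b lam phi n (RtoC (- INR q))) = tau b q n.
Proof.
  unfold xi, CSer; cbn [fst]. rewrite <- (is_series_unique _ _ (tau_series q n)). apply Series_ext; intros k.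
  rewrite fE_nat; auto.
Qed.
Lemma Xi_tau q : is_series (tau b q) (fst (Xi b lam phi (RtoC (- INR q)))).
Proof.
  eapply is_series_ext; [|exact (proj1 (Xi_series (RtoC (- INR q))))]. intros n. cbv beta. apply xi_tau.
Qed.

Lemma tau_1_energy n : tau b 1 n = / PI * (ip (Lam (csn b (S n))) (csn b (S n)) + ip (Lam (snn b (S n))) (snn b (S n))) - 2 * INR (S n).
Proof.
  assert (PP := PI_RGT_0).
  assert (E : forall f g, smooth_circ g -> (fun x => sqrt (b x) * f x) = (fun x => / sqrt PI * g x) ->
    ip (Aop b f) f = / PI * ip (Lam g) g).
  { intros f g Hg Efg. unfold Aop. rewrite Efg, Lam_scal by auto. rewrite <- I2_scal by cstac. apply I2_ext; intros x.
    rewrite <- inv_sqrt_PI. assert (Ex := f_equal (fun h => h x) Efg). cbv beta in Ex.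
    replace (sqrt (b x) * (/ sqrt PI * Lam g x) * f x) with ((/ sqrt PI * Lam g x) * (sqrt (b x) * f x)) by ring. rewrite Ex. ring. }
  unfold tau. change (Aiter b 1 (pc b (S n))) with (Aop b (pc b (S n))). change (Aiter b 1 (ps b (S n))) with (Aop b (ps b (S n))).
  rewrite (E _ (csn b (S n))), (E _ (snn b (S n))); sctac; [ring|apply r_ps; auto|apply r_pc; auto].
Qed.
(** The form of [Lambda] dominates that of [D]. On the pair [snn], [csn] the latter is explicit: it
    is [n] times the integral of [cos^2 (n s) ds], that is [n PI]. *)
Lemma tau_1_nonneg n : 0 <= tau b 1 n.
Proof.
  assert (PP := PI_RGT_0). rewrite tau_1_energy.
  assert (H := Lam_pair (snn b (S n)) (csn b (S n)) ltac:(sctac) ltac:(sctac)).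
  rewrite Derive_snn in H by auto.
  destruct (ortho_trig _ _ (phase_ph b Hadm) (S n) (S n)) as (O1 & _ & _).
  destruct (Nat.eq_dec (S n) (S n)); [|lia]. destruct (Nat.eq_dec (S n) 0); [lia|].
  rewrite (I2_ext _ (fun x => INR (S n) * (cos (INR (S n) * ph b x) * cos (INR (S n) * ph b x) * / b x))) in H
    by (intros; unfold csn; ring).
  rewrite I2_scal, O1 in H.
  - set (s := ip (Lam (csn b (S n))) (csn b (S n)) + ip (Lam (snn b (S n))) (snn b (S n))).
    assert (2 * (INR (S n) * PI) <= s) by (unfold s; lra).
    assert (/ PI * (2 * (INR (S n) * PI)) <= / PI * s) by (apply Rmult_le_compat_l; auto; apply Rinv_nneg; auto).
    replace (/ PI * (2 * (INR (S n) * PI))) with (2 * INR (S n)) in H1 by (field; lra). lra.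
  - apply (cts_mult (fun x => csn b (S n) x * csn b (S n) x)); cstac.
Qed.
(** Termwise [lam^2 - n^2 >= 2 n (lam - n)], which reduces the claim to [tau_1_nonneg]. *)
Lemma tau_2_nonneg n : 0 <= tau b 2 n.
Proof.
  assert (N := INR_S_pos n).
  assert (H1 := is_series_scalR (2 * INR (S n)) _ _ (tau_series 1 n)).
  assert (B : 2 * INR (S n) * tau b 1 n <= tau b 2 n).
  { refine (is_series_le _ _ _ _ (fun k => _) H1 (tau_series 2 n)).
    cbv beta.
    assert (HP := Pm_nonneg b phi (S n) (S k)). set (y := INR (S n)) in *. set (l := lam (S k)).
    assert (0 <= Pk (S n) (S k) * (l - y) ^ 2) by (apply Rmult_le_pos; auto; apply pow2_ge_0).
    simpl. nra. }
  assert (T := tau_1_nonneg n).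
  assert (0 <= 2 * INR (S n) * tau b 1 n) by (apply Rmult_le_pos; lra). lra.
Qed.

Lemma Rop_series n : is_series (fun k => Pk (S n) (S k) * (lam (S k) ^ 2 - INR (S n) ^ 2) ^ 2)
  (N2 (Rop b (pc b (S n))) + N2 (Rop b (ps b (S n)))).
Proof.
  destruct (ak0_psi b lam phi Hadm HE n) as [Z1 Z2].
  apply (is_series_shift (fun k => Pk (S n) k * (lam k ^ 2 - INR (S n) ^ 2) ^ 2)).
  - unfold Pm; rewrite Z1, Z2; ring.
  - assert (H1 := phi_parseval b lam phi HE (Rop b (pc b (S n))) ltac:(sctac)).
    assert (H2 := phi_parseval b lam phi HE (Rop b (ps b (S n))) ltac:(sctac)).
    assert (H3 := is_series_plusR _ _ _ _ H1 H2).
    eapply is_series_ext; [|exact H3]. intros k. cbv beta.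
    destruct (ak_Rop b lam phi Hadm HE k (S n)) as [<- <-]. unfold Pm. toR; ring.
Qed.
(** [pow_tangent] is used with [u = lam_k^2] and [v = n^2]. The first-order terms sum to a
    nonnegative multiple of [tau b 2 n], the second-order terms, by [ak_Rop], to the squared norms
    of [R psi]. *)
Lemma tau_lower p n : INR (S n) ^ (2 * p) * (N2 (Rop b (pc b (S n))) + N2 (Rop b (ps b (S n))))
  <= tau b (2 * (p + 2)) n.
Proof.
  assert (N := INR_S_pos n).
  assert (H1 := is_series_scalR (INR (p + 2) * (INR (S n) ^ 2) ^ (p + 1)) _ _ (tau_series 2 n)).
  assert (H2 := is_series_scalR ((INR (S n) ^ 2) ^ p) _ _ (Rop_series n)).
  assert (H3 := is_series_plusR _ _ _ _ H1 H2).
  assert (B := fun H => is_series_le _ _ _ _ H H3 (tau_series (2 * (p + 2)) n)).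
  lapply B; clear B; [intros B|].
  2: { intros k.
       assert (HP := Pm_nonneg b phi (S n) (S k)). rewrite !(pow_mult _ 2).
       assert (T := pow_tangent (lam (S k) ^ 2) (INR (S n) ^ 2) p ltac:(apply pow2_ge_0) ltac:(apply pow2_ge_0)).
       set (y := INR (S n) ^ 2) in *. set (l := lam (S k) ^ 2) in *. change (lam (S k) ^ 2) with l.
       cbv beta. change (INR (p + 2) * y ^ (p + 1) * (Pk (S n) (S k) * (l - y)) + y ^ p * (Pk (S n) (S k) * (l - y) ^ 2) <= Pk (S n) (S k) * (l ^ (p + 2) - y ^ (p + 2))).
       apply Rle_trans with (Pk (S n) (S k) * (INR (p + 2) * y ^ (p + 1) * (l - y) + y ^ p * (l - y) ^ 2)); [right; ring|].
       apply Rmult_le_compat_l; auto. lra. }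
  rewrite <- (pow_mult _ 2 p) in B.
  assert (0 <= INR (p + 2) * (INR (S n) ^ 2) ^ (p + 1) * tau b 2 n).
  { apply Rmult_le_pos; [apply Rmult_le_pos; [apply pos_INR|apply pow_le, pow2_ge_0]|apply tau_2_nonneg]. }
  lra.
Qed.
Lemma tau_even_nonneg m n : (1 <= m)%nat -> 0 <= tau b (2 * m) n.
Proof.
  intros Hm. destruct m as [|[|p]]; [lia|apply tau_2_nonneg|].
  replace (S (S p)) with (p + 2)%nat by lia. eapply Rle_trans; [|apply tau_lower].
  apply Rmult_le_pos; [apply pow_le, pos_INR|].
  assert (forall f, smooth_circ f -> 0 <= N2 f).
  { intros f Hf. apply I2_nonneg; cstac. intros; apply pow2_ge_0. }
  apply Rplus_le_le_0_compat; apply H; sctac.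
Qed.

(** Where the Dirichlet series converges absolutely the two parts of [xi] may be summed separately.
    Column sums one collapse the first to the sum of [lam_k^-z], and row sums two reduce the second
    to [2 n^-z], in which [b] no longer occurs. *)
Lemma xi_split z : ex_series (fun k => exp (- Re z * ln (lam (S k)))) ->
  is_series (fun n => 2 * fst (Ee (- ln (INR (S n))) z)) (Series (fun k => fst (Ee (- ln (lam (S k))) z)) - fst (Xi b lam phi z)) /\
  is_series (fun n => 2 * snd (Ee (- ln (INR (S n))) z)) (Series (fun k => snd (Ee (- ln (lam (S k))) z)) - snd (Xi b lam phi z)).
Proof.
  intros HS.
  (* [pr] stands for the real or the imaginary part; only real linearity and the bound by the
     modulus enter. *)
  assert (G : forall pr : C -> R, (forall w, Rabs (pr w) <= Cmod w) ->
     (forall p w v, pr (RtoC p * (w - v))%C = p * (pr w - pr v)) ->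
     is_series (fun n => Series (fun k => pr (fE (- ln (lam (S k))) (- ln (INR (S n))) (Pk (S n) (S k)) z))) (pr (Xi b lam phi z)) ->
     is_series (fun n => 2 * pr (Ee (- ln (INR (S n))) z)) (Series (fun k => pr (Ee (- ln (lam (S k))) z)) - pr (Xi b lam phi z))).
  { intros pr Hpr Hlin HX.
    set (x := fun k => pr (Ee (- ln (lam (S k))) z)).
    assert (Hx : ex_series (fun k => Rabs (x k))).
    { apply (ex_series_Rle _ _ (fun k => Rle_trans _ _ _ (Req_le _ _ (Rabs_Rabsolu _)) (Rle_trans _ _ _ (Hpr _) (Req_le _ _ (Cmod_Ee _ _)))) HS). }
    assert (T := tannery x (fun n k => Pk (S n) (S k)) Hx (fun n k => Pm_nonneg b phi (S n) (S k)) (Pm_sum_n b lam phi Hadm HE)).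
    assert (D := is_series_minusR _ _ _ _ T HX).
    eapply is_series_ext; [|exact D]. intros n. cbv beta.
    change (Series (fun k => x k * Pk (S n) (S k)) - Series (fun k => pr (fE (- ln (lam (S k))) (- ln (INR (S n))) (Pk (S n) (S k)) z)) =
      2 * pr (Ee (- ln (INR (S n))) z)).
    rewrite (Series_ext (fun k => pr (fE _ _ _ z)) (fun k => x k * Pk (S n) (S k) - pr (Ee (- ln (INR (S n))) z) * Pk (S n) (S k))).
    2: { intros k. unfold fE. rewrite Hlin. unfold x. ring. }
    rewrite Series_minus.
    - rewrite Series_scal_l, (is_series_unique _ _ (Pm_sum_k b lam phi Hadm HE n)). ring.
    - apply (tannery_term x (fun n k => Pk (S n) (S k)) Hx (fun n k => Pm_nonneg b phi (S n) (S k)) (Pm_sum_n b lam phi Hadm HE) n).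
    - apply ex_series_scalR. eexists; apply (Pm_sum_k b lam phi Hadm HE n). }
  destruct (Xi_series z) as [X1 X2].
  split; apply G.
  - apply Cmod_fst.
  - intros p [w1 w2] [v1 v2]. simpl. ring.
  - exact X1.
  - apply Cmod_snd.
  - intros p [w1 w2] [v1 v2]. simpl. ring.
  - exact X2.
Qed.
End XiSec.

(** * The trace formula behind [zeta (-1)] *)

(** [Dr] is the Dirichlet kernel and [Dk n] is [4 n] times the Fejer kernel, the continuous
    extension of [4 sin^2 (n t / 2) / sin^2 (t / 2)]. Written as sums they have no singularity at
    [t = 0]. *)
Fixpoint Dr i t : R := match i with O => 1 | S j => Dr j t + 2 * cos (INR i * t) end.
Fixpoint Dk n t : R := match n with O => 0 | S m => Dk m t + 4 * Dr m t end.
Fixpoint rsum n (f : nat -> R) : R := match n with O => 0 | S m => rsum m f + f m end.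

Lemma rsum_ext n f g : (forall k, f k = g k) -> rsum n f = rsum n g.
Proof. intros H; induction n; simpl; auto. rewrite IHn, H; auto. Qed.
Lemma rsum_scal n c f : rsum n (fun k => c * f k) = c * rsum n f.
Proof. induction n; simpl; [ring|]. rewrite IHn; ring. Qed.
Lemma rsum_plus n f g : rsum n (fun k => f k + g k) = rsum n f + rsum n g.
Proof. induction n; simpl; [ring|]. rewrite IHn; ring. Qed.
Lemma rsum_le n f g : (forall k, f k <= g k) -> rsum n f <= rsum n g.
Proof. intros H; induction n; simpl; [lra|]. specialize (H n); lra. Qed.
Lemma cts_rsum n (f : nat -> R -> R) : (forall k, cts (f k)) -> cts (fun x => rsum n (fun k => f k x)).
Proof. intros H; induction n; simpl; ctac. Qed.
Lemma RInt_rsum n (f : nat -> R -> R) a b : (forall k, cts (f k)) ->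
  RInt (fun x => rsum n (fun k => f k x)) a b = rsum n (fun k => RInt (f k) a b).
Proof.
  intros H; induction n; simpl; [rewrite RInt_const'; ring|].
  rewrite RInt_plus', IHn; auto. apply cts_rsum; auto.
Qed.
Lemma rsum_sum_n n f : rsum (S n) f = sum_n f n.
Proof. induction n; [rewrite sum_O; simpl; ring|]. rewrite sum_Sn, <- IHn. reflexivity. Qed.

Lemma Dr_sin i t : sin (t / 2) * Dr i t = sin ((INR i + / 2) * t).
Proof.
  induction i; [simpl; rewrite Rmult_1_r; f_equal; field|].
  change (Dr (S i) t) with (Dr i t + 2 * cos (INR (S i) * t)).
  rewrite Rmult_plus_distr_l, IHi, S_INR.
  replace ((INR i + / 2) * t) with ((INR i + 1) * t - t / 2) by field.
  replace ((INR i + 1 + / 2) * t) with ((INR i + 1) * t + t / 2) by field.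
  rewrite sin_minus, sin_plus. ring.
Qed.
Lemma Dk_sin n t : sin (t / 2) ^ 2 * Dk n t = 2 - 2 * cos (INR n * t).
Proof.
  induction n; [simpl; rewrite Rmult_0_l, cos_0; ring|].
  change (Dk (S n) t) with (Dk n t + 4 * Dr n t).
  rewrite Rmult_plus_distr_l, IHn.
  replace (sin (t / 2) ^ 2 * (4 * Dr n t)) with (4 * sin (t / 2) * (sin (t / 2) * Dr n t)) by ring.
  rewrite Dr_sin, S_INR.
  replace ((INR n + / 2) * t) with (INR n * t + t / 2) by field.
  replace ((INR n + 1) * t) with (INR n * t + 2 * (t / 2)) by field.
  rewrite sin_plus, cos_plus, cos_2a_sin, sin_2a. ring.
Qed.
Lemma Dr_rsum i t : Dr i t = 1 + 2 * rsum i (fun k => cos (INR (S k) * t)).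
Proof.
  induction i; [simpl; ring|]. change (Dr (S i) t) with (Dr i t + 2 * cos (INR (S i) * t)).
  rewrite IHi. cbn [rsum]. ring.
Qed.
Lemma Dk_rsum n t : Dk n t = 4 * INR n + 8 * rsum n (fun k => (INR n - INR (S k)) * cos (INR (S k) * t)).
Proof.
  induction n; [simpl; ring|]. change (Dk (S n) t) with (Dk n t + 4 * Dr n t).
  rewrite IHn, Dr_rsum. cbn [rsum].
  replace (INR (S n) - INR (S n)) with 0 by ring.
  rewrite (rsum_ext n (fun k => (INR (S n) - INR (S k)) * cos (INR (S k) * t))
    (fun k => (INR n - INR (S k)) * cos (INR (S k) * t) + cos (INR (S k) * t))).
  - rewrite rsum_plus, (S_INR n). ring.
  - intros k. rewrite (S_INR n). ring.
Qed.
Lemma Dr_bound i t : Rabs (Dr i t) <= 2 * INR i + 1.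
Proof.
  induction i; [simpl; rewrite Rabs_R1; lra|]. change (Dr (S i) t) with (Dr i t + 2 * cos (INR (S i) * t)).
  eapply Rle_trans; [apply Rabs_triang|]. rewrite Rabs_mult, (Rabs_right 2) by lra.
  assert (Rabs (cos (INR (S i) * t)) <= 1) by apply Rabs_le, COS_bound. rewrite (S_INR i) in *. lra.
Qed.
Lemma Dk_bound n t : Rabs (Dk n t) <= 4 * INR n ^ 2.
Proof.
  induction n; [simpl; rewrite Rabs_R0; lra|]. change (Dk (S n) t) with (Dk n t + 4 * Dr n t).
  eapply Rle_trans; [apply Rabs_triang|]. rewrite Rabs_mult, (Rabs_right 4) by lra.
  generalize (Dr_bound n t); intros. rewrite S_INR. replace ((INR n + 1) ^ 2) with (INR n ^ 2 + 2 * INR n + 1) by ring. lra.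
Qed.
Lemma Dk_cts n : cts (Dk n).
Proof.
  assert (H : forall i, cts (Dr i)) by (induction i; simpl; ctac).
  induction n; simpl; ctac.
Qed.
Lemma Dk_even n t : Dk n (- t) = Dk n t.
Proof.
  rewrite !Dk_rsum. f_equal. f_equal. apply rsum_ext. intros k. rewrite <- Ropp_mult_distr_r, cos_neg; auto.
Qed.
Lemma Dk_nonneg n t : 0 <= Dk n t.
Proof.
  destruct (Req_dec (sin (t / 2)) 0) as [Z|Hn].
  - rewrite Dk_rsum.
    assert (C : forall k, cos (INR (S k) * t) = 1).
    { assert (C1 : cos t = 1).
      { replace t with (2 * (t / 2)) by field. rewrite cos_2a_sin, Z. ring. }
      assert (S1 : sin t = 0).
      { replace t with (2 * (t / 2)) by field. rewrite sin_2a, Z. ring. }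
      assert (G : forall k, cos (INR (S k) * t) = 1 /\ sin (INR (S k) * t) = 0).
      { induction k; [simpl; rewrite Rmult_1_l; auto|]. destruct IHk as [A B].
        rewrite (S_INR (S k)), Rmult_plus_distr_r, Rmult_1_l, cos_plus, sin_plus, A, B, C1, S1. split; ring. }
      intros k; apply G. }
    assert (E : forall m : nat, (m <= n)%nat -> 0 <= rsum m (fun k => (INR n - INR (S k)) * cos (INR (S k) * t))).
    { induction m; intros Hm; cbn [rsum]; [lra|]. rewrite C. assert (INR (S m) <= INR n) by (apply le_INR; lia).
      assert (IH := IHm ltac:(lia)). lra. }
    generalize (E n (Nat.le_refl _)) (pos_INR n); lra.
  - assert (0 < sin (t / 2) ^ 2) by (generalize (pow2_ge_0 (sin (t / 2))); intros; assert (sin (t / 2) ^ 2 <> 0) by (apply pow_nonzero; auto); lra).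
    assert (E := Dk_sin n t). assert (B := COS_bound (INR n * t)).
    apply Rmult_le_reg_l with (sin (t / 2) ^ 2); auto. rewrite E. lra.
Qed.

Section Eta.
Variable N : nat.
Hypothesis HN : (2 <= N)%nat.
Let s0 := 2 * PI / INR N.
(** [eta] is the mean of two Fejer kernels of order [N], centred at [s0] and [- s0], where [s0] is
    the first positive zero of such a kernel. So it is nonnegative with constant term one, vanishes
    at 0 and concentrates there as [N] grows. The index [k] stands for the frequency [k + 1]. *)
Definition vk k := (1 - INR (S k) / INR N) * cos (INR (S k) * s0).
Definition eta t := 1 + 2 * rsum N (fun k => vk k * cos (INR (S k) * t)).

Let Npos : 0 < INR N. Proof. apply lt_0_INR; lia. Qed.
Lemma eta_Dk t : eta t = / (8 * INR N) * (Dk N (t - s0) + Dk N (t + s0)).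
Proof.
  unfold eta. rewrite !Dk_rsum.
  transitivity (/ (8 * INR N) * (8 * INR N + 8 * rsum N (fun k => (2 * INR N) * (vk k * cos (INR (S k) * t))))).
  - rewrite rsum_scal. field; lra.
  - f_equal. rewrite (rsum_ext N (fun k => 2 * INR N * (vk k * cos (INR (S k) * t)))
      (fun k => (INR N - INR (S k)) * cos (INR (S k) * (t - s0)) + (INR N - INR (S k)) * cos (INR (S k) * (t + s0)))).
    + rewrite rsum_plus. ring.
    + intros k. unfold vk. rewrite Rmult_minus_distr_l, Rmult_plus_distr_l, cos_minus, cos_plus. field; lra.
Qed.
Lemma eta_nonneg t : 0 <= eta t.
Proof.
  rewrite eta_Dk. apply Rmult_le_pos; [apply Rinv_nneg; lra|].
  generalize (Dk_nonneg N (t - s0)) (Dk_nonneg N (t + s0)); lra.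
Qed.
Lemma eta_0 : eta 0 = 0.
Proof.
  rewrite eta_Dk, Rminus_0_l, Rplus_0_l, Dk_even.
  assert (Z : Dk N s0 = 0).
  { assert (E := Dk_sin N s0). replace (INR N * s0) with (2 * PI) in E by (unfold s0; field; lra).
    rewrite cos_2PI in E.
    assert (P : 0 < sin (s0 / 2)).
    { assert (PP := PI_RGT_0). assert (2 <= INR N) by (change 2 with (INR 2); apply le_INR; auto).
      replace (s0 / 2) with (PI / INR N) by (unfold s0; field; lra).
      apply sin_gt_0; [apply Rdiv_lt_0_compat; lra|].
      apply Rmult_lt_reg_r with (INR N); auto. unfold Rdiv; rewrite Rmult_assoc, Rinv_l; nra. }
    assert (0 < sin (s0 / 2) ^ 2) by (apply pow_lt; auto). nra. }
  rewrite Z; ring.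
Qed.
Lemma vk_abs k : (k < N)%nat -> Rabs (vk k) <= 1.
Proof.
  intros Hk. unfold vk. rewrite Rabs_mult.
  assert (A : Rabs (cos (INR (S k) * s0)) <= 1) by apply Rabs_le, COS_bound.
  assert (B : INR (S k) <= INR N) by (apply le_INR; lia). assert (C := INR_S_pos k).
  assert (D : 0 < / INR N) by (apply Rinv_0_lt_compat; auto).
  assert (E : 0 <= INR (S k) / INR N <= 1).
  { split; [unfold Rdiv; nra|]. apply Rmult_le_reg_r with (INR N); auto. unfold Rdiv; rewrite Rmult_assoc, Rinv_l; lra. }
  rewrite (Rabs_right (1 - _)) by lra. generalize (Rabs_pos (cos (INR (S k) * s0))); nra.
Qed.
(** [eta 0 = 0] says that the [vk] add up to [- 1 / 2], which supplies the constant term of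
    [eta]. *)
Lemma eta_alt t : rsum N (fun k => vk k * (2 - 2 * cos (INR (S k) * t))) = - eta t.
Proof.
  assert (E := eta_0). unfold eta in *.
  rewrite (rsum_ext N (fun k => vk k * cos (INR (S k) * 0)) vk) in E by (intros; rewrite Rmult_0_r, cos_0; ring).
  rewrite (rsum_ext N _ (fun k => 2 * vk k + (-2) * (vk k * cos (INR (S k) * t)))) by (intros; ring).
  rewrite rsum_plus, !rsum_scal. lra.
Qed.
End Eta.
(** The first coefficient tends to one: the mean of [1 - cos] against [eta] tends to zero, which is
    the form in which the concentration of [eta] at the origin is used. *)
Lemma vk_lim : is_lim_seq (fun N => vk (S (S N)) 0) 1.
Proof.
  assert (I : is_lim_seq (fun N => / INR (S (S N))) 0).
  { apply (is_lim_seq_incr_1 (fun n => / INR (S n))), (is_lim_seq_incr_1 (fun n => / INR n)).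
    replace (Finite 0) with (Rbar_inv p_infty) by reflexivity.
    apply is_lim_seq_inv; [apply is_lim_seq_INR|discriminate]. }
  apply (is_lim_seq_ext (fun N => (1 - / INR (S (S N))) * cos (2 * PI * / INR (S (S N))))).
  { intros N. unfold vk, Rdiv. simpl (INR 1). rewrite !Rmult_1_l. auto. }
  replace (Finite 1) with (Finite ((1 - 0) * cos (2 * PI * 0))) by (f_equal; rewrite Rmult_0_r, cos_0; ring).
  apply is_lim_seq_mult'.
  - apply is_lim_seq_minus'; [apply is_lim_seq_const|auto].
  - apply (is_lim_seq_continuous cos); [apply continuity_cos|].
    replace (Finite (2 * PI * 0)) with (Rbar_mult (2 * PI) 0) by reflexivity. apply is_lim_seq_scal_l; auto.
Qed.

(** ** Bounded Lipschitz functions of two variables *)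

(** A class closed under sums and products that contains the integrands below and is strong enough
    for continuity in a parameter and for the exchange of two integrals. *)
Definition BL (f : R -> R -> R) := exists B K, 0 <= B /\ 0 <= K /\ (forall x t, Rabs (f x t) <= B) /\
  forall x t x' t', Rabs (f x t - f x' t') <= K * (Rabs (x - x') + Rabs (t - t')).

Lemma BL_const c : BL (fun _ _ => c).
Proof.
  exists (Rabs c), 0. split; [apply Rabs_pos|]. split; [lra|]. split; [intros; lra|].
  intros. rewrite Rminus_diag, Rabs_R0. lra.
Qed.
Lemma BL_plus f g : BL f -> BL g -> BL (fun x t => f x t + g x t).
Proof.
  intros (B & K & B0 & K0 & H1 & H2) (B' & K' & B0' & K0' & H1' & H2'). exists (B + B'), (K + K').
  split; [lra|]. split; [lra|]. split.
  - intros x t. eapply Rle_trans; [apply Rabs_triang|]. specialize (H1 x t). specialize (H1' x t). lra.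
  - intros x t x' t'. replace (f x t + g x t - (f x' t' + g x' t')) with ((f x t - f x' t') + (g x t - g x' t')) by ring.
    eapply Rle_trans; [apply Rabs_triang|]. specialize (H2 x t x' t'). specialize (H2' x t x' t'). lra.
Qed.
Lemma BL_mult f g : BL f -> BL g -> BL (fun x t => f x t * g x t).
Proof.
  intros (B & K & B0 & K0 & H1 & H2) (B' & K' & B0' & K0' & H1' & H2'). exists (B * B'), (K * B' + B * K').
  split; [nra|]. split; [nra|]. split.
  - intros x t. rewrite Rabs_mult. apply Rmult_le_compat; auto; apply Rabs_pos.
  - intros x t x' t'. replace (f x t * g x t - f x' t' * g x' t') with ((f x t - f x' t') * g x t + f x' t' * (g x t - g x' t')) by ring.
    eapply Rle_trans; [apply Rabs_triang|]. rewrite !Rabs_mult.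
    set (d := Rabs (x - x') + Rabs (t - t')).
    assert (0 <= d) by (unfold d; generalize (Rabs_pos (x - x')) (Rabs_pos (t - t')); lra).
    assert (Rabs (f x t - f x' t') * Rabs (g x t) <= (K * d) * B').
    { apply Rmult_le_compat; try apply Rabs_pos; auto. }
    assert (Rabs (f x' t') * Rabs (g x t - g x' t') <= B * (K' * d)).
    { apply Rmult_le_compat; try apply Rabs_pos; auto. }
    nra.
Qed.
Lemma lip_of_derive (f f' : R -> R) K : (forall x, is_derive f x (f' x)) -> (forall x, Rabs (f' x) <= K) ->
  forall x y, Rabs (f x - f y) <= K * Rabs (x - y).
Proof.
  intros Hd HK x y. destruct (MVT_gen f y x f') as [c [_ E]]; auto.
  - intros; apply continuity_pt_filterlim, (ex_derive_continuous f). eexists; apply Hd.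
  - rewrite E, Rabs_mult. apply Rmult_le_compat_r; [apply Rabs_pos|auto].
Qed.
Lemma BL_sc_fst f : smooth_circ f -> BL (fun x _ => f x).
Proof.
  intros Hf. destruct (sc_bounded f Hf) as [B HB]. destruct (sc_bounded (Derive f) ltac:(sctac)) as [K HK].
  assert (B0 : 0 <= B) by (eapply Rle_trans; [apply Rabs_pos|apply (HB 0)]).
  assert (K0 : 0 <= K) by (eapply Rle_trans; [apply Rabs_pos|apply (HK 0)]).
  exists B, K. split; auto. split; auto. split; auto. intros x t x' t'.
  eapply Rle_trans; [apply (lip_of_derive f (Derive f) K); auto using sc_is_derive|].
  generalize (Rabs_pos (t - t')); nra.
Qed.
Lemma BL_sc_sum f : smooth_circ f -> BL (fun x t => f (x + t)).
Proof.
  intros Hf. destruct (sc_bounded f Hf) as [B HB]. destruct (sc_bounded (Derive f) ltac:(sctac)) as [K HK].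
  assert (B0 : 0 <= B) by (eapply Rle_trans; [apply Rabs_pos|apply (HB 0)]).
  assert (K0 : 0 <= K) by (eapply Rle_trans; [apply Rabs_pos|apply (HK 0)]).
  exists B, K. split; auto. split; auto. split; auto. intros x t x' t'.
  eapply Rle_trans; [apply (lip_of_derive f (Derive f) K); auto using sc_is_derive|].
  apply Rmult_le_compat_l; auto. replace (x + t - (x' + t')) with ((x - x') + (t - t')) by ring. apply Rabs_triang.
Qed.
Lemma BL_cos (g : R -> R -> R) K : 0 <= K -> (forall x t x' t', Rabs (g x t - g x' t') <= K * (Rabs (x - x') + Rabs (t - t'))) ->
  BL (fun x t => cos (g x t)).
Proof.
  intros K0 H. exists 1, K. split; [lra|]. split; auto. split; [intros; apply Rabs_le, COS_bound|].
  intros x t x' t'. eapply Rle_trans; [|apply H].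
  rewrite <- (Rmult_1_l (Rabs (g x t - g x' t'))). apply (lip_of_derive cos (fun x => - sin x)).
  - intros; apply is_derive_cos.
  - intros; rewrite Rabs_Ropp; apply Rabs_le, SIN_bound.
Qed.
Lemma BL_cts1 f t : BL f -> cts (fun x => f x t).
Proof.
  intros (B & K & _ & K0 & _ & H) x P [[eps He] HP].
  exists (mkposreal (eps / (K + 1)) ltac:(apply Rdiv_lt_0_compat; lra)). intros y Hy. apply HP.
  change (Rabs (y - x) < eps / (K + 1)) in Hy. change (Rabs (f y t - f x t) < eps).
  specialize (H y t x t). rewrite Rminus_diag, Rabs_R0, Rplus_0_r in H.
  apply (Rmult_lt_compat_r (K + 1)) in Hy; [|lra]. unfold Rdiv in Hy; rewrite Rmult_assoc, Rinv_l, Rmult_1_r in Hy by lra.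
  generalize (Rabs_pos (y - x)); nra.
Qed.
Lemma BL_swap f : BL f -> BL (fun t x => f x t).
Proof.
  intros (B & K & B0 & K0 & H1 & H2). exists B, K. split; auto. split; auto. split; auto.
  intros. rewrite Rplus_comm. apply H2.
Qed.
Lemma BL_cts2 f x : BL f -> cts (fun t => f x t).
Proof. intros H; apply (BL_cts1 _ x (BL_swap f H)). Qed.
Lemma BL_param f a c : a <= c -> BL f -> cts (fun t => RInt (fun x => f x t) a c).
Proof.
  intros Hac HB. assert (HB' := HB). destruct HB as (B & K & B0 & K0 & H1 & H2).
  intros t P [[eps He] HP].
  assert (Q : 0 < (c - a) * K + 1) by nra.
  exists (mkposreal (eps / ((c - a) * K + 1)) ltac:(apply Rdiv_lt_0_compat; auto)). intros y Hy. apply HP.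
  change (Rabs (y - t) < eps / ((c - a) * K + 1)) in Hy.
  change (Rabs (RInt (fun x => f x y) a c - RInt (fun x => f x t) a c) < eps).
  rewrite <- RInt_minus' by (apply BL_cts1; auto).
  eapply Rle_lt_trans.
  { apply abs_RInt_le_const with (M := K * Rabs (y - t)); auto.
    - apply ex_RInt_cts, cts_minus; apply BL_cts1; auto.
    - intros x _. specialize (H2 x y x t). rewrite Rminus_diag, Rabs_R0, Rplus_0_l in H2. auto. }
  apply (Rmult_lt_compat_r ((c - a) * K + 1)) in Hy; auto. unfold Rdiv in Hy; rewrite Rmult_assoc, Rinv_l, Rmult_1_r in Hy by lra.
  generalize (Rabs_pos (y - t)); nra.
Qed.
Lemma is_derive_RInt' (g : R -> R) a x : cts g -> is_derive (fun y => RInt g a y) x (g x).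
Proof.
  intros Hg. apply (is_derive_RInt g (fun y => RInt g a y) a x); [|apply Hg].
  exists (mkposreal 1 Rlt_0_1); intros y _. apply (RInt_correct g). ctac.
Qed.
(** As functions of the upper limit [q] both sides have the same derivative, and they vanish at
    [q = p]. *)
Lemma fubini f a c p q : a <= c -> BL f ->
  RInt (fun t => RInt (fun x => f x t) a c) p q = RInt (fun x => RInt (fun t => f x t) p q) a c.
Proof.
  intros Hac HB. assert (HB' := HB). destruct HB as (B & K & B0 & K0 & H1 & H2).
  set (Psi := fun y => RInt (fun x => RInt (fun t => f x t) p y) a c).
  assert (cin : forall y, cts (fun x => RInt (fun t => f x t) p y)).
  { intros y. destruct (Rle_dec p y) as [Hpy|Hpy].
    - apply (BL_param (fun t x => f x t) p y Hpy). apply BL_swap; auto.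
    - intros x. apply (continuous_ext (fun x => - RInt (fun t => f x t) y p)).
      + intros u. apply (opp_RInt_swap (fun t => f u t)). apply ex_RInt_cts, BL_cts2; auto.
      + apply cts_opp. apply (BL_param (fun t x => f x t) y p); [lra|]. apply BL_swap; auto. }
  assert (D : forall y, is_derive Psi y (RInt (fun x => f x y) a c)).
  { intros y. apply is_derive_quad with ((c - a) * K). intros h. unfold Psi.
    rewrite <- RInt_minus', <- RInt_scal', <- RInt_minus'; auto using BL_cts1.
    2: { apply cts_minus; auto. }
    2: { apply cts_mult; [apply cts_const|apply BL_cts1; auto]. }
    rewrite Rmult_assoc. apply abs_RInt_le_const; auto.
    - apply ex_RInt_cts. apply cts_minus; [apply cts_minus; auto|]. apply cts_mult; [apply cts_const|apply BL_cts1; auto].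
    - intros x _.
      assert (E : RInt (fun t => f x t) p (y + h) - RInt (fun t => f x t) p y = RInt (fun t => f x t) y (y + h)).
      { rewrite <- (RInt_Chasles' (fun t => f x t) p y (y + h)) by (apply BL_cts2; auto).
        generalize (RInt (fun t => f x t) p y : R) (RInt (fun t => f x t) y (y + h) : R). intros; ring. }
      rewrite E.
      destruct (MVT_gen (fun z => RInt (fun t => f x t) y z) y (y + h) (fun z => f x z)) as [xi [Hxi Exi]].
      + intros; apply (is_derive_RInt' (fun t => f x t)), BL_cts2; auto.
      + intros z _. apply continuity_pt_filterlim.
        apply (ex_derive_continuous (fun z => RInt (fun t => f x t) y z)). eexists. apply (is_derive_RInt' (fun t => f x t)), BL_cts2; auto.
      + cbv beta in Exi. rewrite RInt_point in Exi. change (zero : R) with 0 in Exi.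
        replace (f x xi * (y + h - y)) with (f x xi * h) in Exi by ring.
        replace (RInt (fun t => f x t) y (y + h) - h * f x y) with (h * (f x xi - f x y)) by lra.
        rewrite Rabs_mult. specialize (H2 x xi x y). rewrite Rminus_diag, Rabs_R0, Rplus_0_l in H2.
        assert (Rabs (xi - y) <= Rabs h).
        { unfold Rmin, Rmax in Hxi; destruct Rle_dec; unfold Rabs; repeat destruct Rcase_abs; lra. }
        replace (h ^ 2) with (Rabs h * Rabs h) by (rewrite <- Rabs_mult, Rabs_right; nra).
        apply Rle_trans with (Rabs h * (K * Rabs h)); [|right; ring].
        apply Rmult_le_compat_l; [apply Rabs_pos|]. eapply Rle_trans; [apply H2|]. apply Rmult_le_compat_l; auto. }
  rewrite (RInt_derive' Psi); [|auto|apply BL_param; auto].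
  unfold Psi. rewrite (RInt_ext' (fun x => RInt (fun t => f x t) p p) (fun _ => 0)), RInt_const'.
  - toR. generalize (RInt (fun x => RInt (fun t => f x t) p q) a c : R). intros; ring.
  - intros; apply (RInt_point p (fun t => f x t)).
Qed.

(** ** Douglas' formula *)

Lemma sc_shift f t : smooth_circ f -> smooth_circ (fun x => f (x + t)).
Proof.
  intros [Hp Hs]; split.
  - intros x. replace (x + 2 * PI + t) with (x + t + 2 * PI) by ring. apply Hp.
  - intros n x. replace (Derive_n (fun x => f (x + t)) n) with (fun x => Derive_n f n (x + t)).
    + apply (ex_derive_comp (Derive_n f n) (fun x => x + t)); [apply Hs|]. auto_derive; auto.
    + fext y. symmetry; apply Derive_n_comp_trans.
Qed.
Lemma shift_coef f t j : smooth_circ f ->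
  fc j (fun x => f (x + t)) = cos (INR j * t) * fc j f + sin (INR j * t) * fs j f /\
  fs j (fun x => f (x + t)) = cos (INR j * t) * fs j f - sin (INR j * t) * fc j f.
Proof.
  intros Hf. rewrite !fc_eq, !fs_eq.
  assert (c1 : cts (fun x => f x * cos (INR j * (x - t)))) by (apply cts_mult; [apply sc_cts; auto|apply cts_cos'; ctac]).
  assert (c2 : cts (fun x => f x * sin (INR j * (x - t)))) by (apply cts_mult; [apply sc_cts; auto|apply cts_sin'; ctac]).
  assert (p1 : per (fun x => f x * cos (INR j * (x - t)))).
  { intros x. rewrite (sc_per f Hf). replace (x + 2 * PI - t) with (x - t + 2 * PI) by ring. rewrite cos_INR_per; auto. }
  assert (p2 : per (fun x => f x * sin (INR j * (x - t)))).
  { intros x. rewrite (sc_per f Hf). replace (x + 2 * PI - t) with (x - t + 2 * PI) by ring. rewrite sin_INR_per; auto. }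
  split.
  - transitivity (I2 (fun x => f x * cos (INR j * (x - t)))).
    + rewrite <- (I2_shift _ t c1 p1). apply I2_ext; intros x. replace (x + t - t) with x by ring. auto.
    + rewrite <- !I2_scal, <- I2_plus by cstac. apply I2_ext; intros x. rewrite Rmult_minus_distr_l, cos_minus. ring.
  - transitivity (I2 (fun x => f x * sin (INR j * (x - t)))).
    + rewrite <- (I2_shift _ t c2 p2). apply I2_ext; intros x. replace (x + t - t) with x by ring. auto.
    + rewrite <- !I2_scal, <- I2_minus by cstac. apply I2_ext; intros x. rewrite Rmult_minus_distr_l, sin_minus. ring.
Qed.

(** The Douglas integrand, namely the integral over [x] of [(f (x + t) - f x)^2] divided by
    [sin^2 (t / 2)], extended continuously to [t = 0]. A frequency [j] contributes [Dk j], whose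
    integral is [8 PI j]; hence the form of [Lambda]. *)
Definition Gf f t := Series (fun j => (fc (S j) f ^ 2 + fs (S j) f ^ 2) / PI * Dk (S j) t).

Lemma Dk_int n : RInt (Dk n) (- PI) PI = 8 * PI * INR n.
Proof.
  rewrite (RInt_ext' _ (fun t => 4 * INR n + 8 * rsum n (fun k => (INR n - INR (S k)) * cos (INR (S k) * t)))) by (intros; apply Dk_rsum).
  rewrite RInt_plus', RInt_const', RInt_scal'; ctac; try (apply (cts_rsum n (fun k t => (INR n - INR (S k)) * cos (INR (S k) * t))); intros; ctac).
  2: { apply cts_mult; ctac. apply (cts_rsum n (fun k t => (INR n - INR (S k)) * cos (INR (S k) * t))); intros; ctac. }
  rewrite (RInt_rsum n (fun k t => (INR n - INR (S k)) * cos (INR (S k) * t))) by (intros; ctac).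
  rewrite (rsum_ext _ _ (fun _ => 0 * 0)), rsum_scal; [toR; ring|].
  intros k. rewrite RInt_scal' by ctac. rewrite I2_sym; ctac.
  - assert (E := proj1 (coef_const _ _ phase_id k 1)). rewrite fc_eq in E.
    rewrite (I2_ext _ (fun x => 1 * cos (INR (S k) * x))), E by (intros; ring). ring.
  - intros x; apply cos_INR_per.
Qed.
Lemma Gf_terms f : smooth_circ f ->
  (forall j t, Rabs ((fc (S j) f ^ 2 + fs (S j) f ^ 2) / PI * Dk (S j) t) <=
    4 * ((fc (S j) (Derive f) * fc (S j) (Derive f) + fs (S j) (Derive f) * fs (S j) (Derive f)) / PI)) /\
  ex_series (fun j => 4 * ((fc (S j) (Derive f) * fc (S j) (Derive f) + fs (S j) (Derive f) * fs (S j) (Derive f)) / PI)).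
Proof.
  intros Hf; split.
  - intros j t. rewrite fc_Derive, fs_Derive by auto. assert (PP := PI_RGT_0).
    assert (Q : 0 <= (fc (S j) f ^ 2 + fs (S j) f ^ 2) / PI).
    { apply Rmult_le_pos; [generalize (pow2_ge_0 (fc (S j) f)) (pow2_ge_0 (fs (S j) f)); lra|apply Rinv_nneg; auto]. }
    rewrite Rabs_mult, (Rabs_right (_ / PI)) by lra.
    replace (4 * ((INR (S j) * fs (S j) f * (INR (S j) * fs (S j) f) + - (INR (S j) * fc (S j) f) * - (INR (S j) * fc (S j) f)) / PI))
      with ((fc (S j) f ^ 2 + fs (S j) f ^ 2) / PI * (4 * INR (S j) ^ 2)) by (field; lra).
    apply Rmult_le_compat_l; auto. apply Dk_bound.
  - apply ex_series_scalR. eexists. apply (parseval (Derive f) (Derive f)); sctac.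
Qed.
Lemma Gf_cts f : smooth_circ f -> cts (Gf f).
Proof.
  intros Hf. destruct (Gf_terms f Hf) as [B E]. unfold Gf.
  apply (unif_series_cts _ _ (fun j => cts_mult _ _ (cts_const _) (Dk_cts (S j))) B E).
Qed.
Lemma Gf_int f : smooth_circ f -> RInt (Gf f) (- PI) PI = 8 * PI * ip (Lam f) f.
Proof.
  intros Hf. destruct (Gf_terms f Hf) as [B E]. assert (PP := PI_RGT_0).
  assert (H := unif_series_RInt _ _ (fun j => cts_mult _ _ (cts_const _) (Dk_cts (S j))) B E (- PI) PI ltac:(lra)).
  unfold Gf. rewrite <- (is_series_unique _ _ H), <- (is_series_unique _ _ (Lam_form f f Hf Hf)), <- Series_scal_l.
  apply Series_ext; intros j. rewrite RInt_scal', Dk_int by apply Dk_cts. field; lra.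
Qed.
Lemma Gf_sin f t : smooth_circ f -> sin (t / 2) ^ 2 * Gf f t = I2 (fun x => (f (x + t) - f x) ^ 2).
Proof.
  intros Hf. assert (PP := PI_RGT_0). assert (St := sc_shift f t Hf).
  set (g := fun x => f (x + t) + (-1) * f x). assert (Hg : smooth_circ g) by (unfold g; sctac).
  rewrite (I2_ext _ (fun x => g x * g x)) by (intros; unfold g; ring).
  assert (C : forall j, fc j g = (cos (INR j * t) - 1) * fc j f + sin (INR j * t) * fs j f /\
     fs j g = (cos (INR j * t) - 1) * fs j f - sin (INR j * t) * fc j f).
  { intros j. unfold g. destruct (coef_plus _ _ phase_id j (fun x => f (x + t)) (fun x => (-1) * f x)) as [-> ->]; cstac.
    destruct (coef_scal _ _ phase_id j (-1) f) as [-> ->]; cstac. destruct (shift_coef f t j Hf) as [-> ->]. split; ring. }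
  assert (H := parseval g g Hg Hg).
  rewrite (proj1 (C 0%nat)) in H. simpl (INR 0) in H. rewrite Rmult_0_l, cos_0, sin_0 in H.
  replace (ip g g) with (ip g g - ((1 - 1) * fc 0 f + 0 * fs 0 f) * ((1 - 1) * fc 0 f + 0 * fs 0 f) / (2 * PI)) by (field; lra).
  rewrite <- (is_series_unique _ _ H). unfold Gf. rewrite <- Series_scal_l. apply Series_ext; intros j.
  destruct (C (S j)) as [-> ->].
  replace (sin (t / 2) ^ 2 * ((fc (S j) f ^ 2 + fs (S j) f ^ 2) / PI * Dk (S j) t)) with
    ((fc (S j) f ^ 2 + fs (S j) f ^ 2) / PI * (sin (t / 2) ^ 2 * Dk (S j) t)) by ring.
  rewrite Dk_sin.
  assert (T := sin2_cos2 (INR (S j) * t)). unfold Rsqr in T.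
  set (c := cos (INR (S j) * t)) in *. set (s := sin (INR (S j) * t)) in *.
  replace (((c - 1) * fc (S j) f + s * fs (S j) f) * ((c - 1) * fc (S j) f + s * fs (S j) f) +
    ((c - 1) * fs (S j) f - s * fc (S j) f) * ((c - 1) * fs (S j) f - s * fc (S j) f))
   with ((fc (S j) f ^ 2 + fs (S j) f ^ 2) * ((s * s + c * c) + 1 - 2 * c)) by ring.
  rewrite T. field; lra.
Qed.

Lemma BL_rsum n (f : nat -> R -> R -> R) : (forall k, BL (f k)) -> BL (fun x t => rsum n (fun k => f k x t)).
Proof. intros H; induction n; simpl; [apply BL_const|apply BL_plus; auto]. Qed.
Lemma BL_scal c f : BL f -> BL (fun x t => c * f x t).
Proof. intros; apply BL_mult; auto; apply BL_const. Qed.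
Lemma BL_ext f g : (forall x t, f x t = g x t) -> BL f -> BL g.
Proof.
  intros E H. replace g with f; auto. fext x; apply functional_extensionality; auto.
Qed.

Section Trace.
Variable b : R -> R.
Hypothesis Hadm : admissible b.

Let Hb : smooth_circ b. Proof. apply Hadm. Qed.
Let bpos : forall x, 0 < b x. Proof. apply Hadm. Qed.
Let Hph := phase_ph b Hadm.
Let w x := / b x.
Let s := ph b.
Let sw : smooth_circ w. Proof. apply Hph. Qed.
Let wpos : forall x, 0 < w x. Proof. apply Hph. Qed.
Let sder : forall x, is_derive s x (w x). Proof. apply Hph. Qed.
Let sper : forall x, s (x + 2 * PI) = s x + 2 * PI. Proof. apply Hph. Qed.
Let cs : cts s. Proof. apply (phase_cts _ _ Hph). Qed.
Hint Resolve sc_csn sc_snn : sc.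
Definition sg x t := ph b (x + t) - ph b x.

Lemma sg_lip : exists K, 0 <= K /\ forall x t x' t', Rabs (sg x t - sg x' t') <= K * (Rabs (x - x') + Rabs (t - t')).
Proof.
  destruct (sc_bounded w sw) as [W HW]. assert (W0 : 0 <= W) by (eapply Rle_trans; [apply Rabs_pos|apply (HW 0)]).
  assert (L := lip_of_derive s w W sder HW).
  exists (2 * W); split; [lra|]. intros x t x' t'. unfold sg. fold s.
  replace (s (x + t) - s x - (s (x' + t') - s x')) with ((s (x + t) - s (x' + t')) - (s x - s x')) by ring.
  eapply Rle_trans; [apply Rabs_triang|]. rewrite Rabs_Ropp.
  assert (L1 := L (x + t) (x' + t')). assert (L2 := L x x').
  assert (Rabs (x + t - (x' + t')) <= Rabs (x - x') + Rabs (t - t')).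
  { replace (x + t - (x' + t')) with ((x - x') + (t - t')) by ring. apply Rabs_triang. }
  generalize (Rabs_pos (t - t')); nra.
Qed.
Lemma BL_cos_sg n : BL (fun x t => cos (INR n * sg x t)).
Proof.
  destruct sg_lip as [K [K0 HK]]. apply (BL_cos _ (INR n * K)); [apply Rmult_le_pos; ctac|].
  intros. rewrite <- Rmult_minus_distr_l, Rabs_mult, Rabs_right by (apply Rle_ge; ctac).
  rewrite Rmult_assoc. apply Rmult_le_compat_l; ctac.
Qed.
Lemma BL_Dk n : BL (fun x t => Dk n (sg x t)).
Proof.
  apply (BL_ext (fun x t => 4 * INR n + 8 * rsum n (fun k => (INR n - INR (S k)) * cos (INR (S k) * sg x t)))).
  { intros; symmetry; apply Dk_rsum. }
  apply BL_plus; [apply BL_const|]. apply BL_scal. apply (BL_rsum n (fun k x t => (INR n - INR (S k)) * cos (INR (S k) * sg x t))).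
  intros k; apply BL_scal, BL_cos_sg.
Qed.
Lemma BL_eta N : BL (fun x t => eta N (sg x t)).
Proof.
  unfold eta. apply BL_plus; [apply BL_const|]. apply BL_scal. apply (BL_rsum N (fun k x t => vk N k * cos (INR (S k) * sg x t))).
  intros k; apply BL_scal, BL_cos_sg.
Qed.
Lemma BL_w1 : BL (fun x _ => w x). Proof. apply BL_sc_fst; auto. Qed.
Lemma BL_w2 : BL (fun x t => w (x + t)). Proof. apply BL_sc_sum; auto. Qed.

Lemma int_phase_cos n x : RInt (fun t => w (x + t) * cos (INR n * sg x t)) (- PI) PI = if Nat.eq_dec n 0 then 2 * PI else 0.
Proof.
  set (g := fun y => w y * cos (INR n * (s y - s x))).
  assert (cg : cts g) by (unfold g; apply cts_mult; cstac; apply cts_cos'; ctac).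
  assert (pg : per g).
  { intros y. unfold g. rewrite (sc_per w sw), sper. replace (s y + 2 * PI - s x) with (s y - s x + 2 * PI) by ring.
    rewrite cos_INR_per; auto. }
  transitivity (I2 g).
  - rewrite <- (RInt_per g (- PI + x) cg pg). replace (- PI + x + 2 * PI) with (PI + x) by ring.
    rewrite <- RInt_shift by auto. apply RInt_ext'; intros t. unfold g, sg. rewrite (Rplus_comm t x). auto.
  - assert (Z1 := int_cos_Z' _ _ Hph (Z.of_nat n)). assert (Z2 := int_sin_Z _ _ Hph (Z.of_nat n)).
    rewrite <- INR_IZR_INZ in Z1, Z2.
    transitivity (cos (INR n * s x) * I2 (fun y => cos (INR n * s y) * w y) + sin (INR n * s x) * I2 (fun y => sin (INR n * s y) * w y)).
    + rewrite <- !I2_scal, <- I2_plus; try (apply cts_mult; cstac); try (apply cts_mult; cstac).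
      apply I2_ext; intros y. unfold g. rewrite Rmult_minus_distr_l, cos_minus. ring.
    + change (I2 (fun y => cos (INR n * s y) * w y)) with (I2 (fun x => cos (INR n * ph b x) * / b x)).
      change (I2 (fun y => sin (INR n * s y) * w y)) with (I2 (fun x => sin (INR n * ph b x) * / b x)).
      rewrite Z1, Z2. destruct Nat.eq_dec, Z.eq_dec; try lia; [|toR; ring]. subst. simpl. rewrite Rmult_0_l, cos_0. toR; ring.
Qed.
Lemma cts_w_cos n x : cts (fun t => w (x + t) * cos (INR n * sg x t)).
Proof. apply (BL_cts2 (fun x t => w (x + t) * cos (INR n * sg x t))), BL_mult; [apply BL_w2|apply BL_cos_sg]. Qed.

Lemma int_phase_rsum N (v : nat -> R) (m : nat -> nat) x :
  RInt (fun t => w (x + t) * rsum N (fun k => v k * cos (INR (m k) * sg x t))) (- PI) PI =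
  rsum N (fun k => v k * if Nat.eq_dec (m k) 0 then 2 * PI else 0).
Proof.
  rewrite (RInt_ext' _ (fun t => rsum N (fun k => v k * (w (x + t) * cos (INR (m k) * sg x t))))).
  - rewrite (RInt_rsum N (fun k t => v k * (w (x + t) * cos (INR (m k) * sg x t)))).
    + apply rsum_ext; intros k. rewrite RInt_scal', int_phase_cos by apply cts_w_cos. auto.
    + intros k; apply cts_mult; [apply cts_const|apply cts_w_cos].
  - intros t. rewrite <- rsum_scal. apply rsum_ext; intros; ring.
Qed.
Lemma int_phase_1 x : RInt (fun t => w (x + t)) (- PI) PI = 2 * PI.
Proof.
  assert (H := int_phase_cos 0 x). simpl in H. rewrite <- H. apply RInt_ext'; intros. rewrite Rmult_0_l, cos_0; ring.
Qed.
Lemma rsum_zero n : rsum n (fun _ => 0) = 0.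
Proof. induction n; simpl; lra. Qed.
Lemma cts_w_sum x : cts (fun t => w (x + t)).
Proof. apply (BL_cts2 (fun x t => w (x + t))), BL_w2. Qed.
Lemma cts_w_rsum N (v : nat -> R) (m : nat -> nat) x : cts (fun t => w (x + t) * rsum N (fun k => v k * cos (INR (m k) * sg x t))).
Proof.
  apply (BL_cts2 (fun x t => w (x + t) * rsum N (fun k => v k * cos (INR (m k) * sg x t)))), BL_mult; [apply BL_w2|].
  apply (BL_rsum N (fun k x t => v k * cos (INR (m k) * sg x t))). intros; apply BL_scal, BL_cos_sg.
Qed.
Lemma int_phase_Dk n x : RInt (fun t => w (x + t) * Dk n (sg x t)) (- PI) PI = 8 * PI * INR n.
Proof.
  rewrite (RInt_ext' _ (fun t => 4 * INR n * w (x + t) + 8 * (w (x + t) * rsum n (fun k => (INR n - INR (S k)) * cos (INR (S k) * sg x t)))))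
    by (intros; rewrite Dk_rsum; ring).
  assert (c1 := cts_w_sum x). assert (c2 := cts_w_rsum n (fun k => INR n - INR (S k)) S x).
  rewrite RInt_plus', !RInt_scal' by ctac. rewrite int_phase_1, (int_phase_rsum n (fun k => INR n - INR (S k)) S).
  rewrite (rsum_ext _ _ (fun _ => 0)), rsum_zero; [toR; ring|]. intros; destruct Nat.eq_dec; [lia|ring].
Qed.
Lemma int_phase_eta N x : RInt (fun t => w (x + t) * eta N (sg x t)) (- PI) PI = 2 * PI.
Proof.
  unfold eta.
  rewrite (RInt_ext' _ (fun t => w (x + t) + 2 * (w (x + t) * rsum N (fun k => vk N k * cos (INR (S k) * sg x t))))) by (intros; ring).
  assert (c1 := cts_w_sum x). assert (c2 := cts_w_rsum N (vk N) S x).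
  rewrite RInt_plus', RInt_scal' by ctac. rewrite int_phase_1, (int_phase_rsum N (vk N) S).
  rewrite (rsum_ext _ _ (fun _ => 0)), rsum_zero; [toR; ring|]. intros; destruct Nat.eq_dec; [lia|ring].
Qed.
Lemma int_phase_eta_cos N x : (2 <= N)%nat -> RInt (fun t => w (x + t) * (eta N (sg x t) * cos (sg x t))) (- PI) PI = 2 * PI * vk N 0.
Proof.
  intros HN. unfold eta.
  rewrite (RInt_ext' _ (fun t => w (x + t) * cos (INR 1 * sg x t) + (w (x + t) * rsum N (fun k => vk N k * cos (INR (S (S k)) * sg x t))
     + w (x + t) * rsum N (fun k => vk N k * cos (INR k * sg x t))))).
  - assert (c1 := cts_w_cos 1 x). assert (c2 := cts_w_rsum N (vk N) (fun k => S (S k)) x). assert (c3 := cts_w_rsum N (vk N) (fun k => k) x).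
    rewrite !RInt_plus' by ctac. rewrite int_phase_cos, (int_phase_rsum N (vk N) (fun k => S (S k))), (int_phase_rsum N (vk N) (fun k => k)).
    rewrite (rsum_ext N (fun k => vk N k * (if Nat.eq_dec (S (S k)) 0 then 2 * PI else 0)) (fun _ => 0)), rsum_zero
      by (intros; destruct Nat.eq_dec; [lia|ring]).
    assert (E : forall M, rsum (S M) (fun k => vk N k * (if Nat.eq_dec k 0 then 2 * PI else 0)) = vk N 0 * (2 * PI)).
    { induction M; [simpl; ring|]. cbn [rsum] in *. rewrite IHM. destruct (Nat.eq_dec (S M) 0); [lia|ring]. }
    destruct N as [|M]; [lia|]. rewrite E. destruct Nat.eq_dec; [lia|]. toR; ring.
  - intros t. simpl (INR 1). rewrite Rmult_1_l.
    replace (w (x + t) * ((1 + 2 * rsum N (fun k => vk N k * cos (INR (S k) * sg x t))) * cos (sg x t))) with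
      (w (x + t) * (cos (sg x t) + 2 * cos (sg x t) * rsum N (fun k => vk N k * cos (INR (S k) * sg x t)))) by ring.
    rewrite <- Rmult_plus_distr_l, <- Rmult_plus_distr_l, <- rsum_plus, <- rsum_scal. f_equal. f_equal. apply rsum_ext; intros k.
    rewrite !S_INR.
    replace ((INR k + 1 + 1) * sg x t) with ((INR k + 1) * sg x t + sg x t) by ring.
    replace (INR k * sg x t) with ((INR k + 1) * sg x t - sg x t) by ring.
    rewrite cos_plus, cos_minus. ring.
Qed.

(** [Gn] is the Douglas integrand of [cos (n s)] and [sin (n s)] with increments taken in [x]; [Hn]
    is the same kernel with increments taken in [s], where the energy is exactly that of a pure
    frequency. With [n = k + 1], their difference integrates to [8 PI^2] times [tau b 1 k]. *)
Definition Gn k t := Gf (csn b (S k)) t + Gf (snn b (S k)) t.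
Definition Hn k t := I2 (fun x => w x * w (x + t) * Dk (S k) (sg x t)).

Lemma Gn_int k : RInt (Gn k) (- PI) PI = 8 * PI ^ 2 * (tau b 1 k + 2 * INR (S k)).
Proof.
  unfold Gn. rewrite RInt_plus', !Gf_int by (try apply Gf_cts; sctac). rewrite (tau_1_energy b Hadm).
  toR. field. generalize PI_RGT_0; lra.
Qed.
Lemma BL_ww_Dk n : BL (fun x t => w x * w (x + t) * Dk n (sg x t)).
Proof. apply BL_mult; [apply BL_mult; [apply BL_w1|apply BL_w2]|apply BL_Dk]. Qed.
Lemma Hn_cts k : cts (Hn k).
Proof. apply (BL_param (fun x t => w x * w (x + t) * Dk (S k) (sg x t)) 0 (2 * PI) two_pi_nonneg), BL_ww_Dk. Qed.
Lemma Hn_int k : RInt (Hn k) (- PI) PI = 16 * PI ^ 2 * INR (S k).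
Proof.
  unfold Hn, I2. rewrite (fubini (fun x t => w x * w (x + t) * Dk (S k) (sg x t))); [|ctac|apply BL_ww_Dk].
  rewrite (RInt_ext' _ (fun x => 8 * PI * INR (S k) * w x)).
  - rewrite RInt_scal' by cstac. fold (I2 w). unfold w. rewrite (proj2 (proj2 Hadm)). toR; ring.
  - intros x. rewrite (RInt_ext' _ (fun t => w x * (w (x + t) * Dk (S k) (sg x t)))) by (intros; ring).
    rewrite RInt_scal', int_phase_Dk. toR; ring.
    apply (BL_cts2 (fun x t => w (x + t) * Dk (S k) (sg x t))), BL_mult; [apply BL_w2|apply BL_Dk].
Qed.
Lemma Gn_sin k t : sin (t / 2) ^ 2 * Gn k t = I2 (fun x => 2 - 2 * cos (INR (S k) * sg x t)).
Proof.
  unfold Gn. rewrite Rmult_plus_distr_l, !Gf_sin by sctac.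
  assert (s1 := sc_shift (csn b (S k)) t ltac:(sctac)). assert (s2 := sc_shift (snn b (S k)) t ltac:(sctac)).
  rewrite <- I2_plus by cstac.
  apply I2_ext; intros x. unfold csn, snn, sg. rewrite Rmult_minus_distr_l, cos_minus.
  assert (T1 := sin2_cos2 (INR (S k) * ph b (x + t))). assert (T2 := sin2_cos2 (INR (S k) * ph b x)). unfold Rsqr in *.
  set (c1 := cos (INR (S k) * ph b (x + t))) in *. set (d1 := sin (INR (S k) * ph b (x + t))) in *.
  set (c2 := cos (INR (S k) * ph b x)) in *. set (d2 := sin (INR (S k) * ph b x)) in *. nra.
Qed.

Lemma trace_weighted N : (2 <= N)%nat ->
  8 * PI ^ 2 * rsum N (fun k => vk N k * tau b 1 k) = RInt (fun t => rsum N (fun k => vk N k * (Gn k t - Hn k t))) (- PI) PI.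
Proof.
  intros HN.
  assert (cG : forall k, cts (Gn k)) by (intros k; unfold Gn; apply cts_plus; apply Gf_cts; sctac).
  assert (cH := Hn_cts).
  rewrite (RInt_rsum N (fun k t => vk N k * (Gn k t - Hn k t))) by (intros; ctac).
  rewrite <- rsum_scal. apply rsum_ext; intros k. rewrite RInt_scal', RInt_minus', Gn_int, Hn_int by ctac. toR; ring.
Qed.

(** Weighted by [vk], the numerators [2 - 2 cos] add up to [- eta] at the increment [sg] of the
    angle. For [Gn] this is done here; in [trace_lower] the kernels [Dk] are treated likewise, and
    the sum becomes [eta] times a difference of two double poles. *)
Lemma trace_pointwise N t : (2 <= N)%nat -> sin (t / 2) <> 0 ->
  rsum N (fun k => vk N k * (Gn k t - Hn k t)) =
  I2 (fun x => - eta N (sg x t) / sin (t / 2) ^ 2 - w x * w (x + t) * rsum N (fun k => vk N k * Dk (S k) (sg x t))).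
Proof.
  intros HN Hs.
  assert (Q : sin (t / 2) ^ 2 <> 0) by (apply pow_nonzero; auto).
  assert (cD : forall k, cts (fun x => w x * w (x + t) * Dk (S k) (sg x t))) by (intros k; apply (BL_cts1 _ t (BL_ww_Dk (S k)))).
  assert (cC : forall k, cts (fun x => 2 - 2 * cos (INR (S k) * sg x t))).
  { intros k. apply cts_minus; ctac. apply cts_mult; ctac. apply (BL_cts1 _ t (BL_cos_sg (S k))). }
  transitivity (rsum N (fun k => I2 (fun x => vk N k * (/ sin (t / 2) ^ 2 * (2 - 2 * cos (INR (S k) * sg x t)) - w x * w (x + t) * Dk (S k) (sg x t))))).
  - apply rsum_ext; intros k. rewrite I2_scal, I2_minus, I2_scal by ctac. rewrite <- Gn_sin. unfold Hn. field; auto.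
  - unfold I2. rewrite <- (RInt_rsum N (fun k x => vk N k * (/ sin (t / 2) ^ 2 * (2 - 2 * cos (INR (S k) * sg x t)) - w x * w (x + t) * Dk (S k) (sg x t)))) by (intros; ctac).
    apply RInt_ext'; intros x. rewrite <- (eta_alt N HN).
    transitivity (/ sin (t / 2) ^ 2 * rsum N (fun k => vk N k * (2 - 2 * cos (INR (S k) * sg x t))) +
      (- (w x * w (x + t))) * rsum N (fun k => vk N k * Dk (S k) (sg x t))); [|unfold Rdiv; ring].
    rewrite <- !rsum_scal, <- rsum_plus. apply rsum_ext; intros k. ring.
Qed.
End Trace.

(** * Local analysis of the kernel and the lower bound for the sum of tau_1 *)

Lemma rsum_le_series (a : nat -> R) (l : R) N : (forall n, 0 <= a n) -> is_series a l -> rsum N a <= l.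
Proof.
  intros Ha Hs. destruct N as [|N].
  - simpl. assert (H := is_series_nonneg_term a l 0 Ha Hs). specialize (Ha 0%nat). lra.
  - rewrite rsum_sum_n, <- (is_series_unique _ _ Hs).
    assert (E := Series_minus_sum_n a N ltac:(eexists; apply Hs)).
    assert (0 <= Series (fun k => a (S N + k)%nat)); [|lra].
    transitivity (Series (fun _ => 0 * 0)); [rewrite Series_scal_l; lra|]. apply Series_le; [intros; rewrite Rmult_0_l; split; [lra|auto]|].
    apply (ex_series_incr_n a (S N)). eexists; apply Hs.
Qed.
Lemma series_le_rsum (a : nat -> R) (l C : R) : is_series a l -> (forall N, rsum N a <= C) -> l <= C.
Proof.
  intros Hs H. apply (is_lim_seq_le (fun n => sum_n a n) (fun _ => C) l C); [|exact Hs|apply is_lim_seq_const].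
  intros n. rewrite <- rsum_sum_n. apply H.
Qed.

Lemma taylor_step (h h' : R -> R) B k : h 0 = 0 -> (forall t, is_derive h t (h' t)) ->
  (forall t, Rabs (h' t) <= B * Rabs t ^ k) -> 0 <= B -> forall t, Rabs (h t) <= B * Rabs t ^ S k.
Proof.
  intros H0 Hd HB B0 t. destruct (MVT_gen h 0 t h') as [c [Hc E]]; auto.
  { intros; apply continuity_pt_filterlim, (ex_derive_continuous h). eexists; apply Hd. }
  rewrite H0, !Rminus_0_r in E. rewrite E, Rabs_mult.
  assert (Hct : Rabs c <= Rabs t) by (unfold Rmin, Rmax in Hc; destruct Rle_dec; unfold Rabs; repeat destruct Rcase_abs; lra).
  assert (Rabs c ^ k <= Rabs t ^ k) by (apply pow_incr; split; [apply Rabs_pos|auto]).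
  assert (Rabs (h' c) <= B * Rabs t ^ k) by (eapply Rle_trans; [apply HB|]; apply Rmult_le_compat_l; auto).
  simpl. replace (B * (Rabs t * Rabs t ^ k)) with ((B * Rabs t ^ k) * Rabs t) by ring.
  apply Rmult_le_compat_r; auto. apply Rabs_pos.
Qed.

Lemma sin_lower y : 0 <= y -> y <= 2 -> y - y ^ 3 / 6 <= sin y.
Proof.
  intros H0 H2. assert (y <= PI) by (generalize PI2_3_2; lra).
  destruct (sin_bound y 0 H0 H) as [L _]. unfold sin_approx, sin_term in L. simpl in L. lra.
Qed.
Lemma sin_lower3 y : 0 <= y -> y <= 2 -> y / 3 <= sin y.
Proof. intros H0 H2. generalize (sin_lower y H0 H2). nra. Qed.
(** The true expansion begins with [4 / t^2 + 1 / 3]. The constant 5 leaves room for the cubic lower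
    bound of the sine on the whole half period, and it returns as the factor of [I2 b] in
    [V0_int]. *)
Lemma csc_upper t : 0 < Rabs t <= PI -> / sin (t / 2) ^ 2 <= 4 / t ^ 2 + 5 /\ sin (t / 2) <> 0.
Proof.
  intros Ht. assert (P4 := PI_4).
  assert (G : forall u, 0 < u <= PI -> / sin (u / 2) ^ 2 <= 4 / u ^ 2 + 5 /\ 0 < sin (u / 2)).
  { intros u Hu. set (y := u / 2). assert (Hy : 0 < y <= 2) by (unfold y; lra).
    assert (L := sin_lower y ltac:(lra) ltac:(lra)).
    assert (L2 : 0 < y - y ^ 3 / 6) by nra. split; [|lra].
    replace (4 / u ^ 2 + 5) with (/ y ^ 2 + 5) by (unfold y; field; lra).
    assert (Y : 0 < y ^ 2) by nra.
    assert (S2 : (y - y ^ 3 / 6) ^ 2 <= sin y ^ 2) by (apply pow_incr; lra).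
    assert (S0 : 0 < sin y ^ 2) by nra.
    assert (K : y ^ 2 <= (y - y ^ 3 / 6) ^ 2 * (1 + 5 * y ^ 2)).
    { replace ((y - y ^ 3 / 6) ^ 2) with (y ^ 2 * (1 - y ^ 2 / 6) ^ 2) by field.
      set (Z := y ^ 2) in *. assert (Z <= 4) by (unfold Z; nra).
      assert (1 <= (1 - Z / 6) ^ 2 * (1 + 5 * Z)).
      { replace ((1 - Z / 6) ^ 2 * (1 + 5 * Z)) with (1 + Z * (14 / 3 - 59 / 36 * Z + 5 / 36 * Z ^ 2)) by field.
        assert (0 <= 14 / 3 - 59 / 36 * Z + 5 / 36 * Z ^ 2); [|nra].
        replace (14 / 3 - 59 / 36 * Z + 5 / 36 * Z ^ 2) with (1 / 3 + (4 - Z) * (39 / 36 - 5 / 36 * Z)) by field. nra. }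
      rewrite Rmult_assoc. rewrite <- (Rmult_1_r Z) at 1. apply Rmult_le_compat_l; lra. }
    assert (K2 : y ^ 2 <= sin y ^ 2 * (1 + 5 * y ^ 2)).
    { eapply Rle_trans; [apply K|]. apply Rmult_le_compat_r; lra. }
    apply Rmult_le_reg_r with (sin y ^ 2 * y ^ 2); [apply Rmult_lt_0_compat; lra|].
    replace (/ sin y ^ 2 * (sin y ^ 2 * y ^ 2)) with (y ^ 2) by (field; nra).
    replace ((/ y ^ 2 + 5) * (sin y ^ 2 * y ^ 2)) with (sin y ^ 2 * (1 + 5 * y ^ 2)) by (field; nra). auto. }
  destruct (Rle_lt_dec 0 t) as [Hp|Hn].
  - rewrite Rabs_right in Ht by lra. destruct (G t Ht); split; auto; lra.
  - rewrite Rabs_left in Ht by lra. destruct (G (- t) Ht) as [G1 G2].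
    replace (- t / 2) with (- (t / 2)) in G1, G2 by field. rewrite sin_neg in G1, G2.
    split; [|lra]. replace (sin (t / 2) ^ 2) with ((- sin (t / 2)) ^ 2) by ring. replace (t ^ 2) with ((- t) ^ 2) by ring. auto.
Qed.

Lemma Rabs_mult_le x y a c : Rabs x <= a -> Rabs y <= c -> Rabs (x * y) <= a * c.
Proof. intros; rewrite Rabs_mult; apply Rmult_le_compat; auto; apply Rabs_pos. Qed.
Lemma Rabs_plus_le x y a c : Rabs x <= a -> Rabs y <= c -> Rabs (x + y) <= a + c.
Proof. intros; eapply Rle_trans; [apply Rabs_triang|lra]. Qed.
Lemma Rabs_opp_le x a : Rabs x <= a -> Rabs (- x) <= a.
Proof. rewrite Rabs_Ropp; auto. Qed.

(* The quotient [w w_t / sigma^2 - 1 / t^2] is a difference of double poles; its limit at [t = 0]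
   is one sixth of the Schwarzian derivative of the angle. *)
Lemma pole_difference m B w0 w1 w2 k r t : 0 < m -> 1 <= B -> m <= w0 -> w0 <= B -> Rabs w1 <= B -> Rabs w2 <= B ->
  Rabs k <= B -> Rabs r <= B -> 0 < Rabs t -> Rabs t <= 4 ->
  let mu := w0 + w1 * t / 2 + w2 * t ^ 2 / 6 + r * t ^ 3 in
  let wt := w0 + w1 * t + w2 * t ^ 2 / 2 + k * t ^ 3 in
  let P0 := w2 / (6 * w0) - w1 ^ 2 / (4 * w0 ^ 2) in
  m <= mu ->
  P0 - ((B / m + B ^ 2 / m ^ 2) * (2000 * B ^ 2) + 200 * B ^ 2) / m ^ 2 * Rabs t <= w0 * wt / (t * mu) ^ 2 - / t ^ 2.
Proof.
  intros Hm HB Hw0 Hw0B H1 H2 Hk Hr Ht0 Ht mu wt P0 Hmu.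
  assert (tn : t <> 0) by (intros ->; rewrite Rabs_R0 in Ht0; lra).
  set (Y := w0 * k + - (w1 * w2 / 6) + - (2 * w0 * r) + - (t * (w2 ^ 2 / 36 + w1 * r)) + - (t ^ 2 * (w2 * r / 3)) + - (t ^ 3 * r ^ 2)).
  set (Z := w1 / 2 + w2 * t / 6 + r * t ^ 2).
  set (X := P0 * (- (Z * (w0 + mu))) + Y).
  (* In [w0 wt - mu^2] the orders 0 and 1 cancel; order 2 is [P0 w0^2], and [X] collects the rest
     together with the replacement of [w0^2] by [mu^2]. *)
  assert (E : w0 * wt / (t * mu) ^ 2 - / t ^ 2 = P0 + t * X / mu ^ 2).
  { assert (K : w0 * wt - mu ^ 2 = t ^ 2 * (P0 * mu ^ 2 + t * X)) by (unfold X, Y, Z, P0, wt, mu; field; lra).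
    clearbody mu wt P0 X. replace (w0 * wt / (t * mu) ^ 2 - / t ^ 2) with ((w0 * wt - mu ^ 2) / (t ^ 2 * mu ^ 2)) by (field; split; lra).
    rewrite K. field; split; lra. }
  assert (aw0 : Rabs w0 <= B) by (rewrite Rabs_right; lra).
  assert (at2 : Rabs (t ^ 2) <= 16).
  { replace 16 with (4 * 4) by ring. replace (t ^ 2) with (t * t) by ring. apply Rabs_mult_le; auto. }
  assert (at3 : Rabs (t ^ 3) <= 64).
  { replace 64 with (16 * 4) by ring. replace (t ^ 3) with (t ^ 2 * t) by ring. apply Rabs_mult_le; auto. }
  assert (sq : forall u, Rabs u <= B -> Rabs (u ^ 2) <= B ^ 2).
  { intros u Hu. replace (u ^ 2) with (u * u) by ring. replace (B ^ 2) with (B * B) by ring. apply Rabs_mult_le; auto. }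
  assert (cst : forall u c, 0 < c -> Rabs (u / c) = Rabs u / c).
  { intros u c Hc. unfold Rdiv. rewrite Rabs_mult, (Rabs_right (/ c)); auto. apply Rle_ge, Rinv_nneg; auto. }
  assert (prod : forall u v, Rabs u <= B -> Rabs v <= B -> Rabs (u * v) <= B ^ 2).
  { intros u v Hu Hv. replace (B ^ 2) with (B * B) by ring. apply Rabs_mult_le; auto. }
  assert (B2 : 1 <= B ^ 2) by nra.
  assert (HY : Rabs Y <= 200 * B ^ 2).
  { unfold Y. replace (200 * B ^ 2) with (B ^ 2 + B ^ 2 / 6 + 2 * B ^ 2 + 4 * (B ^ 2 / 36 + B ^ 2) + 16 * (B ^ 2 / 3) + 64 * B ^ 2 + (200 - 3 - 1/6 - 4 - 1/9 - 16/3 - 64) * B ^ 2) by field.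
    apply Rle_trans with (B ^ 2 + B ^ 2 / 6 + 2 * B ^ 2 + 4 * (B ^ 2 / 36 + B ^ 2) + 16 * (B ^ 2 / 3) + 64 * B ^ 2); [|lra].
    apply Rabs_plus_le; [apply Rabs_plus_le; [apply Rabs_plus_le; [apply Rabs_plus_le; [apply Rabs_plus_le|]|]|]|].
    - apply prod; auto.
    - apply Rabs_opp_le. rewrite cst by lra. assert (Q := prod w1 w2 H1 H2). lra.
    - apply Rabs_opp_le. rewrite Rmult_assoc. apply Rabs_mult_le; [rewrite Rabs_right; lra|apply prod; auto].
    - apply Rabs_opp_le, Rabs_mult_le; auto. apply Rabs_plus_le; [rewrite cst by lra; assert (Q := sq w2 H2); lra|apply prod; auto].
    - apply Rabs_opp_le, Rabs_mult_le; auto. rewrite cst by lra. assert (Q := prod w2 r H2 Hr). lra.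
    - apply Rabs_opp_le, Rabs_mult_le; auto. }
  assert (HZ : Rabs Z <= 18 * B).
  { unfold Z. apply Rle_trans with (B / 2 + B * 4 / 6 + B * 16); [|lra].
    apply Rabs_plus_le; [apply Rabs_plus_le|].
    - rewrite cst by lra. lra.
    - rewrite cst by lra. assert (Q := Rabs_mult_le w2 t B 4 H2 Ht). lra.
    - apply Rabs_mult_le; auto. }
  assert (HM : Rabs (w0 + mu) <= 74 * B).
  { unfold mu. apply Rle_trans with (B + (B + B * 4 / 2 + B * 16 / 6 + B * 64)); [|lra].
    apply Rabs_plus_le; auto. apply Rabs_plus_le; [apply Rabs_plus_le; [apply Rabs_plus_le; auto|]|].
    - rewrite cst by lra. assert (Q := Rabs_mult_le w1 t B 4 H1 Ht). lra.
    - rewrite cst by lra. assert (Q := Rabs_mult_le w2 (t ^ 2) B 16 H2 at2). lra.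
    - apply Rabs_mult_le; auto. }
  assert (HP : Rabs P0 <= B / m + B ^ 2 / m ^ 2).
  { unfold P0, Rminus. apply Rabs_plus_le; [|apply Rabs_opp_le].
    - rewrite cst by lra. unfold Rdiv. apply Rmult_le_compat; auto; [apply Rabs_pos|apply Rinv_nneg; lra|].
      apply Rinv_le_contravar; lra.
    - assert (m ^ 2 <= w0 ^ 2) by (apply pow_incr; lra). assert (0 < m ^ 2) by nra.
      rewrite cst by lra. unfold Rdiv. apply Rmult_le_compat; [apply Rabs_pos|apply Rinv_nneg; lra| |].
      + apply sq; auto.
      + apply Rinv_le_contravar; lra. }
  assert (HX : Rabs X <= (B / m + B ^ 2 / m ^ 2) * (2000 * B ^ 2) + 200 * B ^ 2).
  { unfold X. apply Rabs_plus_le; auto. apply Rabs_mult_le; auto. apply Rabs_opp_le.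
    eapply Rle_trans; [apply (Rabs_mult_le _ _ _ _ HZ HM)|]. nra. }
  rewrite E. set (D := (B / m + B ^ 2 / m ^ 2) * (2000 * B ^ 2) + 200 * B ^ 2) in *.
  assert (M2 : 0 < m ^ 2) by nra. assert (M3 : m ^ 2 <= mu ^ 2) by (apply pow_incr; lra).
  assert (Rabs (t * X / mu ^ 2) <= D / m ^ 2 * Rabs t).
  { rewrite cst by lra. rewrite Rabs_mult. unfold Rdiv. replace (D * / m ^ 2 * Rabs t) with (Rabs t * D * / m ^ 2) by ring.
    apply Rmult_le_compat; [apply Rmult_le_pos; apply Rabs_pos|apply Rinv_nneg; lra| |apply Rinv_le_contravar; lra].
    apply Rmult_le_compat_l; auto. apply Rabs_pos. }
  apply Rabs_le_between in H. lra.
Qed.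

Section Trace2.
Variable b : R -> R.
Hypothesis Hadm : admissible b.

Let Hb : smooth_circ b. Proof. apply Hadm. Qed.
Let bpos : forall x, 0 < b x. Proof. apply Hadm. Qed.
Let Hph := phase_ph b Hadm.
Let w x := / b x.
Let s := ph b.
Let sw : smooth_circ w. Proof. apply Hph. Qed.
Let wpos : forall x, 0 < w x. Proof. apply Hph. Qed.
Let sder : forall x, is_derive s x (w x). Proof. apply Hph. Qed.
Let sper : forall x, s (x + 2 * PI) = s x + 2 * PI. Proof. apply Hph. Qed.
Let cs : cts s. Proof. apply (phase_cts _ _ Hph). Qed.
(** One sixth of the Schwarzian derivative of [s], since [s' = w]. In [V0] the factor 4 comes from
    [sin^2 (u / 2)] against [u^2 / 4], the 5 from [csc_upper], and the factor [b] compensates the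
    weight [w (x + t)] with which [eta] has a known integral. *)
Definition Phi0 x := Derive (Derive w) x / (6 * w x) - Derive w x ^ 2 / (4 * w x ^ 2).
Definition V0 x := b x * (4 * Phi0 x - 5).

Lemma is_derive_shift (f f' : R -> R) x t : (forall y, is_derive f y (f' y)) -> is_derive (fun t => f (x + t)) t (f' (x + t)).
Proof.
  intros H. evar_last. apply (is_derive_comp f (fun t => x + t)); [apply H|auto_derive; auto]. unfold scal; simpl; unfold mult; simpl. ring.
Qed.

Lemma is_derive_sub_ext (f g h : R -> R) f' g' l t : (forall u, f u - g u = h u) -> is_derive f t f' -> is_derive g t g' -> f' - g' = l -> is_derive h t l.
Proof. intros E Hf Hg <-. apply (is_derive_ext (fun u => minus (f u) (g u))); [exact E|]. apply (is_derive_minus f g); auto. Qed.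

Lemma sg_taylor : exists B, 1 <= B /\ (forall x, w x <= B) /\ (forall x, Rabs (Derive w x) <= B) /\ (forall x, Rabs (Derive (Derive w) x) <= B) /\
  forall x t, Rabs (w (x + t) - w x - Derive w x * t - Derive (Derive w) x * t ^ 2 / 2) <= B * Rabs t ^ 3 /\
   Rabs (sg b x t - w x * t - Derive w x * t ^ 2 / 2 - Derive (Derive w) x * t ^ 3 / 6) <= B * Rabs t ^ 4.
Proof.
  assert (s1 : smooth_circ (Derive w)) by sctac. assert (s2 : smooth_circ (Derive (Derive w))) by sctac. assert (s3 : smooth_circ (Derive (Derive (Derive w)))) by sctac.
  destruct (sc_bounded w sw) as [B0 H0]. destruct (sc_bounded _ s1) as [B1 H1]. destruct (sc_bounded _ s2) as [B2 H2]. destruct (sc_bounded _ s3) as [B3 H3].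
  set (B := 1 + Rabs B0 + Rabs B1 + Rabs B2 + Rabs B3).
  assert (Q0 := Rabs_pos B0). assert (Q1 := Rabs_pos B1). assert (Q2 := Rabs_pos B2). assert (Q3 := Rabs_pos B3).
  assert (A0 := RRle_abs B0). assert (A1 := RRle_abs B1). assert (A2 := RRle_abs B2). assert (A3 := RRle_abs B3).
  assert (HB : 1 <= B) by (unfold B; lra).
  exists B. split; auto. split; [intros x; specialize (H0 x); generalize (RRle_abs (w x)); unfold B; lra|].
  split; [intros x; specialize (H1 x); unfold B; lra|]. split; [intros x; specialize (H2 x); unfold B; lra|].
  intros x.
  assert (T1 : forall t, Rabs (Derive (Derive w) (x + t) - Derive (Derive w) x) <= B * Rabs t ^ 1).
  { intros t. simpl. rewrite Rmult_1_r. replace t with (x + t - x) at 2 by ring. apply (lip_of_derive _ (Derive (Derive (Derive w)))).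
    - intros; apply sc_is_derive; auto.
    - intros y; specialize (H3 y); unfold B; lra. }
  assert (T2 : forall t, Rabs (Derive w (x + t) - Derive w x - Derive (Derive w) x * t) <= B * Rabs t ^ 2).
  { apply (taylor_step _ (fun t => Derive (Derive w) (x + t) - Derive (Derive w) x) B 1); auto; try lra.
    - rewrite Rplus_0_r; ring.
    - intros t. apply (is_derive_sub_ext (fun t => Derive w (x + t)) (fun t => Derive w x + Derive (Derive w) x * t) _ (Derive (Derive w) (x + t)) (Derive (Derive w) x)).
      + intros; ring.
      + apply (is_derive_shift (Derive w) (Derive (Derive w))); intros; apply sc_is_derive; auto.
      + generalize (Derive w x) (Derive (Derive w) x); intros; auto_derive; auto; ring.
      + ring. }
  assert (T3 : forall t, Rabs (w (x + t) - w x - Derive w x * t - Derive (Derive w) x * t ^ 2 / 2) <= B * Rabs t ^ 3).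
  { apply (taylor_step _ (fun t => Derive w (x + t) - Derive w x - Derive (Derive w) x * t) B 2); auto; try lra.
    - rewrite Rplus_0_r; field.
    - intros t. apply (is_derive_sub_ext (fun t => w (x + t)) (fun t => w x + Derive w x * t + Derive (Derive w) x * t ^ 2 / 2) _ (Derive w (x + t)) (Derive w x + Derive (Derive w) x * t)).
      + intros; ring.
      + apply (is_derive_shift w (Derive w)); intros; apply sc_is_derive; auto.
      + generalize (w x) (Derive w x) (Derive (Derive w) x); intros; auto_derive; auto; field.
      + ring. }
  intros t; split; [apply T3|].
  revert t. apply (taylor_step (fun t => sg b x t - w x * t - Derive w x * t ^ 2 / 2 - Derive (Derive w) x * t ^ 3 / 6)
    (fun t => w (x + t) - w x - Derive w x * t - Derive (Derive w) x * t ^ 2 / 2) B 3); auto; try lra.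
  - unfold sg. rewrite Rplus_0_r; field.
  - intros t. apply (is_derive_sub_ext (fun t => s (x + t)) (fun t => s x + w x * t + Derive w x * t ^ 2 / 2 + Derive (Derive w) x * t ^ 3 / 6) _ (w (x + t)) (w x + Derive w x * t + Derive (Derive w) x * t ^ 2 / 2)).
    + intros; unfold sg; fold s; field.
    + apply (is_derive_shift s w); auto.
    + generalize (s x) (w x) (Derive w x) (Derive (Derive w) x); intros; auto_derive; auto; field.
    + ring.
Qed.

Lemma sg_bounds : exists m, 0 < m /\ (forall x, m <= w x) /\ forall x t, 0 < Rabs t <= PI ->
  m * Rabs t <= Rabs (sg b x t) /\ Rabs (sg b x t) <= 2 * PI - m * Rabs t /\ 0 < t * sg b x t /\ m <= sg b x t / t.
Proof.
  destruct (sc_min_pos w sw wpos) as [m [Hm Hw]]. exists m. split; auto. split; auto.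
  assert (inc : forall x y, x <= y -> m * (y - x) <= s y - s x).
  { intros x y Hxy. rewrite <- (RInt_derive' s w x y) by cstac. rewrite Rmult_comm, <- RInt_const'. apply RInt_le; cstac. }
  intros x t Ht. unfold sg. fold s. destruct (Rle_lt_dec 0 t) as [Hp|Hn].
  - rewrite (Rabs_right t) in * by lra. assert (I1 := inc x (x + t) ltac:(lra)). assert (I2 := inc (x + t) (x + 2 * PI) ltac:(lra)).
    rewrite sper in I2. replace (x + t - x) with t in I1 by ring. replace (x + 2 * PI - (x + t)) with (2 * PI - t) in I2 by ring.
    assert (0 < m * t) by nra. rewrite Rabs_right by lra. split; [lra|]. split; [nra|]. split; [nra|].
    apply Rmult_le_reg_r with t; [lra|]. unfold Rdiv; rewrite (Rmult_assoc (s (x + t) - s x)), Rinv_l; lra.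
  - rewrite (Rabs_left t) in * by lra. assert (I1 := inc (x + t) x ltac:(lra)). assert (I2 := inc x (x + t + 2 * PI) ltac:(lra)).
    rewrite sper in I2. replace (x - (x + t)) with (- t) in I1 by ring. replace (x + t + 2 * PI - x) with (2 * PI - - t) in I2 by ring.
    assert (0 < m * - t) by nra. rewrite Rabs_left by lra. split; [lra|]. split; [nra|]. split; [nra|].
    replace ((s (x + t) - s x) / t) with ((s x - s (x + t)) / (- t)) by (field; lra).
    apply Rmult_le_reg_r with (- t); [lra|]. unfold Rdiv; rewrite (Rmult_assoc (s x - s (x + t))), Rinv_l; lra.
Qed.

Lemma sg_cos m x t : 0 < m -> 0 < Rabs t <= PI -> m * Rabs t <= Rabs (sg b x t) -> Rabs (sg b x t) <= 2 * PI - m * Rabs t ->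
  m ^ 2 * t ^ 2 / 18 <= 1 - cos (sg b x t) /\ sin (sg b x t / 2) <> 0.
Proof.
  intros Hm Ht H1 H2. set (sig := sg b x t) in *. assert (P4 := PI_4).
  assert (L : m * Rabs t / 6 <= sin (Rabs sig / 2)).
  { assert (0 < m * Rabs t) by nra.
    destruct (Rle_lt_dec (Rabs sig / 2) (PI / 2)).
    - assert (Q := sin_lower3 (Rabs sig / 2) ltac:(lra) ltac:(lra)). lra.
    - replace (sin (Rabs sig / 2)) with (sin (PI - Rabs sig / 2)) by (apply sin_PI_x).
      assert (Q := sin_lower3 (PI - Rabs sig / 2) ltac:(lra) ltac:(lra)). lra. }
  assert (E : sin (Rabs sig / 2) ^ 2 = sin (sig / 2) ^ 2).
  { unfold Rabs; destruct Rcase_abs; auto. replace (- sig / 2) with (- (sig / 2)) by field. rewrite sin_neg; ring. }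
  assert (P : 0 < m * Rabs t / 6) by nra.
  assert (S2 : (m * Rabs t / 6) ^ 2 <= sin (sig / 2) ^ 2) by (rewrite <- E; apply pow_incr; lra).
  assert (T2 : Rabs t ^ 2 = t ^ 2) by apply pow2_abs.
  split.
  - replace (cos sig) with (cos (2 * (sig / 2))) by (f_equal; field). rewrite cos_2a_sin.
    replace ((m * Rabs t / 6) ^ 2) with (m ^ 2 * Rabs t ^ 2 / 36) in S2 by field. rewrite T2 in S2. simpl in *. lra.
  - intros Z. rewrite Z in S2. nra.
Qed.

(** At [t = 0] the two sides are compared with an error linear in [t]. An arbitrarily small [e]
    together with a multiple of [1 - cos sg], which is at least of order [t^2], absorbs it. [C] may
    depend on [b], because the concentration of [eta] removes it later. *)
Lemma key_ineq e : 0 < e -> exists C, 0 <= C /\ forall x t, 0 < Rabs t <= PI ->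
  w (x + t) * (V0 x - e - C * (1 - cos (sg b x t))) <= w x * w (x + t) / sin (sg b x t / 2) ^ 2 - / sin (t / 2) ^ 2.
Proof.
  intros He. destruct sg_taylor as (B & HB & HwB & Hw1 & Hw2 & HT). destruct sg_bounds as (m & Hm & Hwm & HS).
  set (Pm0 := B / m + B ^ 2 / m ^ 2).
  set (C1 := (Pm0 * (2000 * B ^ 2) + 200 * B ^ 2) / m ^ 2).
  set (C3 := 4 * C1 + B / m * (4 * Pm0 + 5)).
  assert (P0p : 0 <= Pm0).
  { unfold Pm0. assert (0 < B / m) by (apply Rdiv_lt_0_compat; lra). assert (0 < B ^ 2 / m ^ 2) by (apply Rdiv_lt_0_compat; nra). lra. }
  assert (C1p : 0 <= C1).
  { unfold C1. apply Rmult_le_pos; [|apply Rinv_nneg; nra]. assert (0 <= Pm0 * (2000 * B ^ 2)) by (apply Rmult_le_pos; nra). nra. }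
  assert (C3p : 0 <= C3).
  { unfold C3. assert (0 < B / m) by (apply Rdiv_lt_0_compat; lra). assert (0 <= B / m * (4 * Pm0 + 5)) by (apply Rmult_le_pos; lra). lra. }
  (* From [C3 |t| <= m e + C3^2 t^2 / (4 e m)]: [t^2] is bounded by [18 (1 - cos sg) / m^2] through
     [sg_cos], and one more [m] is the lower bound of the weight [w (x + t)]. *)
  set (C := 18 * C3 ^ 2 / (4 * e * m ^ 4)).
  assert (m4 : 0 < m ^ 4) by (apply pow_lt; auto).
  exists C. split.
  { unfold C. apply Rmult_le_pos; [generalize (pow2_ge_0 C3); lra|apply Rinv_nneg; nra]. }
  intros x t Ht. destruct (HS x t Ht) as (S1 & S2 & S3 & S4). destruct (sg_cos m x t Hm Ht S1 S2) as [S5 S6].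
  destruct (HT x t) as [T1 T2]. destruct (csc_upper t Ht) as [U1 U2]. assert (P4 := PI_4).
  assert (tn : t <> 0) by (intros ->; rewrite Rabs_R0 in Ht; lra).
  assert (At : Rabs t <= 4) by lra.
  assert (Hwx := Hwm x). assert (Hwt := Hwm (x + t)).
  set (sig := sg b x t) in *. set (wt := w (x + t)) in *. set (w0 := w x) in *.
  set (w1 := Derive w x) in *. set (w2 := Derive (Derive w) x) in *.
  set (k := (wt - w0 - w1 * t - w2 * t ^ 2 / 2) / t ^ 3). set (r := (sig - w0 * t - w1 * t ^ 2 / 2 - w2 * t ^ 3 / 6) / t ^ 4).
  assert (Hk : Rabs k <= B).
  { unfold k, Rdiv. rewrite Rabs_mult, Rabs_inv, <- RPow_abs. assert (0 < Rabs t ^ 3) by (apply pow_lt; lra).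
    apply Rmult_le_reg_r with (Rabs t ^ 3); auto. rewrite Rmult_assoc, Rinv_l, Rmult_1_r; lra. }
  assert (Hr : Rabs r <= B).
  { unfold r, Rdiv. rewrite Rabs_mult, Rabs_inv, <- RPow_abs. assert (0 < Rabs t ^ 4) by (apply pow_lt; lra).
    apply Rmult_le_reg_r with (Rabs t ^ 4); auto. rewrite Rmult_assoc, Rinv_l, Rmult_1_r; lra. }
  assert (Emu : w0 + w1 * t / 2 + w2 * t ^ 2 / 6 + r * t ^ 3 = sig / t) by (unfold r; field; auto).
  assert (Ewt : w0 + w1 * t + w2 * t ^ 2 / 2 + k * t ^ 3 = wt) by (unfold k; field; auto).
  assert (D := pole_difference m B w0 w1 w2 k r t Hm HB Hwx (HwB x) (Hw1 x) (Hw2 x) Hk Hr (proj1 Ht) At). cbv zeta in D.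
  rewrite Emu, Ewt in D. specialize (D S4). fold Pm0 in D. fold C1 in D.
  replace (t * (sig / t)) with sig in D by (field; auto).
  change (w2 / (6 * w0) - w1 ^ 2 / (4 * w0 ^ 2)) with (Phi0 x) in D.
  assert (sign : sig <> 0) by (intros Z; rewrite Z in S3; lra).
  assert (sig2 : 0 < sig ^ 2) by (apply pow2_gt_0; auto).
  assert (ss2 : 0 < sin (sig / 2) ^ 2) by (apply pow2_gt_0; auto).
  assert (W1 : 4 * (w0 * wt / sig ^ 2) <= w0 * wt / sin (sig / 2) ^ 2).
  { replace (4 * (w0 * wt / sig ^ 2)) with (w0 * wt * / (sig / 2) ^ 2) by (field; auto).
    unfold Rdiv at 2. apply Rmult_le_compat_l; [nra|]. apply Rinv_le_contravar; auto.
    rewrite <- (pow2_abs (sin _)), <- (pow2_abs (sig / 2)). apply pow_incr; split; [apply Rabs_pos|]. apply (trig_bound1 (sig / 2)). }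
  assert (L1 : 4 * Phi0 x - 5 - 4 * C1 * Rabs t <= w0 * wt / sin (sig / 2) ^ 2 - / sin (t / 2) ^ 2).
  { replace (4 / t ^ 2) with (4 * / t ^ 2) in U1 by (unfold Rdiv; ring). lra. }
  assert (HP0 : Rabs (Phi0 x) <= Pm0).
  { unfold Phi0. fold w0 w1 w2. unfold Pm0, Rminus. apply Rabs_plus_le; [|apply Rabs_opp_le].
    - unfold Rdiv. rewrite Rabs_mult, Rabs_inv, (Rabs_right (6 * w0)) by lra. apply Rmult_le_compat; auto; [apply Rabs_pos|apply Rinv_nneg; lra|apply Hw2|].
      apply Rinv_le_contravar; lra.
    - assert (m ^ 2 <= w0 ^ 2) by (apply pow_incr; lra). assert (0 < m ^ 2) by nra.
      unfold Rdiv. rewrite Rabs_mult, Rabs_inv, (Rabs_right (4 * w0 ^ 2)) by lra. apply Rmult_le_compat; [apply Rabs_pos|apply Rinv_nneg; lra| |].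
      + rewrite <- RPow_abs. apply pow_incr; split; [apply Rabs_pos|apply Hw1].
      + apply Rinv_le_contravar; lra. }
  assert (Hwb : Rabs (wt * b x - 1) <= B / m * Rabs t).
  { assert (E : wt * b x - 1 = (wt - w0) * / w0).
    { unfold w0, w. rewrite Rinv_inv. rewrite Rmult_minus_distr_r. rewrite Rinv_l; auto. generalize (bpos x); lra. }
    rewrite E, Rabs_mult, Rabs_inv, (Rabs_right w0) by lra.
    replace (B / m * Rabs t) with ((B * Rabs t) * / m) by (unfold Rdiv; ring).
    apply Rmult_le_compat; [apply Rabs_pos|apply Rinv_nneg; lra| |apply Rinv_le_contravar; lra].
    unfold wt, w0. replace t with (x + t - x) at 2 by ring. apply (lip_of_derive w (Derive w)); auto. intros; apply sc_is_derive; auto. }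
  assert (L2 : wt * V0 x <= 4 * Phi0 x - 5 + B / m * (4 * Pm0 + 5) * Rabs t).
  { unfold V0. replace (wt * (b x * (4 * Phi0 x - 5))) with ((4 * Phi0 x - 5) + (wt * b x - 1) * (4 * Phi0 x - 5)) by ring.
    assert (Q : Rabs ((wt * b x - 1) * (4 * Phi0 x - 5)) <= (B / m * Rabs t) * (4 * Pm0 + 5)).
    { apply Rabs_mult_le; auto. unfold Rminus. apply Rabs_plus_le; [|rewrite Rabs_Ropp, Rabs_right; lra].
      rewrite Rabs_mult, (Rabs_right 4) by lra. lra. }
    apply Rabs_le_between in Q. lra. }
  assert (L3 : C3 * Rabs t <= wt * (e + C * (1 - cos sig))).
  { assert (Q1 : e + C * (m ^ 2 * t ^ 2 / 18) <= e + C * (1 - cos sig)).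
    { apply Rplus_le_compat_l, Rmult_le_compat_l; auto. unfold C. apply Rmult_le_pos; [generalize (pow2_ge_0 C3); lra|apply Rinv_nneg; nra]. }
    assert (Q2 : m * (e + C * (m ^ 2 * t ^ 2 / 18)) = m * e + C3 ^ 2 * t ^ 2 / (4 * e * m)).
    { unfold C. field. lra. }
    assert (Q3 : C3 * Rabs t <= m * e + C3 ^ 2 * t ^ 2 / (4 * e * m)).
    { rewrite <- (pow2_abs t).
      assert (0 <= (2 * e * m - C3 * Rabs t) ^ 2 / (4 * e * m)).
      { apply Rmult_le_pos; [apply pow2_ge_0|apply Rinv_nneg; nra]. }
      replace ((2 * e * m - C3 * Rabs t) ^ 2 / (4 * e * m)) with (m * e - C3 * Rabs t + C3 ^ 2 * Rabs t ^ 2 / (4 * e * m)) in H by (field; lra). lra. }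
    assert (0 <= e + C * (m ^ 2 * t ^ 2 / 18)).
    { assert (0 <= m * (e + C * (m ^ 2 * t ^ 2 / 18))) by (rewrite Q2; generalize (Rabs_pos t); nra).
      apply Rmult_le_reg_l with m; auto. lra. }
    nra. }
  unfold C3 in L3. lra.
Qed.

Lemma V0_cts : smooth_circ V0.
Proof.
  assert (E : V0 = fun x => b x * (4 * (Derive (Derive w) x * (/ 6 * b x) + (- / 4) * (Derive w x ^ 2 * b x ^ 2)) - 5)).
  { fext x. unfold V0, Phi0, w. generalize (bpos x); intros. field; lra. }
  rewrite E. sctac.
Qed.
(** The part with [b''] is a total derivative. What is left of the Schwarzian has the sign of
    [b'^2 / b], and because of this sign the trace bounds [b]. *)
Lemma V0_int : I2 V0 = / 3 * I2 (fun x => Derive b x ^ 2 * / b x) - 5 * I2 b.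
Proof.
  assert (E1 : Derive w = fun x => - Derive b x * (/ b x * / b x)).
  { fext x. apply is_derive_unique. evar_last.
    - apply (is_derive_inv b x (Derive b x)); [apply sc_is_derive; auto|generalize (bpos x); lra].
    - generalize (bpos x); intros; simpl; field; lra. }
  assert (E2 : Derive (Derive w) = fun x => - Derive (Derive b) x * (/ b x * / b x) + 2 * (Derive b x ^ 2 * (/ b x * / b x * / b x))).
  { rewrite E1. rewrite (Derive_mult_sc (fun x => - Derive b x) (fun x => / b x * / b x)) by sctac.
    rewrite (Derive_mult_sc (fun x => / b x) (fun x => / b x)) by sctac. fold w. rewrite E1.
    fext x. rewrite Derive_opp. unfold w. ring. }
  transitivity (I2 (fun x => (- (2 / 3)) * Derive (Derive b) x + (/ 3 * (Derive b x ^ 2 * / b x) - 5 * b x))).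
  - apply I2_ext; intros x. unfold V0, Phi0. rewrite E2, E1. unfold w. generalize (bpos x); intros. field; lra.
  - rewrite I2_plus, I2_minus, !I2_scal by cstac.
    rewrite (I2_derive_per (Derive b) (Derive (Derive b))); cstac; [ring|]. intros; apply sc_is_derive; sctac.
Qed.

(** [key_ineq] is integrated against [eta (sg x t)]. In the variable [sg] the integrals over [t] are
    Fourier coefficients of [eta], so [V0] comes out with a constant weight and [1 - cos] becomes
    [1 - vk N 0]. *)
Lemma trace_lower N e C T : (2 <= N)%nat -> 0 < e ->
  (forall x t, 0 < Rabs t <= PI ->
    w (x + t) * (V0 x - e - C * (1 - cos (sg b x t))) <= w x * w (x + t) / sin (sg b x t / 2) ^ 2 - / sin (t / 2) ^ 2) ->
  (forall n, 0 <= tau b 1 n) -> is_series (tau b 1) T ->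
  I2 V0 - 2 * PI * e - 2 * PI * C * (1 - vk N 0) <= 4 * PI * T.
Proof.
  intros HN He HC Ht HT. assert (PP := PI_RGT_0). destruct sg_bounds as (m & Hm & Hwm & HS).
  (* The terms [tau_1] are nonnegative, so weights of modulus at most one can only lower the sum. *)
  assert (A : rsum N (fun k => vk N k * tau b 1 k) <= T).
  { apply Rle_trans with (rsum N (tau b 1)).
    - assert (G : forall M, (M <= N)%nat -> rsum M (fun k => vk N k * tau b 1 k) <= rsum M (tau b 1)).
      { induction M; intros HM; cbn [rsum]; [lra|]. assert (IH := IHM ltac:(lia)).
        assert (V := vk_abs N HN M ltac:(lia)). apply Rabs_le_between in V. specialize (Ht M). nra. }
      apply G; auto.
    - apply rsum_le_series; auto. }
  assert (BLf : BL (fun x t => w (x + t) * eta N (sg b x t) * (V0 x - e - C * (1 - cos (INR 1 * sg b x t))))).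
  { apply BL_mult; [apply BL_mult; [apply (BL_w2 b Hadm)|apply (BL_eta b Hadm)]|].
    apply (BL_ext (fun x t => (V0 x + (- e - C)) + C * cos (INR 1 * sg b x t))); [intros; ring|].
    apply BL_plus; [apply BL_plus; [apply BL_sc_fst, V0_cts|apply BL_const]|apply BL_scal, (BL_cos_sg b Hadm)]. }
  set (L := fun t => I2 (fun x => w (x + t) * eta N (sg b x t) * (V0 x - e - C * (1 - cos (INR 1 * sg b x t))))).
  assert (cL : cts L) by (apply (BL_param _ 0 (2 * PI) two_pi_nonneg BLf)).
  set (J := fun t => rsum N (fun k => vk N k * (Gn b k t - Hn b k t))).
  assert (cJ : cts J).
  { apply (cts_rsum N (fun k t => vk N k * (Gn b k t - Hn b k t))). intros k. apply cts_mult; ctac.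
    apply cts_minus; [|apply Hn_cts; auto]. unfold Gn. apply cts_plus; apply Gf_cts; [apply sc_csn|apply sc_snn]; auto. }
  assert (IL : RInt L (- PI) PI = 2 * PI * I2 V0 - 4 * PI ^ 2 * e - 4 * PI ^ 2 * C * (1 - vk N 0)).
  { unfold L, I2 at 1. rewrite (fubini (fun x t => w (x + t) * eta N (sg b x t) * (V0 x - e - C * (1 - cos (INR 1 * sg b x t)))) 0 (2 * PI) (- PI) PI two_pi_nonneg BLf).
    rewrite (RInt_ext' _ (fun x => 2 * PI * V0 x + (- (2 * PI * (e + C)) + 2 * PI * C * vk N 0))).
    - assert (c0 := sc_cts _ V0_cts). rewrite RInt_plus', RInt_scal', RInt_const' by ctac. fold (I2 V0). toR; ring.
    - intros x.
      assert (c1 : cts (fun t => w (x + t) * eta N (sg b x t))) by (apply (BL_cts2 (fun x t => w (x + t) * eta N (sg b x t))), BL_mult; [apply (BL_w2 b Hadm)|apply (BL_eta b Hadm)]).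
      assert (c2 : cts (fun t => w (x + t) * (eta N (sg b x t) * cos (sg b x t)))).
      { apply (BL_cts2 (fun x t => w (x + t) * (eta N (sg b x t) * cos (sg b x t)))), BL_mult; [apply (BL_w2 b Hadm)|].
        apply BL_mult; [apply (BL_eta b Hadm)|]. apply (BL_ext (fun x t => cos (INR 1 * sg b x t))); [intros; simpl; rewrite Rmult_1_l; auto|apply (BL_cos_sg b Hadm)]. }
      rewrite (RInt_ext' _ (fun t => (V0 x - e - C) * (w (x + t) * eta N (sg b x t)) + C * (w (x + t) * (eta N (sg b x t) * cos (sg b x t))))).
      + rewrite RInt_plus', !RInt_scal' by ctac. unfold w. rewrite (int_phase_eta b Hadm), (int_phase_eta_cos b Hadm) by auto. toR; ring.
      + intros t. simpl (INR 1). rewrite Rmult_1_l. ring. }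
  assert (PT : forall t, 0 < Rabs t <= PI -> L t <= J t).
  { intros t Htt. destruct (csc_upper t Htt) as [_ Hs]. unfold J. rewrite (trace_pointwise b Hadm N t HN Hs). unfold L.
    apply I2_le.
    - apply (BL_cts1 _ t BLf).
    - apply cts_minus.
      + unfold Rdiv. apply cts_mult; ctac. apply cts_opp, (BL_cts1 _ t (BL_eta b Hadm N)).
      + apply (BL_cts1 (fun x t => / b x * / b (x + t) * rsum N (fun k => vk N k * Dk (S k) (sg b x t))) t).
        apply BL_mult; [apply BL_mult; [apply (BL_w1 b Hadm)|apply (BL_w2 b Hadm)]|].
        apply (BL_rsum N (fun k x t => vk N k * Dk (S k) (sg b x t))). intros; apply BL_scal, (BL_Dk b Hadm).
    - intros x. destruct (HS x t Htt) as (S1 & S2 & _ & _). destruct (sg_cos m x t Hm Htt S1 S2) as [_ S6].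
      specialize (HC x t Htt). simpl (INR 1). rewrite Rmult_1_l.
      assert (Q : sin (sg b x t / 2) ^ 2 <> 0) by (apply pow_nonzero; auto).
      assert (Q' : sin (t / 2) ^ 2 <> 0) by (apply pow_nonzero; auto).
      assert (ED : sin (sg b x t / 2) ^ 2 * rsum N (fun k => vk N k * Dk (S k) (sg b x t)) = - eta N (sg b x t)).
      { rewrite <- (eta_alt N HN), <- rsum_scal. apply rsum_ext; intros k. rewrite <- (Dk_sin (S k)). ring. }
      assert (ED' : rsum N (fun k => vk N k * Dk (S k) (sg b x t)) = - eta N (sg b x t) / sin (sg b x t / 2) ^ 2) by (rewrite <- ED; field; auto).
      rewrite ED'. fold (w x) (w (x + t)).
      replace (- eta N (sg b x t) / sin (t / 2) ^ 2 - w x * w (x + t) * (- eta N (sg b x t) / sin (sg b x t / 2) ^ 2))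
        with (eta N (sg b x t) * (w x * w (x + t) / sin (sg b x t / 2) ^ 2 - / sin (t / 2) ^ 2)) by (field; auto).
      replace (w (x + t) * eta N (sg b x t) * (V0 x - e - C * (1 - cos (sg b x t)))) with (eta N (sg b x t) * (w (x + t) * (V0 x - e - C * (1 - cos (sg b x t))))) by ring.
      apply Rmult_le_compat_l; auto. apply eta_nonneg; auto. }
  (* The pointwise inequality is known for [t <> 0] only; the interval is cut so that the origin
     becomes an end point. *)
  assert (IJ : RInt L (- PI) PI <= RInt J (- PI) PI).
  { rewrite <- (RInt_Chasles' L (- PI) 0 PI), <- (RInt_Chasles' J (- PI) 0 PI) by auto. apply Rplus_le_compat; apply RInt_le; ctac; try lra; intros t Ht1; apply PT.
    - rewrite Rabs_left; lra.
    - rewrite Rabs_right; lra. }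
  assert (TW := trace_weighted b Hadm N HN). fold J in TW. rewrite <- TW, IL in IJ.
  assert (0 < 2 * PI) by lra. assert (0 < PI ^ 2) by nra.
  apply Rmult_le_reg_l with (2 * PI); auto.
  assert (8 * PI ^ 2 * rsum N (fun k => vk N k * tau b 1 k) <= 8 * PI ^ 2 * T) by (apply Rmult_le_compat_l; lra). lra.
Qed.

Theorem trace_bound T : (forall n, 0 <= tau b 1 n) -> is_series (tau b 1) T ->
  I2 (fun x => Derive b x ^ 2 * / b x) <= 3 * (4 * PI * T + 5 * I2 b).
Proof.
  intros Ht HT. assert (PP := PI_RGT_0).
  assert (G : I2 V0 <= 4 * PI * T); [|rewrite V0_int in G; lra].
  apply Rnot_lt_le. intros Hlt. set (d := I2 V0 - 4 * PI * T). assert (Hd : 0 < d) by (unfold d; lra).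
  (* If the bound failed by [d], this [e] and a sufficiently large [N] would each cost at most
     [d / 4], which is a contradiction. *)
  set (e := d / (8 * PI)). assert (He : 0 < e) by (apply Rdiv_lt_0_compat; lra).
  destruct (key_ineq e He) as [C [HC0 HC]].
  assert (L := vk_lim). apply is_lim_seq_spec in L.
  assert (Hq : 0 < d / (8 * PI * (C + 1))) by (apply Rdiv_lt_0_compat; nra).
  destruct (L (mkposreal _ Hq)) as [N HN]. specialize (HN N (Nat.le_refl _)). simpl in HN.
  assert (B := trace_lower (S (S N)) e C T ltac:(lia) He HC Ht HT).
  apply Rabs_def2 in HN. destruct HN as [_ HN].
  assert (E1 : 2 * PI * e = d / 4) by (unfold e; field; lra).
  assert (E2 : 2 * PI * C * (1 - vk (S (S N)) 0) <= d / 4).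
  { apply Rle_trans with (2 * PI * C * (d / (8 * PI * (C + 1)))).
    - apply Rmult_le_compat_l; [nra|lra].
    - replace (2 * PI * C * (d / (8 * PI * (C + 1)))) with (d / 4 * (C / (C + 1))) by (field; lra).
      assert (C / (C + 1) <= 1).
      { apply Rmult_le_reg_r with (C + 1); [lra|]. unfold Rdiv; rewrite Rmult_assoc, Rinv_l; lra. }
      nra. }
  unfold d in *. lra.
Qed.
End Trace2.

(** * Zeta values as sums of tau *)

Definition zeta_data b lam phi (Z : C -> C) := eigen_decomp b lam phi /\
  (forall z : C, z <> RtoC 1 -> ex_derive (K := C_AbsRing) (V := C_NormedModule) Z z) /\
  (forall z : C, 1 < Re z -> is_series (fun k => cpow_neg (lam (S k)) z) (Z z)).

(** On the real axis the terms are positive, so convergence there is absolute convergence on the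
    whole vertical line. *)
Lemma zeta_abs_series b lam phi Z x : zeta_data b lam phi Z -> 1 < x -> ex_series (fun k => exp (- x * ln (lam (S k)))).
Proof.
  intros (_ & _ & H) Hx. specialize (H (RtoC x) Hx). apply is_series_C in H. destruct H as [H _].
  eexists. refine (is_series_ext _ _ _ _ H). intros k. unfold cpow_neg, RtoC, Re, Im; simpl.
  replace (- 0 * ln (lam (S k))) with 0 by ring. rewrite cos_0, Rmult_1_r. reflexivity.
Qed.

Lemma zeta_minus_Xi b lam phi Z z : admissible b -> zeta_data b lam phi Z -> 1 < Re z ->
  is_series (fun n => 2 * fst (Ee (- ln (INR (S n))) z)) (fst (Z z) - fst (Xi b lam phi z)) /\
  is_series (fun n => 2 * snd (Ee (- ln (INR (S n))) z)) (snd (Z z) - snd (Xi b lam phi z)).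
Proof.
  intros Hadm HD Hz. assert (HX := zeta_abs_series _ _ _ _ _ HD Hz). destruct HD as (HE & _ & HS).
  specialize (HS z Hz). apply is_series_C in HS. destruct HS as [S1 S2].
  assert (X := xi_split b lam phi Hadm HE z HX).
  replace (Series (fun k => fst (Ee (- ln (lam (S k))) z))) with (fst (Z z)) in X.
  2:{ symmetry. apply is_series_unique. refine (is_series_ext _ _ _ _ S1). intros k; rewrite cpow_Ee; auto. }
  replace (Series (fun k => snd (Ee (- ln (lam (S k))) z))) with (snd (Z z)) in X.
  2:{ symmetry. apply is_series_unique. refine (is_series_ext _ _ _ _ S2). intros k; rewrite cpow_Ee; auto. }
  exact X.
Qed.

(** For [Re z > 1] both [Z - Xi] and [Z' - Xi'] are the sum of [2 n^-z]. Their difference is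
    holomorphic off 1, and the identity theorem carries its vanishing to [- q]. *)
Lemma zeta_minus_Xi_unique b lam phi Z b' lam' phi' Z' q : admissible b -> zeta_data b lam phi Z -> admissible b' -> zeta_data b' lam' phi' Z' ->
  fst (Z (RtoC (- INR q))) - fst (Xi b lam phi (RtoC (- INR q))) = fst (Z' (RtoC (- INR q))) - fst (Xi b' lam' phi' (RtoC (- INR q))).
Proof.
  intros Ha HD Ha' HD'.
  assert (I := identity_punctured (fun z => (Z z - Xi b lam phi z) - (Z' z - Xi b' lam' phi' z))%C).
  assert (E : (Z (RtoC (- INR q)) - Xi b lam phi (RtoC (- INR q)) - (Z' (RtoC (- INR q)) - Xi b' lam' phi' (RtoC (- INR q))))%C = RtoC 0).
  { apply I.
    - intros z Hz. destruct HD as (HE & Hd & _). destruct HD' as (HE' & Hd' & _).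
      destruct (Hd z Hz) as [l1 L1]. destruct (Hd' z Hz) as [l2 L2]. destruct (Xi_Cd b lam phi Ha HE z) as [l3 L3]. destruct (Xi_Cd b' lam' phi' Ha' HE' z) as [l4 L4].
      eexists. exact (Cd_minus _ _ _ _ _ (Cd_minus _ _ _ _ _ (is_derive_Cd _ _ _ L1) L3) (Cd_minus _ _ _ _ _ (is_derive_Cd _ _ _ L2) L4)).
    - intros z Hz. destruct (zeta_minus_Xi _ _ _ _ z Ha HD Hz) as [A1 A2]. destruct (zeta_minus_Xi _ _ _ _ z Ha' HD' Hz) as [A3 A4].
      assert (E1 := eq_trans (eq_sym (is_series_unique _ _ A1)) (is_series_unique _ _ A3)).
      assert (E2 := eq_trans (eq_sym (is_series_unique _ _ A2)) (is_series_unique _ _ A4)).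
      destruct (Z z), (Z' z), (Xi b lam phi z), (Xi b' lam' phi' z). simpl in E1, E2. unfold Cminus, Cplus, Copp, RtoC, fst, snd. f_equal; lra.
    - generalize (pos_INR q); lra. }
  destruct (Z (RtoC (- INR q))) as [a1 a2], (Z' (RtoC (- INR q))) as [a3 a4], (Xi b lam phi (RtoC (- INR q))) as [a5 a6], (Xi b' lam' phi' (RtoC (- INR q))) as [a7 a8].
  apply (f_equal fst) in E. unfold Cminus, Cplus, Copp, RtoC, fst, snd in *. lra.
Qed.

(* The constants are those of [b = 1], where [Xi] vanishes; only their independence of [b] matters. *)
Lemma zeta_kappa : exists kappa : nat -> R, forall b lam phi Z, admissible b -> zeta_data b lam phi Z ->
  forall q, is_series (tau b q) (fst (Z (RtoC (- INR q))) - kappa q).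
Proof.
  (* Any member of the class may serve as the reference; if there is none, the claim is empty. *)
  destruct (classic (exists b lam phi Z, admissible b /\ zeta_data b lam phi Z)) as [(b0 & lam0 & phi0 & Z0 & Ha0 & HD0)|Hn].
  - exists (fun q => fst (Z0 (RtoC (- INR q))) - fst (Xi b0 lam0 phi0 (RtoC (- INR q)))). intros b lam phi Z Ha HD q.
    assert (X := Xi_tau b lam phi Ha (proj1 HD) q). rewrite (zeta_minus_Xi_unique b0 lam0 phi0 Z0 b lam phi Z q Ha0 HD0 Ha HD).
    eapply is_series_RR; [apply X|ring].
  - exists (fun _ => 0). intros b lam phi Z Ha HD. destruct Hn. exists b, lam, phi, Z; auto.
Qed.

Lemma Kc_admissible c b : Kc c b -> admissible b.
Proof. intros (H1 & H2 & H3 & _). split; auto. Qed.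
Lemma Kc_mean c b : Kc c b -> 0 <= I2 b <= 2 * PI * c O.
Proof.
  intros K. destruct (Kc_admissible c b K) as (H1 & H2 & _). destruct K as (_ & _ & _ & H3 & _).
  split; [apply I2_nonneg; cstac; intros; apply Rlt_le; auto|].
  change 0%Z with (Z.of_nat 0) in H3. rewrite fourierR_nat in H3 by cstac. simpl in H3. rewrite fc_0 in H3.
  assert (P := two_pi_pos). apply Rmult_le_compat_l with (r := 2 * PI) in H3; [|lra]. rewrite <- Rmult_assoc, Rinv_r, Rmult_1_l in H3; lra.
Qed.
Lemma zeta_value_tau (kappa : nat -> R) q b s v : (forall b lam phi Z, admissible b -> zeta_data b lam phi Z ->
    forall q, is_series (tau b q) (fst (Z (RtoC (- INR q))) - kappa q)) ->
  admissible b -> s = - INR q -> zeta_value b (RtoC s) v -> is_series (tau b q) (Re v - kappa q).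
Proof.
  intros Hk Ha -> (lam & phi & HE & Z & H1 & H2 & <-). apply (Hk b lam phi Z Ha). split; auto.
Qed.

Definition kappa_spec (kappa : nat -> R) := forall c b, Kc c b ->
  (exists T, is_series (tau b 1) T /\ T <= c 1%nat - kappa 1%nat) /\
  (forall m, (1 <= m)%nat -> exists T, is_series (tau b (2 * m)) T /\ T <= c (S m) - kappa (2 * m)%nat).
Lemma kappa_exists : exists kappa, kappa_spec kappa.
Proof.
  destruct zeta_kappa as [kappa Hk]. exists kappa. intros c b K. assert (Ha := Kc_admissible c b K).
  destruct K as (_ & _ & _ & _ & (v & Hv & Lv) & Hm). split.
  - exists (Re v - kappa 1%nat). split; [|lra]. apply (zeta_value_tau kappa 1 b (-1)); auto.
  - intros m Hm1. destruct (Hm m Hm1) as (u & Hu & Lu). exists (Re u - kappa (2 * m)%nat). split; [|lra].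
    apply (zeta_value_tau kappa (2 * m) b (- 2 * INR m)); auto. rewrite mult_INR; simpl; ring.
Qed.
Lemma Kc_eigen c b : Kc c b -> exists lam phi Z, zeta_data b lam phi Z.
Proof. intros (_ & _ & _ & _ & (v & (lam & phi & HE & Z & H1 & H2 & _) & _) & _). exists lam, phi, Z. split; auto. Qed.

(** * Pointwise bounds for b *)

Lemma I2_exists_le f M : cts f -> I2 f <= 2 * PI * M -> exists y, f y <= M.
Proof.
  intros Hf H. apply NNPP. intros Hn. assert (G : forall y, M < f y) by (intros y; apply Rnot_le_lt; intros L; apply Hn; eauto).
  assert (P := PI_RGT_0).
  assert (0 < RInt (fun x => f x - M) 0 (2 * PI)); [apply RInt_gt_0; try lra; [intros; specialize (G x); lra|intros; apply cts_minus; ctac]|].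
  fold (I2 (fun x => f x - M)) in H0. rewrite I2_minus, I2_const in H0 by ctac. lra.
Qed.

Lemma per_osc (f f' : R -> R) x y : (forall x, is_derive f x (f' x)) -> cts f' -> per f -> per f' -> Rabs (f x - f y) <= I2 (fun x => Rabs (f' x)).
Proof.
  intros Hd Hc Hp Hp'.
  assert (G : forall x y, x <= y <= x + 2 * PI -> Rabs (f y - f x) <= I2 (fun x => Rabs (f' x))).
  { intros u v Huv. rewrite <- (RInt_derive' f f' u v) by auto.
    assert (c1 : cts (fun x => Rabs (f' x))) by ctac.
    eapply Rle_trans; [apply abs_RInt_le; [lra|apply ex_RInt_cts; auto]|].
    rewrite <- (RInt_per _ u c1) by (intros t; f_equal; apply Hp').
    rewrite <- (RInt_Chasles' _ u v (u + 2 * PI)) by auto.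
    assert (0 <= RInt (fun x => Rabs (f' x)) v (u + 2 * PI)); [|lra].
    apply RInt_ge_0; [lra|apply ex_RInt_cts; auto|intros; apply Rabs_pos]. }
  destruct (per_reduce f x Hp) as (x' & Hx' & <-). destruct (per_reduce f y Hp) as (y' & Hy' & <-). assert (P := two_pi_pos).
  destruct (Rle_lt_dec x' y'); [rewrite Rabs_minus_sym|]; apply G; lra.
Qed.
(** [|b'| / b <= 1 / b + b'^2 / b], so [ln b] varies by at most [2 PI + K] over a period. As [1 / b]
    has mean one, [ln b] is nonnegative somewhere and nonpositive somewhere, which fixes its
    level. *)
Lemma ln_oscillation b K : admissible b -> I2 (fun x => Derive b x ^ 2 * / b x) <= K ->
  forall x, exp (- (2 * PI + K)) <= b x <= exp (2 * PI + K).
Proof.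
  intros (Hb & Hp & Hi) HK.
  assert (sw := sc_inv b Hb Hp). assert (PP := PI_RGT_0).
  assert (dl : forall x, is_derive (fun x => ln (b x)) x (Derive b x * / b x)).
  { intros x. evar_last. apply (is_derive_comp ln b); [apply is_derive_Reals, derivable_pt_lim_ln; auto|apply sc_is_derive; auto].
    unfold scal; simpl; unfold mult; simpl. toR; ring. }
  assert (sd : smooth_circ (fun x => Derive b x * / b x)) by sctac.
  assert (B : I2 (fun x => Rabs (Derive b x * / b x)) <= 2 * PI + K).
  { apply Rle_trans with (I2 (fun x => / b x + Derive b x ^ 2 * / b x)).
    - apply I2_le; cstac. intros x. specialize (Hp x). rewrite Rabs_mult, (Rabs_right (/ b x)) by (apply Rle_ge, Rinv_nneg; auto).
      assert (0 < / b x) by (apply Rinv_0_lt_compat; auto). rewrite <- (pow2_abs (Derive b x)).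
      generalize (Rabs (Derive b x)); intros r. replace (/ b x + r ^ 2 * / b x) with ((1 + r ^ 2) * / b x) by ring. apply Rmult_le_compat_r; [lra|]. generalize (pow2_ge_0 (r - 1)). nra.
    - rewrite I2_plus by cstac. lra. }
  assert (V : forall x y, Rabs (ln (b x) - ln (b y)) <= 2 * PI + K).
  { intros x y. eapply Rle_trans; [|apply B]. apply (per_osc (fun x => ln (b x))); cstac. intros t; f_equal; apply (sc_per b Hb). }
  destruct (I2_exists_le (fun x => / b x) 1) as [y1 H1]; cstac; [rewrite Hi; lra|].
  destruct (I2_exists_le (fun x => - / b x) (- 1)) as [y2 H2]; cstac; [rewrite I2_opp, Hi by cstac; lra|].
  assert (L : forall y, ln (b y) = - ln (/ b y)) by (intros; rewrite ln_Rinv; auto; ring).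
  assert (L1 : 0 <= ln (b y1)).
  { rewrite L. assert (ln (/ b y1) <= ln 1) by (apply ln_le; auto; apply Rinv_0_lt_compat; auto). rewrite ln_1 in H; lra. }
  assert (L2 : ln (b y2) <= 0).
  { rewrite L. assert (ln 1 <= ln (/ b y2)) by (apply ln_le; lra). rewrite ln_1 in H; lra. }
  intros x. assert (V1 := V x y1). assert (V2 := V x y2). apply Rabs_le_between in V1, V2.
  rewrite <- (exp_ln (b x)) by auto. split; apply exp_le_mono; lra.
Qed.

Definition eps_of (kappa : nat -> R) c0 c1 := exp (- (2 * PI + 3 * (4 * PI * (c1 - kappa 1%nat) + 5 * (2 * PI * c0)))).
Lemma Kc_bounds kappa c b : kappa_spec kappa -> Kc c b -> forall t, eps_of kappa (c O) (c 1%nat) <= b t <= / eps_of kappa (c O) (c 1%nat).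
Proof.
  intros Hk K t. assert (Ha := Kc_admissible c b K). destruct (Hk c b K) as [(T & HT & LT) _].
  assert (B := trace_bound b Ha T (tau_1_nonneg b Ha) HT). assert (M := Kc_mean c b K). assert (PP := PI_RGT_0).
  unfold eps_of. rewrite <- exp_Ropp, Ropp_involutive. apply ln_oscillation; auto. eapply Rle_trans; [apply B|].
  apply Rmult_le_compat_l; [lra|]. apply Rplus_le_compat; [apply Rmult_le_compat_l|]; lra.
Qed.

(** * Sobolev bounds *)

Fixpoint CN k A (f : R -> R) : Prop := (forall x, Rabs (f x) <= A) /\ match k with O => True | S k' => CN k' A (Derive f) end.
Fixpoint HN k (f : R -> R) : R := N2 f + match k with O => 0 | S k' => HN k' (Derive f) end.
(** A Sobolev norm built from [u -> (b u)'], the derivative that turns into a power of [n] when [u]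
    is paired with [csn] and [snn]. [HN_le_QN] returns from it to ordinary derivatives. *)
Fixpoint QN b k (f : R -> R) : R := N2 f + match k with O => 0 | S k' => QN b k' (DB b f) end.

Lemma CN_spec k A f : CN k A f <-> forall i x, (i <= k)%nat -> Rabs (Derive_n f i x) <= A.
Proof.
  revert f. induction k; intros f; simpl; split.
  - intros [H _] i x Hi. replace i with 0%nat by lia. apply H.
  - intros H; split; auto. intros x; apply (H 0%nat x); lia.
  - intros [H1 H2] [|i] x Hi; [apply H1|]. rewrite <- Derive_n_Derive. apply (proj1 (IHk (Derive f)) H2). lia.
  - intros H; split; [intros x; apply (H 0%nat x); lia|]. apply IHk. intros i x Hi. rewrite Derive_n_Derive. apply H; lia.
Qed.
Lemma CN_le k A B f : A <= B -> CN k A f -> CN k B f.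
Proof. rewrite !CN_spec. intros H1 H2 i x Hi. specialize (H2 i x Hi). lra. Qed.
Lemma CN_down k j A f : (j <= k)%nat -> CN k A f -> CN j A f.
Proof. rewrite !CN_spec. intros H1 H2 i x Hi. apply H2; lia. Qed.
Lemma CN_pos k A f : CN k A f -> 0 <= A.
Proof. intros H. destruct k; destruct H as [H _]; specialize (H 0); generalize (Rabs_pos (f 0)); lra. Qed.
Lemma CN_ext k A f g : (forall x, f x = g x) -> CN k A f -> CN k A g.
Proof. intros H. rewrite (functional_extensionality f g H). auto. Qed.
Lemma CN_plus k A B f g : smooth_circ f -> smooth_circ g -> CN k A f -> CN k B g -> CN k (A + B) (fun x => f x + g x).
Proof.
  revert f g. induction k; intros f g Hf Hg [F1 F2] [G1 G2]; split; auto; try (intros; apply Rabs_plus_le; auto).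
  rewrite Derive_plus_sc by auto. apply IHk; sctac.
Qed.
Lemma CN_opp k A f : CN k A f -> CN k A (fun x => - f x).
Proof.
  revert f. induction k; intros f [F1 F2]; split; auto; try (intros; apply Rabs_opp_le; auto).
  apply (CN_ext k A (fun x => - Derive f x)); [intros; rewrite Derive_opp; auto|auto].
Qed.
Lemma CN_mult k A B f g : smooth_circ f -> smooth_circ g -> CN k A f -> CN k B g -> CN k (2 ^ k * (A * B)) (fun x => f x * g x).
Proof.
  revert f g. induction k; intros f g Hf Hg HF HG; assert (PA := CN_pos _ _ _ HF); assert (PB := CN_pos _ _ _ HG).
  - split; auto. intros; rewrite Rmult_1_l. apply Rabs_mult_le; [apply HF|apply HG].
  - assert (F0 := CN_down _ k _ _ (Nat.le_succ_diag_r k) HF). assert (G0 := CN_down _ k _ _ (Nat.le_succ_diag_r k) HG).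
    destruct HF as [F1 F2]. destruct HG as [G1 G2]. split.
    + intros. apply Rle_trans with (A * B); [apply Rabs_mult_le; auto|]. rewrite <- (Rmult_1_l (A * B)) at 1. apply Rmult_le_compat_r; [nra|]. apply pow_R1_Rle; lra.
    + rewrite Derive_mult_sc by auto. replace (2 ^ S k * (A * B)) with (2 ^ k * (A * B) + 2 ^ k * (A * B)) by (simpl; ring).
      apply CN_plus; sctac.
Qed.
Lemma CN_inv k A eps : 0 < eps -> exists B, forall f, smooth_circ f -> (forall x, eps <= f x) -> CN k A f -> CN k B (fun x => / f x).
Proof.
  intros He. induction k.
  - exists (/ eps). intros f Hf Hm _. split; auto. intros x. specialize (Hm x). rewrite Rabs_inv, Rabs_right by lra. apply Rinv_le_contravar; lra.
  - destruct IHk as [B HB]. exists (Rmax (/ eps) (2 ^ k * (A * (2 ^ k * (B * B))))). intros f Hf Hm HF.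
    assert (Hp : forall x, 0 < f x) by (intros x; specialize (Hm x); lra). assert (sw := sc_inv f Hf Hp).
    assert (G := HB f Hf Hm (CN_down _ k _ _ (Nat.le_succ_diag_r k) HF)). split.
    + intros x. specialize (Hm x). rewrite Rabs_inv, Rabs_right by lra. eapply Rle_trans; [|apply Rmax_l]. apply Rinv_le_contravar; lra.
    + apply (CN_le k (2 ^ k * (A * (2 ^ k * (B * B))))); [apply Rmax_r|].
      apply (CN_ext k _ (fun x => - Derive f x * (/ f x * / f x))).
      * intros x. symmetry. apply is_derive_unique. evar_last.
        -- apply (is_derive_inv f x (Derive f x)); [apply sc_is_derive; auto|generalize (Hp x); lra].
        -- generalize (Hp x); intros; simpl; field; lra.
      * apply CN_mult; sctac; [apply CN_opp, HF|apply CN_mult; sctac].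
Qed.

Lemma I2_sq_nonneg f : cts f -> 0 <= N2 f.
Proof. intros; apply I2_nonneg; ctac. intros; apply pow2_ge_0. Qed.
Lemma HN_nonneg k f : smooth_circ f -> 0 <= HN k f.
Proof.
  revert f; induction k; intros f Hf; simpl; assert (H := I2_sq_nonneg f (sc_cts f Hf)); simpl in H; [lra|].
  assert (G := IHk (Derive f) (sc_Derive f Hf)). lra.
Qed.
Lemma HN_S k f : HN (S k) f = N2 f + HN k (Derive f). Proof. reflexivity. Qed.
Lemma HN_down k f : smooth_circ f -> HN k f <= HN (S k) f.
Proof.
  revert f; induction k; intros f Hf.
  - rewrite HN_S. assert (H := HN_nonneg 0 (Derive f) (sc_Derive f Hf)). change (HN 0 f) with (N2 f + 0). lra.
  - assert (H := IHk (Derive f) (sc_Derive f Hf)). rewrite (HN_S (S k)), (HN_S k f). lra.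
Qed.
Lemma HN_last k f : smooth_circ f -> N2 (Derive_n f k) <= HN k f.
Proof.
  revert f; induction k; intros f Hf; [simpl; lra|]. rewrite HN_S, <- Derive_n_Derive.
  assert (H := IHk (Derive f) (sc_Derive f Hf)). assert (G := I2_sq_nonneg f (sc_cts f Hf)). lra.
Qed.
Lemma HN_plus k f g : smooth_circ f -> smooth_circ g -> HN k (fun x => f x + g x) <= 2 * HN k f + 2 * HN k g.
Proof.
  assert (E : forall f g, smooth_circ f -> smooth_circ g -> I2 (fun x => (f x + g x) ^ 2) <= 2 * N2 f + 2 * N2 g).
  { clear. intros f g Hf Hg. rewrite <- !I2_scal, <- I2_plus by cstac. apply I2_le; cstac. intros x. generalize (pow2_ge_0 (f x - g x)). nra. }
  revert f g; induction k; intros f g Hf Hg; [simpl HN; assert (Q := E f g Hf Hg); simpl in *; lra|].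
  rewrite !HN_S. assert (Q := E f g Hf Hg). rewrite Derive_plus_sc by auto. assert (Q2 := IHk (Derive f) (Derive g) (sc_Derive f Hf) (sc_Derive g Hg)). lra.
Qed.
Lemma I2_mult_bd a f A : smooth_circ a -> smooth_circ f -> (forall x, Rabs (a x) <= A) -> I2 (fun x => (a x * f x) ^ 2) <= A ^ 2 * N2 f.
Proof.
  intros Ha Hf H. rewrite <- I2_scal by cstac. apply I2_le; cstac. intros x. rewrite Rpow_mult_distr. apply Rmult_le_compat_r; [apply pow2_ge_0|].
  rewrite <- (pow2_abs (a x)). apply pow_incr; split; auto; apply Rabs_pos.
Qed.
Lemma HN_mult k a f A : smooth_circ a -> smooth_circ f -> CN k A a -> HN k (fun x => a x * f x) <= 4 ^ k * A ^ 2 * HN k f.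
Proof.
  revert a f; induction k; intros a f Ha Hf HA.
  - assert (Q := I2_mult_bd a f A Ha Hf (proj1 HA)). change (I2 (fun x => (a x * f x) ^ 2) + 0 <= 1 * A ^ 2 * (N2 f + 0)). lra.
  - assert (A0 := CN_down _ k _ _ (Nat.le_succ_diag_r k) HA). destruct HA as [A1 A2].
    assert (Q := I2_mult_bd a f A Ha Hf A1). rewrite !HN_S. rewrite Derive_mult_sc by auto.
    assert (Q1 := IHk (Derive a) f (sc_Derive a Ha) Hf A2). assert (Q2 := IHk a (Derive f) Ha (sc_Derive f Hf) A0).
    assert (Q3 := HN_plus k (fun x => Derive a x * f x) (fun x => a x * Derive f x) ltac:(sctac) ltac:(sctac)).
    assert (Q4 := HN_down k f Hf). rewrite HN_S in Q4.
    assert (0 <= HN k (Derive f)) by (apply HN_nonneg; sctac). assert (0 <= N2 f) by (apply I2_sq_nonneg; cstac).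
    assert (0 <= A ^ 2) by apply pow2_ge_0. assert (1 <= 4 ^ k) by (apply pow_R1_Rle; lra).
    change (4 ^ S k) with (4 * 4 ^ k).
    set (X := 4 ^ k * A ^ 2) in *. assert (A ^ 2 <= X) by (unfold X; nra).
    replace (4 * 4 ^ k * A ^ 2) with (4 * X) by (unfold X; ring).
    assert (X * HN k f <= X * (N2 f + HN k (Derive f))) by (apply Rmult_le_compat_l; lra).
    assert (A ^ 2 * N2 f <= X * N2 f) by (apply Rmult_le_compat_r; lra). nra.
Qed.

Lemma sc_DB b f : smooth_circ b -> smooth_circ f -> smooth_circ (DB b f).
Proof. intros; unfold DB; sctac. Qed.
Lemma QN_S b k f : QN b (S k) f = N2 f + QN b k (DB b f). Proof. reflexivity. Qed.
Lemma QN_nonneg b k f : smooth_circ b -> smooth_circ f -> 0 <= QN b k f.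
Proof.
  intros Hb; revert f; induction k; intros f Hf; simpl; assert (H := I2_sq_nonneg f (sc_cts f Hf)); simpl in H; [lra|].
  assert (G := IHk (DB b f) (sc_DB b f Hb Hf)). lra.
Qed.
Lemma QN_down b k f : smooth_circ b -> smooth_circ f -> QN b k f <= QN b (S k) f.
Proof.
  intros Hb. revert f; induction k; intros f Hf.
  - rewrite QN_S. assert (H := QN_nonneg b 0 (DB b f) Hb (sc_DB b f Hb Hf)). change (QN b 0 f) with (N2 f + 0). lra.
  - assert (H := IHk (DB b f) (sc_DB b f Hb Hf)). rewrite (QN_S b (S k)), (QN_S b k f). lra.
Qed.
(* Elliptic regularity for [u |-> (b u)']: solve for [u' = ((b u)' - b' u) / b] and bootstrap. *)
Lemma HN_le_QN k A eps : 0 < eps -> exists C, 0 <= C /\ forall b u, smooth_circ b -> smooth_circ u -> (forall x, eps <= b x) -> CN k A b ->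
  HN k u <= C * QN b k u.
Proof.
  intros He. induction k.
  - exists 1. split; [lra|]. intros; simpl; lra.
  - destruct IHk as (C & HC & H). destruct (CN_inv k A eps He) as [B HB].
    set (X := 4 ^ k * B ^ 2). set (Y := 4 ^ k * (2 ^ k * (A * B)) ^ 2).
    assert (X0 : 0 <= X) by (apply Rmult_le_pos; [apply pow_le; lra|apply pow2_ge_0]). assert (Y0 : 0 <= Y) by (apply Rmult_le_pos; [apply pow_le; lra|apply pow2_ge_0]).
    exists (1 + 2 * X * C + 2 * Y * C). split; [nra|]. intros b u Hb Hu Hm HA.
    assert (Hp : forall x, 0 < b x) by (intros x; specialize (Hm x); lra). assert (sw := sc_inv b Hb Hp).
    assert (A0 := CN_down _ k _ _ (Nat.le_succ_diag_r k) HA). assert (W := HB b Hb Hm A0). destruct HA as [A1 A2].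
    assert (E : Derive u = fun x => / b x * DB b u x + (- Derive b x * / b x) * u x).
    { fext x. unfold DB. rewrite Derive_mult_sc by auto. generalize (Hp x); intros. field; lra. }
    assert (sD := sc_DB b u Hb Hu).
    rewrite HN_S, QN_S. rewrite E.
    assert (Q1 := HN_plus k (fun x => / b x * DB b u x) (fun x => (- Derive b x * / b x) * u x) ltac:(sctac) ltac:(sctac)).
    assert (Q2 := HN_mult k (fun x => / b x) (DB b u) B sw sD W). fold X in Q2.
    assert (Q3 := HN_mult k (fun x => - Derive b x * / b x) u (2 ^ k * (A * B)) ltac:(sctac) Hu ltac:(apply CN_mult; sctac; apply CN_opp; auto)). fold Y in Q3.
    assert (Q4 := H b u Hb Hu Hm A0). assert (Q5 := H b (DB b u) Hb sD Hm A0).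
    assert (Q6 := QN_down b k u Hb Hu). rewrite QN_S in Q6. assert (Q7 := QN_nonneg b k (DB b u) Hb sD). assert (Q8 := I2_sq_nonneg u (sc_cts u Hu)).
    set (q := N2 u) in *. set (Q := QN b k (DB b u)) in *.
    assert (X * HN k (DB b u) <= X * (C * Q)) by (apply Rmult_le_compat_l; lra).
    assert (C * QN b k u <= C * (q + Q)) by (apply Rmult_le_compat_l; lra).
    assert (Y * HN k u <= Y * (C * (q + Q))) by (apply Rmult_le_compat_l; lra).
    assert (0 <= X * C) by nra. assert (0 <= Y * C) by nra. nra.
Qed.

Lemma is_series_zero : is_series (fun _ => 0) 0.
Proof. apply (filterlim_ext (fun _ => 0)); [intros n; rewrite sum_n_const; toR; ring|apply filterlim_const]. Qed.
Lemma is_series_rsum J (a : nat -> nat -> R) (l : nat -> R) : (forall k, is_series (a k) (l k)) -> is_series (fun n => rsum J (fun k => a k n)) (rsum J l).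
Proof.
  intros H. induction J; simpl.
  - apply is_series_zero.
  - apply is_series_plusR; auto.
Qed.
Section StepA.
Variables (b : R -> R) (eps : R).
Hypothesis Hadm : admissible b.
Hypothesis He : 0 < eps.
Hypothesis Hm : forall x, eps <= b x.
Let Hb : smooth_circ b. Proof. apply Hadm. Qed.
Let bpos : forall x, 0 < b x. Proof. apply Hadm. Qed.

Definition DBp i (u : R -> R) := Nat.iter i (DB b) u.
Lemma sc_DBp i u : smooth_circ u -> smooth_circ (DBp i u).
Proof. intros Hu; induction i; simpl; auto. apply sc_DB; auto. Qed.
Lemma DBp_mean i u : smooth_circ u -> I2 u = 0 -> I2 (DBp i u) = 0.
Proof.
  intros Hu H0; destruct i; simpl; auto. assert (s := sc_DBp i u Hu). unfold DB.
  apply (I2_derive_per (fun x => b x * DBp i u x)); [intros; apply sc_is_derive; sctac|cstac|apply sc_per; sctac].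
Qed.
Notation ic n g := (ip (csn b n) g).
Notation is_ n g := (ip (snn b n) g).
Lemma DBp_coef i n u : smooth_circ u -> INR n ^ (2 * i) * (ic n u ^ 2 + is_ n u ^ 2) = ic n (DBp i u) ^ 2 + is_ n (DBp i u) ^ 2.
Proof.
  intros Hu. induction i; [simpl; ring|]. assert (s := sc_DBp i u Hu).
  replace (2 * S i)%nat with (2 + 2 * i)%nat by lia. rewrite pow_add, Rmult_assoc, IHi.
  assert (E1 := csn_DB b Hadm n _ s). assert (E2 := snn_DB b Hadm n _ s).
  change (DBp (S i) u) with (DB b (DBp i u)). rewrite <- E2. replace (is_ n (DB b (DBp i u))) with (- (INR n * ic n (DBp i u))) by lra. ring.
Qed.
Lemma phase_parseval g : smooth_circ g -> I2 g = 0 ->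
  is_series (fun n => (ic (S n) g ^ 2 + is_ (S n) g ^ 2) / PI) (I2 (fun x => b x * g x ^ 2)).
Proof.
  intros Hg H0. assert (P := fourier_parseval _ _ (phase_ph b Hadm) (fun x => b x * g x) (fun x => b x * g x) ltac:(sctac) ltac:(cstac) ltac:(apply sc_per; sctac)).
  assert (C1 : forall n, cc (fun t => / b t) (ph b) n (fun x => b x * g x) = ic n g).
  { intros n. apply I2_ext; intros x. unfold csn. generalize (bpos x); intros; field; lra. }
  assert (C2 : forall n, ss (fun t => / b t) (ph b) n (fun x => b x * g x) = is_ n g).
  { intros n. apply I2_ext; intros x. unfold snn. generalize (bpos x); intros; field; lra. }
  assert (C0 : ic 0 g = 0). { rewrite <- H0. apply I2_ext; intros x. unfold csn. simpl. rewrite Rmult_0_l, cos_0; ring. }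
  eapply is_series_RR; [eapply is_series_ext; [|apply P]|].
  - intros n; cbv beta. rewrite C1, C2. toR. field. apply PI_neq0.
  - rewrite C1, C0. transitivity (I2 (fun x => b x * g x * (b x * g x) * / b x) - 0); [unfold Rdiv; ring|].
    rewrite Rminus_0_r. apply I2_ext; intros x. generalize (bpos x); intros; field; lra.
Qed.

Definition Ucos j := Kop b (fun x => cos (INR (S j) * x)).
Lemma sc_Ucos j : smooth_circ (Ucos j).
Proof. exact (sc_Kop b Hadm _ (sc_cosn (S j))). Qed.
Lemma Ucos_mean j : I2 (Ucos j) = 0.
Proof. rewrite <- fc_0. unfold Ucos. rewrite (proj1 (Kop_cos_coef b Hadm (S j) 0)). simpl (INR 0). ring. Qed.
(** Bessel's inequality with the cosines alone, after the symmetric [K] has been moved to the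
    cosine. *)
Lemma Kop_lower f J : smooth_circ f -> rsum J (fun j => ip f (Ucos j) ^ 2) / PI <= N2 (Kop b f).
Proof.
  intros Hf. assert (s := sc_Kop b Hadm f Hf). assert (PP := PI_RGT_0).
  assert (P := parseval _ _ s s). assert (0 <= fc 0 (Kop b f) * fc 0 (Kop b f) / (2 * PI)) by (apply Rmult_le_pos; [nra|apply Rinv_nneg; lra]).
  assert (L : rsum J (fun j => ip f (Ucos j) ^ 2) / PI <= rsum J (fun n => (fc (S n) (Kop b f) * fc (S n) (Kop b f) + fs (S n) (Kop b f) * fs (S n) (Kop b f)) / PI)).
  { unfold Rdiv at 1. rewrite Rmult_comm, <- rsum_scal. apply rsum_le; intros j. unfold Ucos.
    rewrite <- (Kop_sym b Hadm f _ Hf (sc_cosn (S j))). rewrite <- fc_eq. unfold Rdiv. rewrite Rmult_comm. apply Rmult_le_compat_r; [apply Rinv_nneg; auto|].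
    generalize (fc (S j) (Kop b f)) (fs (S j) (Kop b f)); intros; nra. }
  eapply Rle_trans; [apply L|]. eapply Rle_trans; [apply rsum_le_series; [|apply P]|].
  - intros n; cbv beta. apply Rmult_le_pos; [|apply Rinv_nneg; auto]. generalize (fc (S n) (Kop b f)) (fs (S n) (Kop b f)); intros; nra.
  - assert (ip (Kop b f) (Kop b f) = N2 (Kop b f)) by (apply I2_ext; intros; ring). lra.
Qed.
Lemma Rop_lower n : eps / PI * (N2 (Kop b (csn b n)) + N2 (Kop b (snn b n))) <=
  N2 (Rop b (pc b n)) + N2 (Rop b (ps b n)).
Proof.
  assert (PP := PI_RGT_0).
  assert (G : forall f h, smooth_circ f -> (fun x => sqrt (b x) * h x) = (fun x => / sqrt PI * f x) -> eps / PI * N2 (Kop b f) <= N2 (Rop b h)).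
  { intros f h Hf E. unfold Rop. rewrite E, Kop_scal by auto. assert (s := sc_Kop b Hadm f Hf). rewrite <- I2_scal by cstac. apply I2_le; cstac.
    intros x. replace ((sqrt (b x) * (/ sqrt PI * Kop b f x)) ^ 2) with ((sqrt (b x) * sqrt (b x)) * (/ sqrt PI * / sqrt PI) * Kop b f x ^ 2) by ring.
    rewrite sqrt_sqrt by (apply Rlt_le; auto). rewrite inv_sqrt_PI. apply Rmult_le_compat_r; [apply pow2_ge_0|]. unfold Rdiv.
    apply Rmult_le_compat_r; [apply Rinv_nneg; auto|auto]. }
  rewrite Rmult_plus_distr_l. apply Rplus_le_compat; apply G.
  - apply sc_csn; auto.
  - apply r_pc; auto.
  - apply sc_snn; auto.
  - apply r_ps; auto.
Qed.

(** Summed over [n], the squared norms of [K] applied to [csn] and [snn] form a Hilbert-Schmidt norm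
    with weight [n^(2p)]. Read in the other variable it is a sum over [j] of norms of [K cos (j x)],
    because Parseval in the angle turns the weight into powers of [DB]. One [1 / eps] stems from
    [b^(1/2)] in [Rop], the other from the weight [b] in [phase_parseval]. *)
Lemma DBp_sum_bound p (t : nat -> R) T : (forall n, INR (S n) ^ (2 * p) * (N2 (Rop b (pc b (S n))) + N2 (Rop b (ps b (S n)))) <= t n) ->
  is_series t T -> forall i J, (i <= p)%nat -> rsum J (fun j => N2 (DBp i (Ucos j))) <= PI / eps ^ 2 * T.
Proof.
  intros Ht HT i J Hi. assert (PP := PI_RGT_0).
  assert (S1 := is_series_rsum J (fun j n => (ic (S n) (DBp i (Ucos j)) ^ 2 + is_ (S n) (DBp i (Ucos j)) ^ 2) / PI) (fun j => I2 (fun x => b x * DBp i (Ucos j) x ^ 2))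
    (fun j => phase_parseval (DBp i (Ucos j)) (sc_DBp i _ (sc_Ucos j)) (DBp_mean i _ (sc_Ucos j) (Ucos_mean j)))). cbv beta in S1.
  assert (L1 : rsum J (fun j => I2 (fun x => b x * DBp i (Ucos j) x ^ 2)) <= PI / eps * T).
  { refine (is_series_le _ _ _ _ _ S1 (is_series_scalR (PI / eps) _ _ HT)). intros n.
    assert (N1 : 1 <= INR (S n)) by (apply (le_INR 1); lia).
    apply Rle_trans with (INR (S n) ^ (2 * i) * (rsum J (fun j => ip (csn b (S n)) (Ucos j) ^ 2) / PI + rsum J (fun j => ip (snn b (S n)) (Ucos j) ^ 2) / PI)).
    - apply Req_le. unfold Rdiv. rewrite <- Rmult_plus_distr_r, <- rsum_plus, <- Rmult_assoc, <- rsum_scal, Rmult_comm, <- rsum_scal. apply rsum_ext; intros j.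
      rewrite <- (DBp_coef i (S n) _ (sc_Ucos j)). ring.
    - apply Rle_trans with (INR (S n) ^ (2 * p) * (PI / eps * (N2 (Rop b (pc b (S n))) + N2 (Rop b (ps b (S n)))))).
      + apply Rmult_le_compat.
        * apply pow_le; lra.
        * assert (N : forall f, 0 <= rsum J (fun j => ip f (Ucos j) ^ 2) / PI).
          { intros f. apply Rmult_le_pos; [|apply Rinv_nneg; auto]. clear. induction J; cbn [rsum]; [lra|]. generalize (pow2_ge_0 (ip f (Ucos J))). lra. }
          generalize (N (csn b (S n))) (N (snn b (S n))). lra.
        * apply Rle_pow; auto. lia.
        * assert (K1 := Kop_lower (csn b (S n)) J ltac:(apply sc_csn; auto)). assert (K2 := Kop_lower (snn b (S n)) J ltac:(apply sc_snn; auto)).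
          assert (R1 := Rop_lower (S n)). apply Rmult_le_compat_l with (r := PI / eps) in R1; [|apply Rlt_le, Rdiv_lt_0_compat; lra].
          rewrite <- Rmult_assoc in R1. replace (PI / eps * (eps / PI)) with 1 in R1 by (field; lra). lra.
      + replace (INR (S n) ^ (2 * p) * (PI / eps * (N2 (Rop b (pc b (S n))) + N2 (Rop b (ps b (S n)))))) with
          (PI / eps * (INR (S n) ^ (2 * p) * (N2 (Rop b (pc b (S n))) + N2 (Rop b (ps b (S n)))))) by ring.
        apply Rmult_le_compat_l; auto. apply Rlt_le, Rdiv_lt_0_compat; lra. }
  apply Rmult_le_reg_l with eps; auto. eapply Rle_trans; [|eapply Rle_trans; [apply L1|]].
  - rewrite <- rsum_scal. apply rsum_le; intros j. assert (s := sc_DBp i _ (sc_Ucos j)). rewrite <- I2_scal by cstac. apply I2_le; cstac.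
    intros x. apply Rmult_le_compat_r; [apply pow2_ge_0|auto].
  - apply Req_le. field. lra.
Qed.
Lemma QN_sum_bound B J : forall p (u : nat -> R -> R), (forall i, (i <= p)%nat -> rsum J (fun j => N2 (DBp i (u j))) <= B) ->
  rsum J (fun j => QN b p (u j)) <= INR (S p) * B.
Proof.
  induction p; intros u H.
  - simpl INR. rewrite Rmult_1_l. eapply Rle_trans; [|apply (H 0%nat); lia]. apply rsum_le; intros j. simpl. lra.
  - rewrite (rsum_ext J _ (fun j => N2 (u j) + QN b p (DB b (u j)))) by (intros; apply QN_S).
    rewrite rsum_plus, S_INR, Rmult_plus_distr_r, Rmult_1_l, Rplus_comm. apply Rplus_le_compat.
    + apply (IHp (fun j => DB b (u j))). intros i Hi. eapply Rle_trans; [|apply (H (S i)); lia].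
      apply Req_le, rsum_ext; intros j. unfold DBp. rewrite Nat.iter_succ_r. reflexivity.
    + apply (H 0%nat); lia.
Qed.
End StepA.

Lemma coef_Derive_n_sq n f k : smooth_circ f ->
  fc n (Derive_n f k) ^ 2 + fs n (Derive_n f k) ^ 2 = INR n ^ (2 * k) * (fc n f ^ 2 + fs n f ^ 2).
Proof.
  intros Hf. induction k; [change (Derive_n f 0) with f; simpl; ring|].
  change (Derive_n f (S k)) with (Derive (Derive_n f k)). rewrite fc_Derive, fs_Derive by (apply sc_Derive_n; auto).
  replace (2 * S k)%nat with (2 + 2 * k)%nat by lia. rewrite pow_add, Rmult_assoc, <- IHk. ring.
Qed.
Lemma parseval_sq f : smooth_circ f -> is_series (fun n => (fc (S n) f ^ 2 + fs (S n) f ^ 2) / PI) (N2 f - fc 0 f ^ 2 / (2 * PI)).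
Proof.
  intros Hf. eapply is_series_RR; [eapply is_series_ext; [|apply (parseval f f Hf Hf)]|].
  - intros n; cbv beta. toR; unfold Rdiv; ring.
  - f_equal; [apply I2_ext; intros; ring|unfold Rdiv; ring].
Qed.
Lemma rsum_nonneg n f : (forall k, 0 <= f k) -> 0 <= rsum n f.
Proof. intros H; induction n; simpl; [lra|]. specialize (H n). lra. Qed.
Lemma rsum_mono n m f : (forall k, 0 <= f k) -> (n <= m)%nat -> rsum n f <= rsum m f.
Proof. intros H L; induction L; simpl; [lra|]. specialize (H m). lra. Qed.
Lemma rsum_pairs J f : rsum (2 * J + 1) f = f 0%nat + rsum J (fun j => f (2 * j + 1)%nat + f (2 * j + 2)%nat).
Proof.
  induction J; [simpl; lra|]. replace (2 * S J + 1)%nat with (S (S (2 * J + 1))) by lia. cbn [rsum]. rewrite IHJ.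
  replace (S (2 * J + 1)) with (2 * J + 2)%nat by lia. ring.
Qed.
Lemma coef_sq_nonneg n f : 0 <= fc n f ^ 2 + fs n f ^ 2.
Proof. generalize (pow2_ge_0 (fc n f)) (pow2_ge_0 (fs n f)); lra. Qed.
Lemma coef_le_mean n f : cts f -> (forall x, 0 <= f x) -> fc n f ^ 2 + fs n f ^ 2 <= 2 * I2 f ^ 2.
Proof.
  intros Hf H0.
  assert (G : forall g, cts g -> (forall x, Rabs (g x) <= 1) -> ip f g ^ 2 <= I2 f ^ 2).
  { intros g Hg H. rewrite <- (pow2_abs (ip f g)). apply pow_incr; split; [apply Rabs_pos|].
    eapply Rle_trans; [apply I2_abs; ctac|]. apply I2_le; ctac. intros x. rewrite Rabs_mult, Rabs_right by (apply Rle_ge; auto). specialize (H x); specialize (H0 x). nra. }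
  rewrite fc_eq, fs_eq. assert (A := G (fun x => cos (INR n * x)) ltac:(ctac) (fun x => Rabs_le _ _ (COS_bound _))). assert (B := G (fun x => sin (INR n * x)) ltac:(ctac) (fun x => Rabs_le _ _ (SIN_bound _))). lra.
Qed.

(** At the frequencies [l] and [l + 1], [K cos (l x)] has the coefficients of [b] of index [2 l] and
    [2 l + 1], with factors of order [l^2]: both parities are reached. The power of 3 comes from
    [2 l + 1 <= 3 l]. *)
Lemma Ucos_pair b p j : admissible b ->
  (fc (2 * S j) (Derive_n b (p + 2)) ^ 2 + fs (2 * S j) (Derive_n b (p + 2)) ^ 2) + (fc (2 * S j + 1) (Derive_n b (p + 2)) ^ 2 + fs (2 * S j + 1) (Derive_n b (p + 2)) ^ 2)
  <= 3 ^ (2 * p + 4) * PI * HN p (Ucos b j).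
Proof.
  intros Ha. assert (Hb : smooth_circ b) by apply Ha. assert (PP := PI_RGT_0).
  assert (sU := sc_Ucos b Ha j). assert (sD := sc_Derive_n _ p sU).
  assert (E : forall l, fc l (Derive_n (Ucos b j) p) ^ 2 + fs l (Derive_n (Ucos b j) p) ^ 2 = INR l ^ (2 * p) * (INR l * INR (S j)) ^ 2 * (fc (l + S j) b ^ 2 + fs (l + S j) b ^ 2)).
  { intros l. rewrite coef_Derive_n_sq by auto. destruct (Kop_cos_coef b Ha (S j) l) as [K1 K2]. unfold Ucos. rewrite K1, K2. ring. }
  assert (Q : (fc (S j) (Derive_n (Ucos b j) p) ^ 2 + fs (S j) (Derive_n (Ucos b j) p) ^ 2) / PI + (fc (S (S j)) (Derive_n (Ucos b j) p) ^ 2 + fs (S (S j)) (Derive_n (Ucos b j) p) ^ 2) / PI <= HN p (Ucos b j)).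
  { eapply Rle_trans; [|apply (HN_last p _ sU)].
    assert (P := parseval_sq _ sD).
    assert (N : forall n, 0 <= (fc (S n) (Derive_n (Ucos b j) p) ^ 2 + fs (S n) (Derive_n (Ucos b j) p) ^ 2) / PI).
    { intros n. apply Rmult_le_pos; [apply coef_sq_nonneg|apply Rinv_nneg; auto]. }
    assert (L := rsum_le_series _ _ (S (S j)) N P). cbn [rsum] in L.
    assert (0 <= fc 0 (Derive_n (Ucos b j) p) ^ 2 / (2 * PI)) by (apply Rmult_le_pos; [apply pow2_ge_0|apply Rinv_nneg; lra]).
    assert (Z := rsum_nonneg j _ N). cbv beta in Z. lra. }
  rewrite !E in Q. rewrite !coef_Derive_n_sq by auto.
  replace (S j + S j)%nat with (2 * S j)%nat in Q by lia. replace (S (S j) + S j)%nat with (2 * S j + 1)%nat in Q by lia.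
  assert (X0 := coef_sq_nonneg (2 * S j) b). assert (Y0 := coef_sq_nonneg (2 * S j + 1) b).
  set (X := fc (2 * S j) b ^ 2 + fs (2 * S j) b ^ 2) in *. set (Y := fc (2 * S j + 1) b ^ 2 + fs (2 * S j + 1) b ^ 2) in *.
  assert (L1 : 1 <= INR (S j)) by (apply (le_INR 1); lia).
  assert (E2 : INR (2 * S j) = 2 * INR (S j)) by (rewrite mult_INR; simpl; ring).
  assert (E3 : INR (2 * S j + 1) = 2 * INR (S j) + 1) by (rewrite plus_INR, E2; simpl; ring).
  rewrite E2, E3. rewrite (S_INR (S j)) in Q. clearbody X Y. set (l := INR (S j)) in *. clearbody l.
  replace (2 * (p + 2))%nat with (2 * p + 2 + 2)%nat by lia. replace (2 * p + 4)%nat with (2 * p + 2 + 2)%nat by lia.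
  assert (A1 : (2 * l) ^ (2 * p + 2 + 2) <= 3 ^ (2 * p + 2 + 2) * (l ^ (2 * p) * (l * l) ^ 2)).
  { replace (l ^ (2 * p) * (l * l) ^ 2) with (l ^ (2 * p + 2 + 2)) by (rewrite !pow_add; ring). rewrite <- Rpow_mult_distr. apply pow_incr; lra. }
  assert (A2 : (2 * l + 1) ^ (2 * p + 2 + 2) <= 3 ^ (2 * p + 2 + 2) * ((l + 1) ^ (2 * p) * ((l + 1) * l) ^ 2)).
  { replace (3 ^ (2 * p + 2 + 2) * ((l + 1) ^ (2 * p) * ((l + 1) * l) ^ 2)) with ((3 * (l + 1)) ^ (2 * p + 2) * (3 * l) ^ 2) by (rewrite !Rpow_mult_distr, !pow_add; ring).
    rewrite (pow_add (2 * l + 1)). apply Rmult_le_compat; try (apply pow_le; lra); apply pow_incr; lra. }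
  assert (T0 : 0 < 3 ^ (2 * p + 2 + 2)) by (apply pow_lt; lra).
  apply Rmult_le_compat_r with (r := X) in A1; auto. apply Rmult_le_compat_r with (r := Y) in A2; auto.
  eapply Rle_trans; [apply Rplus_le_compat; [apply A1|apply A2]|].
  rewrite !Rmult_assoc, <- Rmult_plus_distr_l. apply Rmult_le_compat_l; [lra|].
  apply Rmult_le_compat_l with (r := PI) in Q; [|lra]. eapply Rle_trans; [|apply Q]. apply Req_le. field; lra.
Qed.

(* The Hankel-type matrix of [K] sees every Fourier coefficient of [b] near its diagonal. *)
Lemma sobolev_step p A eps T0 I0 : 0 < eps -> exists C, forall b (t : nat -> R) T, admissible b -> (forall x, eps <= b x) -> CN p A b -> I2 b <= I0 ->
  (forall n, INR (S n) ^ (2 * p) * (N2 (Rop b (pc b (S n))) + N2 (Rop b (ps b (S n)))) <= t n) ->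
  is_series t T -> T <= T0 -> N2 (Derive_n b (p + 2)) <= C.
Proof.
  intros He. destruct (HN_le_QN p A eps He) as (C1 & HC1 & H1). assert (PP := PI_RGT_0).
  set (S0 := C1 * (INR (S p) * (PI / eps ^ 2 * T0))).
  exists (2 * I0 ^ 2 / PI + 3 ^ (2 * p + 4) * S0).
  intros b t T Ha Hm HA HI Ht HT HT0. assert (Hb : smooth_circ b) by apply Ha.
  assert (bp : forall x, 0 <= b x) by (intros x; specialize (Hm x); lra).
  assert (B : forall J, rsum J (fun j => HN p (Ucos b j)) <= S0).
  { intros J. apply Rle_trans with (rsum J (fun j => C1 * QN b p (Ucos b j))).
    - apply rsum_le; intros j. apply H1; auto. apply sc_Ucos; auto.
    - rewrite rsum_scal. apply Rmult_le_compat_l; auto. eapply Rle_trans.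
      + apply (QN_sum_bound b (PI / eps ^ 2 * T) J p (Ucos b)). intros i Hi. apply (DBp_sum_bound b eps Ha He Hm p t T Ht HT i J Hi).
      + apply Rmult_le_compat_l; [apply pos_INR|]. apply Rmult_le_compat_l; auto. apply Rlt_le, Rdiv_lt_0_compat; nra. }
  assert (sD := sc_Derive_n b (p + 2) Hb). assert (P := parseval_sq _ sD).
  assert (Z : fc 0 (Derive_n b (p + 2)) = 0).
  { replace (p + 2)%nat with (S (p + 1)) by lia. simpl Derive_n. rewrite fc_Derive by (apply sc_Derive_n; auto). simpl (INR 0); ring. }
  rewrite Z in P. replace (0 ^ 2 / (2 * PI)) with 0 in P by (field; lra). rewrite Rminus_0_r in P.
  apply (series_le_rsum _ _ _ P). intros N.
  eapply Rle_trans; [apply (rsum_mono N (2 * N + 1)); [|lia]|].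
  { intros k; cbv beta. apply Rmult_le_pos; [apply coef_sq_nonneg|apply Rinv_nneg; auto]. }
  rewrite rsum_pairs. apply Rplus_le_compat.
  (* The pairs start at the frequency 2. The frequency 1 is bounded by the mean, because [b] is
     positive. *)
  - unfold Rdiv. apply Rmult_le_compat_r; [apply Rinv_nneg; auto|].
    rewrite coef_Derive_n_sq by auto. simpl (INR 1). rewrite pow1, Rmult_1_l. eapply Rle_trans; [apply coef_le_mean; cstac|].
    apply Rmult_le_compat_l; [lra|]. apply pow_incr; split; auto. apply I2_nonneg; cstac.
  - apply Rle_trans with (rsum N (fun j => 3 ^ (2 * p + 4) * HN p (Ucos b j))).
    + apply rsum_le; intros j. assert (U := Ucos_pair b p j Ha).
      replace (S (2 * j + 1)) with (2 * S j)%nat by lia. replace (S (2 * j + 2)) with (2 * S j + 1)%nat by lia.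
      unfold Rdiv. rewrite <- Rmult_plus_distr_r. apply Rmult_le_reg_r with PI; auto. rewrite Rmult_assoc, Rinv_l, Rmult_1_r by lra. lra.
    + rewrite rsum_scal. apply Rmult_le_compat_l; auto. apply pow_le; lra.
Qed.

Lemma osc_sq f x y : smooth_circ f -> Rabs (f x - f y) <= 2 * PI + N2 (Derive f).
Proof.
  intros Hf. eapply Rle_trans; [apply (per_osc f (Derive f)); cstac; intros; apply sc_is_derive; auto|].
  rewrite <- (Rmult_1_r (2 * PI)), <- I2_const, <- I2_plus by cstac. apply I2_le; cstac. intros z. rewrite <- (pow2_abs (Derive f z)).
  generalize (Rabs (Derive f z)); intros r. generalize (pow2_ge_0 (r - 1)). nra.
Qed.
Lemma mean_zero_sup f : smooth_circ f -> I2 f = 0 -> forall x, Rabs (f x) <= 2 * PI + N2 (Derive f).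
Proof.
  intros Hf H0 x. assert (PP := PI_RGT_0).
  destruct (I2_exists_le f 0) as [y1 L1]; cstac; [rewrite H0; lra|].
  destruct (I2_exists_le (fun x => - f x) 0) as [y2 L2]; cstac; [rewrite I2_opp, H0 by cstac; lra|].
  assert (O1 := osc_sq f x y1 Hf). assert (O2 := osc_sq f x y2 Hf). apply Rabs_le_between in O1, O2. apply Rabs_le_between. lra.
Qed.
Lemma Derive_mean f k : smooth_circ f -> I2 (Derive_n f (S k)) = 0.
Proof.
  intros Hf. assert (s := sc_Derive_n f k Hf). apply (I2_derive_per (Derive_n f k)); [intros; apply sc_is_derive; auto|simpl; cstac|apply sc_per; auto].
Qed.

(** Besides the uniform bounds the induction delivers an L^2 bound for one more derivative, with a
    view to the Hilbert transform, which does not preserve uniform bounds. The step from [p] to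
    [p + 1] uses the value at [-2 (p + 2)], hence the constant of index [p + 3]. *)
Lemma Kc_Cm kappa (d : nat -> R) p : kappa_spec kappa -> exists B, forall c b, (forall k, (k <= p + 2)%nat -> c k = d k) -> Kc c b ->
  CN p B b /\ ((1 <= p)%nat -> N2 (Derive_n b (S p)) <= B).
Proof.
  intros Hk. set (eps := eps_of kappa (d O) (d 1%nat)). assert (He : 0 < eps) by apply exp_pos.
  induction p as [|p [B HB]].
  - exists (/ eps). intros c b Hc K. split; [|lia]. split; auto. intros x. assert (Q := Kc_bounds kappa c b Hk K x). rewrite !Hc in Q by lia. fold eps in Q.
    rewrite Rabs_right; lra.
  - destruct (sobolev_step p B eps (d (p + 3)%nat - kappa (2 * (p + 2))%nat) (2 * PI * d O) He) as [C HC].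
    exists (Rmax B (2 * PI + C)). intros c b Hc K. destruct (HB c b ltac:(intros; apply Hc; lia) K) as [H1 _].
    assert (Ha := Kc_admissible c b K). assert (Hb : smooth_circ b) by apply Ha. destruct (Kc_eigen c b K) as (lam & phi & Z & HE & _).
    destruct (Hk c b K) as [_ Ht]. destruct (Ht (p + 2)%nat ltac:(lia)) as (T & HT & LT). rewrite Hc in LT by lia. replace (S (p + 2)) with (p + 3)%nat in LT by lia.
    assert (E : N2 (Derive_n b (p + 2)) <= C).
    { apply (HC b (tau b (2 * (p + 2))) T); auto.
      - intros x. assert (Q := Kc_bounds kappa c b Hk K x). rewrite !Hc in Q by lia. apply Q.
      - rewrite <- Hc by lia. apply Kc_mean; auto.
      - intros n. apply (tau_lower b lam phi Ha HE). }
    replace (p + 2)%nat with (S (S p)) in E by lia. assert (PP := PI_RGT_0).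
    split; [|intros _; eapply Rle_trans; [|apply Rmax_r]; lra].
    apply CN_spec. intros i x Hi. destruct (Nat.eq_dec i (S p)) as [->|].
    + eapply Rle_trans; [|apply Rmax_r]. eapply Rle_trans; [apply mean_zero_sup; [apply sc_Derive_n; auto|apply Derive_mean; auto]|].
      apply Rplus_le_compat_l. exact E.
    + eapply Rle_trans; [|apply Rmax_l]. apply (proj1 (CN_spec p B b) H1). lia.
Qed.

(** * The Hilbert transform *)

Lemma fourier_pair gr gi n : cts gr -> cts gi -> fourier gr gi (Z.of_nat n) = (/ (2 * PI) * (fc n gr + fs n gi), / (2 * PI) * (fc n gi - fs n gr)) /\
  fourier gr gi (- Z.of_nat n) = (/ (2 * PI) * (fc n gr - fs n gi), / (2 * PI) * (fc n gi + fs n gr)).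
Proof.
  intros H1 H2. unfold fourier. rewrite opp_IZR, <- INR_IZR_INZ, !fc_eq, !fs_eq.
  rewrite <- !I2_plus, <- !I2_minus by ctac. unfold I2.
  split; f_equal; f_equal; apply RInt_ext'; intros x; rewrite ?Ropp_mult_distr_l_reverse, ?cos_neg, ?sin_neg; ring.
Qed.
(** For real [b] the multiplier sgn yields a purely imaginary function, whose imaginary part has the
    coefficients of [b] with cosines and sines exchanged up to sign. *)
Lemma HilbertRel_coef b gr gi : smooth_circ b -> HilbertRel b gr gi ->
  (forall x, gr x = 0) /\ smooth_circ gi /\ I2 gi = 0 /\ forall n, fc (S n) gi ^ 2 + fs (S n) gi ^ 2 = fc (S n) b ^ 2 + fs (S n) b ^ 2.
Proof.
  intros Hb (H1 & H2 & H). assert (P := two_pi_pos). assert (P' : / (2 * PI) <> 0) by (apply Rinv_neq_0_compat; lra).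
  assert (c1 := sc_cts _ H1). assert (c2 := sc_cts _ H2). assert (c3 := sc_cts _ Hb).
  assert (Z0 : fc 0 gr = 0 /\ fc 0 gi = 0).
  { assert (E := H (Z.of_nat 0)). rewrite (proj1 (fourier_pair gr gi 0 c1 c2)) in E. simpl Z.sgn in E. rewrite Cmult_0_l in E. rewrite !fs_0 in E.
    injection E; intros E2 E1. apply Rmult_integral in E1, E2. destruct E1, E2; try contradiction. lra. }
  assert (G : forall n, fc (S n) gr = 0 /\ fs (S n) gr = 0 /\ fs (S n) gi = fc (S n) b /\ fc (S n) gi = - fs (S n) b).
  { intros n. assert (E := H (Z.of_nat (S n))). assert (E' := H (- Z.of_nat (S n))%Z).
    rewrite (proj1 (fourier_pair gr gi (S n) c1 c2)), fourierR_nat in E by auto. rewrite (proj2 (fourier_pair gr gi (S n) c1 c2)), fourierR_neg in E' by auto.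
    change (Z.sgn (Z.of_nat (S n))) with 1%Z in E. change (Z.sgn (- Z.of_nat (S n))) with (-1)%Z in E'. rewrite Cmult_R_pair in E, E'.
    injection E; intros E2 E1. injection E'; intros E4 E3.
    assert (R : forall u v, / (2 * PI) * u = / (2 * PI) * v -> u = v) by (intros u v Q; apply (Rmult_eq_reg_l _ _ _ Q); auto).
    assert (F1 : fc (S n) gr + fs (S n) gi = fc (S n) b) by (apply R; lra). assert (F2 : fc (S n) gi - fs (S n) gr = - fs (S n) b) by (apply R; lra).
    assert (F3 : fc (S n) gr - fs (S n) gi = - fc (S n) b) by (apply R; lra). assert (F4 : fc (S n) gi + fs (S n) gr = - fs (S n) b) by (apply R; lra). lra. }
  assert (C0 : forall n, fc n (fun _ => 0) = 0 /\ fs n (fun _ => 0) = 0).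
  { intros n; rewrite fc_eq, fs_eq; split; (transitivity (I2 (fun _ => 0)); [apply I2_ext; intros; ring|rewrite I2_const; ring]). }
  split; [|split; [auto|split]].
  - assert (E : gr = fun _ => 0); [|rewrite E; auto]. apply sc_coef_inj; sctac.
    + intros [|n]; [exact (eq_trans (proj1 Z0) (eq_sym (proj1 (C0 0%nat))))|exact (eq_trans (proj1 (G n)) (eq_sym (proj1 (C0 (S n)))))].
    + intros [|n]; [rewrite !fs_0; auto|exact (eq_trans (proj1 (proj2 (G n))) (eq_sym (proj2 (C0 (S n)))))].
  - rewrite <- fc_0. exact (proj2 Z0).
  - intros n. destruct (G n) as (_ & _ & -> & ->). ring.
Qed.
Lemma Hilbert_norm b g k : smooth_circ b -> smooth_circ g -> (forall n, fc (S n) g ^ 2 + fs (S n) g ^ 2 = fc (S n) b ^ 2 + fs (S n) b ^ 2) ->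
  N2 (Derive_n g (S k)) = N2 (Derive_n b (S k)).
Proof.
  intros Hb Hg H. assert (P1 := parseval_sq _ (sc_Derive_n g (S k) Hg)). assert (P2 := parseval_sq _ (sc_Derive_n b (S k) Hb)).
  rewrite !fc_0, !Derive_mean in P1, P2 by auto. apply is_series_unique in P1, P2.
  rewrite (Series_ext _ (fun n => (fc (S n) (Derive_n b (S k)) ^ 2 + fs (S n) (Derive_n b (S k)) ^ 2) / PI)) in P1.
  2:{ intros n. rewrite !coef_Derive_n_sq, H by auto. auto. }
  rewrite P1 in P2. lra.
Qed.

Lemma Kc_Cm_bounds (d : nat -> R) m : (1 <= m)%nat -> exists Cm, forall c, (forall k, (k <= m + 2)%nat -> c k = d k) -> forall b, Kc c b ->
  Cm_norm_le m b Cm /\ forall gr gi, HilbertRel b gr gi -> Cm_norm_le_C m gr gi Cm.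
Proof.
  intros Hm. destruct kappa_exists as [kappa Hk]. destruct (Kc_Cm kappa d m Hk) as [B HB]. assert (PP := PI_RGT_0).
  exists (2 * PI + 2 * PI * B ^ 2 + B). intros c Hc b K. destruct (HB c b Hc K) as [H1 H2]. specialize (H2 Hm).
  assert (Hb : smooth_circ b) by apply K. assert (B0 := CN_pos _ _ _ H1). assert (C := proj1 (CN_spec _ _ _) H1).
  assert (0 <= PI * B ^ 2) by (apply Rmult_le_pos; [lra|apply pow2_ge_0]).
  split; [intros j Hj x; eapply Rle_trans; [apply C; auto|lra]|].
  intros gr gi HH j Hj x. destruct (HilbertRel_coef b gr gi Hb HH) as (Z & Hg & M & E).
  assert (gr = fun _ => 0) by (apply functional_extensionality; auto). subst gr.
  assert (D0 : Derive_n (fun _ => 0) j x = 0) by (destruct j; [auto|apply Derive_n_const]).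
  rewrite D0. replace (0 ^ 2 + Derive_n gi j x ^ 2) with (Rsqr (Derive_n gi j x)) by (unfold Rsqr; ring). rewrite sqrt_Rsqr_abs.
  assert (M' : I2 (Derive_n gi j) = 0) by (destruct j; [auto|apply Derive_mean; auto]).
  eapply Rle_trans; [apply (mean_zero_sup _ (sc_Derive_n gi j Hg) M')|].
  change (Derive (Derive_n gi j)) with (Derive_n gi (S j)). rewrite (Hilbert_norm b gi j Hb Hg E).
  (* For [j = m] the derivative of order [m + 1] is controlled in L^2 only, by the second part of
     [Kc_Cm]; for smaller [j] the uniform bound serves. *)
  destruct (Nat.eq_dec j m) as [->|]; [lra|].
  assert (N2 (Derive_n b (S j)) <= 2 * PI * B ^ 2); [|lra].
  assert (s := sc_Derive_n b (S j) Hb). rewrite <- I2_const. apply I2_le; cstac. intros y. rewrite <- pow2_abs. apply pow_incr; split; [apply Rabs_pos|apply C; lia].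
Qed.
Lemma Kc_eps_bounds c0 c1 : exists eps, 0 < eps /\ forall c, c O = c0 -> c 1%nat = c1 -> forall b, Kc c b -> forall t, eps <= b t <= / eps.
Proof.
  destruct kappa_exists as [kappa Hk]. exists (eps_of kappa c0 c1). split; [apply exp_pos|]. intros c <- <- b K. apply Kc_bounds; auto.
Qed.

(** * Compactness *)

Definition strict (s : nat -> nat) := forall n, (s n < s (S n))%nat.
Lemma strict_ge s n : strict s -> (n <= s n)%nat.
Proof. intros H; induction n; [lia|]. specialize (H n). lia. Qed.
Lemma strict_lt s n m : strict s -> (n < m)%nat -> (s n < s m)%nat.
Proof. intros H; induction 1; auto. specialize (H m). lia. Qed.
Lemma strict_le s n m : strict s -> (n <= m)%nat -> (s n <= s m)%nat.
Proof. intros H L. destruct (Nat.eq_dec n m) as [->|]; [lia|]. apply Nat.lt_le_incl, strict_lt; auto; lia. Qed.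
Lemma strict_comp s t : strict s -> strict t -> strict (fun n => s (t n)).
Proof. intros Hs Ht n. apply strict_lt; auto. Qed.
Lemma lim_seq_eps (u : nat -> R) (l : R) : is_lim_seq u l <-> forall e, 0 < e -> exists N, forall n, (N <= n)%nat -> Rabs (u n - l) <= e.
Proof.
  rewrite <- is_lim_seq_spec. split; intros H.
  - intros e He. destruct (H (mkposreal e He)) as [N HN]. exists N; intros n Hn. apply Rlt_le, (HN n Hn).
  - intros [e He]. destruct (H (e / 2) ltac:(lra)) as [N HN]. exists N; intros n Hn. specialize (HN n Hn). simpl. lra.
Qed.

Lemma convergent_subsequence (u : nat -> R) B : (forall n, Rabs (u n) <= B) -> exists s l, strict s /\ is_lim_seq (fun n => u (s n)) (Finite l).
Proof.
  intros HB. destruct (Bolzano_Weierstrass u (fun c => - B <= c <= B) (compact_P3 (- B) B)) as [l Hl].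
  { intros n. apply Rabs_le_between, HB. }
  assert (P : forall N n, exists p, (N <= p)%nat /\ Rabs (u p - l) < / INR (S n)).
  { intros N n. assert (H : 0 < / INR (S n)) by (apply Rinv_0_lt_compat, INR_S_pos).
    destruct (Hl (disc l (mkposreal _ H)) N) as (p & Hp & D); [|exists p; split; auto].
    exists (mkposreal _ H). intros y Hy; exact Hy. }
  assert (P' : forall Nn : nat * nat, { p | (fst Nn <= p)%nat /\ Rabs (u p - l) < / INR (S (snd Nn)) }).
  { intros [N n]. apply constructive_indefinite_description, P. }
  set (s := fix s n := match n with O => proj1_sig (P' (O, O)) | S m => proj1_sig (P' (S (s m), n)) end).
  exists s, l. split.
  - intros n. simpl. destruct (proj2_sig (P' (S (s n), S n))) as [H _]. simpl in H. exact H.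
  - apply lim_seq_eps. intros e He. destruct (nat_above (/ e)) as [N HN]. exists N. intros n Hn.
    assert (A : Rabs (u (s n) - l) < / INR (S n)) by (destruct n; [apply (proj2_sig (P' (0%nat, 0%nat)))|apply (proj2_sig (P' (S (s n), S n)))]).
    apply Rlt_le. eapply Rlt_le_trans; [apply A|]. rewrite <- (Rinv_inv e). apply Rinv_le_contravar; [apply Rinv_0_lt_compat; auto|].
    eapply Rle_trans; [apply HN|]. apply le_INR; lia.
Qed.

Lemma diagonal_subsequence (X : nat -> nat -> R) : (forall j, exists B, forall i, Rabs (X j i) <= B) ->
  exists s, strict s /\ forall j, exists l, is_lim_seq (fun n => X j (s n)) (Finite l).
Proof.
  intros HX.
  assert (P : forall (s : nat -> nat) j, { r | strict r /\ exists l, is_lim_seq (fun n => X j (s (r n))) (Finite l) }).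
  { intros s j. apply constructive_indefinite_description. destruct (HX j) as [B HB].
    destruct (convergent_subsequence (fun n => X j (s n)) B) as (r & l & H1 & H2); [intros; apply HB|]. exists r; split; [auto|exists l; auto]. }
  (* [s j] is the composition of the first [j] refinements, so from the index [j] on the diagonal
     takes its values among those of [s j], at indices that are at least as large; [Hc] records
     this. *)
  set (s := fix s j := match j with O => fun n => n | S k => fun n => s k (proj1_sig (P (s k) k) n) end).
  assert (Hs : forall j, strict (s j)).
  { induction j; [intros n; simpl; lia|]. simpl. apply strict_comp; auto. apply (proj2_sig (P (s j) j)). }
  assert (Hc : forall j d n, exists t, (n <= t)%nat /\ s (d + j)%nat n = s j t).
  { intros j d. induction d; intros n; [exists n; auto|]. simpl. destruct (IHd (proj1_sig (P (s (d + j)%nat) (d + j)%nat) n)) as (t & H1 & H2).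
    exists t; split; auto. eapply Nat.le_trans; [|apply H1]. apply strict_ge, (proj2_sig (P (s (d + j)%nat) (d + j)%nat)). }
  exists (fun n => s n n). split.
  - intros n. eapply Nat.lt_le_trans; [apply (strict_lt (s n) n (S n)); auto|]. simpl. apply strict_le; auto. apply strict_ge, (proj2_sig (P (s n) n)).
  - intros j. destruct (proj2 (proj2_sig (P (s j) j))) as [l Hl]. exists l.
    change (is_lim_seq (fun n => X j (s (S j) n)) l) in Hl. rewrite lim_seq_eps in Hl. apply lim_seq_eps. intros e He. destruct (Hl e He) as [N HN].
    exists (N + S j)%nat. intros n Hn. destruct (Hc (S j) (n - S j)%nat n) as (t & H1 & H2). replace (n - S j + S j)%nat with n in H2 by lia.
    rewrite H2. apply HN. lia.
Qed.

Lemma series_dominated (a : nat -> nat -> R) (l M : nat -> R) : (forall i n, Rabs (a i n) <= M n) -> ex_series M ->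
  (forall n, is_lim_seq (fun i => a i n) (l n)) -> ex_series l /\ is_lim_seq (fun i => Series (a i)) (Series l).
Proof.
  intros Ha HM Hl.
  assert (LM : forall n, Rabs (l n) <= M n).
  { intros n. apply (is_lim_seq_le (fun i => Rabs (a i n)) (fun _ => M n) (Rabs (l n)) (M n)); auto; [apply (is_lim_seq_abs _ (l n)); auto|apply is_lim_seq_const]. }
  assert (El : ex_series l) by (apply (ex_series_Rle l M); auto). split; auto.
  apply lim_seq_eps. intros e He. destruct (series_tail M HM (e / 3) ltac:(lra)) as [N HN].
  assert (F : is_lim_seq (fun i => sum_n (a i) N) (sum_n l N)).
  { clear HN. induction N; [apply (is_lim_seq_ext (fun i => a i 0%nat)); [intros; rewrite sum_O; auto|rewrite sum_O; apply Hl]|].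
    rewrite sum_Sn. apply (is_lim_seq_ext (fun i => sum_n (a i) N + a i (S N))); [intros; rewrite sum_Sn; auto|]. apply is_lim_seq_plus'; auto. }
  rewrite lim_seq_eps in F. destruct (F (e / 3) ltac:(lra)) as [I HI]. exists I; intros i Hi. specialize (HI i Hi).
  assert (T : forall u, (forall n, Rabs (u n) <= M n) -> Rabs (Series u - sum_n u N) <= e / 3).
  { intros u Hu. assert (Q := Series_minus_sum_n u N (ex_series_Rle u M Hu HM)). assert (Q' := Series_minus_sum_n M N HM). specialize (HN N (Nat.le_refl N)).
    rewrite Q. eapply Rle_trans; [apply (Series_Rabs_le _ (fun k => M (S N + k)%nat)); [intros; apply Hu|apply (ex_series_incr_n M (S N)); auto]|].
    rewrite <- Q'. generalize (RRle_abs (Series M - sum_n M N)); lra. }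
  assert (T1 := T (a i) (Ha i)). assert (T2 := T l LM). apply Rabs_le_between in T1, T2, HI. apply Rabs_le_between. lra.
Qed.

(** Uniform convergence with a bounded limit; the bound is what makes products converge. *)
Definition uc (F : nat -> R -> R) G := (exists B, forall x, Rabs (G x) <= B) /\
  forall e, 0 < e -> exists N, forall n, (N <= n)%nat -> forall x, Rabs (F n x - G x) <= e.
Lemma uc_lim F G x : uc F G -> is_lim_seq (fun n => F n x) (G x).
Proof. intros [_ H]. apply lim_seq_eps. intros e He. destruct (H e He) as [N HN]. exists N; auto. Qed.
Lemma uc_const G : (exists B, forall x, Rabs (G x) <= B) -> uc (fun _ => G) G.
Proof. intros H; split; auto. intros e He. exists 0%nat. intros. replace (G x - G x) with 0 by ring. rewrite Rabs_R0; lra. Qed.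
Lemma uc_ext F F' G : (forall n x, F n x = F' n x) -> uc F G -> uc F' G.
Proof. intros H [H1 H2]; split; auto. intros e He. destruct (H2 e He) as [N HN]. exists N; intros; rewrite <- H; auto. Qed.
Lemma uc_mult F G F' G' : uc F G -> uc F' G' -> uc (fun n x => F n x * F' n x) (fun x => G x * G' x).
Proof.
  intros [[B HB] H] [[B' HB'] H'].
  assert (B0 : 0 <= B) by (generalize (HB 0) (Rabs_pos (G 0)); lra). assert (B0' : 0 <= B') by (generalize (HB' 0) (Rabs_pos (G' 0)); lra).
  split; [exists (B * B'); intros; apply Rabs_mult_le; auto|]. intros e He.
  set (d := Rmin 1 (e / (B + B' + 1))). assert (D0 : 0 < d) by (apply Rmin_glb_lt; [lra|apply Rdiv_lt_0_compat; lra]).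
  assert (D1 : d <= 1) by apply Rmin_l.
  assert (D2 : d * (B + B' + 1) <= e).
  { apply Rle_trans with (e / (B + B' + 1) * (B + B' + 1)); [apply Rmult_le_compat_r; [lra|apply Rmin_r]|apply Req_le; field; lra]. }
  destruct (H d D0) as [N HN]. destruct (H' d D0) as [N' HN']. exists (N + N')%nat. intros n Hn x.
  specialize (HN n ltac:(lia) x). specialize (HN' n ltac:(lia) x).
  replace (F n x * F' n x - G x * G' x) with ((F n x - G x) * (F' n x - G' x) + (G x * (F' n x - G' x) + (F n x - G x) * G' x)) by ring.
  apply Rle_trans with (d * d + (B * d + d * B')); [|nra].
  apply Rabs_plus_le; [apply Rabs_mult_le; auto|apply Rabs_plus_le; apply Rabs_mult_le; auto].
Qed.
Lemma uc_lip F G (h : R -> R) (D : R -> Prop) K B : 0 <= K -> (forall n x, D (F n x)) -> (forall x, D (G x)) -> (forall x y, D x -> D y -> Rabs (h x - h y) <= K * Rabs (x - y)) ->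
  (forall x, D x -> Rabs (h x) <= B) -> uc F G -> uc (fun n x => h (F n x)) (fun x => h (G x)).
Proof.
  intros HK HF HG Hh HB [_ H]. split; [exists B; intros; apply HB; auto|]. intros e He.
  destruct (H (e / (K + 1)) ltac:(apply Rdiv_lt_0_compat; lra)) as [N HN]. exists N; intros n Hn x. specialize (HN n Hn x).
  eapply Rle_trans; [apply Hh; auto|]. apply Rle_trans with (K * (e / (K + 1))); [apply Rmult_le_compat_l; auto|].
  replace (K * (e / (K + 1))) with (e * (K / (K + 1))) by (field; lra). assert (K / (K + 1) <= 1); [|nra].
  apply Rmult_le_reg_r with (K + 1); [lra|]. unfold Rdiv; rewrite Rmult_assoc, Rinv_l; lra.
Qed.
Lemma uc_inv F G e : 0 < e -> (forall n x, e <= F n x) -> (forall x, e <= G x) -> uc F G -> uc (fun n x => / F n x) (fun x => / G x).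
Proof.
  intros He HF HG H. apply (uc_lip F G Rinv (fun x => e <= x) (/ (e * e)) (/ e)); auto.
  - apply Rinv_nneg; nra.
  - intros x y Hx Hy. replace (/ x - / y) with (/ (x * y) * - (x - y)) by (field; lra). rewrite Rabs_mult, Rabs_Ropp.
    apply Rmult_le_compat_r; [apply Rabs_pos|]. rewrite Rabs_inv, Rabs_right by nra. apply Rinv_le_contravar; nra.
  - intros x Hx. rewrite Rabs_inv, Rabs_right by lra. apply Rinv_le_contravar; lra.
Qed.
Lemma uc_sqrt F G e : 0 < e -> e <= 1 -> (forall n x, e <= F n x <= / e) -> (forall x, e <= G x <= / e) -> uc F G -> uc (fun n x => sqrt (F n x)) (fun x => sqrt (G x)).
Proof.
  intros He He1 HF HG H. apply (uc_lip F G sqrt (fun x => e <= x <= / e) (/ e) (1 + / e)); auto.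
  - apply Rinv_nneg; auto.
  - intros x y Hx Hy.
    assert (Q : forall z, e <= z -> e <= sqrt z).
    { intros z Hz. rewrite <- (sqrt_Rsqr e) by lra. apply sqrt_le_1_alt. unfold Rsqr. nra. }
    assert (Qx := Q x ltac:(lra)). assert (Qy := Q y ltac:(lra)).
    assert (E : (sqrt x - sqrt y) * (sqrt x + sqrt y) = x - y).
    { replace ((sqrt x - sqrt y) * (sqrt x + sqrt y)) with (sqrt x * sqrt x - sqrt y * sqrt y) by ring. rewrite !sqrt_sqrt by lra. auto. }
    rewrite <- E, Rabs_mult, (Rabs_right (sqrt x + sqrt y)) by lra.
    assert (0 < / e) by (apply Rinv_0_lt_compat; auto). assert (1 <= / e * (sqrt x + sqrt y)).
    { apply Rmult_le_reg_l with e; auto. rewrite <- Rmult_assoc, Rinv_r by lra. lra. }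
    generalize (Rabs_pos (sqrt x - sqrt y)); nra.
  - intros x Hx. rewrite Rabs_right by (apply Rle_ge, sqrt_pos). assert (S := sqrt_sqrt x ltac:(lra)). generalize (sqrt_pos x); nra.
Qed.
Lemma uc_I2 F G : (forall n, cts (F n)) -> cts G -> uc F G -> is_lim_seq (fun n => I2 (F n)) (I2 G).
Proof.
  intros HF HG [_ H]. assert (PP := two_pi_pos). apply lim_seq_eps. intros e He. destruct (H (e / (2 * PI)) ltac:(apply Rdiv_lt_0_compat; lra)) as [N HN].
  exists N; intros n Hn. rewrite <- I2_minus by auto. eapply Rle_trans; [apply (I2_bound _ (e / (2 * PI))); [ctac|intros; apply HN; auto]|]. apply Req_le; field; lra.
Qed.

(** Convergence of each coefficient and bounds in C^infinity imply convergence in C^infinity: the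
    weighted coefficients of the difference have a common summable majorant, and dominated
    convergence applies to their sum. *)
Lemma pusm_coef_uc (F : nat -> R -> R) G : pusm F -> smooth_circ G ->
  (forall n, is_lim_seq (fun i => fc n (F i)) (fc n G)) -> (forall n, is_lim_seq (fun i => fs n (F i)) (fs n G)) ->
  forall j, uc (fun i => Derive_n (F i) j) (Derive_n G j).
Proof.
  intros HF HG Hc Hs j. assert (PP := PI_RGT_0).
  assert (HH : pusm (fun i x => F i x - G x)) by (apply pusm_minus; [auto|apply (sc_pusm G HG)]).
  destruct (pusm_rapid _ HH (j + 2)%nat) as [C HC].
  set (a := fun i n => INR (S n) ^ j * (Rabs (fc (S n) (fun x => F i x - G x)) + Rabs (fs (S n) (fun x => F i x - G x)))).
  assert (Ec : forall i n, fc n (fun x => F i x - G x) = fc n (F i) - fc n G /\ fs n (fun x => F i x - G x) = fs n (F i) - fs n G).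
  { intros i n. assert (sF := pusm_sc F i HF). rewrite !fc_eq, !fs_eq. rewrite <- !I2_minus by cstac. split; apply I2_ext; intros; ring. }
  assert (L0 : forall (u : nat -> R) (l : R), is_lim_seq u l -> is_lim_seq (fun i => Rabs (u i - l)) 0).
  { intros u l Hu. rewrite lim_seq_eps in *. intros e He. destruct (Hu e He) as [N HN]. exists N; intros n Hn. rewrite Rminus_0_r, Rabs_Rabsolu. auto. }
  assert (Abd : forall i n, Rabs (a i n) <= C * / INR (S n) ^ 2).
  { intros i n. assert (P2 : 0 < INR (S n) ^ 2) by (apply pow_lt, INR_S_pos). specialize (HC i n). unfold a. rewrite pow_add in HC.
    rewrite Rabs_right.
    - apply Rmult_le_reg_r with (INR (S n) ^ 2); auto. rewrite (Rmult_assoc C), Rinv_l, Rmult_1_r by lra. lra.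
    - apply Rle_ge, Rmult_le_pos; [apply pow_le, pos_INR|]. generalize (Rabs_pos (fc (S n) (fun x => F i x - G x))) (Rabs_pos (fs (S n) (fun x => F i x - G x))); lra. }
  assert (Csum : ex_series (fun n => C * / INR (S n) ^ 2)) by apply ex_series_scalR, ex_series_inv_sq.
  destruct (series_dominated a (fun _ => 0) (fun n => C * / INR (S n) ^ 2)) as [_ D]; auto.
  - intros n. unfold a. replace 0 with (INR (S n) ^ j * (0 + 0)) by ring. apply (is_lim_seq_scal_l _ _ (0 + 0)), is_lim_seq_plus'.
    + apply (is_lim_seq_ext (fun i => Rabs (fc (S n) (F i) - fc (S n) G))); [intros i; rewrite (proj1 (Ec i (S n))); auto|apply L0, Hc].
    + apply (is_lim_seq_ext (fun i => Rabs (fs (S n) (F i) - fs (S n) G))); [intros i; rewrite (proj2 (Ec i (S n))); auto|apply L0, Hs].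
  - assert (sj := sc_Derive_n G j HG). split; [apply sc_bounded; auto|].
    replace (Series (fun _ => 0)) with 0 in D by (symmetry; apply is_series_unique, is_series_zero).
    assert (D2 := L0 _ _ (Hc 0%nat)). rewrite lim_seq_eps in D, D2. intros e He.
    destruct (D (e / 2) ltac:(lra)) as [N1 H1]. destruct (D2 (e / 2) ltac:(lra)) as [N2 H2]. exists (N1 + N2)%nat; intros n Hn x.
    specialize (H1 n ltac:(lia)). specialize (H2 n ltac:(lia)). rewrite Rminus_0_r in H1, H2. rewrite Rabs_Rabsolu in H2.
    assert (sF := pusm_sc F n HF). assert (sd : smooth_circ (fun x => F n x - G x)) by sctac.
    assert (Ed : forall k x, Derive_n (fun x => F n x - G x) k x = Derive_n (F n) k x - Derive_n G k x).
    { intros k; induction k; intros y; [auto|]. change (Derive (Derive_n (fun x => F n x - G x) k) y = Derive_n (F n) (S k) y - Derive_n G (S k) y).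
      rewrite (Derive_ext _ (fun y => Derive_n (F n) k y - Derive_n G k y)) by auto. rewrite Derive_minus; [auto| |]; apply sc_ex_derive, sc_Derive_n; auto. }
    rewrite <- Ed. assert (sdj := sc_Derive_n _ j sd).
    assert (EA : ex_series (a n)) by (apply (ex_series_Rle (a n) _ (Abd n) Csum)).
    assert (B := sc_sup_bound _ (a n) sdj EA ltac:(intros k; rewrite coef_Derive_n_abs by auto; apply Rle_refl) x).
    assert (P2 := PI2_1). assert (Z : Rabs (fc 0 (Derive_n (fun x => F n x - G x) j)) <= e / 2).
    { destruct j.
      - change (Derive_n (fun x => F n x - G x) 0) with (fun x => F n x - G x). rewrite (proj1 (Ec n 0%nat)). auto.
      - rewrite fc_0, Derive_mean, Rabs_R0 by auto. lra. }
    assert (Y := RRle_abs (Series (a n))). assert (Rabs (fc 0 (Derive_n (fun x => F n x - G x) j)) / (2 * PI) <= e / 2).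
    { apply Rmult_le_reg_r with (2 * PI); [lra|]. unfold Rdiv at 1. rewrite Rmult_assoc, Rinv_l by lra. nra. }
    assert (Series (a n) / PI <= e / 2); [|lra]. apply Rmult_le_reg_r with PI; [lra|]. unfold Rdiv at 1. rewrite Rmult_assoc, Rinv_l by lra. nra.
Qed.

Lemma limit_function (F : nat -> R -> R) (cl dl : nat -> R) : pusm F -> (forall n, is_lim_seq (fun i => fc n (F i)) (cl n)) -> (forall n, is_lim_seq (fun i => fs n (F i)) (dl n)) ->
  exists G, smooth_circ G /\ forall j, uc (fun i => Derive_n (F i) j) (Derive_n G j).
Proof.
  intros HF Hc Hd. assert (PP := PI_RGT_0).
  assert (HR : rapid (fun _ : unit => fun n => cl n / PI) (fun _ => fun n => dl n / PI)).
  { intros m. destruct (pusm_rapid F HF m) as [C HC]. exists (C / PI). intros _ n.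
    assert (L : INR (S n) ^ m * (Rabs (cl (S n)) + Rabs (dl (S n))) <= C).
    { apply (is_lim_seq_le (fun i => INR (S n) ^ m * (Rabs (fc (S n) (F i)) + Rabs (fs (S n) (F i)))) (fun _ => C) (INR (S n) ^ m * (Rabs (cl (S n)) + Rabs (dl (S n)))) C); [intros; apply HC| |apply is_lim_seq_const].
      apply (is_lim_seq_scal_l _ _ (Finite (Rabs (cl (S n)) + Rabs (dl (S n))))), is_lim_seq_plus'; [apply (is_lim_seq_abs _ (cl (S n)))|apply (is_lim_seq_abs _ (dl (S n)))]; auto. }
    unfold Rdiv. rewrite !Rabs_mult, (Rabs_right (/ PI)) by (apply Rle_ge, Rinv_nneg; auto).
    rewrite <- Rmult_plus_distr_r, <- Rmult_assoc. apply Rmult_le_compat_r; auto. apply Rinv_nneg; auto. }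
  set (g := ts (fun n => cl n / PI) (fun n => dl n / PI)). assert (sg : smooth_circ g) by (apply sc_tser; auto).
  set (G := fun x => cl 0%nat / (2 * PI) + g x). assert (sG : smooth_circ G) by (unfold G; sctac). exists G. split; auto.
  assert (EG : forall n, fc n G = cl n /\ fs n G = dl n).
  { intros n. assert (E1 : fc n G = fc n (fun _ => cl 0%nat / (2 * PI)) + fc n g /\ fs n G = fs n (fun _ => cl 0%nat / (2 * PI)) + fs n g).
    { rewrite !fc_eq, !fs_eq, <- !I2_plus by cstac. split; apply I2_ext; intros; unfold G; ring. }
    destruct E1 as [-> ->]. destruct n as [|n].
    - rewrite !fs_0, (fc_0 (fun _ => _)), I2_const. destruct (ts_coef _ _ HR 0) as (_ & _ & E). unfold g; rewrite E. split; [field; lra|].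
      assert (Z := Hd 0%nat). apply (is_lim_seq_ext _ (fun _ => 0)) in Z; [|intros; apply fs_0]. apply is_lim_seq_unique in Z. rewrite Lim_seq_const in Z. injection Z; intros <-. ring.
    - destruct (ts_coef _ _ HR n) as (E1 & E2 & _). unfold g. rewrite E1, E2. rewrite fc_eq, fs_eq, !I2_scal by ctac.
      assert (Z1 : I2 (fun x => cos (INR (S n) * x)) = 0) by (destruct (coef_cosn 0 (S n)) as [Q _]; rewrite fc_0 in Q; exact Q).
      assert (Z2 : I2 (fun x => sin (INR (S n) * x)) = 0) by (destruct (coef_sinn 0 (S n)) as [Q _]; rewrite fc_0 in Q; exact Q).
      rewrite Z1, Z2. split; field; lra. }
  apply pusm_coef_uc; auto; intros n; [rewrite (proj1 (EG n))|rewrite (proj2 (EG n))]; auto.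
Qed.

Lemma pusm_coef_bound {I} (F : I -> R -> R) n : pusm F -> exists B, forall i, Rabs (fc n (F i)) <= B /\ Rabs (fs n (F i)) <= B.
Proof.
  intros HF. destruct (usm_bd F (proj1 HF)) as [B HB]. exists (2 * PI * B). intros i. assert (s := pusm_sc F i HF). rewrite fc_eq, fs_eq.  split.
  - apply I2_bound; [cstac|]. intros x. rewrite <- (Rmult_1_r B). apply Rabs_mult_le; auto. apply Rabs_le, COS_bound.
  - apply I2_bound; [cstac|]. intros x. rewrite <- (Rmult_1_r B). apply Rabs_mult_le; auto. apply Rabs_le, SIN_bound.
Qed.
(** One subsequence for countably many families of functions and sequences of numbers. All of them
    are coded in the numerical sequences [X], where the tag [t] tells numbers, cosine coefficients
    and sine coefficients apart, and a single diagonal argument follows. *)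
Lemma arzela (F : nat -> nat -> R -> R) (L : nat -> nat -> R) : (forall k, pusm (F k)) -> (forall k, exists B, forall i, Rabs (L k i) <= B) ->
  exists s (G : nat -> R -> R) (l : nat -> R), strict s /\ forall k, smooth_circ (G k) /\ (forall j, uc (fun i => Derive_n (F k (s i)) j) (Derive_n (G k) j)) /\ is_lim_seq (fun i => L k (s i)) (l k).
Proof.
  intros HF HL.
  set (X := fun j i => let (k, m) := Cantor.of_nat j in let (t, n) := Cantor.of_nat m in
    match t with O => L k i | 1%nat => fc n (F k i) | _ => fs n (F k i) end).
  assert (HX : forall j, exists B, forall i, Rabs (X j i) <= B).
  { intros j. unfold X. destruct (Cantor.of_nat j) as [k m]. destruct (Cantor.of_nat m) as [t n]. destruct (HL k) as [B HB]. destruct (pusm_coef_bound (F k) n (HF k)) as [B' HB'].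
    destruct t as [|[|t]]; [exists B; auto|exists B'; apply HB'|exists B'; apply HB']. }
  destruct (diagonal_subsequence X HX) as (s & Hs & HX').
  assert (A : forall k t n, exists l, is_lim_seq (fun i => X (Cantor.to_nat (k, Cantor.to_nat (t, n))) (s i)) (Finite l)) by (intros; apply HX').
  unfold X in A. assert (A' := A). clear A.
  assert (A1 : forall k, exists l, is_lim_seq (fun i => L k (s i)) (Finite l)) by (intros k; specialize (A' k 0%nat 0%nat); rewrite !Cantor.cancel_of_to in A'; exact A').
  assert (A2 : forall k n, exists l, is_lim_seq (fun i => fc n (F k (s i))) (Finite l)) by (intros k n; specialize (A' k 1%nat n); rewrite !Cantor.cancel_of_to in A'; exact A').
  assert (A3 : forall k n, exists l, is_lim_seq (fun i => fs n (F k (s i))) (Finite l)) by (intros k n; specialize (A' k 2%nat n); rewrite !Cantor.cancel_of_to in A'; exact A').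
  assert (B : forall k, { Gl : (R -> R) * R | smooth_circ (fst Gl) /\ (forall j, uc (fun i => Derive_n (F k (s i)) j) (Derive_n (fst Gl) j)) /\ is_lim_seq (fun i => L k (s i)) (snd Gl) }).
  { intros k. apply constructive_indefinite_description. destruct (A1 k) as [l Hl].
    destruct (limit_function (fun i => F k (s i)) (fun n => proj1_sig (constructive_indefinite_description _ (A2 k n))) (fun n => proj1_sig (constructive_indefinite_description _ (A3 k n)))) as (G & HG & HU).
    - apply (pusm_reindex (F k) s (HF k)).
    - intros n. exact (proj2_sig (constructive_indefinite_description _ (A2 k n))).
    - intros n. exact (proj2_sig (constructive_indefinite_description _ (A3 k n))).
    - exists (G, l). auto. }
  exists s, (fun k => fst (proj1_sig (B k))), (fun k => snd (proj1_sig (B k))). split; auto. intros k. exact (proj2_sig (B k)).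
Qed.

(** * Two-sided growth of the eigenvalues *)

Lemma rsum_split N P Q M : (forall k, 0 <= P k) -> (forall k, 0 <= Q k) -> (forall k, (N <= k)%nat -> P k <= Q k) -> rsum M P <= rsum N P + rsum M Q.
Proof.
  intros HP HQ H. induction M; [simpl; generalize (rsum_nonneg N P HP); lra|].
  destruct (Nat.le_gt_cases N M) as [L|L].
  - cbn [rsum]. specialize (H M L). lra.
  - assert (A := rsum_mono (S M) N P HP L). assert (B := rsum_nonneg (S M) Q HQ). lra.
Qed.
Lemma rsum_swap n m (f : nat -> nat -> R) : rsum n (fun i => rsum m (f i)) = rsum m (fun j => rsum n (fun i => f i j)).
Proof.
  induction n; cbn [rsum]; [induction m; cbn [rsum]; [auto|rewrite <- IHm; ring]|]. rewrite IHn, <- rsum_plus. auto.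
Qed.
Lemma rsum_const n c : rsum n (fun _ => c) = INR n * c.
Proof. induction n; [simpl; ring|]. rewrite S_INR. simpl. rewrite IHn. ring. Qed.
Lemma rsum_le_lt n f g : (forall k, (k < n)%nat -> f k <= g k) -> rsum n f <= rsum n g.
Proof. induction n; intros H; simpl; [lra|]. assert (A := H n ltac:(lia)). assert (B := IHn ltac:(intros; apply H; lia)). lra. Qed.

Section Growth.
Variables (b : R -> R) (lam : nat -> R) (phi : nat -> R -> R) (eps : R).
Hypothesis Hadm : admissible b.
Hypothesis HE : eigen_decomp b lam phi.
Hypothesis He : 0 < eps.
Hypothesis Hm : forall x, eps <= b x <= / eps.
Let Hb : smooth_circ b. Proof. apply Hadm. Qed.
Let bpos : forall x, 0 < b x. Proof. apply Hadm. Qed.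
Let sr : smooth_circ (fun x => sqrt (b x)). Proof. sctac. Qed.
Let rpos : forall x, 0 < sqrt (b x). Proof. intros; apply sqrt_lt_R0; auto. Qed.
Let sri : smooth_circ (fun x => / sqrt (b x)). Proof. sctac. Qed.
Let sph k : smooth_circ (phi k). Proof. apply (sc_phi b lam phi HE). Qed.
Let rr x : sqrt (b x) * sqrt (b x) = b x. Proof. apply sqrt_sqrt, Rlt_le; auto. Qed.
Notation Pk := (Pm b phi).

(** For [b^(1/2) phi] the eigenvalue equation reads [Lambda f = lam f / b], which is free of square
    roots and suits elliptic estimates. *)
Definition rphi k x := sqrt (b x) * phi k x.
Lemma sc_rphi k : smooth_circ (rphi k).
Proof. unfold rphi; apply sc_mult; auto. Qed.
Lemma rphi_norm k : N2 (rphi k) <= / eps.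
Proof.
  assert (O := phi_ortho b lam phi HE k k). rewrite Nat.eqb_refl in O. rewrite <- (Rmult_1_r (/ eps)), <- O, <- I2_scal by cstac.
  assert (s := sc_rphi k). apply I2_le; cstac. intros x. unfold rphi. replace ((sqrt (b x) * phi k x) ^ 2) with ((sqrt (b x) * sqrt (b x)) * (phi k x * phi k x)) by ring.
  rewrite rr. apply Rmult_le_compat_r; [apply Rle_0_sqr|apply Hm].
Qed.
Lemma Lam_rphi k : Lam (rphi k) = fun x => lam k * (/ b x * rphi k x).
Proof.
  fext x. assert (E := f_equal (fun f => f x) (phi_eigen b lam phi Hadm HE k)). unfold Aop in E. cbv beta in E.
  change (fun y => sqrt (b y) * phi k y) with (rphi k) in E. unfold rphi at 2. replace (/ b x) with (/ (sqrt (b x) * sqrt (b x))) by (rewrite rr; auto). generalize (rpos x); intros.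
  apply Rmult_eq_reg_l with (sqrt (b x)); [|lra]. rewrite E. field. lra.
Qed.
Lemma Lam_rphi_norm k : eps * N2 (Derive (rphi k)) <= lam k ^ 2.
Proof.
  assert (s := sc_rphi k). rewrite <- Lam_norm, <- I2_scal by cstac. assert (O := phi_ortho b lam phi HE k k). rewrite Nat.eqb_refl in O.
  rewrite <- (Rmult_1_r (lam k ^ 2)), <- O, <- I2_scal by cstac. apply I2_le; cstac. intros x. rewrite Lam_rphi. unfold rphi.
  replace ((lam k * (/ b x * (sqrt (b x) * phi k x))) ^ 2) with (lam k ^ 2 * (phi k x * phi k x) * ((sqrt (b x) * sqrt (b x)) * (/ b x * / b x))) by ring.
  rewrite rr. generalize (bpos x) (Hm x); intros. replace (b x * (/ b x * / b x)) with (/ b x) by (field; lra).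
  assert (0 <= lam k ^ 2 * (phi k x * phi k x)) by (apply Rmult_le_pos; [apply pow2_ge_0|apply Rle_0_sqr]).
  assert (eps * / b x <= 1) by (apply Rmult_le_reg_r with (b x); auto; rewrite Rmult_assoc, Rinv_l; lra). nra.
Qed.

(** The sum is the energy of [b^(1/2) phi_k] in the angle. It is comparable to the energy in [x],
    where [D] and [Lambda] have equal norms, and the eigenvalue equation evaluates the latter. *)
Lemma Pm_sq_bound k M : rsum M (fun n => INR (S n) ^ 2 * Pk (S n) k) <= lam k ^ 2 / eps ^ 2.
Proof.
  set (h := fun x => / sqrt (b x) * phi k x). assert (sh : smooth_circ h) by (unfold h; apply sc_mult; auto).
  assert (Eh : DB b h = Derive (rphi k)).
  { unfold DB, h, rphi. f_equal. fext x. transitivity (sqrt (b x) * sqrt (b x) * (/ sqrt (b x) * phi k x)); [rewrite rr; auto|]. generalize (rpos x); intros; field; lra. }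
  assert (sD := sc_Derive _ (sc_rphi k)). assert (PP := PI_RGT_0).
  assert (PS := phase_parseval b Hadm (Derive (rphi k)) sD (Derive_mean (rphi k) 0 (sc_rphi k))).
  assert (E : forall n, INR n ^ 2 * Pk n k = (ip (csn b n) (Derive (rphi k)) ^ 2 + ip (snn b n) (Derive (rphi k)) ^ 2) / PI).
  { intros n. assert (D := DBp_coef b Hadm 1 n h sh). change (DBp b 1 h) with (DB b h) in D. rewrite Eh in D. rewrite <- D. change (2 * 1)%nat with 2%nat.
    assert (sc := sc_csn b Hadm n). assert (ss := sc_snn b Hadm n).
    assert (A1 : ak phi k (pc b n) = / sqrt PI * ip (csn b n) h).
    { unfold ak. rewrite <- I2_scal by cstac. apply I2_ext; intros x. unfold pc, h. ring. }
    assert (A2 : ak phi k (ps b n) = / sqrt PI * ip (snn b n) h).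
    { unfold ak. rewrite <- I2_scal by cstac. apply I2_ext; intros x. unfold ps, h. ring. }
    unfold Pm. rewrite A1, A2, !Rpow_mult_distr. replace ((/ sqrt PI) ^ 2) with (/ sqrt PI * / sqrt PI) by ring. rewrite inv_sqrt_PI. unfold Rdiv; ring. }
  rewrite (rsum_ext M _ (fun n => (ip (csn b (S n)) (Derive (rphi k)) ^ 2 + ip (snn b (S n)) (Derive (rphi k)) ^ 2) / PI)) by (intros; apply E).
  eapply Rle_trans; [apply (rsum_le_series _ _ M) with (2 := PS)|].
  - intros n; cbv beta. apply Rmult_le_pos; [|apply Rinv_nneg; auto]. apply Rplus_le_le_0_compat; apply pow2_ge_0.
  - apply Rle_trans with (/ eps * N2 (Derive (rphi k))).
    + rewrite <- I2_scal by cstac. apply I2_le; cstac. intros x. apply Rmult_le_compat_r; [apply pow2_ge_0|apply Hm].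
    + assert (L := Lam_rphi_norm k). apply Rmult_le_reg_l with (eps ^ 2); [nra|]. replace (eps ^ 2 * (lam k ^ 2 / eps ^ 2)) with (lam k ^ 2) by (field; lra).
      replace (eps ^ 2 * (/ eps * N2 (Derive (rphi k)))) with (eps * N2 (Derive (rphi k))) by (field; lra). auto.
Qed.

(** A count in place of the min-max principle. The first [4 N + 1] positive eigenvalues have total
    overlap [4 N + 1], of which the first [N] frequencies carry at most [2 N]. The rest sits at
    frequencies above [N], which by [Pm_sq_bound] is possible only if the largest of these
    eigenvalues is large. *)
Lemma lam_growth_block N : INR (S N) ^ 2 <= 2 / eps ^ 2 * lam (S (4 * N)) ^ 2.
Proof.
  set (L := lam (S (4 * N)) ^ 2 / eps ^ 2). set (q := INR (S N) ^ 2). assert (q0 : 0 < q) by (apply pow_lt, INR_S_pos).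
  assert (e2 : 0 < eps ^ 2) by nra.
  assert (A : forall k, (k < 4 * N + 1)%nat -> 1 <= rsum N (fun n => Pk (S n) (S k)) + L / q).
  { intros k Hk. apply (series_le_rsum _ _ _ (Pm_sum_n b lam phi Hadm HE k)). intros M.
    eapply Rle_trans; [apply (rsum_split N _ (fun n => / q * (INR (S n) ^ 2 * Pk (S n) (S k))))|].
    - intros; apply Pm_nonneg.
    - intros n. apply Rmult_le_pos; [apply Rinv_nneg; auto|]. apply Rmult_le_pos; [apply pow2_ge_0|apply Pm_nonneg].
    - intros n Hn. rewrite <- Rmult_assoc. rewrite <- (Rmult_1_l (Pk (S n) (S k))) at 1. apply Rmult_le_compat_r; [apply Pm_nonneg|].
      apply Rmult_le_reg_l with q; auto. rewrite <- Rmult_assoc, Rinv_r, Rmult_1_l, Rmult_1_r by lra. apply pow_incr; split; [apply pos_INR|apply le_INR; lia].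
    - apply Rplus_le_compat_l. rewrite rsum_scal, Rmult_comm. apply Rmult_le_compat_r; [apply Rinv_nneg; auto|].
      eapply Rle_trans; [apply Pm_sq_bound|]. unfold L, Rdiv. apply Rmult_le_compat_r; [apply Rinv_nneg; auto|].
      apply pow_incr; split; [apply (lam_nonneg b lam phi Hadm HE)|apply (lam_mono b lam phi HE); lia]. }
  assert (B := rsum_le_lt (4 * N + 1) _ _ A). rewrite rsum_plus, !rsum_const, rsum_swap in B.
  assert (C : rsum N (fun n => rsum (4 * N + 1) (fun k => Pk (S n) (S k))) <= INR N * 2).
  { rewrite <- rsum_const. apply rsum_le; intros n. apply rsum_le_series; [intros; apply Pm_nonneg|apply (Pm_sum_k b lam phi Hadm HE)]. }
  rewrite plus_INR, mult_INR in B. simpl (INR 4) in B. simpl (INR 1) in B. assert (N0 := pos_INR N).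
  replace (2 / eps ^ 2 * lam (S (4 * N)) ^ 2) with (2 * L) by (unfold L; field; lra).
  assert (D : (2 * INR N + 1) <= (4 * INR N + 1) * (L / q)) by lra.
  assert (L0 : 0 <= L / q). { apply Rmult_le_pos; [|apply Rinv_nneg; auto]. apply Rmult_le_pos; [apply pow2_ge_0|apply Rinv_nneg; auto]. }
  assert (1 <= 2 * (L / q)) by nra. apply Rmult_le_compat_r with (r := q) in H; [|lra]. replace (2 * (L / q) * q) with (2 * L) in H by (field; lra). lra.
Qed.
Lemma lam_growth k : INR (S k) ^ 2 <= 32 / eps ^ 2 * lam (S k) ^ 2.
Proof.
  set (N := (k / 4)%nat). assert (D := Nat.div_mod_eq k 4). assert (D2 := Nat.mod_upper_bound k 4 ltac:(lia)). fold N in D.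
  assert (A := lam_growth_block N). assert (e2 : 0 < eps ^ 2) by nra.
  assert (B : INR (S k) ^ 2 <= 16 * INR (S N) ^ 2).
  { replace (16 * INR (S N) ^ 2) with ((INR 4 * INR (S N)) ^ 2) by (simpl (INR 4); ring). rewrite <- mult_INR. apply pow_incr; split; [apply pos_INR|apply le_INR; lia]. }
  assert (C : lam (S (4 * N)) ^ 2 <= lam (S k) ^ 2) by (apply pow_incr; split; [apply (lam_nonneg b lam phi Hadm HE)|apply (lam_mono b lam phi HE); lia]).
  assert (0 < 2 / eps ^ 2) by (apply Rdiv_lt_0_compat; lra). replace (32 / eps ^ 2) with (16 * (2 / eps ^ 2)) by (unfold Rdiv; ring). nra.
Qed.

Lemma Apsi_bound n : ip (Aiter b 2 (pc b (S n))) (pc b (S n)) + ip (Aiter b 2 (ps b (S n))) (ps b (S n)) <= 4 / eps ^ 3 * INR (S n) ^ 2.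
Proof.
  assert (e3 : 0 < / eps ^ 3) by (apply Rinv_0_lt_compat; apply pow_lt; auto). assert (PP := PI_RGT_0).
  assert (G : forall f h g, smooth_circ f -> smooth_circ h -> (fun x => sqrt (b x) * h x) = (fun x => / sqrt PI * f x) ->
    Derive f = (fun x => INR (S n) * / b x * g x) -> (forall x, Rabs (g x) <= 1) ->
    ip (Aiter b 2 h) h <= 2 / eps ^ 3 * INR (S n) ^ 2).
  { intros f h g Hf Hh E Dg Hg. change (Aiter b 2 h) with (Aop b (Aop b h)). assert (sA := sc_Aop b Hadm h Hh). rewrite (Aop_sym b Hadm _ _ sA Hh).
    apply Rle_trans with (/ (PI * eps) * N2 (Derive f)).
    - rewrite <- Lam_norm, <- I2_scal by cstac. apply I2_le; cstac. intros x. unfold Aop. rewrite E, Lam_scal by auto.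
      replace (sqrt (b x) * (/ sqrt PI * Lam f x) * (sqrt (b x) * (/ sqrt PI * Lam f x))) with ((sqrt (b x) * sqrt (b x)) * (/ sqrt PI * / sqrt PI) * Lam f x ^ 2) by ring.
      rewrite rr, inv_sqrt_PI. apply Rmult_le_compat_r; [apply pow2_ge_0|]. rewrite Rinv_mult, Rmult_comm. apply Rmult_le_compat_l; [apply Rinv_nneg; auto|apply Hm].
    - apply Rle_trans with (/ (PI * eps) * (2 * PI * (INR (S n) ^ 2 * / eps ^ 2))); [|apply Req_le; field; lra].
      apply Rmult_le_compat_l; [apply Rinv_nneg; nra|]. rewrite <- I2_const. apply I2_le; cstac. intros x. rewrite Dg.
      replace (INR (S n) ^ 2 * / eps ^ 2) with ((INR (S n) * / eps * 1) ^ 2) by (field; lra).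
      rewrite <- (pow2_abs (INR (S n) * / b x * g x)). apply pow_incr; split; [apply Rabs_pos|].
      apply Rabs_mult_le; auto. apply Rabs_mult_le; [rewrite Rabs_right; [lra|apply Rle_ge, pos_INR]|]. generalize (Hm x); intros. rewrite Rabs_inv, Rabs_right by lra. apply Rinv_le_contravar; lra. }
  assert (G1 := G (csn b (S n)) (pc b (S n)) (fun x => - snn b (S n) x) (sc_csn b Hadm _) (sc_pc b Hadm _) (r_pc b Hadm _)).
  assert (G2 := G (snn b (S n)) (ps b (S n)) (csn b (S n)) (sc_snn b Hadm _) (sc_ps b Hadm _) (r_ps b Hadm _)).
  replace (4 / eps ^ 3 * INR (S n) ^ 2) with (2 / eps ^ 3 * INR (S n) ^ 2 + 2 / eps ^ 3 * INR (S n) ^ 2) by (unfold Rdiv; ring). apply Rplus_le_compat.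
  - apply G1; [rewrite (Derive_csn b Hadm); apply functional_extensionality; intros; ring|]. intros x. rewrite Rabs_Ropp. exact (proj2 (csn_abs b (S n) x)).
  - apply G2; [rewrite (Derive_snn b Hadm); auto|]. intros x. exact (proj1 (csn_abs b (S n) x)).
Qed.
(** The dual count. The first [K] frequencies have total overlap [2 K], the eigenvalues of index 1
    to [K] absorb at most [K] of it, and the other half lies at eigenvalues of at least [lam (S K)],
    within the energy allowed by [Apsi_bound]. The step from [lam^2] to [lam] is the crude
    [x <= 1 + x^2], as any uniform bound suffices. *)
Lemma lam_upper k : Rabs (lam k) <= 1 + 4 / eps ^ 3 * INR (S k) ^ 2.
Proof.
  assert (e3 : 0 < / eps ^ 3) by (apply Rinv_0_lt_compat; apply pow_lt; auto).
  set (K := S k). set (C := 4 / eps ^ 3 * INR K ^ 2).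
  assert (A : lam (S K) ^ 2 <= C).
  { set (P := fun k => rsum K (fun n => Pk (S n) (S k))).
    assert (P0 : forall k, 0 <= P k) by (intros; apply rsum_nonneg; intros; apply Pm_nonneg).
    assert (P1 : forall k, P k <= 1) by (intros j; apply rsum_le_series; [intros; apply Pm_nonneg|apply (Pm_sum_n b lam phi Hadm HE)]).
    assert (S1 := is_series_rsum K (fun n k => Pk (S n) (S k)) (fun _ => 2) (Pm_sum_k b lam phi Hadm HE)). fold P in S1.
    assert (S2 := is_series_rsum K (fun n k => lam (S k) ^ 2 * Pk (S n) (S k)) _ (fun n => Pm_form b lam phi Hadm HE n 2)). cbv beta in S2.
    assert (S3 := is_series_scalR (lam (S K) ^ 2) _ _ S1).
    assert (B : lam (S K) ^ 2 * rsum K (fun _ => 2) <= lam (S K) ^ 2 * INR K + INR K * C).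
    { apply (series_le_rsum _ _ _ S3). intros M. eapply Rle_trans; [apply (rsum_split K _ (fun k => rsum K (fun n => lam (S k) ^ 2 * Pk (S n) (S k))))|].
      - intros j. apply Rmult_le_pos; [apply pow2_ge_0|apply P0].
      - intros j. rewrite rsum_scal. apply Rmult_le_pos; [apply pow2_ge_0|apply P0].
      - intros j Hj. rewrite rsum_scal. fold (P j). apply Rmult_le_compat_r; auto. apply pow_incr; split; [apply (lam_nonneg b lam phi Hadm HE)|apply (lam_mono b lam phi HE); lia].
      - apply Rplus_le_compat.
        + rewrite rsum_scal. apply Rmult_le_compat_l; [apply pow2_ge_0|]. rewrite <- (Rmult_1_r (INR K)), <- rsum_const. apply rsum_le; auto.
        + eapply Rle_trans; [apply (rsum_le_series _ _ M) with (2 := S2)|].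
          * intros j; rewrite rsum_scal. apply Rmult_le_pos; [apply pow2_ge_0|apply P0].
          * rewrite <- rsum_const. apply rsum_le_lt; intros n Hn. eapply Rle_trans; [apply Apsi_bound|]. unfold C. apply Rmult_le_compat_l; [unfold Rdiv; lra|].
            apply pow_incr; split; [apply pos_INR|apply le_INR; lia]. }
    rewrite rsum_const in B. assert (0 < INR K) by apply INR_S_pos. nra. }
  assert (M := lam_mono b lam phi HE k (S K) ltac:(unfold K; lia)). assert (N := lam_nonneg b lam phi Hadm HE k). rewrite Rabs_right by lra.
  fold K. fold C. nra.
Qed.
End Growth.

(** * Regularity of eigenfunctions *)

Lemma HN_scal k c f : smooth_circ f -> HN k (fun x => c * f x) = c ^ 2 * HN k f.
Proof.
  revert f; induction k; intros f Hf; [|rewrite !HN_S, Derive_scal_sc, IHk, Rmult_plus_distr_l by sctac; f_equal].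
  - change (I2 (fun x => (c * f x) ^ 2) + 0 = c ^ 2 * (N2 f + 0)). rewrite !Rplus_0_r, <- I2_scal by cstac. apply I2_ext; intros; ring.
  - rewrite <- I2_scal by cstac. apply I2_ext; intros; ring.
Qed.
Lemma HN_Lam k f : smooth_circ f -> HN k (Lam f) = HN k (Derive f).
Proof.
  revert f; induction k; intros f Hf; [|rewrite !HN_S, <- Lam_Derive, IHk by sctac; f_equal; apply Lam_norm; auto].
  change (N2 (Lam f) + 0 = N2 (Derive f) + 0). rewrite Lam_norm; auto.
Qed.
Lemma sup_bound_sq f x : smooth_circ f -> Rabs (f x) <= 1 + 2 * PI + N2 f + N2 (Derive f).
Proof.
  intros Hf. assert (PP := PI_RGT_0). assert (P4 := PI2_1). assert (N := I2_sq_nonneg f (sc_cts f Hf)).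
  destruct (I2_exists_le (fun x => f x ^ 2) (N2 f / (2 * PI))) as [y Hy]; cstac; [apply Req_le; field; lra|].
  assert (N2 f / (2 * PI) <= N2 f).
  { apply Rmult_le_reg_r with (2 * PI); [lra|]. unfold Rdiv; rewrite Rmult_assoc, Rinv_l by lra. nra. }
  assert (O := osc_sq f x y Hf). assert (Rabs (f y) <= 1 + f y ^ 2) by (rewrite <- (pow2_abs (f y)); generalize (pow2_ge_0 (Rabs (f y) - 1)); nra).
  replace (f x) with (f x - f y + f y) by ring. eapply Rle_trans; [apply Rabs_triang|]. lra.
Qed.
Lemma CN_HN k f B : smooth_circ f -> HN (S k) f <= B -> CN k (1 + 2 * PI + B) f.
Proof.
  revert f; induction k; intros f Hf HB; (split; [intros x; assert (L := sup_bound_sq f x Hf)|try exact I]); rewrite HN_S in HB.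
  - assert (Q := HN_last 0 (Derive f) (sc_Derive f Hf)). simpl Derive_n in Q. lra.
  - assert (Q : N2 (Derive f) <= HN (S k) (Derive f)).
    { rewrite HN_S. generalize (HN_nonneg k _ (sc_Derive _ (sc_Derive f Hf))); lra. } lra.
  - apply IHk; [sctac|]. generalize (I2_sq_nonneg f (sc_cts f Hf)); lra.
Qed.

(* [f'] and [Lambda f = l f / b] have the same Sobolev norms, so each application gains one derivative. *)
Lemma eigen_regular j eps A L0 : 0 < eps -> exists B, forall b f l, smooth_circ b -> smooth_circ f -> (forall x, eps <= b x) -> CN j A b -> Rabs l <= L0 ->
  Lam f = (fun x => l * (/ b x * f x)) -> N2 f <= / eps -> HN j f <= B.
Proof.
  intros He. induction j.
  - exists (/ eps). intros b f l _ _ _ _ _ _ H. change (N2 f + 0 <= / eps). lra.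
  - destruct IHj as [B HB]. destruct (CN_inv j A eps He) as [W HW]. exists (/ eps + L0 ^ 2 * (4 ^ j * W ^ 2 * B)). intros b f l Hb Hf Hm HA Hl E HI.
    assert (A0 := CN_down _ j _ _ (Nat.le_succ_diag_r j) HA). assert (HB' := HB b f l Hb Hf Hm A0 Hl E HI).
    assert (sw : smooth_circ (fun x => / b x)) by (apply sc_inv; auto; intros x; specialize (Hm x); lra).
    rewrite HN_S, <- HN_Lam, E, HN_scal by sctac. apply Rplus_le_compat; auto.
    assert (Q := HN_mult j _ f W sw Hf (HW b Hb Hm A0)). assert (Q0 := HN_nonneg j (fun x => / b x * f x) ltac:(sctac)).
    apply Rmult_le_compat; auto; [apply pow2_ge_0| |].
    + rewrite <- (pow2_abs l). apply pow_incr; split; auto; apply Rabs_pos.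
    + eapply Rle_trans; [apply Q|]. apply Rmult_le_compat_l; auto. apply Rmult_le_pos; [apply pow_le; lra|apply pow2_ge_0].
Qed.

Lemma lim_unique (u v : nat -> R) (l m : R) : (forall n, u n = v n) -> is_lim_seq u l -> is_lim_seq v m -> l = m.
Proof.
  intros E Hu Hv. apply (is_lim_seq_ext _ _ _ E) in Hu. apply is_lim_seq_unique in Hu, Hv. rewrite Hu in Hv. injection Hv; auto.
Qed.
Lemma lim_rsum N (a : nat -> nat -> R) (l : nat -> R) : (forall k, is_lim_seq (fun i => a i k) (l k)) -> is_lim_seq (fun i => rsum N (a i)) (rsum N l).
Proof. intros H; induction N; simpl; [apply is_lim_seq_const|apply is_lim_seq_plus'; auto]. Qed.
Lemma uc_coef F G n : (forall i, cts (F i)) -> cts G -> uc F G -> is_lim_seq (fun i => fc n (F i)) (fc n G) /\ is_lim_seq (fun i => fs n (F i)) (fs n G).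
Proof.
  intros HF HG H. rewrite fc_eq, fs_eq. split.
  - apply (is_lim_seq_ext (fun i => I2 (fun x => F i x * cos (INR n * x)))); [intros; rewrite fc_eq; auto|].
    apply (uc_I2 (fun i x => F i x * cos (INR n * x))); ctac. apply (uc_mult F G (fun _ x => cos (INR n * x))); auto. apply uc_const. exists 1; intros; apply Rabs_le, COS_bound.
  - apply (is_lim_seq_ext (fun i => I2 (fun x => F i x * sin (INR n * x)))); [intros; rewrite fs_eq; auto|].
    apply (uc_I2 (fun i x => F i x * sin (INR n * x))); ctac. apply (uc_mult F G (fun _ x => sin (INR n * x))); auto. apply uc_const. exists 1; intros; apply Rabs_le, SIN_bound.
Qed.
Lemma sqrt_lower e x : 0 < e -> e <= 1 -> e <= x -> e <= sqrt x.
Proof. intros H0 H1 H. rewrite <- (sqrt_Rsqr e) by lra. apply sqrt_le_1_alt. unfold Rsqr. nra. Qed.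

(** * Passage to the limit *)

Section Limit.
Variables (v : nat -> R -> R) (lam : nat -> nat -> R) (phi : nat -> nat -> R -> R) (eps : R) (b : R -> R) (g : nat -> R -> R) (l : nat -> R).
Hypothesis He : 0 < eps.
Hypothesis He1 : eps <= 1.
Hypothesis Hv : pusm v.
Hypothesis Hadm : forall i, admissible (v i).
Hypothesis HE : forall i, eigen_decomp (v i) (lam i) (phi i).
Hypothesis Hm : forall i x, eps <= v i x <= / eps.
Hypothesis Hb : smooth_circ b.
Hypothesis Hvb : uc v b.
Hypothesis Hg : forall k, smooth_circ (g k).
Hypothesis Hrg : forall k, uc (fun i => rphi (v i) (phi i) k) (g k).
Hypothesis Hl : forall k, is_lim_seq (fun i => lam i k) (l k).
(** [g k] is the limit of [b^(1/2) phi_k], for which the elliptic estimates hold directly; division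
    by the limiting [b^(1/2)] gives the eigenfunction. *)
Definition psi k x := / sqrt (b x) * g k x.

Lemma limit_bounds x : eps <= b x <= / eps.
Proof.
  assert (L := uc_lim v b x Hvb). split.
  - apply (is_lim_seq_le (fun _ => eps) (fun i => v i x) eps (b x)); auto; [intros; apply Hm|apply is_lim_seq_const].
  - apply (is_lim_seq_le (fun i => v i x) (fun _ => / eps) (b x) (/ eps)); auto; [intros; apply Hm|apply is_lim_seq_const].
Qed.
Let bpos : forall x, 0 < b x. Proof. intros x; generalize (limit_bounds x); lra. Qed.
Let rpos : forall x, 0 < sqrt (b x). Proof. intros; apply sqrt_lt_R0; auto. Qed.
Let vpos : forall i x, 0 < v i x. Proof. intros i x; generalize (Hm i x); lra. Qed.
Let sv i : smooth_circ (v i). Proof. apply Hadm. Qed.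
Let sphi i k : smooth_circ (phi i k). Proof. apply (sc_phi _ _ _ (HE i)). Qed.
Let srp i k : smooth_circ (rphi (v i) (phi i) k). Proof. apply (sc_rphi _ _ _ (Hadm i) (HE i)). Qed.
Lemma sc_psi k : smooth_circ (psi k).
Proof. unfold psi. sctac. Qed.
Hint Resolve sc_psi : sc.
Lemma uc_winv : uc (fun i x => / v i x) (fun x => / b x).
Proof. apply (uc_inv v b eps); auto; [intros; apply Hm|apply limit_bounds]. Qed.
Lemma limit_admissible : admissible b.
Proof.
  split; [auto|split; [auto|]]. apply (lim_unique (fun i => I2 (fun x => / v i x)) (fun _ => 2 * PI)); [|apply (uc_I2 (fun i x => / v i x)); cstac; apply uc_winv|apply is_lim_seq_const].
  intros i. apply Hadm.
Qed.
Lemma uc_rinv : uc (fun i x => / sqrt (v i x)) (fun x => / sqrt (b x)).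
Proof.
  apply (uc_inv (fun i x => sqrt (v i x)) (fun x => sqrt (b x)) eps); auto.
  - intros i x. apply sqrt_lower; auto; apply Hm.
  - intros x. apply sqrt_lower; auto; apply limit_bounds.
  - apply (uc_sqrt v b eps); auto. apply limit_bounds.
Qed.
Lemma uc_phi k : uc (fun i => phi i k) (psi k).
Proof.
  apply (uc_ext (fun i x => / sqrt (v i x) * rphi (v i) (phi i) k x)); [|apply (uc_mult (fun i x => / sqrt (v i x)) (fun x => / sqrt (b x))); [apply uc_rinv|apply Hrg]].
  intros i x. unfold rphi. field. apply Rgt_not_eq, sqrt_lt_R0; auto.
Qed.
Lemma Lam_limit k : Lam (g k) = fun x => l k * (/ b x * g k x).
Proof.
  assert (U := uc_mult _ _ _ _ uc_winv (Hrg k)).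
  assert (E : forall i, Lam (rphi (v i) (phi i) k) = fun x => lam i k * (/ v i x * rphi (v i) (phi i) k x)) by (intros i; apply (Lam_rphi (v i) (lam i) (phi i) (Hadm i) (HE i))).
  assert (si : forall i, smooth_circ (fun x => / v i x * rphi (v i) (phi i) k x)) by (intros; sctac).
  apply sc_coef_inj; sctac; intros n; destruct (Lam_coef n (g k) (Hg k)) as [L1 L2]; destruct (coef_scal _ _ phase_id n (l k) (fun x => / b x * g k x) ltac:(cstac)) as [C1 C2];
    destruct (uc_coef _ _ n (fun i => sc_cts _ (srp i k)) (sc_cts _ (Hg k)) (Hrg k)) as [R1 R2]; destruct (uc_coef _ (fun x => / b x * g k x) n (fun i => sc_cts _ (si i)) ltac:(cstac) U) as [S1 S2].
  - rewrite L1, C1. apply (lim_unique (fun i => INR n * fc n (rphi (v i) (phi i) k)) (fun i => lam i k * fc n (fun x => / v i x * rphi (v i) (phi i) k x)));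
      [|apply (is_lim_seq_scal_l _ _ (Finite (fc n (g k)))); auto|apply is_lim_seq_mult'; auto].
    intros i. rewrite <- (proj1 (Lam_coef n _ (srp i k))), E. apply (proj1 (coef_scal _ _ phase_id n (lam i k) _ (sc_cts _ (si i)))).
  - rewrite L2, C2. apply (lim_unique (fun i => INR n * fs n (rphi (v i) (phi i) k)) (fun i => lam i k * fs n (fun x => / v i x * rphi (v i) (phi i) k x)));
      [|apply (is_lim_seq_scal_l _ _ (Finite (fs n (g k)))); auto|apply is_lim_seq_mult'; auto].
    intros i. rewrite <- (proj2 (Lam_coef n _ (srp i k))), E. apply (proj2 (coef_scal _ _ phase_id n (lam i k) _ (sc_cts _ (si i)))).
Qed.
Lemma Aop_uniform_bound h : smooth_circ h -> exists C, 0 <= C /\ forall i, N2 (Aop (v i) h) <= C.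
Proof.
  intros Hh. assert (Pr : pusm (fun i x => sqrt (v i x))) by (apply (pusm_sqrt v eps); auto; intros; apply Hm).
  assert (PA : pusm (fun i => Aop (v i) h)).
  { unfold Aop. apply (pusm_mult (fun i x => sqrt (v i x)) (fun i => Lam (fun y => sqrt (v i y) * h y))); auto.
    apply (pusm_Lam (fun i y => sqrt (v i y) * h y)), pusm_mult; auto. apply (sc_pusm h Hh). }
  destruct (usm_bd _ (proj1 PA)) as [B HB]. exists (2 * PI * B ^ 2). assert (PP := PI_RGT_0). split; [generalize (pow2_ge_0 B); nra|].
  intros i. assert (s := pusm_sc _ i PA). cbv beta in s. rewrite <- I2_const. apply I2_le; cstac. intros x. rewrite <- pow2_abs. apply pow_incr; split; [apply Rabs_pos|apply HB].
Qed.
(** Completeness would be lost if mass escaped to large [k]. But [lam_k] times a coefficient of [h]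
    is a coefficient of [A h], whose norm is bounded uniformly, and [lam_k] grows at least linearly
    by [lam_growth]; so the squared coefficients have a majorant [C / k^2]. *)
Lemma limit_parseval h : smooth_circ h -> is_series (fun k => ip h (psi k) ^ 2) (N2 h).
Proof.
  intros Hh. destruct (Aop_uniform_bound h Hh) as (CA & CA0 & HCA). assert (H0 := I2_sq_nonneg h (sc_cts h Hh)). assert (e2 : 0 < / eps ^ 2) by (apply Rinv_0_lt_compat; nra).
  (* 128 is the 32 of [lam_growth] times 4, from [k + 2 <= 2 (k + 1)]. The term [N2 h] covers the
     index 0, where the eigenvalue vanishes. *)
  set (C := N2 h + 128 * / eps ^ 2 * CA).
  assert (PS : forall i, is_series (fun k => ak (phi i) k h ^ 2) (N2 h)) by (intros i; apply (phi_parseval (v i) (lam i) (phi i) (HE i)); auto).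
  destruct (series_dominated (fun i k => ak (phi i) k h ^ 2) (fun k => ip h (psi k) ^ 2) (fun k => C * / INR (S k) ^ 2)) as [D1 D2].
  - intros i k. assert (N0 : 0 <= ak (phi i) k h ^ 2) by apply pow2_ge_0. rewrite Rabs_right by lra.
    assert (P2 : 0 < INR (S k) ^ 2) by (apply pow_lt, INR_S_pos). apply Rmult_le_reg_r with (INR (S k) ^ 2); auto. rewrite (Rmult_assoc C), Rinv_l, Rmult_1_r by lra.
    assert (0 <= / eps ^ 2 * CA) by nra. destruct k as [|k].
    + assert (Q := is_series_nonneg_term _ _ 0%nat (fun n => pow2_ge_0 _) (PS i)). simpl (INR 1). unfold C. lra.
    + assert (sA := sc_Aop (v i) (Hadm i) h Hh).
      assert (Q := is_series_nonneg_term _ _ (S k) (fun n => pow2_ge_0 _) (phi_parseval (v i) (lam i) (phi i) (HE i) _ sA)). cbv beta in Q.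
      rewrite (ak_Aop (v i) (lam i) (phi i) (Hadm i) (HE i)) in Q by auto. specialize (HCA i).
      assert (G := lam_growth (v i) (lam i) (phi i) eps (Hadm i) (HE i) He (Hm i) k).
      assert (M : INR (S (S k)) ^ 2 <= 4 * INR (S k) ^ 2).
      { replace (4 * INR (S k) ^ 2) with ((2 * INR (S k)) ^ 2) by ring. apply pow_incr; split; [apply pos_INR|]. rewrite (S_INR (S k)). assert (1 <= INR (S k)) by (apply (le_INR 1); lia). lra. }
      set (a := ak (phi i) (S k) h) in *. set (L := lam i (S k)) in *. rewrite Rpow_mult_distr in Q.
      apply Rle_trans with (a ^ 2 * (4 * (32 / eps ^ 2 * L ^ 2))); [apply Rmult_le_compat_l; lra|].
      replace (a ^ 2 * (4 * (32 / eps ^ 2 * L ^ 2))) with (128 * / eps ^ 2 * (L ^ 2 * a ^ 2)) by (field; lra). unfold C.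
      assert (128 * / eps ^ 2 * (L ^ 2 * a ^ 2) <= 128 * / eps ^ 2 * CA) by (apply Rmult_le_compat_l; lra). lra.
  - apply ex_series_scalR, ex_series_inv_sq.
  - intros k. assert (L : is_lim_seq (fun i => ak (phi i) k h) (ip h (psi k))).
    { apply (uc_I2 (fun i x => h x * phi i k x)); cstac. apply (uc_mult (fun _ => h)); [apply uc_const, sc_bounded; auto|apply uc_phi]. }
    apply (is_lim_seq_ext (fun i => ak (phi i) k h * ak (phi i) k h)); [intros; ring|]. replace (ip h (psi k) ^ 2) with (ip h (psi k) * ip h (psi k)) by ring.
    apply is_lim_seq_mult'; auto.
  - rewrite (lim_unique (fun _ => N2 h) (fun i => Series (fun k => ak (phi i) k h ^ 2)) (N2 h) (Series (fun k => ip h (psi k) ^ 2))).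
    + apply Series_correct; auto.
    + intros i. symmetry. apply is_series_unique, PS.
    + apply is_lim_seq_const.
    + auto.
Qed.
Lemma limit_eigen : eigen_decomp b l psi.
Proof.
  split; [apply sc_psi|]. split; [|split; [|split]].
  - intros k k'. change (ip (psi k) (psi k') = if Nat.eqb k k' then 1 else 0).
    apply (lim_unique (fun i => ip (phi i k) (phi i k')) (fun _ => if Nat.eqb k k' then 1 else 0)); [|apply (uc_I2 (fun i x => phi i k x * phi i k' x)); cstac; apply uc_mult; apply uc_phi|apply is_lim_seq_const].
    intros i. apply (phi_ortho (v i) (lam i) (phi i) (HE i)).
  - intros k. exists (Lam (g k)). assert (E : (fun t => sqrt (b t) * psi k t) = g k).
    { fext x. unfold psi. field. apply Rgt_not_eq, sqrt_lt_R0; auto. }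
    rewrite E. split; [apply LambdaRel_intro; auto|]. intros t. rewrite Lam_limit. unfold psi. assert (P := sqrt_lt_R0 _ (bpos t)).
    replace (/ b t) with (/ (sqrt (b t) * sqrt (b t))) by (rewrite sqrt_sqrt; auto; apply Rlt_le; auto). field. lra.
  - intros k. apply (is_lim_seq_le (fun i => lam i k) (fun i => lam i (S k)) (l k) (l (S k))); auto. intros i. apply (HE i).
  - apply limit_parseval.
Qed.

(** By periodicity of the trigonometric functions of the angle it suffices to compare the angles on
    one period, where they differ by at most [2 PI] times the distance of the densities [1 / v] and
    [1 / b]. *)
Lemma uc_trig_phase (h h' : R -> R) n : (forall x, is_derive h x (h' x)) -> (forall x, Rabs (h' x) <= 1) -> (forall x, Rabs (h x) <= 1) ->
  (forall w, admissible w -> per (fun x => h (INR n * ph w x))) -> uc (fun i x => h (INR n * ph (v i) x)) (fun x => h (INR n * ph b x)).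
Proof.
  intros Hd H1 H0 Hp. split; [exists 1; auto|]. intros e Hep. assert (PP := PI_RGT_0). assert (N0 := pos_INR n).
  set (d := e / (INR n * (2 * PI) + 1)). assert (D : 0 < INR n * (2 * PI) + 1) by nra. destruct (proj2 uc_winv d ltac:(apply Rdiv_lt_0_compat; auto)) as [N HN]. exists N; intros i Hi x.
  assert (Pd : per (fun x => h (INR n * ph (v i) x) - h (INR n * ph b x))) by (intros t; cbv beta; rewrite (Hp _ (Hadm i)), (Hp _ limit_admissible); auto).
  destruct (per_reduce _ x Pd) as (y & Hy & <-). eapply Rle_trans; [apply (lip_of_derive h h' 1); auto|].
  rewrite Rmult_1_l, <- Rmult_minus_distr_l, Rabs_mult, (Rabs_right (INR n)) by lra. unfold ph. rewrite <- RInt_minus' by cstac.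
  assert (Q : Rabs (RInt (fun x => / v i x - / b x) 0 y) <= (y - 0) * d).
  { apply (abs_RInt_le_const _ 0 y d); [lra|apply ex_RInt_cts; cstac|intros; apply HN; auto]. }
  assert (d0 : 0 < d) by (apply Rdiv_lt_0_compat; auto).
  apply Rle_trans with (INR n * ((2 * PI) * d)); [apply Rmult_le_compat_l; auto; nra|].
  assert (E : d * (INR n * (2 * PI) + 1) = e) by (unfold d; field; lra). nra.
Qed.
Lemma Pm_limit n k : is_lim_seq (fun i => Pm (v i) (phi i) n k) (Pm b psi n k).
Proof.
  assert (Ab := limit_admissible).
  assert (C : uc (fun i => csn (v i) n) (csn b n)).
  { apply (uc_trig_phase cos (fun x => - sin x)); [intros; auto_derive; auto; ring|intros; rewrite Rabs_Ropp; apply Rabs_le, SIN_bound|intros; apply Rabs_le, COS_bound|].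
    intros w Hw. apply (sc_per _ (sc_csn w Hw n)). }
  assert (S : uc (fun i => snn (v i) n) (snn b n)).
  { apply (uc_trig_phase sin cos); [intros; auto_derive; auto; ring|intros; apply Rabs_le, COS_bound|intros; apply Rabs_le, SIN_bound|].
    intros w Hw. apply (sc_per _ (sc_snn w Hw n)). }
  assert (G : forall (F : nat -> R -> R) f, (forall i, cts (F i)) -> cts f -> uc F f -> is_lim_seq (fun i => ak (phi i) k (F i) ^ 2) (ak psi k f ^ 2)).
  { intros F f HF Hf HU. assert (L : is_lim_seq (fun i => ak (phi i) k (F i)) (ak psi k f)) by (apply (uc_I2 (fun i x => F i x * phi i k x)); cstac; apply uc_mult; auto; apply uc_phi).
    apply (is_lim_seq_ext (fun i => ak (phi i) k (F i) * ak (phi i) k (F i))); [intros; ring|]. replace (ak psi k f ^ 2) with (ak psi k f * ak psi k f) by ring. apply is_lim_seq_mult'; auto. }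
  assert (K : uc (fun _ _ => / sqrt PI) (fun _ => / sqrt PI)) by (apply uc_const; exists (Rabs (/ sqrt PI)); intros; lra).
  apply is_lim_seq_plus'; apply G.
  - intros i. apply sc_cts, sc_pc; auto.
  - apply sc_cts, sc_pc; auto.
  - apply (uc_mult (fun i x => csn (v i) n x * / sqrt (v i x)) (fun x => csn b n x * / sqrt (b x))); auto. apply uc_mult; auto. apply uc_rinv.
  - intros i. apply sc_cts, sc_ps; auto.
  - apply sc_cts, sc_ps; auto.
  - apply (uc_mult (fun i x => snn (v i) n x * / sqrt (v i x)) (fun x => snn b n x * / sqrt (b x))); auto. apply uc_mult; auto. apply uc_rinv.
Qed.
(** [tau] is a difference, so Fatou's argument is applied to [tau + 2 n^q], which is a series in [k]
    with nonnegative terms. Finite sections in [n] and [k] converge, and the added part is the same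
    for all functions. *)
Lemma tau_fatou q D T : (forall i n, 0 <= tau (v i) q n) -> (forall i, exists T, is_series (tau (v i) q) T /\ T <= D) -> is_series (tau b q) T -> T <= D.
Proof.
  intros Ht HD HT. assert (Ab := limit_admissible). assert (Eb := limit_eigen). apply (series_le_rsum _ _ _ HT). intros N.
  set (E := fun (w : R -> R) n => ip (Aiter w q (pc w (S n))) (pc w (S n)) + ip (Aiter w q (ps w (S n))) (ps w (S n))).
  assert (ET : forall w, rsum N (tau w q) = rsum N (E w) + -2 * rsum N (fun n => INR (S n) ^ q)).
  { intros w. rewrite <- rsum_scal, <- rsum_plus. apply rsum_ext; intros n. unfold tau, E. ring. }
  rewrite ET. apply Rplus_le_reg_r with (2 * rsum N (fun n => INR (S n) ^ q)).
  assert (S1 := is_series_rsum N _ _ (fun n => Pm_form b l psi Ab Eb n q)). fold (E b) in S1.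
  assert (L : rsum N (E b) <= D + 2 * rsum N (fun n => INR (S n) ^ q)); [|lra].
  apply (series_le_rsum _ _ _ S1). intros K.
  apply (is_lim_seq_le (fun i => rsum K (fun k => rsum N (fun n => lam i (S k) ^ q * Pm (v i) (phi i) (S n) (S k)))) (fun _ => D + 2 * rsum N (fun n => INR (S n) ^ q))
    (rsum K (fun k => rsum N (fun n => l (S k) ^ q * Pm b psi (S n) (S k)))) (D + 2 * rsum N (fun n => INR (S n) ^ q))).
  - intros i. assert (S2 := is_series_rsum N _ _ (fun n => Pm_form (v i) (lam i) (phi i) (Hadm i) (HE i) n q)). fold (E (v i)) in S2.
    eapply Rle_trans; [apply (rsum_le_series _ _ K) with (2 := S2)|].
    + intros k. apply rsum_nonneg; intros n. apply Rmult_le_pos; [apply pow_le, (lam_nonneg _ _ _ (Hadm i) (HE i))|apply Pm_nonneg].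
    + destruct (HD i) as (Ti & H1 & H2). assert (Q := rsum_le_series _ _ N (Ht i) H1). rewrite ET in Q. lra.
  - apply (lim_rsum K (fun i k => rsum N (fun n => lam i (S k) ^ q * Pm (v i) (phi i) (S n) (S k)))). intros k.
    apply (lim_rsum N (fun i n => lam i (S k) ^ q * Pm (v i) (phi i) (S n) (S k))). intros n. apply is_lim_seq_mult'; [|apply Pm_limit].
    clear -Hl. induction q; simpl; [apply is_lim_seq_const|apply is_lim_seq_mult'; auto].
  - apply is_lim_seq_const.
Qed.
End Limit.

(** A continuation for [b] is made from that for [b0]. Where the Dirichlet series converge, zeta
    minus [Xi] is the same for both functions, so [Z0] minus its [Xi] plus the [Xi] of [b] has the
    right values there, and it is holomorphic off 1. *)
Lemma zeta_transfer b0 lam0 phi0 Z0 b lam phi eps : admissible b0 -> zeta_data b0 lam0 phi0 Z0 -> admissible b -> eigen_decomp b lam phi ->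
  0 < eps -> (forall x, eps <= b x <= / eps) -> zeta_data b lam phi (fun z => Z0 z - Xi b0 lam0 phi0 z + Xi b lam phi z)%C.
Proof.
  intros Ha0 HD0 Ha HE He Hm. split; [auto|split].
  - intros z Hz. destruct (proj1 (proj2 HD0) z Hz) as [l1 L1]. destruct (Xi_Cd b0 lam0 phi0 Ha0 (proj1 HD0) z) as [l2 L2]. destruct (Xi_Cd b lam phi Ha HE z) as [l3 L3].
    eexists. exact (Cd_is_derive _ _ _ (Cd_plus _ _ _ _ _ (Cd_minus _ _ _ _ _ (is_derive_Cd _ _ _ L1) L2) L3)).
  - intros z Hz. set (x := Re z) in *. assert (e2 : 0 < eps ^ 2) by (apply pow_lt; auto).
    assert (EX : ex_series (fun k => exp (- x * ln (lam (S k))))).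
    (* The comparison series is the sum of [n^-x], and its convergence is read off from the data of
       [b0]. *)
    { destruct (zeta_minus_Xi b0 lam0 phi0 Z0 (RtoC x) Ha0 HD0 Hz) as [S1 _].
      set (C := exp (x / 2 * ln (32 / eps ^ 2))).
      apply (ex_series_Rle _ (fun n => (C / 2) * (2 * fst (Ee (- ln (INR (S n))) (RtoC x))))); [|apply ex_series_scalR; eexists; apply S1].
      intros k. rewrite Rabs_right by (apply Rle_ge, Rlt_le, exp_pos).
      assert (Ef : fst (Ee (- ln (INR (S k))) (RtoC x)) = exp (- x * ln (INR (S k)))).
      { rewrite <- cpow_Ee. unfold cpow_neg, RtoC, Re, Im; cbn [fst snd]. replace (- 0 * ln (INR (S k))) with 0 by ring. rewrite cos_0; ring. }
      rewrite Ef. replace (C / 2 * (2 * exp (- x * ln (INR (S k))))) with (C * exp (- x * ln (INR (S k)))) by field. unfold C. rewrite <- exp_plus. apply exp_le_mono.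
      assert (Lp := lam_pos b lam phi Ha HE k). assert (Ip := INR_S_pos k). assert (G := lam_growth b lam phi eps Ha HE He Hm k).
      apply ln_le in G; [|apply pow_lt; auto]. assert (0 < 32 / eps ^ 2) by (apply Rdiv_lt_0_compat; lra).
      rewrite ln_mult in G by (auto; apply pow_lt; auto). replace (INR (S k) ^ 2) with (INR (S k) * INR (S k)) in G by ring. replace (lam (S k) ^ 2) with (lam (S k) * lam (S k)) in G by ring.
      rewrite !ln_mult in G by auto. nra. }
    destruct (xi_split b lam phi Ha HE z EX) as [X1 X2]. destruct (zeta_minus_Xi b0 lam0 phi0 Z0 z Ha0 HD0 Hz) as [Y1 Y2].
    assert (E1 := eq_trans (eq_sym (is_series_unique _ _ X1)) (is_series_unique _ _ Y1)). assert (E2 := eq_trans (eq_sym (is_series_unique _ _ X2)) (is_series_unique _ _ Y2)).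
    destruct (CSer_abs (fun k => Ee (- ln (lam (S k))) z) (fun k => exp (- x * ln (lam (S k))))) as [A1 A2]; [intros; rewrite Cmod_Ee; apply Rle_refl|auto|].
    apply (is_series_ext (K := C_AbsRing) (V := C_NormedModule) (fun k => Ee (- ln (lam (S k))) z)); [intros; rewrite cpow_Ee; auto|].
    apply is_series_C. split.
    + eapply is_series_RR; [apply (Series_correct _ A1)|]. toR. unfold Cminus, Copp, Cplus; cbn [fst snd]. lra.
    + eapply is_series_RR; [apply (Series_correct _ A2)|]. toR. unfold Cminus, Copp, Cplus; cbn [fst snd]. lra.
Qed.

Lemma Kc_pusm c (u : nat -> R -> R) : (forall i, Kc c (u i)) -> pusm u.
Proof.
  intros Hu. destruct kappa_exists as [kappa Hk]. split; [|intros i; apply sc_per, (Hu i)].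
  intros n. destruct (Kc_Cm kappa c n Hk) as [B HB]. exists B. intros i x. split; [apply (proj2 (proj1 (Hu i)))|].
  apply (proj1 (CN_spec n B (u i)) (proj1 (HB c (u i) (fun k _ => eq_refl) (Hu i)))). auto.
Qed.

(** [lam_upper] bounds the k-th eigenvalue uniformly in [i], and [eigen_regular] turns this into
    bounds for all Sobolev norms. *)
Lemma rphi_pusm (v : nat -> R -> R) lam phi eps k : 0 < eps -> pusm v -> (forall i, admissible (v i)) -> (forall i, eigen_decomp (v i) (lam i) (phi i)) ->
  (forall i x, eps <= v i x <= / eps) -> pusm (fun i => rphi (v i) (phi i) k).
Proof.
  intros He Hv Ha HE Hm.
  assert (sr : forall i, smooth_circ (rphi (v i) (phi i) k)) by (intros i; apply (sc_rphi _ _ _ (Ha i) (HE i))).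
  split; [|intros i; apply sc_per; auto]. intros n.
  assert (HA : exists A, forall i, CN (S n) A (v i)).
  { assert (G : forall m, exists A, forall i j x, (j <= m)%nat -> Rabs (Derive_n (v i) j x) <= A).
    { induction m as [|m [A HA]].
      - destruct (proj1 Hv 0%nat) as [A HA]. exists A. intros i j x Hj. replace j with 0%nat by lia. apply HA.
      - destruct (proj1 Hv (S m)) as [A' HA']. exists (Rmax A A'). intros i j x Hj. destruct (Nat.eq_dec j (S m)) as [->|].
        + eapply Rle_trans; [apply HA'|apply Rmax_r].
        + eapply Rle_trans; [apply HA; lia|apply Rmax_l]. }
    destruct (G (S n)) as [A HA]. exists A. intros i. apply CN_spec; auto. }
  destruct HA as [A HA]. destruct (eigen_regular (S n) eps A (1 + 4 / eps ^ 3 * INR (S k) ^ 2) He) as [B HB].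
  exists (1 + 2 * PI + B). intros i x. split; [apply sr|].
  apply (proj1 (CN_spec n _ _) (CN_HN n _ B (sr i) (HB (v i) _ (lam i k) (proj1 (Ha i)) (sr i) (fun x => proj1 (Hm i x)) (HA i)
    (lam_upper _ _ _ eps (Ha i) (HE i) He (Hm i) k) (Lam_rphi _ _ _ (Ha i) (HE i) k) (rphi_norm _ _ _ eps (Ha i) (HE i) (Hm i) k)))). auto.
Qed.

Theorem Kc_compact c : compact_Coo (Kc c).
Proof.
  intros u Hu. assert (Ha : forall i, admissible (u i)) by (intros i; apply (Kc_admissible c); auto).
  assert (HD : forall i, { d : (nat -> R) * (nat -> R -> R) * (C -> C) | zeta_data (u i) (fst (fst d)) (snd (fst d)) (snd d) }).
  { intros i. apply constructive_indefinite_description. destruct (Kc_eigen c (u i) (Hu i)) as (lam & phi & Z & H). exists (lam, phi, Z). auto. }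
  set (lam := fun i => fst (fst (proj1_sig (HD i)))). set (phi := fun i => snd (fst (proj1_sig (HD i)))). set (Zt := fun i => snd (proj1_sig (HD i))).
  assert (HZ : forall i, zeta_data (u i) (lam i) (phi i) (Zt i)) by (intros i; apply (proj2_sig (HD i))). clearbody lam phi Zt. clear HD.
  assert (HE : forall i, eigen_decomp (u i) (lam i) (phi i)) by (intros i; apply (HZ i)).
  (* The cut at 1 makes [eps] a lower bound for the square root of [b] as well. *)
  destruct (Kc_eps_bounds (c O) (c 1%nat)) as (eps' & He' & Hb'). set (eps := Rmin eps' 1).
  assert (He : 0 < eps) by (apply Rmin_glb_lt; lra). assert (He1 : eps <= 1) by apply Rmin_r.
  assert (Hm : forall i x, eps <= u i x <= / eps).
  { intros i x. destruct (Hb' c eq_refl eq_refl (u i) (Hu i) x) as [B1 B2]. assert (eps <= eps') by apply Rmin_l. split; [lra|].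
    eapply Rle_trans; [apply B2|]. apply Rinv_le_contravar; auto. }
  assert (Hpu := Kc_pusm c u Hu).
  (* The index 0 carries the functions themselves and the index [k + 1] the functions
     [b^(1/2) phi_k], so a single subsequence serves all of them and the eigenvalues. *)
  destruct (arzela (fun k => match k with O => u | S k => fun i => rphi (u i) (phi i) k end) (fun k i => lam i k)) as (s & G & l & Hs & HG).
  { intros [|k]; auto. apply (rphi_pusm u lam phi eps); auto. }
  { intros k. exists (1 + 4 / eps ^ 3 * INR (S k) ^ 2). intros i. apply (lam_upper _ _ _ eps (Ha i) (HE i) He (Hm i)). }
  set (b := G O) in *. set (g := fun k => G (S k)).
  assert (Hb : smooth_circ b) by apply HG.
  assert (Hvb : forall j, uc (fun i => Derive_n (u (s i)) j) (Derive_n b j)) by (apply (HG O)).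
  assert (Hg : forall k, smooth_circ (g k)) by (intros; apply HG).
  assert (Hrg : forall k, uc (fun i => rphi (u (s i)) (phi (s i)) k) (g k)) by (intros k; apply (proj1 (proj2 (HG (S k))) 0%nat)).
  assert (Hl : forall k, is_lim_seq (fun i => lam (s i) k) (l k)) by (intros; apply HG).
  assert (Hv := pusm_reindex u s Hpu).
  set (v := fun i => u (s i)) in *. set (lv := fun i => lam (s i)) in *. set (pv := fun i => phi (s i)) in *.
  assert (Hav : forall i, admissible (v i)) by (intros; apply Ha). assert (HEv : forall i, eigen_decomp (v i) (lv i) (pv i)) by (intros; apply HE).
  assert (Hmv : forall i x, eps <= v i x <= / eps) by (intros; apply Hm).
  assert (Hvb0 := Hvb 0%nat). change (uc v b) in Hvb0.
  exists s, b. split; [exact Hs|]. split; [|intros j; apply (Hvb j)].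
  assert (Ab := limit_admissible v eps b He Hav Hmv Hb Hvb0).
  assert (Eb := limit_eigen v lv pv eps b g l He He1 Hv Hav HEv Hmv Hb Hvb0 Hg Hrg Hl).
  assert (Bb := limit_bounds v eps b Hmv Hvb0).
  (* The first member of the sequence lends its continued zeta function to the limit. *)
  assert (Zb := zeta_transfer (u O) (lam O) (phi O) (Zt O) b l (psi b g) eps (Ha O) (HZ O) Ab Eb He Bb).
  set (Zl := fun z => (Zt 0%nat z - Xi (u 0%nat) (lam 0%nat) (phi 0%nat) z + Xi b l (psi b g) z)%C) in Zb. clearbody Zl.
  destruct zeta_kappa as [kappa Hk].
  (* The bound on a zeta value becomes one on the sum of [tau], passes to the limit by [tau_fatou],
     and is turned back with the same [kappa q]. *)
  assert (Val : forall q cq, (forall i n, 0 <= tau (v i) q n) -> (forall i, exists w, zeta_value (v i) (RtoC (- INR q)) w /\ Re w <= cq) ->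
    exists w, zeta_value b (RtoC (- INR q)) w /\ Re w <= cq).
  { intros q cq Hn Hw. exists (Zl (RtoC (- INR q))). split; [exists l, (psi b g); split; [auto|exists Zl; split; [apply Zb|split; [apply Zb|auto]]]|].
    assert (F := tau_fatou v lv pv eps b g l He He1 Hv Hav HEv Hmv Hb Hvb0 Hg Hrg Hl q (cq - kappa q) (fst (Zl (RtoC (- INR q))) - kappa q) Hn).
    assert (T : fst (Zl (RtoC (- INR q))) - kappa q <= cq - kappa q).
    { apply F; [|apply (Hk b l (psi b g) Zl Ab Zb q)]. intros i. destruct (Hw i) as (w & W1 & W2). exists (Re w - kappa q). split; [|lra].
      apply (zeta_value_tau kappa q (v i) (- INR q) w Hk (Hav i) eq_refl W1). }
    unfold Re. lra. }
  split; [auto|split; [apply Ab|split; [apply Ab|split; [|split]]]].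
  - assert (PP := two_pi_pos). change 0%Z with (Z.of_nat 0). rewrite fourierR_nat by cstac. cbn [fst Re]. rewrite fc_0.
    apply Rmult_le_reg_l with (2 * PI); auto. unfold Re; cbn [fst]. rewrite <- Rmult_assoc, Rinv_r, Rmult_1_l by lra.
    apply (is_lim_seq_le (fun i => I2 (v i)) (fun _ => 2 * PI * c O) (I2 b) (2 * PI * c O)); [intros i; apply (Kc_mean c (v i)), Hu| |apply is_lim_seq_const].
    apply uc_I2; auto; [intros i; apply sc_cts, Hav|cstac].
  - replace (-1) with (- INR 1) by (simpl; ring). apply Val; [intros i n; apply tau_1_nonneg; auto|].
    intros i. replace (- INR 1) with (-1) by (simpl; ring). apply (Hu (s i)).
  - intros m Hm1. replace (- 2 * INR m) with (- INR (2 * m)) by (rewrite mult_INR; simpl; ring). apply Val; [intros i n; apply (tau_even_nonneg (v i) (lv i) (pv i)); auto|].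
    intros i. replace (- INR (2 * m)) with (- 2 * INR m) by (rewrite mult_INR; simpl; ring). apply (Hu (s i)); auto.
Qed.

Theorem theorem6p1 :
  (* compactness *)
  (forall c : nat -> R, (forall k, 0 < c k) -> compact_Coo (Kc c)) /\
  (* uniform two-sided bound, eps depending only on c_0, c_1 *)
  (forall c0 c1 : R, 0 < c0 -> 0 < c1 ->
     exists eps : R, 0 < eps /\
       forall c : nat -> R, (forall k, 0 < c k) -> c O = c0 -> c 1%nat = c1 ->
         forall b, Kc c b -> forall t, eps <= b t <= / eps) /\
  (* C^m bounds, C_m depending only on c_0, ..., c_{m+2} *)
  (forall m : nat, (1 <= m)%nat ->
     forall d : nat -> R, (forall k, 0 < d k) ->
       exists Cm : R,
         forall c : nat -> R, (forall k, 0 < c k) ->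
           (forall k, (k <= m + 2)%nat -> c k = d k) ->
           forall b, Kc c b ->
             Cm_norm_le m b Cm /\
             forall gr gi, HilbertRel b gr gi -> Cm_norm_le_C m gr gi Cm).
Proof.
  split; [|split].
  - intros c _. apply Kc_compact.
  - intros c0 c1 _ _. destruct (Kc_eps_bounds c0 c1) as (eps & H1 & H2). exists eps. split; auto. intros c _ E0 E1. apply H2; auto.
  - intros m Hm d _. destruct (Kc_Cm_bounds d m Hm) as [Cm H]. exists Cm. intros c _ Hc. apply H; auto.
Qed.
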